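(* (i) The module $B_{\mathfrak g}$ is a free $S(\mathfrak g\times\mathfrak g)$-module of rank $b_{\mathfrak g}$, with basis the sequence $\varepsilon_i^{(m)}$, $(i,m)\in I_0$. (ii) For $\varphi\in S(\mathfrak g\times\mathfrak g)\otimes\mathfrak g$, $\varphi\in B_{\mathfrak g}$ if and only if $p\varphi\in B_{\mathfrak g}$ for some $p\in S(\mathfrak g\times\mathfrak g)\setminus\{0\}$. (iii) For all $\varphi\in B_{\mathfrak g}$ and all $(x,y)\in\mathfrak g\times\mathfrak g$, $\varphi(x,y)$ is orthogonal to $[x,y]$ with respect to $\langle\cdot,\cdot\rangle$.
   Context: Let $k$ be an algebraically closed field of characteristic $0$, $\mathfrak g$ a finite-dimensional reductive Lie algebra over $k$ of rank $\ell$, with a nondegenerate invariant symmetric bilinear form $\langle\cdot,\cdot\rangle$ extending the Killing form of $[\mathfrak g,\mathfrak g]$, used to identify $\mathfrak g^*$ with $\mathfrak g$, so $k[\mathfrak g\times\mathfrak g]=S(\mathfrak g\times\mathfrak g)$. Let $b_{\mathfrak g}$ be the dimension of Borel subalgebras. For $x\in\mathfrak g$, $\mathfrak g^x$ is its centralizer; for $(x,y)$ put $V'_{x,y}=\sum_{(a,b)\in k^2\setminus\{0\}}\mathfrak g^{ax+by}$. $B_{\mathfrak g}$ is the set of $\varphi\in S(\mathfrak g\times\mathfrak g)\otimes\mathfrak g$ with $\varphi(x,y)\in V'_{x,y}$ for all $(x,y)$ in a dense subset of $\mathfrak g\times\mathfrak g$. Let $p_1,\ldots,p_\ell$ be homogeneous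 generators of the algebra of $G$-invariant polynomial functions on $\mathfrak g$ ($G$ the adjoint group), of degrees $d_1\le\cdots\le d_\ell$. For $x\in\mathfrak g$, $\varepsilon_i(x)\in\mathfrak g$ is defined by $\langle\varepsilon_i(x),y\rangle=\frac{d}{dt}p_i(x+ty)|_{t=0}$ for all $y$. Define $\varepsilon_i^{(m)}\in S(\mathfrak g\times\mathfrak g)\otimes\mathfrak g$, $0\le m\le d_i-1$, by $\varepsilon_i(x+ty)=\sum_{m=0}^{d_i-1}\varepsilon_i^{(m)}(x,y)t^m$ for all $t\in k$, $x,y\in\mathfrak g$. Let $I_0=\{(i,m):1\le i\le\ell,\ 0\le m\le d_i-1\}$. *)

(* Defs.v *)
From HB Require Import structures.
From mathcomp Require Import all_boot all_order all_algebra.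
From mathcomp Require Import mpoly.

Set Implicit Arguments.
Unset Strict Implicit.
Unset Printing Implicit Defensive.

Import Order.TTheory GRing.Theory.
Local Open Scope ring_scope.

(* The Lie algebra g is k^n (row vectors 'rV[k]_n) with bracket given by
   structure constants c : [e_i, e_j] = \sum_l c i j l e_l. *)
Section LieDefs.
Variables (k : fieldType) (n : nat).
Local Notation vec := 'rV[k]_n.
Variable c : 'I_n -> 'I_n -> 'I_n -> k.

Definition brk (x y : vec) : vec :=
  \row_l \sum_(i < n) \sum_(j < n) c i j l * x 0 i * y 0 j.

Definition is_lie : Prop :=
  (forall x, brk x x = 0) /\
  (forall x y z, brk x (brk y z) + brk y (brk z x) + brk z (brk x y) = 0).

(* ad x as a matrix acting on row vectors: y *m adm x = [x, y] *)
Definition adm (x : vec) : 'M[k]_n :=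
  \matrix_(i < n, j < n) brk x (delta_mx 0 i) 0 j.

Definition cent_dim (x : vec) : nat := \rank (kermx (adm x)).

Definition lie_rank (l : nat) : Prop :=
  (exists x, cent_dim x = l) /\ (forall x, (l <= cent_dim x)%N).

(* ideals (ad-stable subspaces) and reductivity: the adjoint representation
   is completely reducible (every ideal has a complementary ideal) *)
Definition is_ideal (W : 'M[k]_n) : Prop := forall x, (W *m adm x <= W)%MS.

Definition reductive : Prop :=
  forall W : 'M[k]_n, is_ideal W ->
    exists W' : 'M[k]_n, is_ideal W' /\
      (1%:M <= W + W')%MS /\ (W :&: W' <= (0 : 'M[k]_n))%MS.

Definition derived (W : 'M[k]_n) : 'M[k]_n :=
  (\sum_(i < n) \sum_(j < n) <<brk (row i W) (row j W)>>)%MS.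

Definition subalg (W : 'M[k]_n) : Prop := (derived W <= W)%MS.
Definition solvable_sub (W : 'M[k]_n) : Prop :=
  exists m : nat, iter m derived W == 0.
Definition borel (W : 'M[k]_n) : Prop :=
  subalg W /\ solvable_sub W /\
  (forall W' : 'M[k]_n, subalg W' -> solvable_sub W' ->
     (W <= W')%MS -> (W' <= W)%MS).

Definition bform (Bm : 'M[k]_n) (x y : vec) : k := (x *m Bm *m y^T) 0 0.

(* Killing form of the derived algebra [g,g]: trace of the product of
   the restrictions of ad x, ad y to [g,g], in the basis row_base [g,g]. *)
Definition Dg := row_base (derived 1%:M).
Definition resad (x : vec) := Dg *m adm x *m pinvmx Dg.
Definition killing_derived (x y : vec) : k := \tr (resad x *m resad y).

Definition good_form (Bm : 'M[k]_n) : Prop :=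
  Bm^T = Bm /\ Bm \in unitmx /\
  (forall x y z, bform Bm (brk x y) z = bform Bm x (brk y z)) /\
  (forall x y, (x <= derived 1%:M)%MS -> (y <= derived 1%:M)%MS ->
     bform Bm x y = killing_derived x y).

(* exp(ad z) for nilpotent ad z *)
Definition expad (z : vec) : 'M[k]_n :=
  \sum_(j < n) (j`!%:R)^-1 *: (adm z) ^+ j.

Definition vcoord (x : vec) : 'I_n -> k := fun i => x 0 i.

(* invariance under the adjoint group G, which is generated by the
   exp(ad z), ad z nilpotent *)
Definition G_invariant (q : {mpoly k[n]}) : Prop :=
  forall z : vec, (adm z) ^+ n = 0 ->
    forall x : vec, q.@[vcoord (x *m expad z)] = q.@[vcoord x].

Definition homog_of (d : nat) (q : {mpoly k[n]}) : bool :=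
  q \is @ishomog1 n k d mdeg.

(* directional derivative d/dt q(z + t w) at t = 0 *)
Definition dder (q : {mpoly k[n]}) (z w : vec) : k :=
  (mmap (@polyC k) (fun i => (z 0 i)%:P + (w 0 i)%:P * 'X) q)`_1.

(* polynomial functions on g x g, and S(g x g) (x) g *)
Definition eval2 (P : {mpoly k[n + n]}) (x y : vec) : k :=
  P.@[fun i => match split i with inl a => x 0 a | inr b => y 0 b end].

Definition evalv (phi : 'I_n -> {mpoly k[n + n]}) (x y : vec) : vec :=
  \row_j eval2 (phi j) x y.

(* v \in V'_{x,y} = sum over (a,b) <> 0 of g^{ax+by} *)
Definition inVp (x y v : vec) : Prop :=
  exists s : seq ((k * k) * vec),
    all (fun t => ((t.1.1, t.1.2) != (0, 0)) &&
                  (brk (t.1.1 *: x + t.1.2 *: y) t.2 == 0)) s &&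
    (v == \sum_(t <- s) t.2).

Definition zdense (D : vec -> vec -> Prop) : Prop :=
  forall P : {mpoly k[n + n]}, (forall x y, D x y -> eval2 P x y = 0) -> P = 0.

Definition inB (phi : 'I_n -> {mpoly k[n + n]}) : Prop :=
  exists D, zdense D /\ forall x y, D x y -> inVp x y (evalv phi x y).

End LieDefs.

(* Main.v *)
(** By invariance [eps_i z] lies in the centralizer of [z], so expanding
[[x + t y, eps_i (x + t y)] = 0] in [t] shows that the vectors [eps_i^(m) (x, y)] are
values of the pencil, hence lie in [V'_(x,y)], that they are isotropic for the form
[<[x, .], .>], and that they are orthogonal to [[x, y]].

If every nonzero [a x + b y] is regular, they are linearly independent.  Kostant's
theorem that the [eps_i z] are independent at every regular [z] is obtained from the
comparison of the maximal minors of the Jacobian matrix of the [p_i] with the pfaffian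
type minors of [ad z]: their ratio is an invariant polynomial, and a prime factor of it
would be an invariant dividing all the Jacobian minors, which Knop's argument excludes.
Comparing degrees gives [2 sum d_i = dim g + l = 2 b].  Hence for generic [(x, y)] the
[eps_i^(m) (x, y)] span a maximal isotropic space, which contains every [g^(a x + b y)].

So [phi] in [B_g] is a combination of the [eps_i^(m)] with rational coefficients.  The
denominators disappear because the maximal minors of the matrix of the [eps_i^(m)] have
no common prime factor [F]: they are homogeneous, so [F] would vanish at a point of the
plane of pairs [(a e + b h, a h + b f)], where [(e, h, f)] spans a space all of whose
nonzero elements are regular (a principal sl_2-triple). *)
Require Import Defs.
From HB Require Import structures.
From mathcomp Require Import all_boot all_order all_algebra.
From mathcomp Require Import ring_quotient fraction generic_quotient mpoly.
From mathcomp Require Import ring zify.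
From Stdlib Require Import Classical ClassicalEpsilon.
Import GRing.Theory.
Local Open Scope ring_scope.

Set Implicit Arguments.
Unset Strict Implicit.
Unset Printing Implicit Defensive.

(** Three obstacles shape the proof. [Bo] is only known to be a maximal solvable subalgebra, so the
    formula 2 dim Bo = dim g + l has to be drawn from Lie's theorem and the trace form; a Cartan
    subalgebra appears on the way, as the centralizer of a semisimple element of [Bo] whose
    centralizer is smallest. The field [k] has no order, so Cartan's criterion, positive roots and
    the independence of simple roots go through Q-linear functionals on subspaces of [k], under
    which vanishing traces become vanishing sums of squares. Invariance under [G] only speaks of
    exponentials of nilpotent elements, so derivatives along the rest of g are recovered from
    brackets of root vectors. Pfaffians are never formed: up to sign, the determinant of a skew
    matrix bordered by a constant matrix is the square of a pfaffian, and it is compared with the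
    square of a Jacobian minor; all degree counts are therefore doubled. *)

Lemma not_forall_not (T : Type) (P Q : T -> Prop) :
  ~ (forall x, P x -> ~ Q x) -> exists x, P x /\ Q x.
Proof. by move=> h; apply: NNPP => h'; apply: h => x px qx; apply: h'; exists x. Qed.

(** * Divisibility and prime factorization in a domain *)

Definition rdvd (A : comNzRingType) (a b : A) : Prop := exists q, b = q * a.

Definition prime_elt (A : idomainType) (p : A) : Prop :=
  [/\ p != 0, p \isn't a GRing.unit
    & forall a b, rdvd p (a * b) -> rdvd p a \/ rdvd p b].

(** The factors are prime and not merely irreducible, so uniqueness of the factorization comes for
    free ([prime_elt_assoc]). *)
Definition factorial_ring (A : idomainType) : Prop :=
  forall a : A, a != 0 -> exists (u : A) (s : seq A),
    [/\ u \is a GRing.unit, {in s, forall p, prime_elt p}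
      & a = u * \prod_(p <- s) p].

Section Divisibility.
Variable A : idomainType.
Implicit Types a b p q : A.

Lemma rdvdMl a b c : rdvd a b -> rdvd a (c * b).
Proof. by case=> q ->; exists (c * q); rewrite mulrA. Qed.

Lemma rdvdMr a b c : rdvd a b -> rdvd a (b * c).
Proof. by rewrite mulrC; exact: rdvdMl. Qed.

Lemma rdvdD a b c : rdvd a b -> rdvd a c -> rdvd a (b + c).
Proof. by case=> q -> [r ->]; exists (q + r); rewrite mulrDl. Qed.

Lemma rdvdB a b c : rdvd a b -> rdvd a c -> rdvd a (b - c).
Proof. by case=> q -> [r ->]; exists (q - r); rewrite mulrBl. Qed.

Lemma rdvd0 a : rdvd a 0.
Proof. by exists 0; rewrite mul0r. Qed.

Lemma rdvd_sum a (I : Type) (r : seq I) (P : pred I) (F : I -> A) :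
  (forall i, P i -> rdvd a (F i)) -> rdvd a (\sum_(i <- r | P i) F i).
Proof. by move=> h; elim/big_ind: _ => //; [exact: rdvd0 | exact: rdvdD]. Qed.

Lemma rdvd_unit a u : rdvd a u -> u \is a GRing.unit -> a \is a GRing.unit.
Proof. by case=> q -> ; rewrite unitrM => /andP[]. Qed.

Lemma prime_elt_prod p (s : seq A) :
  prime_elt p -> rdvd p (\prod_(q <- s) q) -> exists2 q, q \in s & rdvd p q.
Proof.
move=> [p0 pu pp]; elim: s => [|q s IH].
  by rewrite big_nil => /rdvd_unit /(_ (unitr1 _)) h; rewrite h in pu.
rewrite big_cons => /pp [h|/IH [r rs h]]; first by exists q; rewrite ?mem_head.
by exists r; rewrite // inE rs orbT.
Qed.

Lemma prime_elt_exp p a m : prime_elt p -> rdvd p (a ^+ m) -> rdvd p a.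
Proof.
move=> [p0 pu pp]; elim: m => [|m IH].
  by rewrite expr0 => /rdvd_unit /(_ (unitr1 _)) h; rewrite h in pu.
by rewrite exprS => /pp[|/IH].
Qed.

Lemma prime_elt_assoc p q : prime_elt p -> prime_elt q -> rdvd p q ->
  exists2 v, v \is a GRing.unit & q = v * p.
Proof.
move=> [p0 pu _] [q0 qu qp] [v e]; exists v => //.
case: (qp v p); rewrite -?e; first by exists 1; rewrite mul1r.
  case=> w ew; have : (w * p) * q = 1 * q by rewrite mul1r [RHS]e ew mulrAC.
  move/(mulIf q0) => wp1; have: rdvd p 1 by exists w; rewrite wp1.
  by move/rdvd_unit => /(_ (unitr1 _)) h; rewrite h in pu.
case=> w ew; have: (w * v) * p = 1 * p by rewrite mul1r [RHS]ew e mulrA.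
by move/(mulIf p0) => wv; apply: (rdvd_unit _ (unitr1 _)); exists w.
Qed.

(** Some member of [s] is associate to [p]; removing it factors [a]. The length drops by one, which
    is the induction measure whenever prime factors are cancelled. *)
Lemma factorization_div p a (u : A) (s : seq A) : prime_elt p ->
  u \is a GRing.unit -> {in s, forall q, prime_elt q} ->
  a * p = u * \prod_(q <- s) q ->
  exists (v : A) (t : seq A), [/\ v \is a GRing.unit,
    {in t, forall q, prime_elt q}, a = v * \prod_(q <- t) q & size s = (size t).+1].
Proof.
move=> pp uu ps e; have p0 : p != 0 by case: pp.
have [q qs dq] : exists2 q, q \in s & rdvd p q.
  apply: prime_elt_prod => //; case: (pp) => _ pu pP.
  case: (pP u (\prod_(q <- s) q)) => //; first by exists a.
  by move/rdvd_unit => /(_ uu) h; rewrite h in pu.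
have [w wu ew] : exists2 w, w \is a GRing.unit & q = w * p.
  by apply: prime_elt_assoc => //; exact: ps.
exists (u * w), (rem q s); split.
- by rewrite unitrM uu wu.
- by move=> r /mem_rem; exact: ps.
- apply: (mulIf p0); rewrite e (big_rem q) //= ew.
  by rewrite -!mulrA; congr (_ * (_ * _)); rewrite mulrC.
by rewrite size_rem // prednK //; case: s qs {ps e}.
Qed.

(** Common primes are cancelled one at a time, by induction on the number of prime factors of
    [a]. *)
Lemma coprime_reduction a b : factorial_ring A -> a != 0 -> b != 0 ->
  exists d a' b', [/\ d != 0, a = d * a', b = d * b'
    & forall p, prime_elt p -> rdvd p a' -> ~ rdvd p b'].
Proof.
move=> UA a0 b0; have [u [s [uu ps e]]] := UA a a0.
move: {2}(size s) (erefl (size s)) => m.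
elim: m a a0 b b0 u s uu ps e => [|m IH] a a0 b b0 u s uu ps e sz.
  exists 1, a, b; split; rewrite ?mul1r ?oner_eq0 // => p [_ pu _].
  rewrite e (size0nil sz) big_nil mulr1 => /rdvd_unit /(_ uu) h.
  by rewrite h in pu.
case: (classic (forall p, prime_elt p -> ~ (rdvd p a /\ rdvd p b))) => [h|].
  exists 1, a, b; split; rewrite ?mul1r ?oner_eq0 // => p pp pa pb.
  exact: (h p pp).
case/not_forall_not=> p [pp [[a' ea] [b' eb]]].
rewrite ea in e; have [v [t [vu pt et szt]]] := factorization_div pp uu ps e.
have a'0 : a' != 0 by apply: contraNneq a0 => z; rewrite ea z mul0r.
have b'0 : b' != 0 by apply: contraNneq b0 => z; rewrite eb z mul0r.
have [] := IH a' a'0 b' b'0 v t vu pt et; first by move: szt; rewrite sz => -[].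
move=> d [a1 [b1 [d0 e1 e2 cop]]]; exists (p * d), a1, b1; split => //.
- by rewrite mulf_neq0 //; case: pp.
- by rewrite ea e1 mulrC mulrA.
by rewrite eb e2 mulrC mulrA.
Qed.

Lemma prime_factor a : factorial_ring A -> a != 0 -> a \isn't a GRing.unit ->
  exists2 p, prime_elt p & rdvd p a.
Proof.
move=> UA a0 au; have [u [[|p s] [uu ps e]]] := UA a a0.
  by rewrite e big_nil mulr1 uu in au.
exists p; first by apply: ps; rewrite mem_head.
by exists (u * \prod_(q <- s) q); rewrite e big_cons mulrCA mulrC.
Qed.

Lemma factorial_iso (B : idomainType) (f : {rmorphism A -> B}) (g : {rmorphism B -> A}) :
  cancel f g -> cancel g f -> factorial_ring B -> factorial_ring A.
Proof.
move=> fK gK UB a a0.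
have fa0 : f a != 0 by apply: contraNneq a0 => h; rewrite -(fK a) h rmorph0.
have [u [s [uu ps e]]] := UB _ fa0.
have gdvd (x y : B) : rdvd x y -> rdvd (g x) (g y).
  by case=> q ->; exists (g q); rewrite rmorphM.
have fdvd (x y : A) : rdvd x y -> rdvd (f x) (f y).
  by case=> q ->; exists (f q); rewrite rmorphM.
exists (g u), (map g s); split; first exact: rmorph_unit.
  move=> _ /mapP [p /ps [p0 pu pp] ->]; split.
  - by apply: contraNneq p0 => h; rewrite -(gK p) h rmorph0.
  - by apply: contra pu => h; rewrite -(gK p); exact: rmorph_unit.
  move=> x y /fdvd; rewrite gK rmorphM => /pp [] /gdvd; rewrite fK; tauto.
by rewrite big_map -rmorph_prod -rmorphM -e fK.
Qed.

End Divisibility.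

(** * Gauss's lemma: polynomials over a factorial ring *)

Section FactorialPoly.
Variable A : idomainType.
Implicit Types (p : A) (f g h : {poly A}).

Lemma rdvd_polyC p f : rdvd p%:P f <-> forall i, rdvd p f`_i.
Proof.
split=> [[q ->] i|]; first by exists (q`_i); rewrite coefMC.
elim/poly_ind: f => [|f c IH] h; first exact: rdvd0.
have [q ->] : rdvd p%:P f.
  by apply: IH => i; have := h i.+1; rewrite coefD coefMX coefC /= addr0.
have [r ->] : rdvd p c by have := h 0; rewrite coefD coefMX coefC /= add0r.
by exists (q * 'X + r%:P); rewrite polyCM mulrDl mulrAC.
Qed.

Let behead_poly f := \poly_(i < (size f).-1) f`_i.

Let behead_polyE f : f = behead_poly f + (lead_coef f)%:P * 'X^((size f).-1).
Proof.
apply/polyP=> i; rewrite coefD coef_poly coefCM coefXn lead_coefE.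
case: (ltngtP i (size f).-1) => hi /=; rewrite ?mulr0 ?addr0 ?mulr1 ?add0r //.
  by rewrite nth_default //; case: (size f) hi.
by rewrite hi.
Qed.

(** If [p] divides [f * g], it divides one of the two leading coefficients; that leading term is
    dropped and the induction runs on the sum of the sizes. *)
Lemma prime_elt_polyC p : prime_elt p -> prime_elt p%:P.
Proof.
move=> [p0 pu pp]; split; first by rewrite polyC_eq0.
  by apply: contra pu; rewrite poly_unitE coefC size_polyC p0.
move=> f g; move: {2}(size f + size g)%N (leqnn (size f + size g)) => m.
elim: m f g => [|m IH] f g hs dv.
  move: hs; rewrite leqn0 addn_eq0 size_poly_eq0 => /andP[/eqP-> _].
  by left; exact: rdvd0.
have [->|f0] := eqVneq f 0; first by left; exact: rdvd0.
have [->|g0] := eqVneq g 0; first by right; exact: rdvd0.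
have sz h : h != 0 -> (size (behead_poly h) < size h)%N.
  rewrite -size_poly_gt0 => h0; apply: leq_ltn_trans (size_poly _ _) _.
  by rewrite prednK.
have dX h : rdvd p (lead_coef h) -> rdvd p%:P ((lead_coef h)%:P * 'X^((size h).-1)).
  by case=> q ->; apply: rdvdMr; exists q%:P; rewrite polyCM.
have : rdvd p (lead_coef f * lead_coef g).
  by rewrite -lead_coefM lead_coefE; move/rdvd_polyC: dv; exact.
case/pp=> dl.
  have dv' : rdvd p%:P (behead_poly f * g).
    have -> : behead_poly f * g = f * g - (lead_coef f)%:P * 'X^((size f).-1) * g.
      by rewrite {2}(behead_polyE f) mulrDl addrK.
    by apply: rdvdB => //; apply: rdvdMr; exact: dX.
  case: (IH _ _ _ dv'); last by right.
    by rewrite -ltnS (leq_trans _ hs) // ltn_add2r sz.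
  by move=> d; left; rewrite (behead_polyE f); apply: rdvdD => //; exact: dX.
have dv' : rdvd p%:P (f * behead_poly g).
  have -> : f * behead_poly g = f * g - f * ((lead_coef g)%:P * 'X^((size g).-1)).
    by rewrite {2}(behead_polyE g) mulrDr addrK.
  by apply: rdvdB => //; apply: rdvdMl; exact: dX.
case: (IH _ _ _ dv'); first by rewrite -ltnS (leq_trans _ hs) // ltn_add2l sz.
  by left.
by move=> d; right; rewrite (behead_polyE g); apply: rdvdD => //; exact: dX.
Qed.

Let primitive f := forall p, prime_elt p -> ~ rdvd p%:P f.

Hypothesis UA : factorial_ring A.

Let strip f : f != 0 -> exists (c : A) (g : {poly A}),
  [/\ c != 0, primitive g & f = c%:P * g].
Proof.
move=> f0; have l0 : lead_coef f != 0 by rewrite lead_coef_eq0.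
have [u [s [uu ps e]]] := UA l0.
move: {2}(size s) (erefl (size s)) => m; elim: m f f0 {l0} u s uu ps e => [|m IH] f f0 u s uu ps e sz.
  exists 1, f; split; rewrite ?oner_eq0 ?mul1r // => p pp /rdvd_polyC /(_ (size f).-1).
  rewrite -lead_coefE e (size0nil sz) big_nil mulr1 => /rdvd_unit /(_ uu).
  by case: pp => _ /negbTE ->.
case: (classic (primitive f)) => [pf|]; first by exists 1, f; rewrite oner_eq0 mul1r.
case/not_forall_not=> p [pp [g eg]].
have p0 : p != 0 by case: pp.
have g0 : g != 0 by apply: contraNneq f0 => g0; rewrite eg g0 mul0r.
have lf : lead_coef f = lead_coef g * p by rewrite eg lead_coefM lead_coefC.
rewrite lf in e; have [v [t [vu pt et szt]]] := factorization_div pp uu ps e.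
have [] := IH g g0 v t vu pt et; first by move: szt; rewrite sz => -[].
move=> c [h [c0 ph eh]]; exists (c * p), h; split=> //.
  by rewrite mulf_neq0.
by rewrite eg eh polyCM mulrAC.
Qed.

(** Each prime factor of [a] divides [g] or [h] by [prime_elt_polyC] and is cancelled there without
    changing the degrees: a factorization over the fraction field descends to [A]. *)
Let unscale f g h (a : A) : a != 0 -> a%:P * f = g * h ->
  exists g' h', [/\ f = g' * h', size g' = size g & size h' = size h].
Proof.
move=> a0; have [u [s [uu ps ->]]] := UA a0.
elim: s ps g h => [|p s IH] ps g h.
  rewrite big_nil mulr1 => e; exists ((u^-1)%:P * g), h; split=> //.
    by rewrite -mulrA -e mulrA -polyCM mulVr // mul1r.
  by rewrite mul_polyC size_scale // invr_eq0; apply: contraTneq uu => ->; rewrite unitr0.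
have pp : prime_elt p by apply: ps; rewrite mem_head.
have p0 : p%:P != 0 by rewrite polyC_eq0; case: pp.
have ps' : {in s, forall p, prime_elt p} by move=> q qs; apply: ps; rewrite inE qs orbT.
rewrite big_cons mulrCA polyCM -mulrA => e.
have szM q : size (q * p%:P) = size q.
  by rewrite mulrC mul_polyC size_scale; case: pp.
case: (prime_elt_polyC pp) => _ _ /(_ g h) [].
- by exists ((u * \prod_(j <- s) j)%:P * f); rewrite -e mulrC.
- case=> q eq; have [] := IH ps' q h.
    by apply: (mulfI p0); rewrite e eq mulrA [q * _]mulrC.
  by move=> g' [h' [-> e1 e2]]; exists g', h'; split=> //; rewrite eq szM.
case=> q eq; have [] := IH ps' g q.
  by apply: (mulfI p0); rewrite e eq [q * _]mulrC mulrCA.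
by move=> g' [h' [-> e1 e2]]; exists g', h'; split=> //; rewrite eq szM.
Qed.

Let unscale_dvd f g w (a : A) : primitive f -> a != 0 -> a%:P * g = w * f -> rdvd f g.
Proof.
move=> pf a0; have [u [s [uu ps ->]]] := UA a0.
elim: s ps w => [|p s IH] ps w.
  rewrite big_nil mulr1 => e; exists ((u^-1)%:P * w).
  by rewrite -mulrA -e mulrA -polyCM mulVr // mul1r.
have pp : prime_elt p by apply: ps; rewrite mem_head.
have p0 : p%:P != 0 by rewrite polyC_eq0; case: pp.
have ps' : {in s, forall p, prime_elt p} by move=> q qs; apply: ps; rewrite inE qs orbT.
rewrite big_cons mulrCA polyCM -mulrA => e.
case: (prime_elt_polyC pp) => _ _ /(_ w f) [].
- by exists ((u * \prod_(j <- s) j)%:P * g); rewrite -e mulrC.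
- case=> q eq; apply: (IH ps' q).
  by apply: (mulfI p0); rewrite e eq mulrA [q * _]mulrC.
by move=> h; case: (pf p pp h).
Qed.

(** The last hypothesis is irreducibility over the fraction field, with the denominator [a] cleared.
    Divisibility [%|] over a domain is up to constants, which [unscale_dvd] removes because [f] is
    primitive. The gcd of [f] and [g] is then either constant or [f], up to constants. *)
Let prime_primitive f : primitive f -> (1 < size f)%N ->
  (forall a g h, a != 0 -> a%:P * f = g * h -> (1 < size g)%N -> (1 < size h)%N -> False) ->
  prime_elt f.
Proof.
move=> pf sf irr.
have f0 : f != 0 by rewrite -size_poly_gt0; apply: leq_trans sf.
split=> //; first by rewrite poly_unitE negb_and gtn_eqF.
have dvd_of g : (f %| g)%R -> rdvd f g.
  case/Pdiv.Idomain.dvdpP => -[a q] /= a0 e.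
  by apply: (@unscale_dvd f g q a) => //; rewrite mul_polyC.
move=> g h [q e]; set d := gcdp f g.
have d0 : d != 0 by rewrite gcdp_eq0 negb_and f0.
have : (d %| f)%R by apply: dvdp_gcdl.
case/Pdiv.Idomain.dvdpP => -[a r] /= a0 er.
have fd : f %| g * h by rewrite e dvdp_mull.
have [sd|sd] := leqP (size d) 1.
  have cop : coprimep f g by rewrite coprimep_def eqn_leq sd size_poly_gt0.
  by right; apply: dvd_of; rewrite -(Gauss_dvdpr _ cop).
have r0 : r != 0.
  apply: contraNneq f0 => r0; move/eqP: er.
  by rewrite r0 mul0r scale_poly_eq0 (negbTE a0).
have [sr|sr] := leqP (size r) 1; last first.
  by exfalso; apply: (irr a r d a0) => //; rewrite mul_polyC.
have er0 : r = (r`_0)%:P by apply: size1_polyC.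
have rn0 : r`_0 != 0 by rewrite -polyC_eq0 -er0.
left; apply: dvd_of; apply: dvdp_trans (dvdp_gcdr f g).
apply/Pdiv.Idomain.dvdpP; exists (r`_0, a%:P) => //=.
by rewrite -mul_polyC -er0 mul_polyC er.
Qed.

Let unitC (u : A) : u \is a GRing.unit -> u%:P \is a GRing.unit.
Proof.
move=> uu; rewrite poly_unitE coefC size_polyC uu andbT eqb1.
by apply: contraTneq uu => ->; rewrite unitr0.
Qed.

(** Induction on the size: the content factors in [A], and the primitive part is constant, prime, or
    a product of two polynomials of smaller size by [unscale]. *)
Lemma factorial_poly : factorial_ring {poly A}.
Proof.
move=> f; move: {2}(size f) (leqnn (size f)) => m.
elim: m f => [|m IH] f hs f0; first by move: hs; rewrite leqn0 size_poly_eq0 (negbTE f0).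
have [c [g [c0 pg e]]] := strip f0.
have [u [s [uu ps ec]]] := UA c0.
have g0 : g != 0 by apply: contraNneq f0 => g0; rewrite e g0 mulr0.
have sg : size g = size f by rewrite e mul_polyC size_scale.
have psC : {in map polyC s, forall p : {poly A}, prime_elt p}.
  by move=> _ /mapP [p /ps pp ->]; exact: prime_elt_polyC.
suff [v [t [vu pt eg]]] : exists (v : {poly A}) (t : seq {poly A}),
    [/\ v \is a GRing.unit, {in t, forall p : {poly A}, prime_elt p} & g = v * \prod_(p <- t) p].
  exists (u%:P * v), (map polyC s ++ t); split.
  - by rewrite unitrM vu andbT unitC.
  - by move=> p; rewrite mem_cat => /orP[/psC|/pt].
  rewrite e eg ec big_cat big_map /= polyCM (rmorph_prod (@polyC A)) /=.
  by rewrite -!mulrA; congr (_ * _); rewrite mulrCA.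
have [sg1|sg1] := leqP (size g) 1.
  have eg0 : g = (g`_0)%:P by apply: size1_polyC.
  have gn0 : g`_0 != 0 by rewrite -polyC_eq0 -eg0.
  exists g, [::]; split=> //; last by rewrite big_nil mulr1.
  have [v [t [vu pt et]]] := UA gn0.
  case: t pt et => [|p t] pt et.
    by rewrite eg0 et big_nil mulr1 unitC.
  have pp : prime_elt p by apply: pt; rewrite mem_head.
  case: (pg p pp); exists (v * \prod_(q <- t) q)%:P.
  by rewrite -polyCM eg0 et big_cons mulrCA mulrC.
case: (classic (forall a g1 g2, a != 0 -> a%:P * g = g1 * g2 ->
   (1 < size g1)%N -> (1 < size g2)%N -> False)) => [irr|red].
  exists 1, [:: g]; split; rewrite ?unitr1 //; last by rewrite big_seq1 mul1r.
  by move=> p; rewrite inE => /eqP->; exact: prime_primitive.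
have [a [g1 [g2 [a0 ea s1 s2]]]] : exists a g1 g2, [/\ a != 0, a%:P * g = g1 * g2,
   (1 < size g1)%N & (1 < size g2)%N].
  apply: NNPP => hn; apply: red => a g1 g2 a0 ea s1 s2; apply: hn.
  by exists a, g1, g2.
have [h1 [h2 [eh sh1 sh2]]] := unscale a0 ea.
have h10 : h1 != 0 by rewrite -size_poly_gt0 sh1; apply: leq_trans s1.
have h20 : h2 != 0 by rewrite -size_poly_gt0 sh2; apply: leq_trans s2.
have szg : (size h1 + size h2).-1 = size f by rewrite -sg eh size_mul.
have [|v1 [t1 [vu1 pt1 et1]]] := IH h1 _ h10.
  rewrite -ltnS; apply: leq_trans hs; rewrite -szg sh2.
  by case: (size g2) s2 => [|[|z]] // _; rewrite addnS /= addnS ltnS leq_addr.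
have [|v2 [t2 [vu2 pt2 et2]]] := IH h2 _ h20.
  rewrite -ltnS; apply: leq_trans hs; rewrite -szg sh1.
  by case: (size g1) s1 => [|[|z]] // _; rewrite addSn /= addSn ltnS leq_addl.
exists (v1 * v2), (t1 ++ t2); split.
- by rewrite unitrM vu1.
- by move=> p; rewrite mem_cat => /orP[/pt1|/pt2].
by rewrite eh et1 et2 big_cat /= mulrACA.
Qed.

End FactorialPoly.

(** * Polynomial rings in several variables over a field are factorial *)

Local Notation mwiden_ord := (widen_ord (leqnSn _)).

Section MultiToUni.
Variables (n : nat) (R : comNzRingType).

Definition unmuni : {poly {mpoly R[n]}} -> {mpoly R[n.+1]} :=
  horner_eval 'X_ord_max \o map_poly (@mwiden n R).

HB.instance Definition _ := GRing.RMorphism.on unmuni.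

Lemma muniX_max : muni ('X_ord_max : {mpoly R[n.+1]}) = 'X.
Proof.
rewrite muniE msuppX big_seq1 mcoeffX eqxx scale1r mnm1E eqxx expr1.
rewrite (_ : [multinom _ | i < n] = 0%MM) ?mpolyX0 ?scale1r //.
apply/mnmP=> i; rewrite mnmE mnm0E mnm1E.
by rewrite -val_eqE /= eq_sym ltn_eqF.
Qed.

Lemma muni_mwiden (p : {mpoly R[n]}) : muni (mwiden p) = p%:P.
Proof.
elim/mpolyind: p => [|c m p _ _ IH]; first by rewrite mwiden0 muni0.
rewrite mwidenD muniD IH polyCD; congr (_ + _).
rewrite mwidenZ muniZ mwidenX muniE msuppX big_seq1 mcoeffX eqxx scale1r.
rewrite mnmwiden_ordmax expr0 -mul_polyC alg_polyC -polyCM mul_mpolyC.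
congr (c *: 'X_[_])%:P; apply/mnmP=> i; rewrite mnmE.
exact: mnmwiden_widen.
Qed.

Lemma unmuniK : cancel unmuni (@muni n R).
Proof.
move=> p; rewrite /unmuni /= /horner_eval -[RHS]coefK poly_def.
rewrite horner_coef size_map_inj_poly ?rmorph0 //; last exact: inj_mwiden.
rewrite rmorph_sum /=; apply: eq_bigr => i _.
by rewrite coef_map /= rmorphM rmorphXn /= muniX_max muni_mwiden mul_polyC.
Qed.

Lemma muniK : cancel (@muni n R) unmuni.
Proof.
move=> p; rewrite {2}[p]mpolyE muniE rmorph_sum /=; apply: eq_bigr => m _.
rewrite /unmuni /= /horner_eval map_polyZ map_polyXn hornerZ hornerXn /=.
rewrite mwidenZ mwidenX -scalerAl mpolyXn -mpolyXD; congr (_ *: 'X_[_]).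
apply/mnmP=> i; rewrite mnmDE mulmnE mnm1E.
case: (unliftP ord_max i) => [j ->|->]; last first.
  by rewrite mnmwiden_ordmax eqxx add0n mul1n.
have -> : lift ord_max j = mwiden_ord j by apply/val_inj; rewrite /= /bump leqNgt ltn_ord.
rewrite mnmwiden_widen mnmE -val_eqE /= gtn_eqF ?ltn_ord // mul0n addn0 //.
Qed.

End MultiToUni.

Lemma factorial_mpoly (k : fieldType) n : factorial_ring {mpoly k[n]}.
Proof.
elim: n => [|n IH]; last first.
  exact: (factorial_iso (@muniK n k) (@unmuniK n k) (factorial_poly IH)).
move=> p p0; exists p, [::]; split; rewrite ?big_nil ?mulr1 //.
have e : p = (p@_0)%:MP.
  apply/mpolyP=> m; rewrite mcoeffC.
  by have -> : m = 0%MM; [apply/mnmP; case | rewrite eqxx mulr1].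
rewrite e; apply: rmorph_unit; rewrite unitfE.
by apply: contraNneq p0 => h; rewrite e h mpolyC0.
Qed.

(** * Polynomials as functions, homogeneity, zeros on a plane *)

Section Genericity.
Variable k : closedFieldType.

Lemma poly_nonroot (p : {poly k}) : p != 0 -> exists x, p.[x] != 0.
Proof. by move/closed_nonrootP=> [x]; exists x. Qed.

Lemma poly_eq0P (p : {poly k}) : (forall x, p.[x] = 0) -> p = 0.
Proof.
move=> h; apply/eqP; apply: contraT => /poly_nonroot [x]; by rewrite h eqxx.
Qed.

Lemma poly_ext (p q : {poly k}) : (forall x, p.[x] = q.[x]) -> p = q.
Proof.
move=> h; apply/eqP; rewrite -subr_eq0; apply/eqP/poly_eq0P => x.
by rewrite hornerD hornerN h subrr.
Qed.

Lemma meval_muni n (p : {mpoly k[n.+1]}) (v : 'I_n.+1 -> k) :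
  p.@[v] = (map_poly (meval (fun i => v (mwiden_ord i))) (muni p)).[v ord_max].
Proof.
rewrite muniE {1}[p]mpolyE !rmorph_sum /= horner_sum; apply: eq_bigr => m _.
rewrite map_polyZ map_polyXn /= hornerZ hornerXn !mevalZ !mevalX.
rewrite big_ord_recr /= mulrA; congr (_ * _ * _).
by apply: eq_bigr => i _; rewrite mnmE.
Qed.

Lemma mpoly_nonvanishing n (p : {mpoly k[n]}) : p != 0 -> exists v, p.@[v] != 0.
Proof.
elim: n p => [|n IH] p p0.
  exists (fun=> 0); have e : p = (p@_0)%:MP.
    apply/mpolyP=> m; rewrite mcoeffC.
    by have -> : m = 0%MM; [apply/mnmP; case | rewrite eqxx mulr1].
  by apply: contraNneq p0; rewrite e mevalC => ->; rewrite mpolyC0.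
have q0 : lead_coef (muni p) != 0.
  by rewrite lead_coef_eq0; apply: contraNneq p0 => h; rewrite -(muniK p) h rmorph0.
have [v vP] := IH _ q0.
have [t tP] : exists t, (map_poly (meval v) (muni p)).[t] != 0.
  apply: poly_nonroot; apply: contraNneq vP => /polyP /(_ (size (muni p)).-1).
  by rewrite coef_map coef0 lead_coefE => ->.
exists (fun i => if unlift ord_max i is Some j then v j else t).
rewrite meval_muni unlift_none; congr (_.[_] != 0): tP.
apply: eq_map_poly => q; apply: meval_eq => i /=.
have -> : mwiden_ord i = lift ord_max i by apply/val_inj; rewrite /= /bump leqNgt ltn_ord.
by rewrite liftK.
Qed.

Lemma mpoly_ext n (p q : {mpoly k[n]}) : (forall v, p.@[v] = q.@[v]) -> p = q.
Proof.
move=> h; apply/eqP; rewrite -subr_eq0; apply: contraT => /mpoly_nonvanishing [v].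
by rewrite mevalB h subrr eqxx.
Qed.

(** Homogeneity is read on values, so that it passes to determinants without inspecting
    monomials. *)
Definition homogf n (d : nat) (p : {mpoly k[n]}) :=
  forall t v, p.@[fun i => t * v i] = t ^+ d * p.@[v].

(** Once the powers of ['X] are split off, the cofactors do not vanish at 0 and their product has to
    be a constant. *)
Lemma poly_monomial_factor (A : idomainType) (p q : {poly A}) (c : A) d :
  c != 0 -> p * q = c%:P * 'X^d -> exists a e, p = a%:P * 'X^e.
Proof.
move=> c0 e.
have pq0 : p * q != 0 by rewrite e mulf_neq0 ?polyC_eq0 ?monic_neq0 ?monicXn.
have [p0 q0] : p != 0 /\ q != 0 by move: pq0; rewrite mulf_eq0 negb_or => /andP.
have [i [p1 r1 e1]] := multiplicity_XsubC p 0.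
have [j [q1 r2 e2]] := multiplicity_XsubC q 0.
move: r1 r2; rewrite p0 q0 /= /root => r1 r2.
rewrite subr0 in e1 e2; exists (p1`_0), i.
suff sp : (size p1 <= 1)%N by rewrite {1}e1 {1}(size1_polyC sp).
have e3 : p1 * q1 * 'X^(i + j) = c%:P * 'X^d by rewrite -e e1 e2 exprD mulrACA.
have ed : d = (i + j)%N.
  apply/eqP; rewrite eqn_leq; apply/andP; split; rewrite leqNgt; apply/negP=> lt.
    move/polyP: e3 => /(_ (i + j)%N); rewrite coefMXn coefCM coefXn ltnn subnn.
    rewrite (ltn_eqF lt) mulr0 -horner_coef0 hornerM => /eqP.
    by rewrite mulf_eq0 (negbTE r1) (negbTE r2).
  move/polyP: e3 => /(_ d); rewrite coefMXn coefCM coefXn lt eqxx mulr1.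
  by move=> h; rewrite -h eqxx in c0.
have e4 : p1 * q1 = c%:P by apply: (@mulIf _ 'X^d); rewrite ?monic_neq0 ?monicXn // -e3 ed.
have : size (p1 * q1) = 1%N by rewrite e4 size_polyC c0.
have p10 : p1 != 0 by apply: contraNneq p0 => h; rewrite e1 h mul0r.
have q10 : q1 != 0 by apply: contraNneq q0 => h; rewrite e2 h mul0r.
rewrite size_mul // => h; move: q10; rewrite -size_poly_gt0.
by case: (size q1) h => // z; rewrite addnS /= => <- _; rewrite leq_addr.
Qed.

(** Under the substitution of ['X_i * T] for ['X_i], homogeneity of degree [d] becomes equality with
    a monomial of degree [d] in [T], and factors of monomials are monomials. *)
Lemma homogf_factor n (p q : {mpoly k[n]}) d :
  p * q != 0 -> homogf d (p * q) -> exists e, homogf e p.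
Proof.
move=> pq0 h.
pose S := mmap (polyC \o @mpolyC n k) (fun i : 'I_n => ('X_i : {mpoly k[n]})%:P * 'X).
have SE (r : {mpoly k[n]}) t v : (map_poly (meval v) (S r)).[t] = r.@[fun i => t * v i].
  rewrite {2}[r]mpolyE /S /mmap !rmorph_sum /= horner_sum; apply: eq_bigr => m _.
  rewrite rmorphM /= hornerM map_polyC /= hornerC mevalC mevalZ mevalX; congr (_ * _).
  rewrite /mmap1 rmorph_prod horner_prod; apply: eq_bigr => i _.
  rewrite rmorphXn /= rmorphM /= map_polyX map_polyC /= mevalXU.
  by rewrite horner_exp hornerM hornerC hornerX mulrC.
have SM0 : S (p * q) = S p * S q by rewrite /S rmorphM.
move: S SE SM0 => S SE SM0.
have SC (r : {mpoly k[n]}) e v : map_poly (meval v) (r%:P * 'X^e) = r.@[v]%:P * 'X^e.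
  by rewrite rmorphM /= map_polyXn map_polyC.
have ext (f g : {poly {mpoly k[n]}}) :
    (forall v, map_poly (meval v) f = map_poly (meval v) g) -> f = g.
  move=> e; apply/polyP=> i; apply: mpoly_ext => v.
  by have /polyP/(_ i) := e v; rewrite !coef_map.
have SM : S p * S q = (p * q)%:P * 'X^d.
  apply: ext => v; apply: poly_ext => t; rewrite SC hornerM hornerC hornerXn.
  by rewrite -SM0 SE h mulrC.
have [a [e ea]] := poly_monomial_factor pq0 SM.
exists e => t v; rewrite -SE ea SC hornerM hornerC hornerXn mulrC; congr (_ * _).
have := SE p 1 v; rewrite ea SC hornerM hornerC hornerXn expr1n mulr1 => ->.
by apply: meval_eq => i; rewrite mul1r.
Qed.

(** The restriction to the line [t v + w] has a root unless it is a nonzero constant [c]. In that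
    case homogeneity makes the restriction to [t w + v] equal to [c t^d], which vanishes at [t = 0],
    that is at [v]. *)
Lemma homogf_zero n (p : {mpoly k[n]}) d (v w : 'I_n -> k) : (0 < d)%N -> homogf d p ->
  exists a b : k, (a, b) != (0, 0) /\ p.@[fun i => a * v i + b * w i] = 0.
Proof.
move=> d0 h.
pose L (x y : 'I_n -> k) := mmap (@polyC k) (fun i : 'I_n => (x i)%:P * 'X + (y i)%:P) p.
have LE x y t : (L x y).[t] = p.@[fun i => t * x i + y i].
  rewrite /L /mmap horner_sum mevalE; apply: eq_bigr => m _.
  rewrite hornerM hornerC; congr (_ * _); rewrite /mmap1 horner_prod.
  apply: eq_bigr => i _.
  by rewrite horner_exp hornerD hornerM !hornerC hornerX mulrC.
have [s1|s1] := eqVneq (size (L v w)) 1%N; last first.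
  have /closed_rootP[t] := s1; rewrite /root LE => /eqP e.
  exists t, 1; split; first by rewrite xpair_eqE negb_and oner_eq0 orbT.
  by rewrite -e; apply: meval_eq => i; rewrite mul1r.
exists 1, 0; split; first by rewrite xpair_eqE negb_and oner_eq0.
have [c ec] : exists c, L v w = c%:P.
  by exists ((L v w)`_0); apply: size1_polyC; rewrite s1.
have e2 : L w v * 'X = c%:P * 'X^d * 'X.
  apply: poly_ext => t; rewrite !hornerM hornerC hornerX hornerXn LE.
  have [->|t0] := eqVneq t 0; first by rewrite !mulr0.
  congr (_ * _); rewrite mulrC -[c](hornerC c t^-1) -ec LE -h.
  by apply: meval_eq => i; rewrite mulrDr mulVKf // addrC.
have e3 : L w v = c%:P * 'X^d by apply: (@mulIf _ 'X); rewrite ?polyX_eq0.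
have := LE w v 0; rewrite e3 hornerM hornerXn expr0n gtn_eqF // mulr0 => e4.
by rewrite [RHS]e4; apply: meval_eq => i; rewrite !mul0r mul1r add0r addr0.
Qed.

End Genericity.

(** * The residue field of a prime element *)

Local Open Scope quotient_scope.

Section ResidueField.
Variables (A : idomainType) (p : A).
Hypothesis pp : prime_elt p.

Definition multiples of prime_elt p := fun u : A =>
  if excluded_middle_informative (rdvd p u) then true else false.

Local Notation I := (multiples pp).

Lemma multiplesP u : reflect (rdvd p u) (u \in I).
Proof.
by rewrite unfold_in /multiples; case: excluded_middle_informative => h; constructor.
Qed.

Fact multiples_idealr_closed : idealr_closed I.
Proof.
split; first by apply/multiplesP; exact: rdvd0.
  apply/multiplesP => /rdvd_unit /(_ (unitr1 _)) h.
  by have [_] := pp; rewrite h.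
move=> a u v /multiplesP hu /multiplesP hv; apply/multiplesP.
by apply: rdvdD => //; exact: rdvdMl.
Qed.

HB.instance Definition _ := isIdealr.Build A I multiples_idealr_closed.

Fact multiples_prime_closed : prime_idealr_closed I.
Proof.
by move=> u v /multiplesP; have [_ _ h] := pp => /h [] /multiplesP ->; rewrite ?orbT.
Qed.

HB.instance Definition _ := isPrimeIdealrClosed.Build A I multiples_prime_closed.

Definition multiples_ideal : prime_idealr A := I.

Definition residue_ring := {ideal_quot multiples_ideal}.
HB.instance Definition _ := GRing.ComNzRing.on residue_ring.

Let has_inv (x : residue_ring) := exists y, y * x = 1.

(** Units and inverses are picked classically; they give the quotient the domain structure from
    which fractions are formed. *)
Definition residue_unit : pred residue_ring := fun x =>
  if excluded_middle_informative (has_inv x) then true else false.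

Definition residue_inv (x : residue_ring) : residue_ring :=
  if excluded_middle_informative (has_inv x) is left h
  then proj1_sig (constructive_indefinite_description _ h) else x.

Fact residue_mulVx : {in residue_unit, left_inverse 1 residue_inv *%R}.
Proof.
move=> x; rewrite unfold_in /residue_unit /residue_inv.
by case: excluded_middle_informative => // h _; case: constructive_indefinite_description.
Qed.

Fact residue_unitPl (x y : residue_ring) : y * x = 1 -> residue_unit x.
Proof.
rewrite /residue_unit => e; case: excluded_middle_informative => // h.
by case: h; exists y.
Qed.

Fact residue_inv_out : {in [predC residue_unit], residue_inv =1 id}.
Proof.
move=> x; rewrite inE unfold_in /residue_unit /residue_inv.
by case: excluded_middle_informative.
Qed.

HB.instance Definition _ := GRing.ComNzRing_hasMulInverse.Build residue_ring
  residue_mulVx residue_unitPl residue_inv_out.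

Fact residue_integral : GRing.integral_domain_axiom residue_ring.
Proof. exact: Quotient.rquot_IdomainAxiom. Qed.

HB.instance Definition _ := GRing.ComUnitRing_isIntegral.Build residue_ring
  residue_integral.

(** Divisibility by [p] becomes vanishing in a field, so ranks, kernels and bases can be used modulo
    [p]. *)
Lemma residue_field : exists (K : fieldType) (f : {rmorphism A -> K}),
  forall u, f u = 0 <-> rdvd p u.
Proof.
pose pi_I : {rmorphism A -> residue_ring} := \pi_{ideal_quot multiples_ideal}.
exists {fraction residue_ring}, (@tofrac residue_ring \o pi_I) => u.
have piE : (u \in multiples_ideal) = (pi_I u == 0).
  by rewrite -[0](rmorph0 pi_I) -[u in LHS]subr0 Quotient.idealrBE.
rewrite /=; split=> [/eqP|h]; first by rewrite tofrac_eq0 -piE => /multiplesP.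
by apply/eqP; rewrite tofrac_eq0 -piE; apply/multiplesP.
Qed.

End ResidueField.

Local Close Scope quotient_scope.

(** * Derivations and partial derivatives, characteristic zero *)

Section Derivations.
Variables (n : nat) (k : comNzRingType).
Implicit Types p q : {mpoly k[n]}.

Lemma mpoly_alg_ind (P : {mpoly k[n]} -> Prop) :
  (forall a, P a%:MP) -> (forall i, P 'X_i) ->
  (forall p q, P p -> P q -> P (p + q)) -> (forall p q, P p -> P q -> P (p * q)) ->
  forall p, P p.
Proof.
move=> PC PX PD PM; elim/mpolyind => [|a m p _ _ IH]; first by rewrite -mpolyC0.
apply: (PD) => //; rewrite -mul_mpolyC; apply: (PM) => //.
rewrite mpolyXE_id; apply: (big_ind P) => [|x y px py|i _].
- by rewrite -mpolyC1.
- exact: PM.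
by elim: (m i) => [|e IHe]; rewrite ?expr0 ?exprS -?mpolyC1 //; exact: PM.
Qed.

Lemma mderivXU i j : ('X_i : {mpoly k[n]})^`M(j) = (i == j)%:R.
Proof.
rewrite mderivX mnm1E; case: eqP => [->|_]; last by rewrite scale0r.
by rewrite -{1}[U_(_)%MM]add0m addmK mpolyX0 scale1r.
Qed.

(** Chain rule: a derivation that kills the constants is determined on polynomial expressions by its
    values on the arguments. It serves both for compositions of polynomials and for derivatives
    along polynomial curves. *)
Lemma mmap_derivation (S : comNzRingType) (f : {rmorphism k -> S}) (h : 'I_n -> S)
    (D : S -> S) (p : {mpoly k[n]}) :
  {morph D : x y / x + y} -> (forall x y, D (x * y) = D x * y + x * D y) ->
  (forall a, D (f a) = 0) ->
  D (mmap f h p) = \sum_(i < n) mmap f h p^`M(i) * D (h i).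
Proof.
move=> DD DM Df; elim/mpoly_alg_ind: p => [a|j|p q IHp IHq|p q IHp IHq].
- rewrite mmapC Df big1 // => i _; by rewrite mderivC mmap0 mul0r.
- rewrite mmapX mmap1U (bigD1 j) //= big1 ?addr0 => [|i ij].
    by rewrite mderivXU eqxx rmorph1 mul1r.
  by rewrite mderivXU eq_sym (negbTE ij) mmap0 mul0r.
- rewrite mmapD DD IHp IHq -big_split; apply: eq_bigr => i _.
  by rewrite mderivD mmapD mulrDl.
rewrite rmorphM DM IHp IHq mulr_suml mulr_sumr -big_split; apply: eq_bigr => i _.
by rewrite mderivM rmorphD !rmorphM /= mulrDl mulrAC -!mulrA.
Qed.

Lemma mderiv_comp_mpoly m (t : n.-tuple {mpoly k[m]}) p j :
  (p \mPo t)^`M(j) = \sum_(i < n) (p^`M(i) \mPo t) * (tnth t i)^`M(j).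
Proof.
apply: (@mmap_derivation _ (@mpolyC m k) (tnth t) (mderiv j)) => [x y|x y|a].
- exact: mderivD.
- exact: mderivM.
- exact: mderivC.
Qed.

Lemma comp_mpolyA m r (t : n.-tuple {mpoly k[m]}) (u : m.-tuple {mpoly k[r]}) p :
  (p \mPo t) \mPo u = p \mPo [tuple tnth t i \mPo u | i < n].
Proof.
elim/mpoly_alg_ind: p => [a|j|p q IHp IHq|p q IHp IHq].
- by rewrite !comp_mpolyC.
- by rewrite !comp_mpolyXU -!tnth_nth tnth_mktuple.
- by rewrite !rmorphD /= IHp IHq.
- by rewrite !rmorphM /= IHp IHq.
Qed.

Lemma eq_comp_mpoly m (t u : n.-tuple {mpoly k[m]}) p :
  (forall i, (exists2 mm, mm \in msupp p & mm i != 0%N) -> tnth t i = tnth u i) ->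
  p \mPo t = p \mPo u.
Proof.
move=> h; rewrite !comp_mpolyE; apply: eq_big_seq => mm mmp; congr (_ *: _).
apply: eq_bigr => i _; have [->|mi] := eqVneq (mm i) 0%N; first by rewrite !expr0.
by rewrite h //; exists mm.
Qed.

End Derivations.

Section CharZero.
Variables (n : nat) (k : fieldType).
Hypothesis char0 : [pchar k] =i pred0.
Implicit Types p q : {mpoly k[n]}.

Lemma natr_neq0 m : (0 < m)%N -> m%:R != 0 :> k.
Proof. by have /pcharf0P -> := char0; rewrite -lt0n. Qed.

Lemma mderiv_eq0P p i : p^`M(i) = 0 <-> (forall m, m \in msupp p -> m i = 0%N).
Proof.
split=> [e m mp|h]; last first.
  apply/mpolyP=> m; rewrite mcoeff_mderiv mcoeff0.
  have [/h|/memN_msupp_eq0->] := boolP ((m + U_(i))%MM \in msupp p); last by rewrite mul0rn.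
  by rewrite mnmDE mnm1E eqxx addn1.
apply/eqP; apply: contraLR mp => mi; rewrite -mcoeff_eq0; rewrite -lt0n in mi.
have e2 : m = ((m - U_(i)) + U_(i))%MM.
  by rewrite submK // lep1mP -lt0n.
have := mcoeff_mderiv i p (m - U_(i)); rewrite e mcoeff0 -e2 -mulr_natr => /esym/eqP.
by rewrite mulf_eq0 (negbTE (natr_neq0 _)) // orbF.
Qed.

Lemma mderiv_all_eq0 p : (forall i, p^`M(i) = 0) -> p = (p@_0)%:MP.
Proof.
move=> h; apply/mpolyP=> m; rewrite mcoeffC.
case: eqP => [->|/eqP m0]; first by rewrite mulr1.
rewrite mulr0; apply: memN_msupp_eq0; apply: contra m0 => mp.
by apply/eqP/mnmP => i; rewrite mnm0E; have /mderiv_eq0P -> := h i.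
Qed.

Lemma msize_gt0 p : (0 < msize p)%N = (p != 0).
Proof. by rewrite lt0n mmeasure_poly_eq0. Qed.

Lemma msize_mderiv p i : p != 0 -> (msize p^`M(i) < msize p)%N.
Proof.
move=> p0; rewrite [X in (X < _)%N]msizeE; apply: (@leq_ltn_trans (msize p).-1); last first.
  by rewrite prednK // msize_gt0.
apply/bigmax_leqP_seq => m mp _; rewrite -ltnS prednK ?msize_gt0 //.
suff /msize_mdeg_lt : (m + U_(i))%MM \in msupp p by rewrite mdegD mdeg1 addn1.
by apply: contraLR mp => /memN_msupp_eq0 h; rewrite -mcoeff_eq0 mcoeff_mderiv h mul0rn.
Qed.

Lemma rdvd_msize p q : rdvd p q -> q != 0 -> (msize p <= msize q)%N.
Proof.
case=> r -> rp0; have [r0 p0] : r != 0 /\ p != 0 by move: rp0; rewrite mulf_eq0 negb_or => /andP.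
rewrite msizeM //; move: r0; rewrite -msize_gt0.
by case: (msize r) => // z _; rewrite addSn /= leq_addl.
Qed.

(* Viewing [p * q] as a polynomial in ['X_i] alone, degrees in ['X_i] add up. *)
Lemma mderiv_factor p q i : p * q != 0 -> (p * q)^`M(i) = 0 -> p^`M(i) = 0.
Proof.
pose h a : {poly {mpoly k[n]}} := if a == i then 'X else ('X_a)%:P.
pose f : {rmorphism k -> {poly {mpoly k[n]}}} := @polyC {mpoly k[n]} \o @mpolyC n k.
pose S : {rmorphism {mpoly k[n]} -> {poly {mpoly k[n]}}} := mmap f h.
have SC a : S a%:MP = a%:MP%:P by rewrite /S /= mmapC.
have SX j : S 'X_j = h j by rewrite /S /= mmapX mmap1U.
have SD r : (S r)^`() = \sum_(j < n) S r^`M(j) * (h j)^`().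
  apply: mmap_derivation; [exact: derivD | exact: derivM | by move=> a; rewrite derivC].
clearbody S; clear f.
have SK r : (S r).['X_i] = r.
  elim/mpoly_alg_ind: r => [a|j|r s IHr IHs|r s IHr IHs].
  - by rewrite SC hornerC.
  - rewrite SX /h; case: eqP => [->|_]; by rewrite ?hornerX ?hornerC.
  - by rewrite rmorphD hornerD IHr IHs.
  - by rewrite rmorphM hornerM IHr IHs.
have {}SD r : (S r)^`() = S r^`M(i).
  rewrite SD (bigD1 i) //= big1 ?addr0 => [|j ji]; rewrite /h ?eqxx ?derivX ?mulr1 //.
  by rewrite (negbTE ji) derivC mulr0.
move=> pq0 e.
have S0 r : r != 0 -> S r != 0 by apply: contraNneq => z; rewrite -(SK r) z horner0.
have [p0 q0] : p != 0 /\ q != 0 by move: pq0; rewrite mulf_eq0 negb_or => /andP.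
have : (size (S (p * q)%R) <= 1)%N.
  apply/leq_sizeP => -[//|j] _; have := SD (p * q); rewrite e rmorph0 => /polyP /(_ j).
  rewrite coef_deriv coef0 -scaler_nat => /eqP; rewrite mscalerI.
  by rewrite (negbTE (natr_neq0 _)) // => /eqP.
rewrite rmorphM size_mul ?S0 // => sz.
have sp : (size (S p) <= 1)%N.
  apply: leq_trans sz; have := S0 _ q0; rewrite -size_poly_gt0.
  by case: (size (S q)) => // z _; rewrite addnS leq_addr.
by rewrite -[LHS]SK -SD (size1_polyC sp) derivC horner0.
Qed.

End CharZero.

(** * Algebraic dependence modulo a polynomial *)

Lemma linear_dependence (k : fieldType) (I J : finType) (M : I -> J -> k) :
  (#|J| < #|I|)%N ->
  exists2 c : I -> k, (exists i, c i != 0) & forall j, \sum_i c i * M i j = 0.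
Proof.
move=> lt; pose A := \matrix_(i < #|I|, j < #|J|) M (enum_val i) (enum_val j).
have [v vA v0] : exists2 v : 'rV_#|I|, (v <= kermx A)%MS & v != 0.
  apply/rowV0Pn; rewrite -mxrank_eq0 mxrank_ker subn_eq0 -ltnNge.
  exact: leq_ltn_trans (rank_leq_col A) lt.
exists (fun i => v 0 (enum_rank i)).
  by have /rV0Pn [i vi] := v0; exists (enum_val i); rewrite enum_valK.
move=> j; have /sub_kermxP /rowP /(_ (enum_rank j)) := vA.
rewrite !mxE (reindex (@enum_rank I)) /=; last exact/onW_bij/enum_rank_bij.
by move=> e; apply: etrans e; apply: eq_bigr => i _; rewrite mxE !enum_rankK.
Qed.

Section AlgebraicRelation.
Variables (n : nat) (k : fieldType).

Lemma msizeM_bound (p q : {mpoly k[n]}) a b :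
  (msize p <= a.+1)%N -> (msize q <= b.+1)%N -> (msize (p * q)%R <= (a + b).+1)%N.
Proof.
have [->|p0] := eqVneq p 0; first by rewrite mul0r mmeasure0.
have [->|q0] := eqVneq q 0; first by rewrite mulr0 mmeasure0.
rewrite msizeM // => pa qb; have := leq_add pa qb; rewrite addSn addnS.
by case: (_ + _)%N => [//|z]; rewrite ltnS.
Qed.

Lemma msizeX_bound (p : {mpoly k[n]}) a m :
  (msize p <= a.+1)%N -> (msize (p ^+ m)%R <= (a * m).+1)%N.
Proof.
move=> pa; elim: m => [|m IH]; first by rewrite expr0 msize1.
by rewrite exprS mulnS msizeM_bound.
Qed.

Lemma msize_prod_bound (I : Type) (r : seq I) (F : I -> {mpoly k[n]}) (g : I -> nat) :
  (forall i, msize (F i) <= (g i).+1)%N ->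
  (msize (\prod_(i <- r) F i) <= (\sum_(i <- r) g i).+1)%N.
Proof.
move=> h; elim: r => [|i r IH]; first by rewrite !big_nil msize1.
by rewrite !big_cons msizeM_bound.
Qed.

(* Cancelling powers of [F] in a relation between [t] and [F]. *)
Lemma relation_mod_of_relation N (t : N.-tuple {mpoly k[n]}) (F : {mpoly k[n]}) D
    (P : {mpoly k[N]} -> Prop) (H : nat -> {mpoly k[N]}) :
  F != 0 -> (forall z, P (H z)) -> (exists2 z, (z < D)%N & H z != 0) ->
  \sum_(z < D) (H z \mPo t) * F ^+ z = 0 ->
  exists H', [/\ H' != 0, P H' & rdvd F (H' \mPo t)].
Proof.
move=> F0; elim: D H => [|D IH] H PH [z zD Hz] e; first by [].
have [H0|H0] := eqVneq (H 0%N) 0; last first.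
  exists (H 0%N); split=> //; move: e; rewrite big_ord_recl expr0 mulr1.
  move/eqP; rewrite addr_eq0 => /eqP ->; rewrite -mulN1r; apply: rdvdMl.
  by apply: rdvd_sum => i _; rewrite /= /bump exprS mulrCA mulrC; exists ((H (1 + i)%N \mPo t) * F ^+ i).
apply: (IH (fun z => H z.+1)) => //.
  case: z zD Hz => [|z] zD Hz; first by rewrite H0 eqxx in Hz.
  by exists z.
apply: (mulfI F0); rewrite mulr0 -[RHS]e big_ord_recl H0 comp_mpoly0 mul0r add0r mulr_sumr.
by apply: eq_bigr => i _; rewrite /= /bump exprS mulrCA.
Qed.

(** The [t_a] with [a] in [A] and [F] are [n + 1] polynomials in [n] variables, hence algebraically
    dependent. Cancelling powers of [F] leaves a relation between the [t_a] modulo [F]. *)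
Lemma algebraic_relation N (t : N.-tuple {mpoly k[n]}) (A : {set 'I_N}) (F : {mpoly k[n]}) :
  F != 0 -> #|A| = n ->
  exists H : {mpoly k[N]}, [/\ H != 0,
     forall m, m \in msupp H -> forall a, a \notin A -> m a = 0%N
   & rdvd F (H \mPo t)].
Proof.
move=> F0 cA.
(* [M] bounds all sizes, so a monomial in the [t_a] and [F] with exponents at most [D] has size at
   most [B]. There are [D.+1 ^ n.+1] such monomials, in a space of dimension at most
   [B ^ n = D.+1 ^ n * D]; hence the choice [D = C ^ n]. *)
pose M := (\max_(a < N) msize (tnth t a) + msize F)%N.
pose C := (#|A| * M + M)%N.+1.
pose D := (C ^ n)%N.
pose B := (D.+1 * C)%N.
pose I := ({f : {ffun 'I_N -> 'I_D.+1} | f \in pffun_on ord0 (mem A) predT} * 'I_D.+1)%type.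
pose mn (f : {ffun 'I_N -> 'I_D.+1}) : 'X_{1..N} := [multinom (f a : nat) | a < N].
pose J := {ffun 'I_n -> 'I_B}.
pose mon (x : I) : {mpoly k[n]} := ('X_[mn (val x.1)] \mPo t) * F ^+ x.2.
have cards : (#|{: J}| < #|{: I}|)%N.
  rewrite card_ffun !card_ord card_prod card_ord card_sig.
  have -> : #|[pred f | f \in pffun_on (ord0 : 'I_D.+1) (mem A) predT]| = (D.+1 ^ n)%N.
    by rewrite -cA -[in RHS](card_ord D.+1) -(card_pffun_on (ord0 : 'I_D.+1)); apply: eq_card.
  by rewrite /B expnMn ltn_pmul2l ?expn_gt0.
have [c [x cx] ce] := linear_dependence (fun (x : I) (f : J) => (mon x)@_[multinom (f a : nat) | a < n]) cards.
have mon_size y : (msize (mon y) <= B)%N.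
  have Mt a : (msize (tnth t a) <= M.+1)%N.
    by apply: leqW; apply: leq_trans (leq_addr _ _); exact: (leq_bigmax a).
  have MF : (msize F <= M.+1)%N by apply: leqW; exact: leq_addl.
  rewrite /mon comp_mpolyX.
  have e1 : (msize (\prod_(i < N) tnth t i ^+ mn (val y.1) i) <=
      (\sum_(i < N) M * mn (val y.1) i).+1)%N.
    by apply: msize_prod_bound => i; exact: msizeX_bound.
  apply: leq_trans (msizeM_bound e1 (msizeX_bound _ MF)) _.
  have le1 : (\sum_(i < N) M * mn (val y.1) i <= #|A| * M * D)%N.
    rewrite (bigID (mem A)) /= [X in (_ + X)%N]big1 ?addn0 => [|i iA]; last first.
      have /pffun_onP [/supportP /(_ _ iA) h _] := valP y.1.
      by rewrite mnmE h muln0.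
    rewrite -mulnA -sum_nat_const; apply: leq_sum => i _.
    by rewrite leq_mul2l mnmE -ltnS ltn_ord orbT.
  have le2 : (M * y.2 <= M * D)%N by rewrite leq_mul2l -ltnS ltn_ord orbT.
  apply: (@leq_trans ((#|A| * M + M) * D).+1).
    by rewrite ltnS mulnDl leq_add.
  by rewrite /B mulnC ltn_mul.
pose H z := \sum_(f : {f : {ffun 'I_N -> 'I_D.+1} | f \in pffun_on ord0 (mem A) predT})
   c (f, inord z) *: ('X_[mn (val f)] : {mpoly k[N]}).
have mn_inj : injective mn.
  move=> f g /mnmP e; apply/ffunP=> a; apply: val_inj.
  by have := e a; rewrite !mnmE.
apply: (@relation_mod_of_relation N t F D.+1
  (fun H => forall m, m \in msupp H -> forall a, a \notin A -> m a = 0%N) H) => //.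
- move=> z m mH a aA; have : m \notin msupp (H z) \/ m a = 0%N; last by rewrite mH; case.
  case: (eqVneq (m a) 0%N) => [|ma]; [by right | left].
  rewrite -mcoeff_eq0 /H raddf_sum /= big1 // => f _; rewrite mcoeffZ mcoeffX.
  case: eqP => [e|_]; last by rewrite mulr0.
  have /pffun_onP [/supportP /(_ _ aA) h _] := valP f.
  by move: ma; rewrite -e mnmE h eqxx.
- exists x.2 => //; apply: contraNneq cx => /(congr1 (mcoeff (mn (val x.1)))).
  rewrite mcoeff0 /H raddf_sum /= (bigD1 x.1) //= mcoeffZ mcoeffX eqxx mulr1 inord_val.
  rewrite big1 ?addr0 => [<-|f fx]; first by case: (x).
  by rewrite mcoeffZ mcoeffX (inj_eq mn_inj) (inj_eq val_inj) (negbTE fx) mulr0.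
have -> : \sum_(z < D.+1) (H z \mPo t) * F ^+ z = \sum_x c x *: mon x.
  rewrite [RHS](eq_bigr (fun x => c (x.1, x.2) *: mon (x.1, x.2))); last by case.
  rewrite -(pair_bigA _ (fun f z => c (f, z) *: mon (f, z))) exchange_big /=.
  apply: eq_bigr => z _; rewrite /H raddf_sum mulr_suml; apply: eq_bigr => f _ /=.
  by rewrite comp_mpolyZ inord_val /mon -scalerAl.
apply/mpolyP=> m; rewrite mcoeff0 raddf_sum /=.
have [mB|mB] := boolP [forall a, (m a < B)%N]; last first.
  apply: big1 => y _; rewrite mcoeffZ memN_msupp_eq0 ?mulr0 //; apply: msize_mdeg_ge.
  apply: leq_trans (mon_size y) _; have [a] := forallPn mB; rewrite -leqNgt => h.
  by apply: leq_trans h _; rewrite mdegE (bigD1 a) //= leq_addr.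
have e : m = [multinom ([ffun a => Ordinal (forallP mB a)] a : nat) | a < n].
  by apply/mnmP=> a; rewrite mnmE ffunE.
by rewrite e -[RHS](ce [ffun a => Ordinal (forallP mB a)]); apply: eq_bigr => y _; rewrite mcoeffZ.
Qed.

End AlgebraicRelation.

Lemma extend_free (K : fieldType) (V : vectType K) (I : eqType) (G : I -> V)
    (X : seq V) (s : seq I) : free X ->
  exists T : seq I, [/\ {subset T <= s}, free (X ++ map G T)
    & forall i, i \in s -> G i \in <<X ++ map G T>>%VS].
Proof.
move=> fX; elim: s => [|i s [T [Ts fT spT]]]; first by exists [::]; rewrite cats0.
have [Gi|Gi] := boolP (G i \in <<X ++ map G T>>%VS).
  exists T; split=> // [j /Ts js|j]; first by rewrite inE js orbT.
  by rewrite inE => /orP[/eqP->|/spT].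
have pe : perm_eq (X ++ map G (i :: T)) (G i :: (X ++ map G T)).
  by rewrite /= -cat1s perm_catCA.
exists (i :: T); split.
- by move=> j; rewrite !inE => /orP[->|/Ts ->] //; rewrite orbT.
- by rewrite (perm_free pe) free_cons Gi.
move=> j; rewrite (eq_span (perm_mem pe)) inE => /orP[/eqP->|/spT h].
  by rewrite memv_span ?mem_head.
by apply: subvP h; apply: sub_span => y; rewrite inE => ->; rewrite orbT.
Qed.

Lemma exists_minimal (T : Type) (m : T -> nat) (P : T -> Prop) :
  (exists x, P x) -> exists x, P x /\ forall y, P y -> (m x <= m y)%N.
Proof.
case=> x; have [b] := ubnP (m x); elim: b x => // b IH x xb Px.
case: (classic (forall y, P y -> (m x <= m y)%N)) => [h|]; first by exists x.
move/not_all_ex_not => [y /not_all_ex_not [Py /negP]]; rewrite -ltnNge => yx.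
by apply: (IH y) => //; apply: leq_trans yx _.
Qed.

(** * Knop's argument on the minors of a Jacobian matrix *)

Section Jacobian.
Variables (k : fieldType) (n : nat).

Definition jacobian l (p : 'I_l -> {mpoly k[n]}) : 'M[{mpoly k[n]}]_(l, n) :=
  \matrix_(i, j) (p i)^`M(j).

(** Maximal minors are tested as [\det (M *m mxC n U)] for all constant [U]; these determinants are
    the combinations of the minors with constant coefficients, column selections included. *)
Definition mxC m r (U : 'M[k]_(m, r)) : 'M[{mpoly k[n]}]_(m, r) := map_mx (@mpolyC n k) U.

End Jacobian.

Section Knop.
Variables (k : fieldType) (n l : nat).
Hypothesis char0 : [pchar k] =i pred0.
Variables (p : 'I_l -> {mpoly k[n]}) (F : {mpoly k[n]}) (Fh : {mpoly k[l]}).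
Let P := [tuple p i | i < l].
Hypothesis pF : prime_elt F.
Hypothesis FE : F = Fh \mPo P.
Hypothesis F_dvd : forall h : {mpoly k[l]}, rdvd F (h \mPo P) -> rdvd Fh h.
Hypothesis F_minors : forall U : 'M[k]_(n, l), rdvd F (\det (jacobian p *m mxC n U)).

Lemma prime_nonconstant : exists j, F^`M(j) != 0.
Proof.
apply: NNPP => h; have [F0 Fu _] := pF.
have e : F = (F@_0)%:MP.
  apply: mderiv_all_eq0 => // i; apply/eqP; apply: contraT => hi; case: h; by exists i.
have c0 : F@_0 != 0 by apply: contraNneq F0 => z; rewrite e z mpolyC0.
by move: Fu; rewrite e rmorph_unit // unitfE.
Qed.

(** Gradients are taken modulo [F]. Those of the [p i] are dependent, and their span contains the
    nonzero gradient of [F]; a basis of the span made of [grad F] and the [grad (p b)], [b] in [T],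
    leaves at least two indices outside [T]. For each such [i], a minimal relation modulo [F] shows
    that [Fh] involves only variables from [T] and [i]. So [Fh] involves only those from [T], and
    the chain rule puts [grad F] in the span of the [grad (p b)], against the choice of [T]. *)
Lemma knop_contradiction : False.
Proof.
have [F0 Fu Fp] := pF; have [K [psi psi0]] := residue_field pF.
pose grad (u : {mpoly k[n]}) : 'rV[K]_n := \row_j psi u^`M(j).
have gradM u v : grad (u * v) = psi v *: grad u + psi u *: grad v.
  by apply/rowP=> j; rewrite !mxE mderivM rmorphD !rmorphM mulrC.
have psiF : psi F = 0 by apply/psi0; exists 1; rewrite mul1r.
have grad_dvd u : rdvd F u -> exists a, grad u = a *: grad F.
  by case=> w ->; exists (psi w); rewrite gradM psiF scale0r add0r.
have grad_comp N (t : N.-tuple {mpoly k[n]}) (H : {mpoly k[N]}) :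
    grad (H \mPo t) = \sum_(a < N) psi (H^`M(a) \mPo t) *: grad (tnth t a).
  apply/rowP=> j; rewrite summxE mxE mderiv_comp_mpoly rmorph_sum.
  by apply: eq_bigr => a _; rewrite !mxE rmorphM.
have gF0 : grad F != 0.
  have [j Fj] := prime_nonconstant; apply: contraNneq Fj => /rowP /(_ j); rewrite !mxE.
  move/psi0 => d; apply: contraT => Fj0; have := rdvd_msize d Fj0.
  by rewrite leqNgt msize_mderiv.
pose G i := grad (p i).
have fF : free [:: grad F] by rewrite seq1_free.
have [T [_ fT spT]] := extend_free G (enum 'I_l) fF.
have {}spT i : G i \in <<grad F :: map G T>>%VS by apply: spT; rewrite mem_enum.
(* Coordinate vectors complete the basis, so that the [p b] with [b] in [T], one more [p i] and the
   ['X_j] with [j] in [T'] are exactly [n] polynomials. *)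
pose E (j : 'I_n) : 'rV[K]_n := delta_mx 0 j.
have [T' [_ fT' spT']] := extend_free E (enum 'I_n) fT.
have {}spT' j : E j \in <<grad F :: map G T ++ map E T'>>%VS by apply: spT'; rewrite mem_enum.
have uT : uniq T by have := free_uniq fT; rewrite /= => /andP[_ /map_uniq].
have uT' : uniq T' by have := free_uniq (catr_free fT'); move/map_uniq.
have sz : (size T + size T').+1 = n.
  have full : (<<grad F :: map G T ++ map E T'>> = fullv)%VS.
    apply/eqP; rewrite eqEsubv subvf /=; apply/subvP => v _.
    rewrite [v]row_sum_delta; apply: memv_suml => j _; apply: memvZ; exact: spT'.
  have := fT'; rewrite /free /= full dimvf /dim /= mul1n => /eqP e.
  by apply: esym; apply: etrans e _; rewrite size_cat !size_map.
(* The differentials of the [p i] have rank [< l] and their span contains that of [F]. *)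
have szT : (size T + 2 <= l)%N.
  have dimG : (\dim <<map G (enum 'I_l)>> < l)%N.
    rewrite ltn_neqAle; apply/andP; split; last first.
      by apply: leq_trans (dim_span _) _; rewrite size_map size_enum_ord.
    apply/negP => /eqP e.
    have fr : free [tuple G i | i < l].
      rewrite /free size_tuple -[X in _ == X]e; apply/eqP; congr (\dim <<_>>).
    pose A := \matrix_(i < l, j < n) psi (p i)^`M(j).
    have rA i : row i A = G i by apply/rowP=> j; rewrite !mxE.
    have fA : row_full A^T.
      rewrite /row_full mxrank_tr -/(row_free A); apply: inj_row_free => v vA.
      apply/rowP=> i; rewrite mxE; have /freeP/(_ (fun i => v 0 i)) -> // := fr.
      rewrite -[RHS]vA mulmx_sum_row; apply: eq_bigr => j _.
      by rewrite rA -tnth_nth tnth_mktuple.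
    pose f := fullrankfun fA.
    pose U : 'M[k]_(n, l) := \matrix_(j, i) (j == f i)%:R.
    have := fullrowsub_unit fA; rewrite -/f unitmxE -det_tr.
    suff -> : (rowsub f A^T)^T = map_mx psi (jacobian p *m mxC n U).
      by have /psi0 h := F_minors U; rewrite det_map_mx h unitr0.
    apply/matrixP=> i j; rewrite !mxE [RHS]rmorph_sum [RHS](bigD1 (f j)) //= big1 => [|a aj].
      by rewrite !mxE eqxx rmorph1 mulr1 addr0.
    by rewrite !mxE (negbTE aj) rmorph0 mulr0 rmorph0.
  have : (\dim <<grad F :: map G T>> <= \dim <<map G (enum 'I_l)>>)%N.
    have Gin i : G i \in <<map G (enum 'I_l)>>%VS.
      by apply: memv_span; apply: map_f; rewrite mem_enum.
    apply/dimvS/span_subvP => v; rewrite inE => /orP[/eqP->|/mapP [i _ ->]] //.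
    rewrite FE grad_comp; apply: memv_suml => b _; rewrite tnth_mktuple.
    by apply: memvZ; exact: Gin.
  have := fT; rewrite /free => /eqP -> /=; rewrite size_map => h.
  by have := leq_ltn_trans h dimG; rewrite addn2.
have rel i : i \notin T -> forall b, b \notin T -> b != i -> Fh^`M(b) = 0.
  move=> iT.
  pose t : (l + n).-tuple {mpoly k[n]} :=
    [tuple (match split a with inl b => p b | inr j => 'X_j end) | a < l + n].
  pose A := [set a : 'I_(l + n) |
    match split a with inl b => b \in i :: T | inr j => j \in T' end].
  have tl b : tnth t (lshift n b) = p b by rewrite tnth_mktuple (unsplitK (inl b)).
  have tr j : tnth t (rshift l j) = 'X_j by rewrite tnth_mktuple (unsplitK (inr j)).
  have Al b : (lshift n b \in A) = (b \in i :: T) by rewrite inE (unsplitK (inl b)).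
  have Ar j : (rshift l j \in A) = (j \in T') by rewrite inE (unsplitK (inr j)).
  have cA : #|A| = n.
    rewrite -sum1_card big_split_ord /= (eq_bigl (mem (i :: T)) _ Al).
    rewrite (eq_bigl (mem T') _ Ar) !sum1_card.
    have /card_uniqP -> : uniq (i :: T) by rewrite /= iT.
    by have /card_uniqP -> := uT'.
  pose good (H : {mpoly k[l + n]}) := [/\ H != 0,
     forall m, m \in msupp H -> forall a, a \notin A -> m a = 0%N & rdvd F (H \mPo t)].
  have [H [[H0 HA HF] Hmin]] := exists_minimal (fun H : {mpoly k[l + n]} => msize H)
    (algebraic_relation t F0 cA : exists H, good H).
  have Hder a : rdvd F (H^`M(a) \mPo t) -> H^`M(a) = 0.
    move=> d; apply/eqP; apply: contraT => h0; have := msize_mderiv a H0.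
    rewrite ltnNge Hmin //; split=> // m mH b bA.
    have /HA /(_ b bA) : (m + U_(a))%MM \in msupp H; last first.
      by rewrite mnmDE => /eqP; rewrite addn_eq0 => /andP[/eqP].
    by apply: contraLR mH => /memN_msupp_eq0 z; rewrite -mcoeff_eq0 mcoeff_mderiv z mul0rn.
  have HnA a : a \notin A -> H^`M(a) = 0.
    by move=> aA; apply/mderiv_eq0P => // m mH; exact: HA.
  have gX j : grad 'X_j = E j.
    by apply/rowP=> j'; rewrite !mxE mderivXU rmorph_nat eq_sym eqxx.
  (* Differentiating the relation gives a multiple of [grad F]. The [E j] are independent of all the
     gradients, so their coefficients vanish modulo [F], and by minimality [H] does not involve
     these variables. *)
  have HX j : H^`M(rshift l j) = 0.
    apply: Hder; apply/psi0.
    pose w := \sum_j psi (H^`M(rshift l j) \mPo t) *: E j.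
    suff w0 : w = 0.
      have /rowP/(_ j) := w0; rewrite summxE !mxE (bigD1 j) //= !mxE !eqxx mulr1.
      by rewrite big1 ?addr0 // => j' jj; rewrite !mxE eq_sym (negbTE jj) andbF mulr0.
    have [a ea] := grad_dvd _ HF.
    move: ea; rewrite grad_comp big_split_ord /=.
    rewrite [X in _ + X = _ -> _](eq_bigr (fun j => psi (H^`M(rshift l j) \mPo t) *: E j)) => [ea|j' _]; last by rewrite tr gX.
    have w1 : w \in <<grad F :: map G T>>%VS.
      have -> : w = a *: grad F - \sum_b psi (H^`M(lshift n b) \mPo t) *: grad (tnth t (lshift n b)).
        by rewrite -ea addrC addKr.
      apply: memvB; first by apply: memvZ; apply: memv_span; exact: mem_head.
      by apply: memv_suml => b _; apply: memvZ; rewrite tl; exact: spT.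
    have w2 : w \in <<map E T'>>%VS.
      apply: memv_suml => j' _; have [jT|jT] := boolP (j' \in T').
        by apply: memvZ; apply: memv_span; apply: map_f.
      by rewrite HnA ?Ar // comp_mpoly0 rmorph0 scale0r mem0v.
    have := fT'; rewrite cat_free => /and3P[_ _ /directv_addP d].
    by apply/eqP; rewrite -memv0 -d memv_cap w1.
  pose Hh : {mpoly k[l]} := H \mPo [tuple (match split a with inl b => 'X_b | inr j => 0 end) | a < l + n].
  have HXm m : m \in msupp H -> forall j, m (rshift l j) = 0%N.
    by move=> mH j; have /mderiv_eq0P -> := HX j.
  have HhP : Hh \mPo P = H \mPo t.
    rewrite comp_mpolyA; apply: eq_comp_mpoly => a [m mH ma]; rewrite !tnth_mktuple.
    case: splitP ma => [b _|j ej]; first by rewrite comp_mpolyXU -tnth_nth tnth_mktuple.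
    by rewrite (_ : a = rshift l j) ?HXm //; exact: val_inj.
  have Hh0 : Hh != 0.
    apply: contraNneq H0 => z; rewrite -(comp_mpoly0 [tuple 'X_(lshift n b) | b < l]) -z comp_mpolyA.
    apply/eqP; rewrite -[LHS]comp_mpoly_id; apply: eq_comp_mpoly => a [m mH ma]; rewrite !tnth_mktuple.
    case: splitP ma => [b eb _|j ej].
      by rewrite comp_mpolyXU -tnth_nth tnth_mktuple; congr 'X_(_); exact: val_inj.
    by rewrite (_ : a = rshift l j) ?HXm //; exact: val_inj.
  have Hhb b : b \notin i :: T -> Hh^`M(b) = 0.
    move=> bT; rewrite mderiv_comp_mpoly big1 // => a _; rewrite tnth_mktuple.
    case: splitP => [b' eb|j _]; last by rewrite mderiv0 mulr0.
    rewrite mderivXU; case: eqP => [e|_]; last by rewrite mulr0.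
    rewrite HnA ?comp_mpoly0 ?mul0r // (_ : a = lshift n b) ?Al //.
    by apply: val_inj; rewrite /= -e.
  have [w ew] : rdvd Fh Hh by apply: F_dvd; rewrite HhP.
  move=> b bT bi; apply: (@mderiv_factor _ _ char0 Fh w).
    by rewrite mulrC -ew.
  by rewrite mulrC -ew; apply: Hhb; rewrite inE negb_or bi.
have [i1 [i2 [i1T i2T i12]]] : exists i1 i2, [/\ i1 \notin T, i2 \notin T & i1 != i2].
  have : (1 < #|[set i | i \notin T]|)%N.
    have := cardC (mem T); rewrite card_ord (card_uniqP uT) => e.
    have -> : #|[set i | i \notin T]| = #|[predC mem T]| by apply: eq_card => j; rewrite !inE.
    rewrite -(ltn_add2l (size T)) addn1 -addn2.
    by apply: leq_trans szT _; rewrite leq_eqVlt e eqxx.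
  by case/card_gt1P => i1 [i2 []]; rewrite !inE; exists i1, i2.
have Fb b : b \notin T -> Fh^`M(b) = 0.
  move=> bT; have [e|bi] := eqVneq b i1; last exact: (rel i1).
  by rewrite e; apply: (rel i2).
have : grad F \in <<map G T>>%VS.
  rewrite {1}FE grad_comp; apply: memv_suml => b _; rewrite tnth_mktuple.
  have [bT|/Fb ->] := boolP (b \in T); last by rewrite comp_mpoly0 rmorph0 scale0r mem0v.
  by apply: memvZ; apply: memv_span; apply: map_f.
by move: fT; rewrite /= free_cons => /andP[/negP].
Qed.
End Knop.

(** * The Lie bracket, derivations and the invariant form *)

Section Bracket.
Variables (k : fieldType) (n : nat) (c : 'I_n -> 'I_n -> 'I_n -> k).
Local Notation vec := 'rV[k]_n.
Local Notation br := (brk c).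
Local Notation ad := (adm c).

Lemma brk_linearr x a y z : br x (a *: y + z) = a *: br x y + br x z.
Proof.
apply/rowP=> r; rewrite !mxE mulr_sumr -big_split; apply: eq_bigr => i _ /=.
rewrite mulr_sumr -big_split; apply: eq_bigr => j _ /=.
by rewrite !mxE mulrDr mulrCA.
Qed.

Lemma brk_linearl y a x z : br (a *: x + z) y = a *: br x y + br z y.
Proof.
apply/rowP=> r; rewrite !mxE mulr_sumr -big_split; apply: eq_bigr => i _ /=.
rewrite mulr_sumr -big_split; apply: eq_bigr => j _ /=.
by rewrite !mxE mulrDr mulrDl mulrCA !mulrA.
Qed.

HB.instance Definition _ x := GRing.isLinear.Build k vec vec _ (br x) (brk_linearr x).

Lemma brkDr x y z : br x (y + z) = br x y + br x z. Proof. exact: linearD. Qed.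
Lemma brkZr x a y : br x (a *: y) = a *: br x y. Proof. exact: linearZ. Qed.
Lemma brk0r x : br x 0 = 0. Proof. exact: linear0. Qed.
Lemma brkBr x y z : br x (y - z) = br x y - br x z. Proof. exact: linearB. Qed.
Lemma brkDl x y z : br (x + y) z = br x z + br y z.
Proof. by rewrite -[x]scale1r brk_linearl !scale1r. Qed.
Lemma brk0l y : br 0 y = 0.
Proof. by apply: (addrI (br 0 y)); rewrite addr0 -brkDl addr0. Qed.
Lemma brkZl a x y : br (a *: x) y = a *: br x y.
Proof. by rewrite -[a *: x]addr0 brk_linearl brk0l addr0. Qed.
Lemma brkNl x y : br (- x) y = - br x y.
Proof. by rewrite -scaleN1r brkZl scaleN1r. Qed.
Lemma brkBl x y z : br (x - y) z = br x z - br y z.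
Proof. by rewrite brkDl brkNl. Qed.
Lemma brk_suml I (r : seq I) (P : pred I) (F : I -> vec) y :
  br (\sum_(i <- r | P i) F i) y = \sum_(i <- r | P i) br (F i) y.
Proof. by apply: (big_morph (fun x => br x y)) => [u v|]; rewrite ?brkDl ?brk0l. Qed.

Lemma brk_sumr I (r : seq I) (P : pred I) (F : I -> vec) x :
  br x (\sum_(i <- r | P i) F i) = \sum_(i <- r | P i) br x (F i).
Proof. exact: linear_sum. Qed.

Lemma mul_adm x y : y *m ad x = br x y.
Proof.
rewrite {2}[y]row_sum_delta linear_sum mulmx_sum_row; apply: eq_bigr => i _.
by rewrite linearZ; congr (_ *: _); apply/rowP=> j; rewrite !mxE.
Qed.

Lemma mx_ext (A B : 'M[k]_n) : (forall y : vec, y *m A = y *m B) -> A = B.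
Proof. by move=> h; apply/row_matrixP=> i; rewrite !rowE h. Qed.

Lemma admD x y : ad (x + y) = ad x + ad y.
Proof. by apply: mx_ext => z; rewrite mulmxDr !mul_adm brkDl. Qed.
Lemma admZ a x : ad (a *: x) = a *: ad x.
Proof. by apply: mx_ext => z; rewrite -scalemxAr !mul_adm brkZl. Qed.
Lemma adm0 : ad 0 = 0.
Proof. by apply: mx_ext => z; rewrite mulmx0 !mul_adm brk0l. Qed.
Lemma admN x : ad (- x) = - ad x.
Proof. by rewrite -scaleN1r admZ scaleN1r. Qed.
Lemma admB x y : ad (x - y) = ad x - ad y.
Proof. by rewrite admD admN. Qed.

Hypothesis lieP : is_lie c.

Lemma brkxx x : br x x = 0. Proof. by case: lieP. Qed.

Lemma brkC x y : br x y = - br y x.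
Proof.
apply/eqP; rewrite -addr_eq0; have := brkxx (x + y).
by rewrite brkDl !brkDr !brkxx add0r addr0 => ->.
Qed.

Lemma jacobi x y z : br x (br y z) = br (br x y) z + br y (br x z).
Proof.
have [_ /(_ x y z) h] := lieP; rewrite (brkC (br x y)) [br x z]brkC raddfN /=.
by apply/eqP; rewrite -subr_eq0 opprD !opprK [X in _ + X]addrC addrA h.
Qed.

(** The products appear in reversed order because matrices act on row vectors from the right. *)
Lemma adm_brk x y : ad (br x y) = ad y *m ad x - ad x *m ad y.
Proof.
apply: mx_ext => z; rewrite mulmxBr !mulmxA !mul_adm.
by rewrite [br x (br y z)]jacobi addrK.
Qed.

Definition derivation (E : 'M[k]_n) := forall x y, br x y *m E = br (x *m E) y + br x (y *m E).

Lemma derivation_adm x : derivation (ad x).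
Proof. by move=> y z; rewrite !mul_adm jacobi. Qed.

Lemma adm_derivation E x : derivation E -> ad (x *m E) = ad x *m E - E *m ad x.
Proof.
move=> dE; apply: mx_ext => y; rewrite mulmxBr !mulmxA !mul_adm dE.
by rewrite addrK.
Qed.

Lemma derivationB E F : derivation E -> derivation F -> derivation (E - F).
Proof.
move=> dE dF x y; rewrite !mulmxBr dE dF brkBl brkBr opprD.
by rewrite addrACA.
Qed.

Definition dg := derived c 1%:M.

Lemma brk_derived (W : 'M[k]_n) (u v : vec) :
  (u <= W)%MS -> (v <= W)%MS -> (br u v <= derived c W)%MS.
Proof.
case/submxP=> a -> /submxP [b ->]; rewrite !mulmx_sum_row brk_suml.
apply: summx_sub => i _; rewrite brkZl brk_sumr; apply/scalemx_sub/summx_sub => j _.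
rewrite brkZr; apply: scalemx_sub.
by rewrite /derived; apply: (sumsmx_sup i) => //; apply: (sumsmx_sup j) => //; rewrite genmxE.
Qed.

Lemma derived_sub (W : 'M[k]_n) m (S : 'M[k]_(m, n)) :
  (forall u v : vec, (u <= W)%MS -> (v <= W)%MS -> (br u v <= S)%MS) ->
  (derived c W <= S)%MS.
Proof.
move=> h; apply/sumsmx_subP=> i _; apply/sumsmx_subP=> j _; rewrite genmxE.
by apply: h; exact: row_sub.
Qed.

Lemma derivedS (W W' : 'M[k]_n) : (W <= W')%MS -> (derived c W <= derived c W')%MS.
Proof. by move=> h; apply: derived_sub => u v uW vW; apply: brk_derived => //; exact: submx_trans h. Qed.

Lemma brk_dg x y : (br x y <= dg)%MS.
Proof. by apply: brk_derived; rewrite ?submx1. Qed.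

End Bracket.

Lemma mxtraceB (R : pzRingType) n (A B : 'M[R]_n) : \tr (A - B) = \tr A - \tr B.
Proof. exact: raddfB. Qed.

Section Form.
Variables (k : fieldType) (n : nat) (c : 'I_n -> 'I_n -> 'I_n -> k) (Bm : 'M[k]_n).
Local Notation vec := 'rV[k]_n.
Local Notation br := (brk c).
Local Notation ad := (adm c).
Local Notation B := (bform Bm).

Lemma bform_linearr x a y z : B x (a *: y + z) = a * B x y + B x z.
Proof. by rewrite /bform linearP mulmxDr -scalemxAr !mxE. Qed.

HB.instance Definition _ x := GRing.isLinear.Build k vec k^o _ (bform Bm x) (bform_linearr x).

Lemma bformDr x y z : B x (y + z) = B x y + B x z. Proof. exact: (linearD (bform Bm x)). Qed.
Lemma bform0r x : B x 0 = 0. Proof. exact: (linear0 (bform Bm x)). Qed.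
Lemma bformZr x a y : B x (a *: y) = a * B x y.
Proof. by rewrite -[a *: y]addr0 bform_linearr bform0r addr0. Qed.
Lemma bformBr x y z : B x (y - z) = B x y - B x z. Proof. exact: (linearB (bform Bm x)). Qed.
Lemma bformNr x y : B x (- y) = - B x y. Proof. exact: (linearN (bform Bm x)). Qed.
Lemma bform_sumr I (r : seq I) (P : pred I) (F : I -> vec) x :
  B x (\sum_(i <- r | P i) F i) = \sum_(i <- r | P i) B x (F i).
Proof. exact: (linear_sum (bform Bm x)). Qed.

Hypothesis lieP : is_lie c.
Hypothesis redP : reductive c.
Hypothesis formP : good_form c Bm.

Lemma bformC x y : B x y = B y x.
Proof.
have [sym _] := formP; rewrite /bform -[x in LHS]trmxK -[Bm in LHS]sym -trmx_mul -trmx_mul.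
by rewrite mxE mulmxA.
Qed.

Lemma bform_inv x y z : B (br x y) z = B x (br y z).
Proof. by have [_ [_ [h _]]] := formP. Qed.

Lemma bform_invl x y z : B (br x y) z = - B y (br x z).
Proof. by rewrite (brkC lieP) -[- br y x]scaleN1r bformC bformZr mulN1r bformC bform_inv. Qed.

Lemma bformZl a x y : B (a *: x) y = a * B x y.
Proof. by rewrite bformC bformZr bformC. Qed.
Lemma bformDl x y z : B (x + y) z = B x z + B y z.
Proof. by rewrite !(bformC _ z) bformDr. Qed.
Lemma bformBl x y z : B (x - y) z = B x z - B y z.
Proof. by rewrite !(bformC _ z) bformBr. Qed.
Lemma bform0l x : B 0 x = 0. Proof. by rewrite bformC bform0r. Qed.
Lemma bform_suml I (r : seq I) (P : pred I) (F : I -> vec) x :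
  B (\sum_(i <- r | P i) F i) x = \sum_(i <- r | P i) B (F i) x.
Proof. by rewrite bformC bform_sumr; apply: eq_bigr => i _; rewrite bformC. Qed.

Lemma form_repr (phi : vec -> k) :
  (forall a x y, phi (a *: x + y) = a * phi x + phi y) ->
  exists d, forall y, B d y = phi y.
Proof.
move=> lin; pose f := \col_i phi (delta_mx 0 i).
have [_ [uB _]] := formP; exists (invmx Bm *m f)^T => y.
rewrite bformC /bform trmxK mulmxA mulmxK //.
have phi0 : phi 0 = 0 by have := lin (-1) 0 0; rewrite scaler0 addr0 mulN1r addNr.
rewrite mxE {2}[y]row_sum_delta.
have -> : phi (\sum_j y 0 j *: delta_mx 0 j) = \sum_j phi (y 0 j *: delta_mx 0 j).
  apply: (big_morph phi) => // u v.
  by rewrite -[u in LHS]scale1r lin mul1r.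
by apply: eq_bigr => j _; rewrite mxE -[_ *: _]addr0 lin phi0 addr0.
Qed.

Lemma bform_nondeg x : (forall y, B x y = 0) -> x = 0.
Proof.
move=> h; have [_ [uB _]] := formP; apply: (can_inj (mulmxK uB)).
rewrite mul0mx; apply/rowP=> i; have := h (delta_mx 0 i).
by rewrite /bform trmx_delta -colE => e; rewrite [RHS]mxE -e [RHS]mxE.
Qed.

(** The double orthogonal of [W] is [W]: a coordinate modulo [W] is a linear form, represented by a
    vector orthogonal to [W]. *)
Lemma sub_perp m (W : 'M[k]_(m, n)) (v : vec) :
  (forall u, (forall w, (w <= W)%MS -> B u w = 0) -> B u v = 0) -> (v <= W)%MS.
Proof.
move=> h; rewrite submxE; apply/eqP/matrixP=> i0 j; rewrite ord1 [RHS]mxE.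
have [|d dP] := form_repr (phi := fun y => (y *m cokermx W) 0 j).
  by move=> a x y; rewrite mulmxDl -scalemxAl !mxE.
rewrite -dP; apply: h => w; rewrite submxE => /eqP wW.
by rewrite dP wW mxE.
Qed.

Local Notation Dg := (dg c).

Lemma ideal_dg x : (Dg *m ad x <= Dg)%MS.
Proof. by apply/row_subP=> i; rewrite row_mul mul_adm brk_dg. Qed.

(** Reductivity gives an ideal [W] complementary to the derived ideal; [[g, W]] lies in both, so it
    is 0 and [W] is central. *)
Lemma dg_center x : exists y z, [/\ x = y + z, (y <= Dg)%MS & ad z = 0].
Proof.
have [W [Wid [full disj]]] := redP ideal_dg.
have /sub_addsmxP [[a b] /= e] : (x <= Dg + W)%MS by apply: submx_trans full; exact: submx1.
exists (a *m Dg), (b *m W); split=> //; first exact: submxMl.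
apply: mx_ext => y; rewrite mulmx0 mul_adm; apply/eqP; rewrite -submx0.
apply: submx_trans disj; rewrite sub_capmx brk_dg //= (brkC lieP) eqmx_opp.
by rewrite -mul_adm -mulmxA; apply: submx_trans (Wid y); exact: submxMl.
Qed.

Lemma dg_adP x : (ad x <= Dg)%MS.
Proof. by apply/row_subP=> i; rewrite rowE mul_adm brk_dg. Qed.

Lemma form_dg_center x z : (x <= Dg)%MS -> ad z = 0 -> B x z = 0.
Proof.
move=> xD z0; suff /(submx_trans xD)/sub_kermxP : (Dg <= kermx (Bm *m z^T))%MS.
  by rewrite mulmxA /bform => ->; rewrite mxE.
apply: derived_sub => u v _ _; apply/sub_kermxP; rewrite mulmxA.
apply/rowP=> i; rewrite ord1 [RHS]mxE; have := bform_inv u v z.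
by rewrite (brkC lieP v z) -(mul_adm c z) z0 mulmx0 bformNr bform0r oppr0 => e; exact: e.
Qed.

Definition kap (x y : vec) : k := \tr (ad x *m ad y).

(** Since [ad] maps g into the derived algebra, traces on g and on the derived algebra agree. *)
Lemma killing_derivedE x y : killing_derived c x y = kap x y.
Proof.
rewrite /killing_derived /resad /kap.
have h m (A : 'M[k]_(m, n)) : (A <= Dg)%MS -> A *m pinvmx (Defs.Dg c) *m Defs.Dg c = A.
  by move=> AD; rewrite mulmxKpV // eq_row_base.
have DA : (Defs.Dg c *m ad x <= Dg)%MS.
  by apply: submx_trans (ideal_dg x); apply: submxMr; rewrite eq_row_base.
move: h DA; move: (pinvmx (Defs.Dg c)) => P; move: (Defs.Dg c) => D h DA; rewrite !mulmxA (h _ _ DA) -!mulmxA mxtrace_mulC -!mulmxA; congr (\tr _).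
by congr (_ *m _); rewrite mulmxA h ?dg_adP.
Qed.

Lemma form_kap x y : (x <= Dg)%MS -> B x y = kap x y.
Proof.
move=> xD; have [y' [z [-> y'D z0]]] := dg_center y.
rewrite bformDr /kap admD z0 addr0 -/(kap x y') -killing_derivedE.
by have [_ [_ [_ h]]] := formP; rewrite -h // (form_dg_center xD z0) addr0.
Qed.

Lemma dg_center0 x : (x <= Dg)%MS -> ad x = 0 -> x = 0.
Proof.
move=> xD x0; apply: bform_nondeg => y.
by rewrite form_kap // /kap x0 mul0mx mxtrace0.
Qed.

Lemma perp_center x : (forall z, ad z = 0 -> B z x = 0) -> (x <= Dg)%MS.
Proof.
move=> h; have [y [z [e yD z0]]] := dg_center x.
suff -> : x = y by [].
rewrite e; suff -> : z = 0 by rewrite addr0.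
apply: bform_nondeg => u; have [u' [w [-> uD w0]]] := dg_center u.
rewrite bformDr bformC form_dg_center // add0r.
have -> : z = x - y by rewrite e addrAC subrr add0r.
by rewrite bformBl (form_dg_center yD w0) subr0 bformC h.
Qed.

(** Let [d] represent the form [y |-> \tr (E *m ad y)] and [F = E - ad d], so that
    [\tr (F *m ad y) = 0] for all [y]. For [y] in the derived algebra, [B (y F, w)] is a trace of
    [ad (y F)], a commutator of [ad y] and [F]; cyclicity turns it into a trace of [F] against some
    [ad], which is 0. *)
Lemma derivation_inner E : derivation c E -> (forall z, ad z = 0 -> z *m E = 0) ->
  exists2 d, (d <= Dg)%MS & ad d = E.
Proof.
move=> dE Ez; have [|d dP] := form_repr (phi := fun y => \tr (E *m ad y)).
  by move=> a x y; rewrite admD admZ mulmxDr -scalemxAr mxtraceD mxtraceZ.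
have dD : (d <= Dg)%MS by apply: perp_center => z z0; rewrite bformC dP z0 mulmx0 mxtrace0.
exists d => //; apply/esym/eqP; rewrite -subr_eq0; apply/eqP.
set F := E - ad d; have dF : derivation c F by apply: derivationB => //; exact: derivation_adm.
have trF y : \tr (F *m ad y) = 0.
  by rewrite mulmxBl mxtraceB -dP form_kap // subrr.
apply: mx_ext => y; rewrite mulmx0.
have [y' [z [-> yD z0]]] := dg_center y.
have zF : z *m F = 0.
  by rewrite mulmxBr Ez // mul_adm (brkC lieP) -mul_adm z0 mulmx0 oppr0 subr0.
rewrite mulmxDl zF addr0.
have yFD : (y' *m F <= Dg)%MS.
  apply: submx_trans (submxMr F yD) _.
  have : (Dg <= kermx (F *m cokermx Dg))%MS.
    apply: derived_sub => u v _ _; apply/sub_kermxP; rewrite mulmxA dF mulmxDl.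
    by have := brk_dg c (u *m F) v; have := brk_dg c u (v *m F);
      rewrite !submxE => /eqP -> /eqP ->; rewrite addr0.
  by move/sub_kermxP; rewrite mulmxA submxE => ->.
apply: bform_nondeg => w; rewrite form_kap // /kap (adm_derivation _ dF).
rewrite mulmxBl mxtraceB -!mulmxA mxtrace_mulC -!mulmxA -mxtraceB -mulmxBr.
by rewrite -(adm_brk lieP) trF.
Qed.

End Form.

(** * Generalized eigenspaces, nilpotent matrices, sl_2 weights *)

Section Spectral.
Variables (k : closedFieldType) (n : nat).
Hypothesis char0 : [pchar k] =i pred0.
Local Notation vec := 'rV[k]_n.+1.
Implicit Types (A E W U H : 'M[k]_n.+1) (v y : vec).

Definition gev A (mu : k) v := exists m, v *m (A - mu%:M) ^+ m = 0.

Definition nilmx A := exists m, A ^+ m = 0.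

Lemma kill_coprime A v (p q : {poly k}) : coprimep p q ->
  v *m horner_mx A p = 0 -> v *m horner_mx A q = 0 -> v = 0.
Proof.
move=> /(mxdirect_kermxpoly A) d p0 q0; apply/eqP; rewrite -submx0 -d sub_capmx.
by apply/andP; split; apply/sub_kermxP.
Qed.

Lemma horner_mx_XsubC_exp A mu m :
  horner_mx A (('X - mu%:P) ^+ m) = (A - mu%:M) ^+ m.
Proof. by rewrite rmorphXn rmorphB /= horner_mx_X horner_mx_C. Qed.

(** Chinese remainders for the powers of the ['X - mu%:P], adding one root at a time by a Bezout
    identity. *)
Lemma interpolation (rs : seq k) N (theta : k -> k) : uniq rs ->
  exists P : {poly k}, forall mu, mu \in rs -> ('X - mu%:P) ^+ N %| P - (theta mu)%:P.
Proof.
elim: rs => [|a rs IH]; first by exists 0.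
rewrite /= => /andP[ars /IH [P hP]].
pose Q := \prod_(b <- rs) ('X - b%:P) ^+ N.
have cop : coprimep Q (('X - a%:P) ^+ N).
  rewrite /Q; elim: (rs) ars => [|b s IHs]; first by rewrite big_nil coprime1p.
  rewrite inE negb_or big_cons => /andP[ab /IHs h]; rewrite coprimepMl h andbT.
  by rewrite coprimep_expl // coprimep_expr // coprimep_XsubC root_XsubC.
have [[u w] /= e] := Bezout_eq1_coprimepP _ _ cop.
exists (P + ((theta a)%:P - P) * u * Q) => mu.
rewrite inE => /orP[/eqP->|mrs].
  have -> : P + ((theta a)%:P - P) * u * Q - (theta a)%:P =
     (P - (theta a)%:P) * (1 - u * Q) by ring.
  by rewrite -e addrAC subrr add0r mulrA dvdp_mull.
rewrite addrAC dvdp_add ?hP // dvdp_mull // /Q (big_rem mu) //=.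
exact: dvdp_mulr.
Qed.

Lemma spectrum A : exists rs : seq k, [/\ uniq rs,
   forall mu, (mu \in rs) = eigenvalue A mu,
   horner_mx A (\prod_(a <- rs) ('X - a%:P) ^+ n.+1) = 0
 & forall M : 'M[k]_n.+1, (forall mu v, mu \in rs -> gev A mu v -> v *m M = 0) -> M = 0].
Proof.
have [rl e] := closed_field_poly_normal (char_poly A).
rewrite (monicP (char_poly_monic A)) scale1r in e.
have szl : size rl = n.+1.
  have := size_char_poly A; rewrite e size_prod_XsubC => -[]; by [].
exists (undup rl); set rs := undup rl.
have root_rs mu : (mu \in rs) = eigenvalue A mu.
  by rewrite eigenvalue_root_char e root_prod_XsubC mem_undup.
have dvd_rs : char_poly A %| \prod_(a <- rs) ('X - a%:P) ^+ n.+1.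
  rewrite e -big_undup_iterop_count.
  apply: (big_ind2 (fun x y : {poly k} => x %| y)) => [|p1 q1 p2 q2|a _]; rewrite ?dvdpp //.
    exact: dvdp_mul.
  by rewrite -/(('X - a%:P) ^+ _) dvdp_exp2l // -szl count_size.
have h0 : horner_mx A (\prod_(a <- rs) ('X - a%:P) ^+ n.+1) = 0.
  by case/dvdpP: dvd_rs => q ->; rewrite rmorphM /= Cayley_Hamilton mulr0.
split=> //; first exact: undup_uniq.
move=> M hM; apply: mx_ext => v; rewrite mulmx0.
have : (v <= \sum_(i < size rs) kermxpoly A (('X - (rs`_i)%:P) ^+ n.+1))%MS.
  have cop : {in predT &, forall i j : 'I_(size rs), j != i ->
      coprimep (('X - (rs`_i)%:P) ^+ n.+1) (('X - (rs`_j)%:P) ^+ n.+1)}.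
    move=> i j _ _ ji; rewrite coprimep_expr ?coprimep_expl // coprimep_XsubC root_XsubC.
    by rewrite nth_uniq ?undup_uniq // eq_sym.
  rewrite -(kermxpoly_prod A cop); rewrite (big_nth 0) big_mkord in h0.
  by apply/sub_kermxP; rewrite h0 mulmx0.
case/sub_sumsmxP => u ->; rewrite mulmx_suml big1 // => i _; apply: (hM rs`_i).
  exact: mem_nth.
exists n.+1; rewrite -horner_mx_XsubC_exp -mulmxA.
by rewrite (_ : kermxpoly _ _ *m _ = 0) ?mulmx0 //; exact: mulmx_ker.
Qed.

Lemma gev_horner A (P : {poly k}) rs (theta : k -> k) mu v : uniq rs ->
  horner_mx A (\prod_(a <- rs) ('X - a%:P) ^+ n.+1) = 0 ->
  (forall a, a \in rs -> ('X - a%:P) ^+ n.+1 %| P - (theta a)%:P) ->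
  gev A mu v -> (v != 0 -> mu \in rs) /\ v *m horner_mx A P = theta mu *: v
    /\ v *m (A - mu%:M) ^+ n.+1 = 0.
Proof.
move=> urs h0 hP [m hm]; rewrite -horner_mx_XsubC_exp in hm.
have hM p q : horner_mx A p *m horner_mx A q = horner_mx A (p * q) by rewrite rmorphM.
pose Q (s : seq k) := \prod_(a <- s) ('X - a%:P) ^+ n.+1.
rewrite -/(Q rs) in h0.
have cop s : mu \notin s -> coprimep (Q s) (('X - mu%:P) ^+ m).
  rewrite /Q; elim: s => [|b s IHs]; first by rewrite big_nil coprime1p.
  rewrite inE negb_or big_cons => /andP[ab /IHs h]; rewrite coprimepMl h andbT.
  by rewrite coprimep_expl // coprimep_expr // coprimep_XsubC root_XsubC.
have [mrs|mrs] := boolP (mu \in rs); last first.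
  have -> : v = 0 by apply: (kill_coprime (cop _ mrs) (A := A)) => //; rewrite h0 mulmx0.
  by rewrite eqxx scaler0 !mul0mx.
have e : v *m (A - mu%:M) ^+ n.+1 = 0.
  apply: (kill_coprime (cop (rem mu rs) _) (A := A)).
  - by rewrite mem_rem_uniq // inE eqxx.
  - rewrite -horner_mx_XsubC_exp -mulmxA hM.
    by have <- : Q rs = _ := big_rem _ mrs; rewrite h0 mulmx0.
  by rewrite -horner_mx_XsubC_exp -mulmxA hM mulrC -hM mulmxA hm mul0mx.
do 2!split=> //; have /dvdpP [q eq] := hP _ mrs.
have -> : P = q * ('X - mu%:P) ^+ n.+1 + (theta mu)%:P by rewrite -eq subrK.
rewrite mulrC rmorphD rmorphM /= horner_mx_C mulmxDr mul_mx_scalar.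
by rewrite horner_mx_XsubC_exp mulmxA e mul0mx add0r.
Qed.

(** Functional calculus of the semisimple part of [A]. It is used with the identity for the Jordan
    decomposition, with indicator functions for spectral projections and with Q-linear functionals
    for Cartan's criterion. *)
Lemma gev_calculus A (theta : k -> k) : exists P : {poly k},
  forall mu v, gev A mu v -> v *m horner_mx A P = theta mu *: v.
Proof.
have [rs [urs _ h0 _]] := spectrum A; have [P hP] := interpolation n.+1 theta urs.
by exists P => mu v /(gev_horner urs h0 hP) [_ []].
Qed.

Lemma gev_bound A mu v : gev A mu v -> v *m (A - mu%:M) ^+ n.+1 = 0.
Proof.
have [rs [urs _ h0 _]] := spectrum A; have [P hP] := interpolation n.+1 id urs.
by move=> /(gev_horner urs h0 hP) [_ []].
Qed.

Lemma gev_ext A (M M' : 'M[k]_n.+1) :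
  (forall mu v, gev A mu v -> v *m M = v *m M') -> M = M'.
Proof.
have [rs [_ _ _ h]] := spectrum A => e; apply/eqP; rewrite -subr_eq0; apply/eqP.
by apply: h => mu v _ g; rewrite mulmxBr (e mu) // subrr.
Qed.

(** The components are obtained from [v] by polynomials in [A], so they stay in every [A]-stable
    subspace that contains [v]. *)
Lemma gev_sum A v : exists (rs : seq k) (w : k -> vec),
  v = \sum_(mu <- rs) w mu /\ forall mu, gev A mu (w mu) /\
   exists P, w mu = v *m horner_mx A P.
Proof.
have [rs [urs _ h0 hM]] := spectrum A.
have hP mu := interpolation n.+1 (fun a => (a == mu)%:R) urs.
pose P mu := sval (constructive_indefinite_description _ (hP mu)).
have PP mu : forall a, a \in rs -> ('X - a%:P) ^+ n.+1 %| P mu - ((a == mu)%:R)%:P.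
  by rewrite /P; case: constructive_indefinite_description.
have gP mu a u : gev A a u -> u *m horner_mx A (P mu) = (a == mu)%:R *: u.
  by move=> /(gev_horner urs h0 (PP mu)) [_ []].
exists rs, (fun mu => v *m horner_mx A (P mu)); split=> [|mu]; last first.
  split; last by exists (P mu).
  exists n.+1; rewrite -mulmxA; set M := horner_mx _ _ *m _; suff -> : M = 0 by rewrite mulmx0.
  apply: hM => a u ars ga; rewrite mulmxA (gP mu a) //; case: eqP => [<-|_].
    by rewrite scale1r gev_bound.
  by rewrite scale0r mul0mx.
have -> : \sum_(mu <- rs) v *m horner_mx A (P mu) = v *m \sum_(mu <- rs) horner_mx A (P mu).
  by rewrite mulmx_sumr.
rewrite -[LHS]mulmx1; congr (_ *m _); apply/eqP; rewrite -subr_eq0; apply/eqP.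
apply: hM => a u ars ga; rewrite mulmxBr mulmx1 mulmx_sumr (bigD1_seq a) //=.
rewrite (gP a a) // eqxx scale1r big1 ?addr0 ?subrr // => b ba.
by rewrite (gP b a) // eq_sym (negbTE ba) scale0r.
Qed.

Lemma gev_eigen A mu v : gev A mu v -> v != 0 ->
  exists j, v *m (A - mu%:M) ^+ j != 0 /\ v *m (A - mu%:M) ^+ j *m A = mu *: (v *m (A - mu%:M) ^+ j).
Proof.
case=> m hm v0; elim: m hm => [|m IH]; first by rewrite expr0 mulmx1 => h; rewrite h eqxx in v0.
have [/IH//|h] := eqVneq (v *m (A - mu%:M) ^+ m) 0; exists m; split=> //.
apply/eqP; rewrite -subr_eq0 -mul_mx_scalar -mulmxBr -mulmxA -[_ *m (_ - _)]exprSr.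
exact/eqP.
Qed.

Lemma eigen_gev A mu v : v *m A = mu *: v -> gev A mu v.
Proof. by move=> e; exists 1%N; rewrite expr1 mulmxBr mul_mx_scalar e subrr. Qed.

Lemma gev0_nilp A : (forall mu v, v != 0 -> v *m A = mu *: v -> mu = 0) -> nilmx A.
Proof.
move=> h; exists n.+1; apply: (@gev_ext A) => mu v g; rewrite mulmx0.
have [->|v0] := eqVneq v 0; first by rewrite mul0mx.
have [j [/h w0 /w0 mu0]] := gev_eigen g v0.
by have := gev_bound g; rewrite mu0 raddf0 subr0.
Qed.

Lemma nilp_expn A : nilmx A -> A ^+ n.+1 = 0.
Proof.
case=> m hm; apply: mx_ext => v; rewrite mulmx0.
have : gev A 0 v by exists m; rewrite raddf0 subr0 hm mulmx0.
by move/gev_bound; rewrite raddf0 subr0.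
Qed.

Lemma nilp_eigen A mu v : nilmx A -> v != 0 -> v *m A = mu *: v -> mu = 0.
Proof.
case=> m hm v0 e; have e2 j : v *m A ^+ j = mu ^+ j *: v.
  elim: j => [|j IH]; first by rewrite !expr0 mulmx1 scale1r.
  by rewrite exprSr mulmxA IH -scalemxAl e scalerA -exprSr.
have /eqP := e2 m; rewrite hm mulmx0 eq_sym scaler_eq0 (negbTE v0) orbF.
by rewrite expf_eq0 => /andP[_ /eqP].
Qed.

Lemma nilp_trace A : nilmx A -> \tr A = 0.
Proof.
move=> hA; have [rl e] := closed_field_poly_normal (char_poly A).
rewrite (monicP (char_poly_monic A)) scale1r in e.
have rl0 a : a \in rl -> a = 0.
  rewrite -root_prod_XsubC -e -eigenvalue_root_char => /eigenvalueP [v va v0].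
  exact: nilp_eigen va.
have szl : size rl = n.+1.
  by have := size_char_poly A; rewrite e size_prod_XsubC => -[].
have e2 : char_poly A = 'X^(n.+1).
  rewrite e (eq_big_seq (fun=> 'X)) => [|a /rl0 ->]; last by rewrite subr0.
  by rewrite big_const_seq count_predT szl iter_mulr_1.
have := char_poly_trace A (ltn0Sn n); rewrite e2 coefXn /= ltn_eqF // => /esym/eqP.
by rewrite oppr_eq0 => /eqP.
Qed.

Lemma last_nonzero A v : nilmx A -> v != 0 -> exists j, v *m A ^+ j != 0 /\ v *m A ^+ j.+1 = 0.
Proof.
case=> m hm v0; have : v *m A ^+ m = 0 by rewrite hm mulmx0.
elim: m {hm} => [|m IH]; first by rewrite expr0 mulmx1 => h; rewrite h eqxx in v0.
by have [/IH//|h] := eqVneq (v *m A ^+ m) 0; exists m.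
Qed.

Lemma comm_exp_step E W C m : W *m E - E *m W = C -> C *m E = E *m C ->
  W *m E ^+ m.+1 = E ^+ m.+1 *m W + m.+1%:R *: (E ^+ m *m C).
Proof.
move=> eC cC; have eWE : W *m E = E *m W + C by rewrite -eC addrC subrK.
have cE j : C *m E ^+ j = E ^+ j *m C.
  elim: j => [|j IH]; first by rewrite expr0 mulmx1 mul1mx.
  by rewrite exprSr -[_ * _]/(_ *m _) mulmxA IH -mulmxA cC mulmxA.
elim: m => [|m IH]; first by rewrite !expr1 expr0 mul1mx scale1r.
rewrite [in LHS]exprSr -[_ * _]/(_ *m _) mulmxA IH mulmxDl -mulmxA eWE mulmxDr.
rewrite -scalemxAl -mulmxA cC !mulmxA -[_ ^+ m *m E]exprSr -[_ ^+ m.+1 *m E]exprSr.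
by rewrite -addrA -[X in _ + (X + _)]scale1r -scalerDl nat1r.
Qed.

(* [y W^j E^j = j! mu^j y] for every [j], whereas [E] is nilpotent. *)
Lemma comm_nilp_eigen E W C mu v : nilmx E -> W *m E - E *m W = C -> C *m E = E *m C ->
  v != 0 -> v *m C = mu *: v -> mu = 0.
Proof.
move=> nE eC cC v0 vC; have [j [w0 wE]] := last_nonzero nE v0.
set y := v *m E ^+ j in w0; have yE : y *m E = 0 by rewrite -mulmxA -[_ *m E]exprSr.
have yC : y *m C = mu *: y.
  rewrite -mulmxA (_ : E ^+ j *m C = C *m E ^+ j) ?mulmxA ?vC -?scalemxAl //.
  elim: (j) => [|i IH]; first by rewrite expr0 mulmx1 mul1mx.
  by rewrite exprS -[_ * _]/(_ *m _) -mulmxA IH !mulmxA cC.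
have e i : y *m W ^+ i *m E ^+ i = (i`!%:R * mu ^+ i) *: y.
  elim: i => [|i IH]; first by rewrite !expr0 !mulmx1 mul1r scale1r.
  rewrite exprSr -[_ * _]/(_ *m _) -!mulmxA (comm_exp_step _ eC cC) mulmxDr.
  rewrite [E ^+ i.+1]exprSr -[_ ^+ i * _]/(_ *m _) !mulmxDr !mulmxA IH.
  rewrite -!scalemxAl yE mul0mx scaler0 add0r -!scalemxAr !mulmxA IH -scalemxAl yC !scalerA.
  by congr (_ *: _); rewrite factS natrM exprS; ring.
have [m hm] := nE; have /eqP := e m; rewrite hm mulmx0 eq_sym scaler_eq0 (negbTE w0) orbF.
rewrite mulf_eq0 expf_eq0 => /orP[|/andP[_ /eqP]//].
by rewrite (negbTE (natr_neq0 char0 (fact_gt0 m))).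
Qed.

Lemma sl2_step E U H m : U *m E - E *m U = H -> E *m H - H *m E = 2%:R *: E ->
  U *m E ^+ m.+1 = E ^+ m.+1 *m U + m.+1%:R *: (E ^+ m *m (H - m%:R%:M)).
Proof.
move=> eH eE; have eUE : U *m E = E *m U + H by rewrite -eH addrC subrK.
have eHE : H *m E = E *m H - 2%:R *: E by rewrite -eE opprB addrC subrK.
elim: m => [|m IH]; first by rewrite !expr1 expr0 mul1mx scale1r raddf0 subr0.
rewrite [in LHS]exprSr -[_ * _]/(_ *m _) mulmxA IH mulmxDl -mulmxA eUE mulmxDr.
rewrite -scalemxAl -mulmxA mulmxBl eHE !mulmxA -[_ ^+ m.+1 *m E]exprSr -addrA; congr (_ + _).
rewrite mul_scalar_mx !mulmxBr !mulmxA -!scalemxAr -[_ ^+ m *m E]exprSr mul_mx_scalar.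
rewrite -addrA -opprD -scalerDl.
move: (E ^+ m.+1 *m H) (E ^+ m.+1) => X Y; apply/matrixP=> i j; rewrite !mxE.
by ring.
Qed.

(* If [y = z E^i] is killed by [E], then [z U E^(i+1) = (i+1)(mu - i) y]; take [i] maximal. *)
Lemma sl2_weight E U H mu y : nilmx E -> U *m E - E *m U = H ->
  E *m H - H *m E = 2%:R *: E -> y != 0 -> y *m E = 0 -> y *m H = mu *: y ->
  exists i : nat, mu = i%:R.
Proof.
move=> [m hm] eH eE y0 yE yH.
have : exists i, exists z, y = z *m E ^+ i by exists 0%N, y; rewrite expr0 mulmx1.
move=> h; apply: NNPP => hn.
have all_i i : exists z, y = z *m E ^+ i.
  elim: i => [|i [z ez]]; first by exists y; rewrite expr0 mulmx1.
  have ne : mu - i%:R != 0 by rewrite subr_eq0; apply/eqP => e; apply: hn; exists i.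
  have e : z *m U *m E ^+ i.+1 = (i.+1%:R * (mu - i%:R)) *: y.
    rewrite -mulmxA (sl2_step _ eH eE) mulmxDr mulmxA exprSr -[_ * _]/(_ *m _) mulmxA -ez yE.
    by rewrite mul0mx add0r -scalemxAr mulmxA -ez mulmxBr yH mul_mx_scalar -scalerBl scalerA.
  exists ((i.+1%:R * (mu - i%:R))^-1 *: (z *m U)).
  by rewrite -scalemxAl e scalerA mulVf ?scale1r // mulf_neq0 // (natr_neq0 char0).
have [z ez] := all_i m; by rewrite ez hm mulmx0 eqxx in y0.
Qed.

End Spectral.

(** * Rational functionals on the field *)

Section RationalFunctional.
Import Order.TTheory Num.Theory.
Variable k : fieldType.
Hypothesis char0 : [pchar k] =i pred0.

Lemma intr_neq0 (z : int) : z != 0 -> z%:~R != 0 :> k.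
Proof.
case: z => m; first by move=> h; apply: (natr_neq0 char0); rewrite lt0n.
by move=> _; rewrite NegzE rmorphN oppr_eq0; exact: (natr_neq0 char0).
Qed.

Let rat_is_zmod_morphism : zmod_morphism (@ratr k).
Proof.
have nz_den x : (denq x)%:~R != 0 :> k by apply: intr_neq0; exact: denq_neq0.
move=> x y; apply: (canLR (mulfK (nz_den _))); apply: (mulIf (nz_den x)).
rewrite mulrAC mulrBl divfK ?nz_den // mulrAC -!rmorphM.
apply: (mulIf (nz_den y)); rewrite mulrAC mulrBl divfK ?nz_den //.
rewrite -!(rmorphM, rmorphB); congr _%:~R; apply: (@intr_inj rat).
by rewrite !(rmorphM, rmorphB) [_ - _]lock /= -lock !numqE; ring.
Qed.

Let rat_is_monoid_morphism : monoid_morphism (@ratr k).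
Proof.
have nz_den x : (denq x)%:~R != 0 :> k by apply: intr_neq0; exact: denq_neq0.
split=> [|x y]; first by rewrite /ratr divr1.
rewrite /ratr mulrC mulrAC; apply: canLR (mulKf (nz_den _)) _; rewrite !mulrA.
do 2!apply: canRL (mulfK (nz_den _)) _; rewrite -!rmorphM; congr _%:~R.
apply: (@intr_inj rat); rewrite !rmorphM [x * y]lock /= !numqE -lock.
by rewrite -!mulrA mulrA mulrCA -!mulrA (mulrCA y).
Qed.

Lemma rat_embedding : exists iota : {rmorphism rat -> k}, forall m : nat, iota m%:R = m%:R.
Proof.
pose f := GRing.isZmodMorphism.Build rat k (@ratr k) rat_is_zmod_morphism.
pose g := GRing.isMonoidMorphism.Build rat k (@ratr k) rat_is_monoid_morphism.
pose iota : {rmorphism rat -> k} := HB.pack (@ratr k) f g.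
by exists iota => m; rewrite rmorph_nat.
Qed.

Variable iota : {rmorphism rat -> k}.

(* A [Q]-linear functional on a [Q]-subspace of [k], given by its graph. *)
Let functional (G : k -> rat -> Prop) := [/\ G 0 0,
  forall x y r q, G x r -> G y q -> G (x + y) (r + q),
  forall a x r, G x r -> G (iota a * x) (a * r) & forall r, G 0 r -> r = 0].

Let functional_extend G y : functional G ->
  exists G', [/\ functional G', forall x r, G x r -> G' x r & exists r, G' y r].
Proof.
move=> fG; have [G0 GD GZ Gf] := fG.
case: (classic (exists r, G y r)) => [h|ny]; first by exists G.
exists (fun x r => exists v q, G v r /\ x = v + iota q * y); split.
- split.
  + by exists 0, 0; rewrite rmorph0 mul0r addr0.
  + move=> x z r s [v [q [Gv ->]]] [w [t [Gw ->]]]; exists (v + w), (q + t).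
    by split; [exact: GD | rewrite rmorphD mulrDl addrACA].
  + move=> a x r [v [q [Gv ->]]]; exists (iota a * v), (a * q).
    by split; [exact: GZ | rewrite mulrDr rmorphM mulrA].
  move=> r [v [q [Gv e]]]; have [q0|q0] := eqVneq q 0.
    by apply: Gf; rewrite e q0 rmorph0 mul0r addr0.
  case: ny; exists (- q^-1 * r); have -> : y = iota (- q^-1) * v; last exact: GZ.
  have ev : v = - (iota q * y) by apply/eqP; rewrite -addr_eq0 -e.
  by rewrite ev rmorphN fmorphV mulrNN mulKf // fmorph_eq0.
- by move=> x r Gx; exists x, 0; rewrite rmorph0 mul0r addr0.
by exists 0, 0, 1; rewrite rmorph1 mul1r add0r.
Qed.

Definition rat_functional (V : k -> Prop) (la : k -> rat) :=
  (forall x y, V x -> V y -> V (x + y) /\ la (x + y) = la x + la y) /\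
  (forall a x, V x -> V (iota a * x) /\ la (iota a * x) = a * la x).

(** The graph starts as the line spanned by [mu0] and is extended over the members of [s] one at a
    time, a new independent element receiving the value 0. *)
Lemma rational_functional (s : seq k) (mu0 : k) : mu0 != 0 ->
  exists V la, [/\ rat_functional V la, la mu0 = 1, V mu0 & forall x, x \in s -> V x].
Proof.
move=> mu00.
pose G0 (x : k) (r : rat) := x = iota r * mu0.
have fG0 : functional G0.
  split.
  - by rewrite /G0 rmorph0 mul0r.
  - by move=> x y r q -> ->; rewrite /G0 rmorphD mulrDl.
  - by move=> a x r ->; rewrite /G0 rmorphM mulrA.
  move=> r /esym/eqP; rewrite mulf_eq0 (negbTE mu00) orbF fmorph_eq0.
  by move/eqP.
have [G [fG G1 Gs]] : exists G, [/\ functional G, G mu0 1 & forall x, x \in s -> exists r, G x r].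
  elim: s => [|y s [G [fG G1 Gs]]].
    by exists G0; split=> //; rewrite /G0 rmorph1 mul1r.
  have [G' [fG' GG' Gy]] := functional_extend y fG.
  exists G'; split=> // [|x]; first exact: GG'.
  by rewrite inE => /orP[/eqP->//|/Gs [r /GG' h]]; exists r.
have [G00 GD GZ Gf] := fG.
have Gu x r q : G x r -> G x q -> r = q.
  move=> Gr /(GZ (-1)); rewrite rmorphN rmorph1 !mulN1r => Gq.
  have := GD _ _ _ _ Gr Gq; rewrite subrr => /Gf /eqP; by rewrite subr_eq0 => /eqP.
pose la x := epsilon (inhabits 0) (G x).
have laP x : (exists r, G x r) -> G x (la x) by exact: epsilon_spec.
exists (fun x => exists r, G x r), la; split=> //; last by exists 1.
  split=> [x y Vx Vy|a x Vx].
    have Vxy : exists r, G (x + y) r.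
      by exists (la x + la y); apply: GD; exact: laP.
    by split=> //; apply: (Gu (x + y)); [exact: laP | apply: GD; exact: laP].
  have Vax : exists r, G (iota a * x) r by exists (a * la x); apply: GZ; exact: laP.
  by split=> //; apply: (Gu (iota a * x)); [exact: laP | apply: GZ; exact: laP].
by apply: (Gu mu0) => //; apply: laP; exists 1.
Qed.

Lemma rat_avoid (s : seq rat) : exists r, r \notin s.
Proof.
exists (1 + \sum_(x <- s) `|x|); set r := 1 + _; apply/negP=> h.
have : r <= \sum_(x <- s) `|x|.
  rewrite (big_rem r h) /=; apply: le_trans (ler_norm r) _.
  by rewrite lerDl; apply: sumr_ge0 => y _; exact: normr_ge0.
by rewrite gerDr ler10.
Qed.

(** Two functionals are combined as [la1 + r la2] with [r] outside a finite set. A functional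
    vanishing at no nonzero weight orders the roots by the sign of its values. *)
Lemma rational_functional_nz (s t : seq k) : 0 \notin s ->
  exists V la, [/\ rat_functional V la, forall x, x \in t -> V x
    & forall x, x \in s -> V x /\ la x != 0].
Proof.
elim: s t => [|y s IH] t.
  by move=> _; have [V [la [h _ _ ht]]] := rational_functional t (oner_neq0 k); exists V, la.
rewrite inE negb_or eq_sym => /andP[y0 s0].
have [V1 [la1 [[D1 Z1] t1 h1]]] := IH (y :: t) s0.
have [V2 [la2 [[D2 Z2] l2 y2 h2]]] := rational_functional (s ++ t) y0.
have [r hr] := rat_avoid [seq - (la1 x / la2 x) | x <- y :: s].
exists (fun x => V1 x /\ V2 x), (fun x => la1 x + r * la2 x); split.
- split=> [x z [x1 x2] [z1 z2]|a x [x1 x2]].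
    have [? ->] := D1 _ _ x1 z1; have [? ->] := D2 _ _ x2 z2; split=> //; ring.
  have [? ->] := Z1 a _ x1; have [? ->] := Z2 a _ x2; split=> //; ring.
- by move=> x xt; split; [apply: t1; rewrite inE xt orbT | apply: h2; rewrite mem_cat xt orbT].
move=> x xs; split.
  move: xs; rewrite inE => /orP[/eqP->|xs]; first by split=> //; apply: t1; rewrite mem_head.
  by split; [have [] := h1 _ xs | apply: h2; rewrite mem_cat xs].
have [l0|l0] := eqVneq (la2 x) 0.
  rewrite l0 mulr0 addr0; move: xs; rewrite inE => /orP[/eqP ex|/h1 []] //.
  by move: l0; rewrite ex l2 => /eqP; rewrite oner_eq0.
apply: contra hr => /eqP h; apply/mapP; exists x => //.
by apply: (mulIf l0); rewrite mulNr divfK //; apply/eqP; rewrite -addr_eq0 addrC h.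
Qed.

End RationalFunctional.

(** * Functional calculus in the adjoint representation, Jordan decomposition *)

Section AdCalculus.
Variables (k : closedFieldType) (n : nat) (c : 'I_n.+1 -> 'I_n.+1 -> 'I_n.+1 -> k).
Variable Bm : 'M[k]_n.+1.
Local Notation vec := 'rV[k]_n.+1.
Local Notation br := (brk c).
Local Notation ad := (adm c).
Local Notation B := (bform Bm).
Hypothesis char0 : [pchar k] =i pred0.
Hypothesis lieP : is_lie c.

(** Leibniz rule for [ad x - (mu + nu)], by induction on the sum of the two nilpotency exponents. *)
Lemma gev_brk x mu nu (u w : vec) :
  gev (ad x) mu u -> gev (ad x) nu w -> gev (ad x) (mu + nu) (br u w).
Proof.
move=> [a ha] [b hb]; exists (a + b)%N; move: {2}(a + b)%N (erefl (a + b)%N) => m.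
elim: m a b u w ha hb => [|m IH] a b u w ha hb.
  move=> /eqP; rewrite addn_eq0 => /andP[/eqP a0 _]; move: ha.
  by rewrite a0 expr0 mulmx1 => ->; rewrite brk0l mul0mx.
case: a ha => [|a] ha; first by move: ha; rewrite expr0 mulmx1 => -> _; rewrite brk0l mul0mx.
case: b hb => [|b] hb; first by move: hb; rewrite expr0 mulmx1 => -> _; rewrite brk0r mul0mx.
move=> e; have step : br u w *m (ad x - (mu + nu)%:M) =
    br (u *m (ad x - mu%:M)) w + br u (w *m (ad x - nu%:M)).
  rewrite !mulmxBr !mul_mx_scalar brkBl brkBr (derivation_adm lieP) brkZl brkZr.
  by rewrite scalerDl opprD addrACA.
have [e1 e2] : (a + b.+1 = m /\ a.+1 + b = m)%N.
  by move: e; rewrite !addSn !addnS => -[->].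
rewrite e exprS -[_ * _]/(_ *m _) mulmxA step mulmxDl -{1}e1 -e2.
rewrite (IH a b.+1) ?(IH a.+1 b) ?addr0 //; rewrite ?e1 ?e2 //.
- by rewrite -mulmxA -[(_ - _) *m _]exprS.
- by rewrite -mulmxA -[(_ - _) *m _]exprS.
Qed.

Lemma gev_eigenvalue A (mu : k) (v : vec) : v != 0 -> gev A mu v -> eigenvalue A mu.
Proof.
move=> v0 g; have [j [w0 e]] := gev_eigen g v0.
by apply/eigenvalueP; exists (v *m (A - mu%:M) ^+ j).
Qed.

Hypothesis redP : reductive c.
Hypothesis formP : good_form c Bm.

(** Additivity of [theta] on eigenvalues makes the corresponding polynomial in [ad x] a derivation
    by [gev_brk], and [theta 0 = 0] makes it kill the center; so it is inner. *)
Lemma ad_calculus x (theta : k -> k) : theta 0 = 0 ->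
  (forall a b, eigenvalue (ad x) a -> eigenvalue (ad x) b -> eigenvalue (ad x) (a + b) ->
     theta (a + b) = theta a + theta b) ->
  exists x' P, [/\ (x' <= dg c)%MS, ad x' = horner_mx (ad x) P
    & forall mu v, gev (ad x) mu v -> br x' v = theta mu *: v].
Proof.
move=> th0 thD; have [P hP] := gev_calculus (ad x) theta.
have dE : derivation c (horner_mx (ad x) P).
  have dE' a b u w : gev (ad x) a u -> gev (ad x) b w ->
      br u w *m horner_mx (ad x) P = br (u *m horner_mx (ad x) P) w + br u (w *m horner_mx (ad x) P).
    move=> gu gw; rewrite (hP _ _ gu) (hP _ _ gw) (hP _ _ (gev_brk gu gw)) brkZl brkZr -scalerDl.
    have [->|uw0] := eqVneq (br u w) 0; first by rewrite !scaler0.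
    congr (_ *: _); apply: thD; last by apply: gev_eigenvalue (gev_brk gu gw).
      by apply: gev_eigenvalue gu; apply: contraNneq uw0 => ->; rewrite brk0l.
    by apply: gev_eigenvalue gw; apply: contraNneq uw0 => ->; rewrite brk0r.
  move=> u w; have [rs [f [-> hf]]] := gev_sum (ad x) u.
  have [rs' [f' [-> hf']]] := gev_sum (ad x) w.
  rewrite brk_suml !mulmx_suml !brk_suml -big_split; apply: eq_bigr => a _ /=.
  rewrite !brk_sumr mulmx_suml -big_split; apply: eq_bigr => b _ /=.
  by apply: (dE' a b); [have [h _] := hf a | have [h _] := hf' b].
have [z z0|x' x'D ex'] := derivation_inner lieP redP formP dE.
  have g : gev (ad x) 0 z.
    apply: eigen_gev; rewrite scale0r mul_adm (brkC lieP) -mul_adm z0 mulmx0.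
    exact: oppr0.
  by rewrite (hP _ _ g) th0 scale0r.
exists x', P; split=> // mu v g; by rewrite -mul_adm ex' (hP _ _ g).
Qed.

(** The case [theta = id] of [ad_calculus]: on the generalized eigenspace of [mu], [ad (x - s)] acts
    as the nilpotent [ad x - mu]. *)
Lemma jordan x : exists s, [/\ (s <= dg c)%MS, nilmx (ad (x - s))
  & forall mu v, gev (ad x) mu v -> br s v = mu *: v].
Proof.
have [//|//|s [P [sD es hs]]] := @ad_calculus x id; exists s; split=> //.
exists n.+1; apply: (@gev_ext _ _ (ad x)) => mu v g; rewrite mulmx0.
have h j w : gev (ad x) mu w -> w *m ad (x - s) ^+ j = w *m (ad x - mu%:M) ^+ j.
  elim: j w => [|j IH] w gw; first by rewrite !expr0.
  rewrite !exprS -![_ * _]/(_ *m _) !mulmxA admB !mulmxBr mul_mx_scalar (mul_adm c s) (hs mu) //.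
  rewrite -admB -mul_mx_scalar -mulmxBr; apply: IH.
  have [m hm] := gw; exists m; rewrite -mulmxA -[(_ - _) *m _]exprS exprSr.
  by rewrite -[_ * _]/(_ *m _) mulmxA hm mul0mx.
by rewrite h // gev_bound.
Qed.

Lemma cent_gev0 x y : br x y = 0 -> gev (ad x) 0 y.
Proof. by move=> e; apply: eigen_gev; rewrite scale0r mul_adm. Qed.

(* The centralizer of a semisimple element, with complement [ [x, g] ]. *)
Definition split_cent x := forall y, exists a b, y = a + br x b /\ br x a = 0.

Lemma form_cent x a b : br x a = 0 -> B a (br x b) = 0.
Proof.
move=> e; rewrite -(bform_inv formP) (brkC lieP) e oppr0.
exact: (bform0l formP).
Qed.

End AdCalculus.

(** * Lie's theorem and nilpotency in solvable subalgebras *)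

Lemma closed_eigenvector (k : closedFieldType) m (A : 'M[k]_m.+1) :
  exists mu (v : 'rV_m.+1), v != 0 /\ v *m A = mu *: v.
Proof.
have [rl e] := closed_field_poly_normal (char_poly A).
rewrite (monicP (char_poly_monic A)) scale1r in e.
case: rl e => [|a rl] e.
  by have := size_char_poly A; rewrite e big_nil size_poly1.
have : eigenvalue A a by rewrite eigenvalue_root_char e root_prod_XsubC mem_head.
by case/eigenvalueP => v e1 v0; exists a, v.
Qed.

Section Krylov.
Variables (k : closedFieldType) (m : nat).
Hypothesis char0 : [pchar k] =i pred0.
Variables (X : 'M[k]_m.+1) (u : 'rV[k]_m.+1).

Definition krylov j : 'M[k]_(j, m.+1) := \matrix_(i < j) (u *m X ^+ i).

Lemma krylov_mem i j : (i < j)%N -> (u *m X ^+ i <= krylov j)%MS.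
Proof. by move=> h; have := row_sub (Ordinal h) (krylov j); rewrite rowK. Qed.

Lemma krylov_sub i j : (i <= j)%N -> (krylov i <= krylov j)%MS.
Proof.
move=> h; apply/row_subP=> s; rewrite rowK; apply: krylov_mem.
exact: leq_trans h.
Qed.

Lemma krylov_shift i : (krylov i *m X <= krylov i.+1)%MS.
Proof.
apply/row_subP=> s; rewrite row_mul rowK -mulmxA -[_ *m X]exprSr.
by apply: krylov_mem; rewrite ltnS.
Qed.

Lemma krylov_stable : u != 0 ->
  exists j, [/\ (0 < j)%N, row_free (krylov j) & (krylov j *m X <= krylov j)%MS].
Proof.
move=> u0; have ex : exists j, ~~ row_free (krylov j).
  by exists m.+2; rewrite /row_free neq_ltn ltnS rank_leq_col.
case: (ex_minnP ex) => j nf jmin; case: j nf jmin => [|j] nf jmin.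
  by move: nf; rewrite /row_free -leqn0 rank_leq_row.
have fr : row_free (krylov j) by apply/negPn/negP=> /jmin; rewrite ltnn.
exists j; split=> //.
  case: j nf fr {jmin} => // nf _; move: nf; rewrite /row_free.
  have -> : krylov 1 = u by apply/row_matrixP=> i; rewrite rowK ord1 expr0 mulmx1 row_id.
  by rewrite rank_rV u0.
apply: submx_trans (krylov_shift j) _.
have /mxrank_leqif_sup/geq_leqif <- := krylov_sub (leqnSn j).
move: nf fr; rewrite /row_free => nf /eqP->.
by rewrite -ltnS ltn_neqAle nf rank_leq_row.
Qed.

Lemma krylov_coord j (r : 'rV[k]_j) (i : 'I_j) : row_free (krylov j) ->
  (r *m krylov j <= krylov i)%MS -> r 0 i = 0.
Proof.
move=> fr /submxP [b]; have ij := ltnW (ltn_ord i).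
have -> : krylov i = rowsub (widen_ord ij) (krylov j).
  by apply/row_matrixP=> s; rewrite row_rowsub !rowK.
rewrite rowsubE mulmxA => /(row_free_inj fr) ->; rewrite mxE big1 // => s _.
rewrite !mxE; case: eqP => [e|_]; last by rewrite mulr0.
by have := ltn_ord s; have /= -> := congr1 val e; rewrite ltnn.
Qed.

End Krylov.

Section LieTheorem.
Variables (k : closedFieldType) (n m : nat) (c : 'I_n -> 'I_n -> 'I_n -> k).
Hypothesis char0 : [pchar k] =i pred0.
Hypothesis lieP : is_lie c.
Local Notation vec := 'rV[k]_n.
Local Notation br := (brk c).
Variable rho : vec -> 'M[k]_m.+1.
Hypothesis rhoP : forall a x y, rho (a *: x + y) = a *: rho x + rho y.

Definition bracket_repr (L : 'M[k]_n) := forall x y, (x <= L)%MS -> (y <= L)%MS ->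
  rho (br x y) = rho y *m rho x - rho x *m rho y.

Definition common_eigen (L : 'M[k]_n) := exists (u : 'rV[k]_m.+1) (chi : vec -> k),
  u != 0 /\ forall y, (y <= L)%MS -> u *m rho y = chi y *: u.

(* The trace of [rho [x, y]] on the Krylov space of [x] is a multiple of the
   weight of [[x, y]], so the weight vanishes and the Krylov space consists of
   weight vectors. *)
Lemma common_eigen_step (L : 'M[k]_n) x : (forall y, (y <= L)%MS -> (br x y <= L)%MS) ->
  bracket_repr (L + x)%MS -> common_eigen L -> common_eigen (L + x)%MS.
Proof.
move=> Lx rep [u [chi [u0 hu]]]; pose X := rho x.
have LxS : (L <= L + x)%MS by rewrite addsmxSl.
have xS : (x <= L + x)%MS by rewrite addsmxSr.
have com y : (y <= L)%MS -> X *m rho y = rho y *m X - rho (br x y).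
  by move=> yL; rewrite (rep x y) ?(submx_trans yL) // subKr.
have tri i : forall y, (y <= L)%MS ->
    (u *m X ^+ i *m rho y - chi y *: (u *m X ^+ i) <= krylov X u i)%MS.
  elim: i => [|i IH] y yL; first by rewrite expr0 mulmx1 hu // subrr sub0mx.
  have e : u *m X ^+ i.+1 *m rho y - chi y *: (u *m X ^+ i.+1) =
    (u *m X ^+ i *m rho y - chi y *: (u *m X ^+ i)) *m X
    - (u *m X ^+ i *m rho (br x y) - chi (br x y) *: (u *m X ^+ i))
    - chi (br x y) *: (u *m X ^+ i).
    have aux (a z b : 'rV[k]_m.+1) : a - (z - b) - b = a - z.
      by rewrite opprB addrA addrAC addrK.
    rewrite aux exprSr -[_ * X]/(_ *m X) !mulmxA -mulmxA com // mulmxBr mulmxBl !mulmxA -scalemxAl.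
    by rewrite addrAC.
  rewrite e addmx_sub ?eqmx_opp ?scalemx_sub ?krylov_mem //.
  rewrite addmx_sub ?eqmx_opp //.
    by apply: submx_trans (submxMr _ (IH _ yL)) (krylov_shift _ _ _).
  by apply: submx_trans (IH _ (Lx _ yL)) (krylov_sub _ _ _).
have [j [j0 fr st]] := krylov_stable X u0; set K := krylov X u j in fr st.
have stY y : (y <= L)%MS -> (K *m rho y <= K)%MS.
  move=> yL; apply/row_subP=> i; rewrite row_mul rowK.
  rewrite -[X in (X <= _)%MS](subrK (chi y *: (u *m X ^+ i))).
  rewrite addmx_sub ?scalemx_sub ?krylov_mem //.
  by apply: submx_trans (tri _ _ yL) (krylov_sub _ _ (ltnW _)).
have chi0 y : (y <= L)%MS -> chi (br x y) = 0.
  move=> yL; have zL := Lx _ yL.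
  have /submxP [CX eX] := st; have /submxP [CY eY] := stY _ yL.
  have /submxP [CZ eZ] := stY _ zL.
  have eC : CZ = CY *m CX - CX *m CY.
    apply: (row_free_inj fr); rewrite mulmxBl -eZ (rep x y) ?(submx_trans yL) //.
    rewrite mulmxBr !mulmxA eY -/X -[CY *m K *m _]mulmxA eX -[CX *m K *m _]mulmxA eY.
    by rewrite !mulmxA.
  have : \tr CZ = 0 by rewrite eC mxtraceB mxtrace_mulC subrr.
  have -> : \tr CZ = j%:R * chi (br x y).
    rewrite /mxtrace (eq_bigr (fun=> chi (br x y))); last first.
      move=> i _; have := @krylov_coord _ _ X u j (row i CZ - chi (br x y) *: delta_mx 0 i) i fr.
      rewrite mulmxBl -row_mul -eZ -scalemxAl -rowE row_mul rowK => /(_ (tri _ _ zL)).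
      by rewrite !mxE !eqxx mulr1 => /eqP; rewrite subr_eq0 => /eqP.
    by rewrite sumr_const card_ord mulr_natl.
  by move/eqP; rewrite mulf_eq0 (negPf (natr_neq0 char0 j0)) => /eqP.
have wt i : forall y, (y <= L)%MS -> u *m X ^+ i *m rho y = chi y *: (u *m X ^+ i).
  elim: i => [|i IH] y yL; first by rewrite expr0 mulmx1 hu.
  rewrite exprSr -[_ * X]/(_ *m X) !mulmxA -mulmxA com // mulmxBr !mulmxA IH // (IH (br x y)) ?Lx //.
  by rewrite chi0 // scale0r subr0 -scalemxAl.
have [j1 ej] : exists j1, j = j1.+1 by exists j.-1; rewrite prednK.
have /submxP [CX eX] := st; subst j.
have [mu [a [a0 ea]]] := closed_eigenvector CX.
have aX : a *m K *m X = mu *: (a *m K) by rewrite -mulmxA eX mulmxA ea scalemxAl.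
have aY y : (y <= L)%MS -> a *m K *m rho y = chi y *: (a *m K).
  move=> yL; rewrite -mulmxA scalemxAr; congr (_ *m _); apply/row_matrixP=> i.
  by rewrite row_mul rowK wt // linearZ /= rowK.
have ex y : exists b, (y <= L + x)%MS -> a *m K *m rho y = b *: (a *m K).
  case: (boolP (y <= L + x)%MS) => [|_]; last by exists 0.
  case/sub_addsmxP => -[s t] /= ->; have [r ->] : exists r, t *m x = r *: x.
    by exists (t 0 0); rewrite {1}[t]mx11_scalar mul_scalar_mx.
  exists (r * mu + chi (s *m L)) => _.
  by rewrite addrC rhoP mulmxDr -scalemxAr aX aY ?submxMl // scalerA -scalerDl.
exists (a *m K), (fun y => proj1_sig (constructive_indefinite_description _ (ex y))); split.
  by apply: contraNneq a0 => /eqP; rewrite (mulmx_free_eq0 _ fr).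
by move=> y yL; case: constructive_indefinite_description => b /=; apply.
Qed.

(** Induction on the derived length. Every subspace between the derived algebra and [L] is an ideal
    of [L], so the rows of [L] can be adjoined one by one with [common_eigen_step]. *)
Lemma lie_repr s : forall L, subalg c L -> iter s (derived c) L == 0 ->
  bracket_repr L -> common_eigen L.
Proof.
elim: s => [|s IH] L sL; first move=> /eqP /= L0 _.
  exists (const_mx 1), (fun=> 0); split.
    by apply/eqP=> /rowP /(_ 0) /eqP; rewrite !mxE oner_eq0.
  move=> y; rewrite L0 submx0 => /eqP ->; rewrite scale0r.
  by have := rhoP (-1) 0 0; rewrite scaler0 addr0 scaleN1r addrC subrr => ->; rewrite mulmx0.
rewrite iterSr => h rep.
have rep' L' : (L' <= L)%MS -> bracket_repr L'.
  by move=> h' x y xL yL; apply: rep; exact: submx_trans h'.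
pose D j : 'M[k]_n := (derived c L + \sum_(i < n | (i < j)%N) <<row i L>>)%MS.
have DL j : (D j <= L)%MS.
  by rewrite addsmx_sub sL; apply/sumsmx_subP=> i _; rewrite genmxE row_sub.
have hD j : common_eigen (D j).
  elim: j => [|j IHj].
    have [|||u [chi [u0 hu]]] := IH (derived c L); rewrite ?h //; first exact: derivedS.
      exact: rep'.
    by exists u, chi; split=> // y; rewrite /D big_pred0 // addsmx0; exact: hu.
  have [jn|jn] := ltnP j n; last first.
    suff -> : D j.+1 = D j by [].
    congr (_ + _)%MS; apply: eq_bigl => i; rewrite !(leq_trans (ltn_ord i)) //.
    exact: leq_trans jn _.
  have [||u [chi [u0 hu]]] := @common_eigen_step (D j) (row (Ordinal jn) L) _ _ IHj.
  - move=> y yD; apply: submx_trans (addsmxSl _ _); apply: brk_derived; rewrite ?row_sub //.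
    exact: submx_trans (DL j).
  - by apply: rep'; rewrite addsmx_sub DL row_sub.
  exists u, chi; split=> // y yD; apply: hu; apply: submx_trans yD _.
  rewrite addsmx_sub; apply/andP; split.
    by apply: submx_trans (addsmxSl _ _); rewrite addsmxSl.
  apply/sumsmx_subP=> i; rewrite ltnS leq_eqVlt => /orP [/eqP e|ij].
    have -> : Ordinal jn = i by apply: val_inj.
    by rewrite genmxE addsmxSr.
  apply: submx_trans (addsmxSl _ _); apply: submx_trans (addsmxSr _ _).
  by rewrite (sumsmx_sup i).
have [u [chi [u0 hu]]] := hD n; exists u, chi; split=> // y yL; apply: hu.
apply: submx_trans yL _; apply: submx_trans (addsmxSr _ _).
by apply/row_subP=> i; rewrite (sumsmx_sup i) ?genmxE.
Qed.

End LieTheorem.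

(** [Q] lifts a basis of the nonzero quotient [M / W], and [K] reads off coordinates modulo [W]. *)
Lemma quotient_coords (k : fieldType) n (M W : 'M[k]_n) : (W <= M)%MS -> ~~ (M <= W)%MS ->
  exists r (Q : 'M[k]_(r.+1, n)) (K : 'M[k]_(n, r.+1)), [/\ (Q <= M)%MS, Q *m K = 1%:M,
    forall m (u : 'M[k]_(m, n)), (u <= M)%MS -> (u - u *m K *m Q <= W)%MS
    & forall m (u : 'M[k]_(m, n)), (u <= W)%MS -> u *m K = 0].
Proof.
move=> WM MW; set A := (M :\: W)%MS; have cap : (A :&: W)%MS = 0 by exact: capmx_diff.
have sum m (u : 'M[k]_(m, n)) : (u <= M)%MS -> (u <= A + W)%MS.
  move=> h; apply: submx_trans h _; rewrite -(addsmx_diff_cap_eq M W).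
  by rewrite addsmxS // capmxSr.
have : exists r (Q : 'M[k]_(r, n)), (Q :=: A)%MS /\ row_free Q.
  by exists (\rank A), (row_base A); split; [exact: eq_row_base | exact: row_base_free].
case=> -[|r] [Q [QA Qf]].
  case/negP: MW; apply: submx_trans (sum _ M (submx_refl M)) _.
  rewrite addsmx_sub submx_refl andbT -QA; by rewrite [Q]flatmx0 sub0mx.
exists r, Q, (proj_mx A W *m pinvmx Q); split.
- by rewrite QA diffmxSl.
- by rewrite mulmxA proj_mx_id ?QA // mulmxVp.
- move=> m u uM; rewrite mulmxA mulmxKpV ?QA ?proj_mx_sub //.
  by rewrite -{1}(add_proj_mx cap (sum _ _ uM)) addrC addKr proj_mx_sub.
by move=> m u uW; rewrite mulmxA proj_mx_0 // mul0mx.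
Qed.

Lemma idempotent_trace (k : fieldType) n (A : 'M[k]_n) : A *m A = A -> \tr A = (\rank A)%:R.
Proof.
move=> e; rewrite -{1}(mulmx_base A) mxtrace_mulC.
suff -> : row_base A *m col_base A = 1%:M by rewrite mxtrace1.
apply: (row_full_inj (col_base_full A)); apply: (row_free_inj (row_base_free A)).
by rewrite mulmx1 mulmxA -mulmxA !mulmx_base.
Qed.

Section SpectralTrace.
Variables (k : closedFieldType) (n : nat).

(** [r mu] is the rank of the spectral projection, which is also its trace. The same positive
    multiplicities serve for every [theta], as the trace argument in Cartan's criterion requires. *)
Lemma spectral_trace (A : 'M[k]_n.+1) : exists (rs : seq k) (r : k -> nat),
  (forall mu, (mu \in rs) = eigenvalue A mu) /\ (forall mu, mu \in rs -> (0 < r mu)%N) /\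
  forall theta M, (forall mu v, gev A mu v -> v *m M = theta mu *: v) ->
    \tr M = \sum_(mu <- rs) (r mu)%:R * theta mu.
Proof.
have [rs [urs rsE _ _]] := spectrum A.
have hP mu := gev_calculus A (fun a => (a == mu)%:R).
pose e mu := horner_mx A (sval (constructive_indefinite_description _ (hP mu))).
have eP mu a v : gev A a v -> v *m e mu = (a == mu)%:R *: v.
  by rewrite /e; case: constructive_indefinite_description => /= P; apply.
have ei mu : e mu *m e mu = e mu.
  apply: (@gev_ext _ _ A) => a v g; rewrite mulmxA !(eP mu a v) // -scalemxAl (eP mu a v) //.
  by rewrite scalerA -natrM; case: eqP.
exists rs, (fun mu => \rank (e mu)); split=> //; split.
  move=> mu; rewrite rsE => /eigenvalueP [v ev v0]; rewrite lt0n mxrank_eq0.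
  apply: contraNneq v0 => e0; have := eP mu mu v (eigen_gev ev).
  by rewrite e0 mulmx0 eqxx scale1r => <-.
move=> theta M hM; have -> : M = \sum_(mu <- rs) theta mu *: e mu.
  apply: (@gev_ext _ _ A) => a v g; rewrite (hM _ _ g) mulmx_sumr.
  have [->|v0] := eqVneq v 0; first by rewrite scaler0 big1 // => mu _; rewrite mul0mx.
  have ars : a \in rs by rewrite rsE; exact: gev_eigenvalue g.
  rewrite (bigD1_seq a) //= -scalemxAr (eP a a) // eqxx scale1r big1 ?addr0 // => b ba.
  by rewrite -scalemxAr (eP b a) // eq_sym (negbTE ba) scale0r scaler0.
rewrite raddf_sum; apply: eq_bigr => mu _ /=.
by rewrite mxtraceZ idempotent_trace ?ei // mulrC.
Qed.

End SpectralTrace.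

Section Solvable.
Variables (k : closedFieldType) (n : nat) (c : 'I_n.+1 -> 'I_n.+1 -> 'I_n.+1 -> k).
Hypothesis char0 : [pchar k] =i pred0.
Hypothesis lieP : is_lie c.
Local Notation vec := 'rV[k]_n.+1.
Local Notation br := (brk c).
Local Notation ad := (adm c).
Implicit Types (L M W : 'M[k]_n.+1) (x y v : vec).

Lemma lie_theorem L M W : subalg c L -> solvable_sub c L -> (W <= M)%MS ->
  (forall x, (x <= L)%MS -> (M *m ad x <= M)%MS) ->
  (forall x, (x <= L)%MS -> (W *m ad x <= W)%MS) -> ~~ (M <= W)%MS ->
  exists v, [/\ (v <= M)%MS, ~~ (v <= W)%MS
    & forall x, (x <= L)%MS -> exists a, (br x v - a *: v <= W)%MS].
Proof.
move=> sL [s sol] WM Mst Wst MW.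
have [r [Q [K [QM QK h1 h2]]]] := quotient_coords WM MW.
pose rho x := Q *m ad x *m K.
have rhoP a x y : rho (a *: x + y) = a *: rho x + rho y.
  by rewrite /rho admD admZ mulmxDr mulmxDl -scalemxAr -scalemxAl.
have Qst x : (x <= L)%MS -> (Q *m ad x <= M)%MS.
  by move=> xL; apply: submx_trans (submxMr _ QM) (Mst _ xL).
have rep : bracket_repr c rho L.
  have h x y : (x <= L)%MS -> (y <= L)%MS -> rho y *m rho x = Q *m ad y *m ad x *m K.
    move=> xL yL; rewrite /rho !mulmxA; apply/eqP; rewrite eq_sym -subr_eq0 -!mulmxBl; apply/eqP.
    apply: h2; apply: submx_trans (Wst _ xL); apply: submxMr; apply: h1; exact: Qst.
  move=> x y xL yL; rewrite (h x y) // (h y x) // /rho (adm_brk lieP).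
  by rewrite mulmxBr mulmxBl !mulmxA.
have [u [chi [u0 hu]]] := lie_repr char0 rhoP sL sol rep.
exists (u *m Q); split.
- exact: submx_trans (submxMl _ _) QM.
- by apply: contra u0 => /h2; rewrite -mulmxA QK mulmx1 => ->.
move=> x xL; exists (chi x).
rewrite -mul_adm -mulmxA; have := h1 _ (u *m (Q *m ad x)).
rewrite (submx_trans (submxMl _ _) (Qst _ xL)) => /(_ isT).
by rewrite -[u *m _ *m K]mulmxA -/(rho x) hu // -scalemxAl.
Qed.

Lemma nilp_weight W y v a : (W *m ad y <= W)%MS -> nilmx (ad y) -> ~~ (v <= W)%MS ->
  (br y v - a *: v <= W)%MS -> a = 0.
Proof.
move=> Wst [m hm] vW h; have hj j : (v *m ad y ^+ j - a ^+ j *: v <= W)%MS.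
  elim: j => [|j IH]; first by rewrite !expr0 mulmx1 scale1r subrr sub0mx.
  have -> : v *m ad y ^+ j.+1 - a ^+ j.+1 *: v =
     (v *m ad y ^+ j - a ^+ j *: v) *m ad y + a ^+ j *: (br y v - a *: v).
    by rewrite exprSr -[_ * ad y]/(_ *m ad y) mulmxA mulmxBl scalerBr scalerA -exprSr -scalemxAl (mul_adm c y v) addrA subrK.
  rewrite addmx_sub ?scalemx_sub //.
  by apply: submx_trans Wst; apply: submxMr.
have := hj m; rewrite hm mulmx0 sub0r eqmx_opp; have [->//|a0] := eqVneq a 0.
move=> /(scalemx_sub (a ^- m)); rewrite scalerA mulVf ?expf_neq0 // scale1r => h'.
by rewrite h' in vW.
Qed.

(** [lie_theorem] builds a flag of [L]-stable subspaces, one dimension at a time, and the second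
    hypothesis says that [A] sends each new vector into the previous step. *)
Lemma flag_nilp L A : subalg c L -> solvable_sub c L ->
  (forall W, (forall x, (x <= L)%MS -> (W *m ad x <= W)%MS) -> (W *m A <= W)%MS) ->
  (forall W v, (forall x, (x <= L)%MS -> (W *m ad x <= W)%MS) -> ~~ (v <= W)%MS ->
     (forall x, (x <= L)%MS -> exists a, (br x v - a *: v <= W)%MS) -> (v *m A <= W)%MS) ->
  nilmx A.
Proof.
move=> sL solL hA hv.
have hr r : (r <= n.+1)%N -> exists W, [/\ (r <= \rank W)%N,
    forall x, (x <= L)%MS -> (W *m ad x <= W)%MS & exists j, W *m A ^+ j = 0]; last first.
  have [W [rW _ [j hj]]] := hr _ (leqnn _).
  exists j; apply: mx_ext => v; rewrite mulmx0; have : (v <= W)%MS.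
    by apply: submx_full; rewrite /row_full eqn_leq rank_leq_col rW.
  by case/submxP => a ->; rewrite -mulmxA hj mulmx0.
elim: r => [_|r IH rn].
  by exists 0; split=> // [x _|]; [rewrite mul0mx sub0mx | exists 0%N; rewrite mul0mx].
have [W [rW Wst [j hj]]] := IH (ltnW rn).
have [h|h] := leqP r.+1 (\rank W); first by exists W; split=> //; exists j.
have nfull : ~~ (1%:M <= W)%MS.
  by rewrite sub1mx /row_full; apply/negP => /eqP e; move: h; rewrite e ltnNge rn.
have [||||v [_ vW hvW]] := @lie_theorem L 1%:M W sL solL; rewrite ?submx1 //.
  by move=> x _; rewrite submx1.
exists (W + v)%MS; split.
- apply: leq_trans (_ : (\rank W).+1 <= _)%N; first by rewrite ltnS.
  rewrite ltnNge; apply: contra vW => le; apply: submx_trans (addsmxSr W v) _.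
  by have /mxrank_leqif_sup/geq_leqif <- := addsmxSl W v.
- move=> x xL; rewrite addsmxMr addsmx_sub (submx_trans (Wst _ xL)) ?addsmxSl //=.
  have [a ha] := hvW _ xL; rewrite mul_adm -[br x v](subrK (a *: v)).
  by rewrite addmx_sub ?scalemx_sub ?addsmxSr // (submx_trans ha) ?addsmxSl.
exists j.+1; have : ((W + v)%MS *m A <= W)%MS by rewrite addsmxMr addsmx_sub hA // hv.
by case/submxP => D e; rewrite exprS -[_ * _]/(_ *m _) mulmxA e -mulmxA hj mulmx0.
Qed.

(** On a common eigenvector modulo [W] the actions of [ad x] and [ad y] commute, so the bracket
    sends it into [W]. *)
Lemma solvable_brk_nilp L x y : subalg c L -> solvable_sub c L ->
  (x <= L)%MS -> (y <= L)%MS -> nilmx (ad (br x y)).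
Proof.
move=> sL solL xL yL; apply: (flag_nilp sL solL) => [W Wst|W v Wst vW hv].
  by apply: Wst; apply: submx_trans sL; apply: brk_derived.
rewrite (adm_brk lieP) mulmxBr.
have [a ha] := hv _ xL; have [b hb] := hv _ yL.
have h z t d (e : k) : (z <= L)%MS -> (br z v - e *: v <= W)%MS -> (br t v - d *: v <= W)%MS ->
    (v *m ad t *m ad z - (d * e) *: v <= W)%MS.
  move=> zL hz ht; have -> : v *m ad t *m ad z - (d * e) *: v =
     (br t v - d *: v) *m ad z + d *: (br z v - e *: v).
    by rewrite mulmxBl scalerBr scalerA -scalemxAl !mul_adm addrA subrK.
  by rewrite addmx_sub ?scalemx_sub // (submx_trans _ (Wst _ zL)) // submxMr.
rewrite !mulmxA -[X in (X <= _)%MS](_ : (v *m ad y *m ad x - (b * a) *: v) - (v *m ad x *m ad y - (a * b) *: v) = _).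
  by rewrite addmx_sub ?eqmx_opp // h.
by rewrite [b * a]mulrC opprB addrA subrK.
Qed.

(** Along a flag for [L] a nilpotent [ad y] is strictly triangular, and so is its product with
    [ad x]. *)
Lemma solvable_trace L x y : subalg c L -> solvable_sub c L ->
  (x <= L)%MS -> (y <= L)%MS -> nilmx (ad y) -> \tr (ad x *m ad y) = 0.
Proof.
move=> sL solL xL yL yn; rewrite mxtrace_mulC; apply: nilp_trace.
apply: (flag_nilp sL solL) => [W Wst|W v Wst vW hv].
  by rewrite mulmxA (submx_trans (submxMr _ (Wst _ yL))) // Wst.
have [a ha] := hv _ yL; have a0 := nilp_weight (Wst _ yL) yn vW ha.
move: ha; rewrite a0 scale0r subr0 -mul_adm => h.
by rewrite mulmxA (submx_trans (submxMr _ h)) // Wst.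
Qed.

End Solvable.

(** * Semisimple matrices and common eigenbases *)

Section Semisimple.
Variables (k : closedFieldType) (n : nat).
Implicit Types (A : 'M[k]_n.+1) (v : 'rV[k]_n.+1).

Definition semisimple A := forall mu v, gev A mu v -> v *m A = mu *: v.

Definition eigenbasis A (P : 'M[k]_n.+1) (d : 'I_n.+1 -> k) :=
  forall i, row i P *m A = d i *: row i P.

Lemma row_comb (P : 'M[k]_n.+1) v : P \in unitmx ->
  exists a, v = \sum_i a i *: row i P.
Proof.
move=> uP; exists (fun i => (v *m invmx P) 0 i).
by rewrite -[LHS](mulmxKV uP) mulmx_sum_row.
Qed.

Lemma row_comb_eq0 (P : 'M[k]_n.+1) a : P \in unitmx ->
  \sum_i a i *: row i P = 0 -> forall i, a i = 0.
Proof.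
move=> uP e i; have : (\row_j a j) *m P = 0.
  by rewrite mulmx_sum_row -[RHS]e; apply: eq_bigr => j _; rewrite mxE.
by move/(canRL (mulmxK uP))/rowP/(_ i); rewrite mul0mx !mxE.
Qed.

Lemma eigenbasis_mul A P d a : eigenbasis A P d ->
  (\sum_i a i *: row i P) *m A = \sum_i (a i * d i) *: row i P.
Proof.
move=> h; rewrite mulmx_suml; apply: eq_bigr => i _.
by rewrite -scalemxAl h scalerA.
Qed.

Lemma eigenbasis_semisimple A P d : P \in unitmx -> eigenbasis A P d -> semisimple A.
Proof.
move=> uP hP mu v [m hm]; have [a ev] := row_comb v uP.
have hj j : v *m (A - mu%:M) ^+ j = \sum_i (a i * (d i - mu) ^+ j) *: row i P.
  elim: j => [|j IH]; first by rewrite expr0 mulmx1 ev; apply: eq_bigr => i _; rewrite mulr1.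
  rewrite exprSr -[_ * (A - _)]/(_ *m _) mulmxA IH (@eigenbasis_mul _ _ (fun i => d i - mu)).
    by apply: eq_bigr => i _; rewrite exprSr mulrA.
  by move=> i; rewrite mulmxBr hP mul_mx_scalar scalerBl.
rewrite ev (eigenbasis_mul _ hP) scaler_sumr; apply: eq_bigr => i _; rewrite scalerA.
have /eqP := row_comb_eq0 uP (etrans (esym (hj m)) hm) i.
rewrite mulf_eq0 => /orP[/eqP->|]; first by rewrite mul0r mulr0.
by case: m {hm} => [|m]; rewrite ?expr0 ?oner_eq0 // expf_eq0 subr_eq0 mulrC => /eqP->.
Qed.

Lemma acts_diagonalizable A M theta :
  (forall mu v, gev A mu v -> v *m M = theta mu *: v) -> diagonalizable M.
Proof.
move=> h; have [rs [urs rsE _ _]] := spectrum A.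
apply/diagonalizableP; exists (undup (map theta rs)); first exact: undup_uniq.
apply: mxminpoly_min; apply: (@gev_ext _ _ A) => mu v g; rewrite mulmx0.
have [->|v0] := eqVneq v 0; first by rewrite mul0mx.
have mrs : theta mu \in undup (map theta rs).
  by rewrite mem_undup map_f // rsE; exact: gev_eigenvalue g.
rewrite (bigD1_seq (theta mu)) ?undup_uniq //= rmorphM /= -[_ * _]/(_ *m _) mulmxA.
by rewrite rmorphB /= horner_mx_X horner_mx_C mulmxBr mul_mx_scalar (h _ _ g) subrr mul0mx.
Qed.

Lemma common_eigenbasis (As : seq 'M[k]_n.+1) :
  {in As, forall A, semisimple A} -> {in As &, forall A B, A *m B = B *m A} ->
  exists2 P, P \in unitmx & forall A, A \in As -> exists d, eigenbasis A P d.
Proof.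
move=> hs hc; have [h _] := codiagonalizableP As.
have [|P uP /allP hP] := h.
  by split=> // A /hs /(acts_diagonalizable (theta := id)).
exists P => // A /hP /= /diagonalizable_forPex [D /simmxPp e].
exists (fun i => D 0 i) => i; rewrite -row_mul e.
  by rewrite row_mul row_diag_mx -scalemxAl -rowE.
by rewrite submx_full // row_full_unit.
Qed.

Lemma acts_semisimple A M theta :
  (forall mu v, gev A mu v -> v *m M = theta mu *: v) -> semisimple M.
Proof.
move=> /acts_diagonalizable [P uP /diagonalizable_forPex [D /simmxPp e]].
apply: (@eigenbasis_semisimple _ P (fun i => D 0 i)) => // i; rewrite -row_mul e.
  by rewrite row_mul row_diag_mx -scalemxAl -rowE.
by rewrite submx_full // row_full_unit.
Qed.

Lemma semisimple0 : semisimple 0.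
Proof.
by apply: (@eigenbasis_semisimple _ 1%:M (fun=> 0)); rewrite ?unitmx1 // => i; rewrite mulmx0 scale0r.
Qed.

Lemma gev_sum_stable A (W : 'M[k]_n.+1) v : (W *m A <= W)%MS -> (v <= W)%MS ->
  exists (rs : seq k) w, v = \sum_(mu <- rs) w mu /\ forall mu, gev A mu (w mu) /\ (w mu <= W)%MS.
Proof.
move=> st vW; have [rs [w [ev hw]]] := gev_sum A v; exists rs, w; split=> // mu.
have [g [P eP]] := hw mu; split=> //; rewrite eP.
by apply: submx_trans (submxMr _ vW) _; exact: horner_mx_stable.
Qed.

Lemma field_avoid (s : seq k) : exists r, r \notin s.
Proof.
have [|r hr] := @poly_nonroot k (\prod_(a <- s) ('X - a%:P)).
  by rewrite -lead_coef_eq0 (monicP (monic_prod_XsubC _ _ _)) oner_eq0.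
by exists r; rewrite -root_prod_XsubC.
Qed.

End Semisimple.

(** * Borel subalgebras and Cartan's criterion *)

Section Borel.
Import Order.TTheory Num.Theory.
Variables (k : closedFieldType) (n : nat) (c : 'I_n.+1 -> 'I_n.+1 -> 'I_n.+1 -> k).
Variable Bm : 'M[k]_n.+1.
Hypothesis char0 : [pchar k] =i pred0.
Hypothesis lieP : is_lie c.
Hypothesis redP : reductive c.
Hypothesis formP : good_form c Bm.
Local Notation vec := 'rV[k]_n.+1.
Local Notation br := (brk c).
Local Notation ad := (adm c).
Local Notation B := (bform Bm).
Implicit Types (x y v : vec) (W S : 'M[k]_n.+1).

Definition perp W : 'M[k]_n.+1 := kermx (Bm *m W^T).

Lemma perpP W v : reflect (forall w : vec, (w <= W)%MS -> B v w = 0) (v <= perp W)%MS.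
Proof.
apply: (iffP sub_kermxP) => [h w /submxP [a ->]|h].
  by rewrite /bform trmx_mul mulmxA -[v *m Bm *m W^T]mulmxA h mul0mx mxE.
apply/rowP=> i; have := h (row i W) (row_sub _ _).
by rewrite /bform !mulmxA tr_row !mxE => e; rewrite -[RHS]e; apply: eq_bigr => j _; rewrite !mxE.
Qed.

Lemma rank_perp W : (\rank (perp W) + \rank W = n.+1)%N.
Proof.
rewrite mxrank_ker -(mxrank_tr (Bm *m _)) trmx_mul trmxK mxrankMfree.
  by rewrite subnK ?rank_leq_row.
by rewrite row_free_unit unitmx_tr; case: formP => _ [].
Qed.

(* [y] is nilpotent as soon as it is orthogonal to the elements acting on its
   generalized eigenspaces by rational functionals of the eigenvalues. *)
Lemma kap_nilp y : (y <= dg c)%MS ->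
  (forall y' Q, ad y' = ad y *m horner_mx (ad y) Q -> B y y' = 0) -> nilmx (ad y).
Proof.
move=> yD h; have [->|y0] := eqVneq y 0; first by exists 1%N; rewrite adm0 expr1.
apply: gev0_nilp => mu0 v v0 ev; apply/eqP; apply: contraT => mu00.
have [iota _] := rat_embedding char0.
have [rs [r [rsE [rpos rtr]]]] := spectral_trace (ad y).
have [V [la [[laD laZ] l1 V1 Vrs]]] := rational_functional iota rs mu00.
have [V0 l0] : V 0 /\ la 0 = 0.
  by have := laZ 0 _ V1; rewrite rmorph0 !mul0r.
pose theta a := iota (la a).
have [||y' [P [_ ey' hy']]] := @ad_calculus k n c Bm lieP redP formP y theta.
- by rewrite /theta l0 rmorph0.
- move=> a b; rewrite -!rsE => /Vrs Va /Vrs Vb _; rewrite /theta.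
  by have [_ ->] := laD _ _ Va Vb; rewrite rmorphD.
have yy : gev (ad y) 0 y by apply: eigen_gev; rewrite mul_adm (brkxx lieP) scale0r.
(* [y] is itself an eigenvector of [ad y] for 0, where [ad y'] acts by [theta 0 = 0]. So [P] has no
   constant term and [ad y'] is [ad y] times a polynomial, the shape required by [h]. *)
have P0 : root P 0.
  have := hy' _ _ yy; rewrite /theta l0 rmorph0 scale0r -mul_adm ey'.
  have [Q eQ] : exists Q, P = Q * 'X + P.[0]%:P.
    have /factor_theorem [Q eQ] : root (P - P.[0]%:P) 0.
      by rewrite /root !hornerE subrr.
    by exists Q; move: eQ; rewrite polyC0 subr0 => /(canRL (subrK _)).
  rewrite eQ rmorphD rmorphM /= horner_mx_X horner_mx_C mulmxDr.
  rewrite -[_ * ad y](comm_mx_horner Q (comm_mx_refl (ad y))).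
  rewrite mulmxA mul_adm (brkxx lieP) mul0mx add0r mul_mx_scalar => /eqP.
  by rewrite scaler_eq0 (negPf y0) orbF /root !hornerE => /eqP ->.
have /factor_theorem [Q eQ] := P0; rewrite polyC0 subr0 in eQ.
have e' : ad y' = ad y *m horner_mx (ad y) Q.
  rewrite ey' eQ rmorphM /= horner_mx_X; exact/esym/(comm_mx_horner Q (comm_mx_refl (ad y))).
have := h _ _ e'; rewrite (form_kap lieP redP formP) // /kap mxtrace_mulC.
(* [M] acts on a generalized eigenspace by [theta mu * mu] up to a nilpotent, so its trace is that
   of the polynomial in [ad y] with exactly these scalars. *)
pose M := ad y' *m ad y; have [P' hP'] := gev_calculus (ad y) (fun a => theta a * a).
have nM : nilmx (M - horner_mx (ad y) P').
  exists n.+1; apply: (@gev_ext _ _ (ad y)) => mu w g; rewrite mulmx0.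
  have hj j u : gev (ad y) mu u -> u *m (M - horner_mx (ad y) P') ^+ j =
      theta mu ^+ j *: (u *m (ad y - mu%:M) ^+ j).
    elim: j u => [|j IH] u gu; first by rewrite !expr0 !mulmx1 scale1r.
    have gu' : gev (ad y) mu (u *m (ad y - mu%:M)).
      have [m hm] := gu; exists m; rewrite -mulmxA -[(_ - _) *m _]exprS exprSr.
      by rewrite -[_ * _]/(_ *m _) mulmxA hm mul0mx.
    rewrite !exprS -![_ * (_ ^+ j)]/(_ *m _) !mulmxA.
    have -> : u *m (M - horner_mx (ad y) P') = theta mu *: (u *m (ad y - mu%:M)).
      rewrite mulmxBr /M mulmxA (mul_adm c y' u) (hy' mu) // (hP' mu) // -scalemxAl.
      by rewrite mulmxBr mul_mx_scalar scalerBr scalerA.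
    by rewrite -scalemxAl IH // scalerA.
  by rewrite hj // gev_bound // scaler0.
have -> : \tr M = \sum_(mu <- rs) (r mu)%:R * (theta mu * mu).
  rewrite -(rtr (fun a => theta a * a) (horner_mx (ad y) P')) //.
  by apply/eqP; rewrite -subr_eq0 -mxtraceB (nilp_trace nM).
(* Applying [la] to the vanishing trace yields a sum of squares of rationals with positive weights,
   in which the term of [mu0] is positive. *)
have : V (\sum_(mu <- rs) (r mu)%:R * (theta mu * mu)) /\
    la (\sum_(mu <- rs) (r mu)%:R * (theta mu * mu)) = \sum_(mu <- rs) (r mu)%:R * (la mu * la mu).
  elim: {rsE rpos rtr} rs Vrs => [|a s IH] Vs; first by rewrite !big_nil.
  have Va : V a by apply: Vs; rewrite mem_head.
  have [|VS eS] := IH; first by move=> b bs; apply: Vs; rewrite inE bs orbT.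
  rewrite !big_cons /theta mulrA -(rmorph_nat iota) -rmorphM.
  have [Va' ea'] := laZ ((r a)%:R * la a) _ Va.
  by have [? ->] := laD _ _ Va' VS; split=> //; rewrite ea' eS mulrA.
move=> [_ +] e0; rewrite e0 l0 => /esym/eqP.
have mu0rs : mu0 \in rs by rewrite rsE; apply/eigenvalueP; exists v.
rewrite (big_rem _ mu0rs) /= l1 !mulr1 gt_eqF // ltr_pwDl ?ltr0n ?rpos //.
by apply: sumr_ge0 => i _; rewrite mulr_ge0 ?ler0n // -expr2 sqr_ge0.
Qed.

Lemma iter_derivedS j W S : (W <= S)%MS -> (iter j (derived c) W <= iter j (derived c) S)%MS.
Proof. by move=> h; elim: j => //= j IH; exact: derivedS. Qed.

Lemma solvable_derived W S j : (iter j (derived c) W <= S)%MS -> solvable_sub c S -> solvable_sub c W.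
Proof.
move=> h [i /eqP hi]; exists (i + j)%N; rewrite iterD -submx0 -hi.
exact: iter_derivedS.
Qed.

Variable Bo : 'M[k]_n.+1.
Hypothesis borelP : borel c Bo.
Let subB : subalg c Bo. Proof. by case: borelP. Qed.
Let solB : solvable_sub c Bo. Proof. by case: borelP => _ []. Qed.
Let brkB x y : (x <= Bo)%MS -> (y <= Bo)%MS -> (br x y <= Bo)%MS.
Proof. by move=> h h'; apply: submx_trans subB; exact: brk_derived. Qed.

Lemma sub_adjoin W x u : (u <= W + x)%MS -> exists a y, (y <= W)%MS /\ u = y + a *: x.
Proof.
case/sub_addsmxP => -[s t] /= ->; exists (t 0 0), (s *m W); split; first exact: submxMl.
by rewrite {1}[t]mx11_scalar mul_scalar_mx.
Qed.

Lemma borel_max v : (derived c (Bo + v)%MS <= Bo + v)%MS -> solvable_sub c (Bo + v)%MS ->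
  (v <= Bo)%MS.
Proof.
move=> h s; have [_ [_ /(_ _ h s)]] := borelP.
by rewrite addsmxSl => /(_ isT); apply: submx_trans; exact: addsmxSr.
Qed.

(** The derived algebra of [Bo + v] lies in [Bo], so [Bo + v] is a solvable subalgebra and
    maximality applies: [Bo] is its own normalizer. *)
Lemma borel_normal v : (forall b, (b <= Bo)%MS -> (br b v <= Bo)%MS) -> (v <= Bo)%MS.
Proof.
move=> h; have d : (derived c (Bo + v)%MS <= Bo)%MS.
  apply: derived_sub => u w /sub_adjoin [a [y [yB ->]]] /sub_adjoin [b [z [zB ->]]].
  rewrite brkDl !brkDr !brkZl !brkZr (brkxx lieP) !scaler0 addr0.
  rewrite !addmx_sub ?scalemx_sub ?h ?(brkB yB zB) //.
  by rewrite (brkC lieP) eqmx_opp h.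
apply: borel_max; first exact: submx_trans d (addsmxSl _ _).
exact: (@solvable_derived _ _ 1%N d).
Qed.

Lemma borel_center z : ad z = 0 -> (z <= Bo)%MS.
Proof.
move=> h; apply: borel_normal => b _; rewrite (brkC lieP) -mul_adm h mulmx0.
by rewrite oppr0 sub0mx.
Qed.

Lemma nilp_perp x : (x <= Bo)%MS -> (x <= dg c)%MS -> nilmx (ad x) -> (x <= perp Bo)%MS.
Proof.
move=> xB xD xn; apply/perpP => b bB; rewrite (form_kap lieP redP formP) // /kap mxtrace_mulC.
exact: (solvable_trace char0 lieP subB solB).
Qed.

Lemma brk_perp x y : (x <= Bo)%MS -> (y <= Bo)%MS -> (br x y <= perp Bo)%MS.
Proof.
move=> xB yB; apply: nilp_perp; rewrite ?brk_dg ?brkB //.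
exact: (solvable_brk_nilp char0 lieP subB solB).
Qed.

Lemma stable_horner W y Q (u : vec) : (W *m ad y <= W)%MS -> (u <= W)%MS ->
  (u *m ad y *m horner_mx (ad y) Q <= W *m ad y)%MS.
Proof.
move=> st uW; have e : ad y *m horner_mx (ad y) Q = horner_mx (ad y) Q *m ad y.
  exact: comm_mx_horner (comm_mx_refl _).
rewrite -mulmxA e mulmxA submxMr //; apply: submx_trans (submxMr _ uW) _.
exact: horner_mx_stable.
Qed.

(* Otherwise some [v] orthogonal to [Bo] is an eigenvector of [Bo] modulo [Bo],
   and Cartan's criterion shows that [Bo + k v] is solvable. *)
Lemma perp_borel : (perp Bo <= Bo)%MS.
Proof.
apply: contraT => nP; set P := perp Bo in nP *.
have Pst x : (x <= Bo)%MS -> (P *m ad x <= P)%MS.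
  move=> xB; apply/row_subP => i; rewrite row_mul mul_adm; apply/perpP => b bB.
  rewrite (bform_invl lieP formP) (perpP _ _ (row_sub i P)) ?oppr0 ?brkB //.
have Bst x : (x <= Bo)%MS -> (Bo *m ad x <= Bo)%MS.
  move=> xB; apply/row_subP => i; rewrite row_mul mul_adm.
  by rewrite brkB ?row_sub.
have [||||v [vM vB hv]] := @lie_theorem k n c char0 lieP Bo (Bo + P)%MS Bo subB solB.
- exact: addsmxSl.
- by move=> x xB; rewrite addsmxMr addsmx_sub (submx_trans (Bst _ xB)) ?addsmxSl // (submx_trans (Pst _ xB)) ?addsmxSr.
- exact: Bst.
- by apply: contra nP; apply: submx_trans; exact: addsmxSr.
have {v vM vB hv} [v [vP vB hv]] : exists v, [/\ (v <= P)%MS, ~~ (v <= Bo)%MS &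
    forall x, (x <= Bo)%MS -> exists a, (br x v - a *: v <= Bo)%MS].
  have /sub_addsmxP [[s t] /= ev] := vM.
  exists (t *m P); split; first exact: submxMl.
    by apply: contra vB => h; rewrite ev addmx_sub ?submxMl.
  move=> x xB; have [a ha] := hv x xB; exists a.
  have -> : br x (t *m P) - a *: (t *m P) = (br x v - a *: v) - (br x (s *m Bo) - a *: (s *m Bo)).
    by rewrite ev brkDr scalerDr opprD addrACA addrC addrK.
  rewrite addmx_sub ?eqmx_opp // addmx_sub ?eqmx_opp ?scalemx_sub ?submxMl //.
  by rewrite brkB ?submxMl.
set S := (Bo + v)%MS; have vS : (v <= S)%MS by exact: addsmxSr.
have BS : (Bo <= S)%MS by exact: addsmxSl.
have vb b : (b <= Bo)%MS -> B v b = 0 by apply: (perpP _ _ vP).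
have brS x : (x <= Bo)%MS -> (br x v <= S)%MS.
  move=> xB; have [a ha] := hv x xB; rewrite -[br x v](subrK (a *: v)).
  by rewrite addmx_sub ?scalemx_sub // (submx_trans ha).
have subS : (derived c S <= S)%MS.
  apply: derived_sub => u w /sub_adjoin [a [y [yB ->]]] /sub_adjoin [b [z [zB ->]]].
  rewrite brkDl !brkDr !brkZl !brkZr (brkxx lieP) !scaler0 addr0.
  rewrite !addmx_sub ?scalemx_sub ?brS //.
    by apply: submx_trans BS; rewrite brkB.
  by rewrite (brkC lieP) eqmx_opp brS.
have T1 y s : (y <= derived c S)%MS -> (s <= S)%MS -> B y s = 0.
  move=> yS' sS; suff h : (derived c S <= perp S)%MS by apply: (perpP _ _ (submx_trans yS' h)).
  apply: derived_sub => u w /sub_adjoin [a1 [b1 [B1 ->]]] /sub_adjoin [a2 [b2 [B2 ->]]].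
  apply/perpP => _ /sub_adjoin [a3 [b3 [B3 ->]]].
  have z1 : B (br b1 b2) b3 = 0 by apply: (perpP _ _ (brk_perp B1 B2)).
  have z2 b b' : (b <= Bo)%MS -> (b' <= Bo)%MS -> B (br v b) b' = 0.
    by move=> h h'; rewrite (bform_inv formP) vb ?brkB.
  have z3 b : (b <= Bo)%MS -> B (br v b) v = 0.
    by move=> h; rewrite (bform_invl lieP formP) (brkxx lieP) bform0r oppr0.
  rewrite brkDl !brkDr !brkZl !brkZr (brkxx lieP) !scaler0 addr0 (brkC lieP b1 v) scalerN -scaleNr.
  rewrite !(bformDr, bformZr, bformDl formP, bformZl formP, bformBl formP).
  by rewrite z1 !z3 // !z2 // (bformC formP (br b1 b2)) vb ?brkB // !(mulr0, subr0, oppr0, addr0, add0r).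
(* If [ad y'] is [ad y] times a polynomial, it maps [S] into the derived algebra of [S]; by
   invariance and [T1], [y'] is then orthogonal to that derived algebra, so [kap_nilp] applies. *)
have T2 y : (y <= derived c S)%MS -> nilmx (ad y).
  move=> yS'; apply: kap_nilp; first exact: submx_trans yS' (derivedS _ (submx1 _)).
  have yS := submx_trans yS' subS.
  move=> y' Q ey'; have hS s : (s <= S)%MS -> (br y' s <= derived c S)%MS.
    move=> sS; have st : (S *m ad y <= derived c S)%MS.
      by apply/row_subP => i; rewrite row_mul mul_adm brk_derived ?row_sub.
    rewrite -mul_adm ey' mulmxA; apply: (submx_trans _ st); apply: stable_horner => //.
    exact: submx_trans st subS.
  suff h : (derived c S <= perp <<y'>>)%MS.
    by apply: (perpP _ _ (submx_trans yS' h)); rewrite genmxE.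
  apply: derived_sub => u w uS wS; apply/perpP => t; rewrite genmxE => /sub_rVP [a ->].
  rewrite bformZr (bform_inv formP) (brkC lieP) bformNr (bformC formP) T1 ?hS //.
  by rewrite oppr0 mulr0.
have T3 u w : (u <= derived c S)%MS -> (u <= Bo)%MS -> (w <= S)%MS -> (br u w <= Bo)%MS.
  move=> uS' uB /sub_adjoin [a [y [yB ->]]]; rewrite brkDr brkZr addmx_sub ?brkB ?scalemx_sub //.
  have [e he] := hv u uB; have e0 := nilp_weight (Bst _ uB) (T2 _ uS') vB he.
  by move: he; rewrite e0 scale0r subr0.
suff d2 : (derived c (derived c S) <= Bo)%MS.
  have /borel_max : solvable_sub c S by apply: (@solvable_derived _ _ 2%N d2).
  by rewrite (negPf vB) => /(_ subS).
apply: derived_sub => u w uS' wS'; have uS := submx_trans uS' subS; have wS := submx_trans wS' subS.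
have [a [y [yB eu]]] := sub_adjoin uS; have [b [z [zB ew]]] := sub_adjoin wS.
have [a0|a0] := eqVneq a 0.
  by apply: T3 => //; rewrite eu a0 scale0r addr0.
(* Subtracting this multiple of [u] removes the component along [v], so the first argument falls in
   [Bo] and [T3] applies. *)
have -> : br u w = - br (w - (b / a) *: u) u.
  by rewrite brkBl brkZl (brkxx lieP) scaler0 subr0 (brkC lieP).
rewrite eqmx_opp T3 //; first by rewrite addmx_sub ?eqmx_opp ?scalemx_sub.
rewrite ew eu scalerDr scalerA divfK // opprD addrACA subrr addr0.
by rewrite addmx_sub ?eqmx_opp ?scalemx_sub.
Qed.

End Borel.

(** * A Cartan subalgebra inside a Borel subalgebra *)

Section Cartan.
Variables (k : closedFieldType) (n : nat) (c : 'I_n.+1 -> 'I_n.+1 -> 'I_n.+1 -> k).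
Variable Bm : 'M[k]_n.+1.
Hypothesis char0 : [pchar k] =i pred0.
Hypothesis lieP : is_lie c.
Hypothesis redP : reductive c.
Hypothesis formP : good_form c Bm.
Local Notation vec := 'rV[k]_n.+1.
Local Notation br := (brk c).
Local Notation ad := (adm c).
Local Notation B := (bform Bm).
Local Notation perp := (perp Bm).
Implicit Types (x y v : vec) (W S : 'M[k]_n.+1).

Lemma semisimple_split x W y : semisimple (ad x) -> (W *m ad x <= W)%MS ->
  (y <= W)%MS -> exists a b, [/\ (a <= W)%MS, (b <= W)%MS, y = a + br x b & br x a = 0].
Proof.
move=> ss st yW; have [rs [w [-> hw]]] := gev_sum_stable st yW.
exists (\sum_(mu <- rs | mu == 0) w mu), (\sum_(mu <- rs | mu != 0) mu^-1 *: w mu); split.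
- by apply: summx_sub => mu _; have [] := hw mu.
- by apply: summx_sub => mu _; rewrite scalemx_sub //; have [] := hw mu.
- rewrite (bigID (fun mu => mu == 0)) /=; congr (_ + _).
  rewrite brk_sumr; apply: eq_bigr => mu mu0; rewrite brkZr -mul_adm (ss mu).
    by rewrite scalerA mulVf // scale1r.
  by have [] := hw mu.
rewrite brk_sumr big1 // => mu /eqP e; rewrite -mul_adm (ss mu) ?e ?scale0r //.
by have [] := hw 0.
Qed.

Lemma semisimple_split_cent x : semisimple (ad x) -> split_cent c x.
Proof.
move=> ss y; have [||a [b [_ _ e e']]] := @semisimple_split x 1%:M y ss; rewrite ?submx1 //.
by exists a, b.
Qed.

Variable Bo : 'M[k]_n.+1.
Hypothesis borelP : borel c Bo.
Let subB : subalg c Bo. Proof. by case: borelP. Qed.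
Let solB : solvable_sub c Bo. Proof. by case: borelP => _ []. Qed.
Let brkB x y : (x <= Bo)%MS -> (y <= Bo)%MS -> (br x y <= Bo)%MS.
Proof. by move=> h h'; apply: submx_trans subB; exact: brk_derived. Qed.
Let stB x : (x <= Bo)%MS -> (Bo *m ad x <= Bo)%MS.
Proof. by move=> h; apply/row_subP => i; rewrite row_mul mul_adm brkB ?row_sub. Qed.
Let perpB : (perp Bo <= Bo)%MS. Proof. exact: perp_borel char0 lieP redP formP _ borelP. Qed.
Let centB z : ad z = 0 -> (z <= Bo)%MS. Proof. exact: (borel_center lieP borelP). Qed.

(** An element acting as [ad u] times a polynomial normalizes [Bo], so it lies in [Bo] and is
    orthogonal to [u]; this is the hypothesis of [kap_nilp]. *)
Lemma perp_borel_nilp u : (u <= perp Bo)%MS -> (u <= dg c)%MS /\ nilmx (ad u).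
Proof.
move=> uP; have uB := submx_trans uP perpB.
have uD : (u <= dg c)%MS.
  apply: (perp_center lieP redP formP) => z /centB zB.
  by rewrite (bformC formP); apply: (perpP Bm _ _ uP).
split=> //; apply: (kap_nilp char0 lieP redP formP uD) => y' Q ey'.
apply: (perpP Bm _ _ uP); apply: (borel_normal lieP borelP) => b bB.
rewrite (brkC lieP) eqmx_opp -mul_adm ey' mulmxA.
by apply: submx_trans (stB uB); apply: stable_horner => //; exact: stB.
Qed.

(** In a common eigenbasis, for [r] outside a finite set the centralizer of [x + r t] is the
    intersection of those of [x] and [t]. Minimality forces it to be the whole centralizer of
    [x]. *)
Lemma torus_cent x t : semisimple (ad x) -> semisimple (ad t) -> br x t = 0 ->
  (x <= Bo)%MS -> (t <= Bo)%MS ->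
  (forall x', (x' <= Bo)%MS /\ semisimple (ad x') -> (cent_dim c x <= cent_dim c x')%N) ->
  forall u, br x u = 0 -> br t u = 0.
Proof.
move=> sx st xt xB tB xmin u xu.
have com : ad x *m ad t = ad t *m ad x.
  by apply/eqP; rewrite eq_sym -subr_eq0 -(adm_brk lieP) xt adm0.
have [|A A'|P uP hP] := @common_eigenbasis k n [:: ad x; ad t].
- by move=> A; rewrite !inE => /orP[] /eqP ->.
- by rewrite !inE => /orP[] /eqP -> /orP[] /eqP ->; rewrite ?com.
have [d hd] := hP (ad x) (mem_head _ _); have [|e he] := hP (ad t); first by rewrite !inE eqxx orbT.
have [r hr] := field_avoid [seq - d i / e i | i <- enum 'I_n.+1].
have hde i : d i + r * e i = 0 -> d i = 0 /\ e i = 0.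
  have [e0|e0] := eqVneq (e i) 0; first by rewrite e0 mulr0 addr0.
  move/eqP; rewrite addrC addr_eq0 => /eqP h; case/mapP: hr; exists i; first by rewrite mem_enum.
  by rewrite -h mulfK.
have hx' : eigenbasis (ad (x + r *: t)) P (fun i => d i + r * e i).
  by move=> i; rewrite admD admZ mulmxDr -scalemxAr hd he scalerDl scalerA.
have key w : br (x + r *: t) w = 0 -> br x w = 0 /\ br t w = 0.
  have [a ->] := row_comb w uP; rewrite -!mul_adm (eigenbasis_mul _ hx') => /(row_comb_eq0 uP) h.
  have h' i : a i * d i = 0 /\ a i * e i = 0.
    by move/eqP: (h i); rewrite mulf_eq0 => /orP[/eqP->|/eqP/hde [-> ->]]; rewrite ?mul0r ?mulr0.
  by split; [rewrite (eigenbasis_mul _ hd)|rewrite (eigenbasis_mul _ he)]; rewrite big1 // => i _;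
    have [h1 h2] := h' i; rewrite ?h1 ?h2 scale0r.
have kerP y w : (w <= kermx (ad y))%MS = (br y w == 0).
  by rewrite -mul_adm; apply/sub_kermxP/eqP.
have sub : (kermx (ad (x + r *: t)) <= kermx (ad x))%MS.
  apply/row_subP => i; rewrite kerP; apply/eqP.
  have := row_sub i (kermx (ad (x + r *: t))); rewrite kerP => /eqP /key [].
  by [].
have : (u <= kermx (ad (x + r *: t)))%MS.
  apply: submx_trans (_ : (kermx (ad x) <= _)%MS); first by rewrite kerP xu.
  have /mxrank_leqif_sup/geq_leqif <- := sub; apply: xmin; split.
    by rewrite addmx_sub ?scalemx_sub.
  exact: eigenbasis_semisimple hx'.
by rewrite kerP => /eqP /key [].
Qed.

(** The semisimple part [s] of [y] normalizes [Bo], hence lies in it. The central component of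
    [y - s] is moved into [t], so that [d] is in the derived algebra and [nilp_perp] makes it
    orthogonal to [Bo]. *)
Lemma borel_jordan x y : br x y = 0 -> (y <= Bo)%MS -> exists t d,
  [/\ y = t + d, (t <= Bo)%MS, (d <= perp Bo)%MS, semisimple (ad t) & br x t = 0].
Proof.
move=> xy yB; have [s [sD ns hs]] := jordan lieP redP formP y.
have yx : br y x = 0 by rewrite (brkC lieP) xy oppr0.
have xs : br x s = 0 by rewrite (brkC lieP) (hs 0) ?scale0r ?oppr0 //; exact: cent_gev0.
have sB : (s <= Bo)%MS.
  apply: (borel_normal lieP borelP) => b bB; rewrite (brkC lieP) eqmx_opp.
  have [rs [w [-> hw]]] := gev_sum_stable (stB yB) bB; rewrite brk_sumr.
  by apply: summx_sub => mu _; have [g h] := hw mu; rewrite (hs mu) ?scalemx_sub.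
have [d [z [e dD z0]]] := dg_center lieP redP (y - s).
have dn : nilmx (ad d) by rewrite -[ad d]addr0 -z0 -admD -e.
have dE : d = y - s - z by rewrite e addrK.
exists (s + z), d; split.
- by rewrite dE -[y - s - z]addrA -opprD addrCA subrr addr0.
- by rewrite addmx_sub // centB.
- apply: (nilp_perp char0 lieP redP formP borelP) => //.
  by rewrite dE !addmx_sub ?eqmx_opp // centB.
- rewrite admD z0 addr0; apply: (@acts_semisimple _ _ (ad y) _ id) => mu v g.
  by rewrite mul_adm (hs mu).
by rewrite brkDr xs add0r (brkC lieP) -mul_adm z0 mulmx0 oppr0.
Qed.

(** [x] is a semisimple element of [Bo] with smallest centralizer [K]. Then [K] lies in [Bo] and
    meets [perp Bo] trivially, so the nilpotent parts of its elements vanish, and [Bo] is the sum of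
    [K] and [perp Bo]. Counting ranks gives the last formula. *)
Theorem cartan_of_borel : exists x, [/\ semisimple (ad x),
  forall y, br x y = 0 -> semisimple (ad y),
  forall y z, br x y = 0 -> br x z = 0 -> br y z = 0
  & (2 * \rank Bo = n.+1 + cent_dim c x)%N].
Proof.
have [|x [[xB sx] xmin]] := exists_minimal (cent_dim c) (P := fun x => (x <= Bo)%MS /\ semisimple (ad x)).
  by exists 0; split; rewrite ?sub0mx // adm0; exact: semisimple0.
have cent t u : (t <= Bo)%MS -> semisimple (ad t) -> br x t = 0 -> br x u = 0 -> br t u = 0.
  by move=> tB st xt; apply: torus_cent xmin _.
set K := kermx (ad x).
have KP (u : vec) : (u <= K)%MS = (br x u == 0) by rewrite -mul_adm; apply/sub_kermxP/eqP.
have brK u v : (u <= K)%MS -> (v <= K)%MS -> (br u v <= K)%MS.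
  rewrite !KP => /eqP hu /eqP hv; apply/eqP.
  by rewrite (jacobi lieP) hu hv brk0l brk0r addr0.
pose P0 := (perp Bo :&: K)%MS; pose B0 := (Bo :&: K)%MS.
(* [Bo] is spanned by [B0] and brackets with [x], and the latter are orthogonal to [K]. *)
have p0 u : (u <= K)%MS -> (forall b, (b <= B0)%MS -> B u b = 0) -> (u <= perp Bo)%MS.
  rewrite KP => /eqP uK h; apply/perpP => b bB.
  have [a [b' [aB b'B -> xa]]] := semisimple_split sx (stB xB) bB.
  by rewrite bformDr (h a) ?(form_cent lieP formP) ?addr0 // sub_capmx aB KP xa eqxx.
(* Otherwise [P0], acting nilpotently, sends some [y] of [K] outside [B0] into [B0], and then even
   into [P0]. So [P0 + y] is solvable and the trace form makes [y] orthogonal to [P0]; hence [y]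
   lies in the double orthogonal of [B0], a contradiction. *)
have KB : (K <= Bo)%MS.
  suff : (K <= B0)%MS by rewrite sub_capmx => /andP[].
  apply: contraT => nK.
  have P0B : (P0 <= Bo)%MS by apply: submx_trans (capmxSl _ _) perpB.
  have inP0 (u : vec) : (u <= P0)%MS -> [/\ (u <= perp Bo)%MS, (u <= Bo)%MS & (u <= K)%MS].
    by rewrite sub_capmx => /andP[h1 h2]; split=> //; exact: submx_trans perpB.
  have stK (u : vec) : (u <= K)%MS -> (K *m ad u <= K)%MS.
    by move=> h; apply/row_subP => i; rewrite row_mul mul_adm brK ?row_sub.
  have stB0 (u : vec) : (u <= P0)%MS -> (B0 *m ad u <= B0)%MS.
    move=> /inP0 [_ uB uK]; apply/row_subP => i; rewrite row_mul mul_adm sub_capmx.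
    have := row_sub i B0; rewrite sub_capmx => /andP [h1 h2].
    by rewrite brkB ?brK.
  have subP : subalg c P0.
    apply: derived_sub => u v /inP0 [uP uB uK] /inP0 [vP vB vK].
    by rewrite sub_capmx brK // (brk_perp char0 lieP redP formP borelP).
  have solP : solvable_sub c P0 by apply: (@solvable_derived _ _ _ _ _ 0%N P0B).
  have [||||y [yK yB0 hy]] := @lie_theorem _ _ _ char0 lieP P0 K B0 subP solP.
  - exact: capmxSr.
  - by move=> u /inP0 [_ _ uK]; exact: stK.
  - exact: stB0.
  - exact: nK.
  have yB u : (u <= P0)%MS -> (br u y <= B0)%MS.
    move=> uP0; have [a ha] := hy u uP0; have [uP _ _] := inP0 _ uP0.
    have [_ un] := perp_borel_nilp uP.
    by have a0 := nilp_weight (stB0 _ uP0) un yB0 ha; move: ha; rewrite a0 scale0r subr0.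
  have yP u : (u <= P0)%MS -> (br u y <= P0)%MS.
    move=> uP0; have [uP uB uK] := inP0 _ uP0; rewrite sub_capmx brK // andbT.
    apply: p0; first exact: brK.
    move=> b; rewrite sub_capmx KP => /andP[bB /eqP xb].
    have [t [d [eb tB dP st xt]]] := borel_jordan xb bB.
    have dP0 : (d <= P0)%MS.
      by rewrite sub_capmx dP KP; apply/eqP; move: xb; rewrite eb brkDr xt add0r.
    rewrite (bform_inv formP) eb brkDr (brkC lieP y t) (cent t y) ?oppr0 ?add0r //; last first.
      by apply/eqP; rewrite -KP.
    rewrite (brkC lieP) bformNr (perpP Bm _ _ uP) ?oppr0 //.
    by have := yB _ dP0; rewrite sub_capmx => /andP[].
  have d1 : (derived c (P0 + y)%MS <= P0)%MS.
    apply: derived_sub => u w /sub_adjoin [a1 [b1 [B1 ->]]] /sub_adjoin [a2 [b2 [B2 ->]]].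
    rewrite brkDl !brkDr !brkZl !brkZr (brkxx lieP) !scaler0 addr0.
    rewrite !addmx_sub ?scalemx_sub ?yP //.
      by apply: submx_trans subP; exact: brk_derived.
    by rewrite (brkC lieP) eqmx_opp yP.
  case/negP: yB0; rewrite sub_capmx yK andbT.
  apply: (sub_perp formP) => u hu; have [a [b [eu xa]]] := semisimple_split_cent sx u.
  have yK0 : br x y = 0 by apply/eqP; rewrite -KP.
  have e w : br x w = 0 -> B u w = B a w.
    by move=> xw; rewrite eu (bformDl formP) (bformC formP (br x b)) (form_cent lieP formP) // addr0.
  have aP0 : (a <= P0)%MS.
    have aK : (a <= K)%MS by rewrite KP xa.
    rewrite sub_capmx aK andbT; apply: p0 => // b'; rewrite sub_capmx KP => /andP[bB /eqP xb'].
    by rewrite -e // hu.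
  have [aP aB aK] := inP0 _ aP0; have [aD an] := perp_borel_nilp aP.
  rewrite e // (form_kap lieP redP formP) // /kap mxtrace_mulC.
  apply: (@solvable_trace _ _ _ char0 lieP (P0 + y)%MS); rewrite ?addsmxSr //.
  - exact: submx_trans d1 (addsmxSl _ _).
  - exact: (@solvable_derived _ _ _ _ _ 1%N d1).
  - exact: submx_trans aP0 (addsmxSl _ _).
have PK0 (u : vec) : (u <= perp Bo)%MS -> (u <= K)%MS -> u = 0.
  move=> uP uK; apply: (bform_nondeg formP) => v.
  have [a [b [-> xa]]] := semisimple_split_cent sx v.
  rewrite bformDr (form_cent lieP formP) ?addr0; last by apply/eqP; rewrite -KP.
  by apply: (perpP Bm _ _ uP); apply: submx_trans KB; rewrite KP xa.
have ssK y : br x y = 0 -> semisimple (ad y).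
  move=> xy; have yB : (y <= Bo)%MS by apply: submx_trans KB; rewrite KP xy.
  have [t [d [ey tB dP st xt]]] := borel_jordan xy yB.
  suff d0 : d = 0 by rewrite ey d0 addr0.
  by apply: PK0 => //; rewrite KP; apply/eqP; move: xy; rewrite ey brkDr xt add0r.
exists x; split=> //.
- move=> y z xy xz; apply: cent => //; first by apply: submx_trans KB; rewrite KP xy.
  exact: ssK.
have disj : (K :&: perp Bo)%MS = 0.
  apply/eqP; rewrite -submx0; apply/row_subP => i; have := row_sub i (K :&: perp Bo)%MS.
  by rewrite sub_capmx => /andP[h1 h2]; rewrite (PK0 _ h2 h1) sub0mx.
have sum : (K + perp Bo :=: Bo)%MS.
  apply/eqmxP; rewrite addsmx_sub KB perpB /=; apply/row_subP => i.
  have [a [b [aB bB -> xa]]] := semisimple_split sx (stB xB) (row_sub i Bo).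
  rewrite addmx_sub //; first by apply: submx_trans (addsmxSl _ _); rewrite KP xa.
  by apply: submx_trans (addsmxSr _ _); apply: (brk_perp char0 lieP redP formP borelP).
have := mxrank_disjoint_sum disj; rewrite sum => e.
have := rank_perp formP Bo; rewrite /cent_dim -/K => e2.
apply: (@addIn (\rank (perp Bo))); rewrite -[X in (X + _ + _)%N]e2; lia.
Qed.

End Cartan.

(** * Derivatives along curves, exponentials, invariant polynomials *)

Section Curves.
Variables (k : closedFieldType) (n : nat).
Implicit Types (q : {mpoly k[n]}) (x w : 'rV[k]_n).

Lemma mmap_horner (h : 'I_n -> {poly k}) q t :
  (mmap (@polyC k) h q).[t] = q.@[fun i => (h i).[t]].
Proof.
rewrite /mmap horner_sum mevalE; apply: eq_bigr => m _.
rewrite hornerM hornerC; congr (_ * _); rewrite /mmap1 horner_prod.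
by apply: eq_bigr => i _; rewrite horner_exp.
Qed.

Lemma deriv_mmap (h : 'I_n -> {poly k}) q t :
  (mmap (@polyC k) h q)^`().[t] = \sum_i q^`M(i).@[fun j => (h j).[t]] * (h i)^`().[t].
Proof.
rewrite (@mmap_derivation _ _ _ (@polyC k) h (@deriv k)) ?horner_sum.
- by apply: eq_bigr => i _; rewrite hornerM mmap_horner.
- by move=> u v; rewrite derivD.
- by move=> u v; rewrite derivM.
- by move=> a; rewrite derivC.
Qed.

Lemma horner_deriv0 (f : {poly k}) : f^`().[0] = f`_1.
Proof. by rewrite horner_coef0 coef_deriv. Qed.

Lemma dderE q x w : dder q x w = \sum_i q^`M(i).@[vcoord x] * w 0 i.
Proof.
rewrite /dder -horner_deriv0 deriv_mmap; apply: eq_bigr => i _; congr (_ * _).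
  by apply: meval_eq => j; rewrite !hornerE.
by rewrite derivD derivC derivM derivC derivX mul0r !add0r mulr1 hornerC.
Qed.

Lemma dder_line q x w (f : {poly k}) :
  (forall t, f.[t] = q.@[vcoord (x + t *: w)]) -> dder q x w = f`_1.
Proof.
move=> h; rewrite /dder (_ : mmap _ _ _ = f) //; apply: poly_ext => t; rewrite mmap_horner h.
by apply: meval_eq => i; rewrite !hornerE /vcoord !mxE mulrC.
Qed.

Lemma dder_linear q x a v w : dder q x (a *: v + w) = a * dder q x v + dder q x w.
Proof.
rewrite !dderE mulr_sumr -big_split; apply: eq_bigr => i _ /=.
by rewrite !mxE mulrDr mulrCA.
Qed.

Lemma dder_comp l (p : 'I_l -> {mpoly k[n]}) (Q : {mpoly k[l]}) x w :
  dder (Q \mPo [tuple p i | i < l]) x w =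
  \sum_i (Q^`M(i) \mPo [tuple p i | i < l]).@[vcoord x] * dder (p i) x w.
Proof.
rewrite dderE; under eq_bigr => j _ do rewrite mderiv_comp_mpoly rmorph_sum /= mulr_suml.
rewrite exchange_big; apply: eq_bigr => i _ /=; rewrite dderE mulr_sumr.
by apply: eq_bigr => j _; rewrite tnth_mktuple mevalM mulrA.
Qed.

End Curves.

Section Exponential.
Variables (k : closedFieldType) (n : nat) (c : 'I_n.+1 -> 'I_n.+1 -> 'I_n.+1 -> k).
Hypothesis char0 : [pchar k] =i pred0.
Hypothesis lieP : is_lie c.
Local Notation vec := 'rV[k]_n.+1.
Local Notation br := (brk c).
Local Notation ad := (adm c).

(* Locked because unification must not unfold the factorial. *)
Fact dpow_key : unit. Proof. exact: tt. Qed.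
Definition dpow (z : vec) j := locked_with dpow_key ((j`!%:R)^-1 *: ad z ^+ j).

Lemma dpowE z j : dpow z j = (j`!%:R)^-1 *: ad z ^+ j.
Proof. by rewrite /dpow unlock. Qed.

Lemma dpow0 z : dpow z 0 = 1%:M.
Proof. by rewrite dpowE fact0 invr1 scale1r expr0. Qed.

Lemma dpowS z j : dpow z j *m ad z = j.+1%:R *: dpow z j.+1.
Proof.
rewrite !dpowE -scalemxAl -[_ *m ad z]exprSr scalerA factS natrM invfM mulrA.
by rewrite mulfV ?mul1r //; apply: natr_neq0.
Qed.

Lemma dpow_eq0 z j : nilmx (ad z) -> (n < j)%N -> dpow z j = 0.
Proof.
move=> nz h; rewrite dpowE -(subnK h) exprD (nilp_expn nz).
by rewrite mulr0 scaler0.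
Qed.

Lemma dpowZ a z j : dpow (a *: z) j = a ^+ j *: dpow z j.
Proof. by rewrite !dpowE admZ exprZn !scalerA mulrC. Qed.

Lemma mul_dpowZ a (w z : vec) j : w *m dpow (a *: z) j = a ^+ j *: (w *m dpow z j).
Proof. by rewrite dpowZ [RHS]scalemxAr. Qed.

Lemma mul_dpowS (w z : vec) j : br z (w *m dpow z j) = j.+1%:R *: (w *m dpow z j.+1).
Proof. by rewrite -mul_adm -mulmxA dpowS [RHS]scalemxAr. Qed.

Lemma leibniz z u v m :
  br u v *m dpow z m = \sum_(i < m.+1) br (u *m dpow z i) (v *m dpow z (m - i)).
Proof.
elim: m => [|m IH]; first by rewrite big_ord1 subn0 dpow0 !mulmx1.
apply: (scalerI (natr_neq0 char0 (ltn0Sn m))).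
rewrite scalemxAr -dpowS mulmxA IH mulmx_suml.
under eq_bigr => i _ do rewrite derivation_adm // !mul_adm !mul_dpowS brkZl brkZr.
rewrite big_split /= scaler_sumr.
transitivity (\sum_(i < m.+2) i%:R *: br (u *m dpow z i) (v *m dpow z (m.+1 - i)) +
  \sum_(i < m.+2) (m.+1 - i)%:R *: br (u *m dpow z i) (v *m dpow z (m.+1 - i))).
  congr (_ + _).
    by rewrite [RHS]big_ord_recl scale0r add0r; apply: eq_bigr => i _; rewrite lift0 subSS.
  rewrite [RHS]big_ord_recr /= subnn scale0r addr0; apply: eq_bigr => i _.
  by rewrite subSn // -ltnS.
rewrite -big_split; apply: eq_bigr => i _ /=.
by rewrite -scalerDl -natrD subnKC // -ltnS.
Qed.

Lemma expad_sum z N : nilmx (ad z) -> (n < N)%N -> expad c z = \sum_(j < N) dpow z j.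
Proof.
move=> nz h; rewrite /expad (eq_bigr (fun j : 'I_n.+1 => dpow z j)) => [|j _]; last by rewrite dpowE.
rewrite (big_ord_widen _ (fun j => dpow z j) h).
rewrite [RHS](bigID (fun j : 'I_N => (j < n.+1)%N)) /= [X in _ + X]big1 ?addr0 //.
by move=> j; rewrite -leqNgt => hj; rewrite dpow_eq0.
Qed.

Lemma expad_brk z u v : nilmx (ad z) -> br u v *m expad c z = br (u *m expad c z) (v *m expad c z).
Proof.
(* With this [N], a term with [i + j >= N] has an exponent above [n] and vanishes, so the truncated
   exponentials multiply like full series. *)
move=> nz; pose N := (n.+1 + n.+1)%N; have nN : (n < N)%N by rewrite /N; lia.
rewrite (expad_sum nz nN) !mulmx_sumr brk_suml.
transitivity (\sum_(m < N) \sum_(i < N) \sum_(j < N | (i + j == m)%N)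
    br (u *m dpow z i) (v *m dpow z j)).
  apply: eq_bigr => m _; rewrite leibniz.
  rewrite (big_ord_widen _ (fun i => br (u *m dpow z i) (v *m dpow z (m - i))) (ltn_ord m)).
  rewrite [RHS](bigID (fun i : 'I_N => (i < m.+1)%N)) /= [X in _ + X]big1 ?addr0.
    apply: eq_bigr => i; rewrite ltnS => im.
    have mi : (m - i < N)%N by apply: leq_ltn_trans (ltn_ord m); exact: leq_subr.
    rewrite (big_pred1 (Ordinal mi)) // => j; rewrite /= -val_eqE /=.
    by rewrite -[RHS](eqn_add2l i) subnKC.
  move=> i; rewrite -leqNgt => im; rewrite big1 // => j /eqP e.
  by move: im; rewrite -e -addSn; lia.
rewrite exchange_big; apply: eq_bigr => i _ /=; rewrite brk_sumr.
rewrite (exchange_big_dep xpredT) //=; apply: eq_bigr => j _.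
have [ij|ij] := ltnP (i + j) N.
  by rewrite (big_pred1 (Ordinal ij)) // => m; rewrite /= -val_eqE /= eq_sym.
rewrite big1 => [|m /eqP e]; last by have := ltn_ord m; rewrite -e ltnNge ij.
have [h|h] := ltnP n i; first by rewrite (dpow_eq0 nz h) mulmx0 brk0l.
rewrite (@dpow_eq0 z j nz) ?mulmx0 ?brk0r // ltnNge; apply/negP => jn.
by have := leq_trans ij (leq_add h jn); rewrite /N; lia.
Qed.

Lemma expad_conj z x : nilmx (ad z) -> expad c z *m ad (x *m expad c z) = ad x *m expad c z.
Proof.
by move=> nz; apply: mx_ext => y; rewrite !mulmxA !mul_adm expad_brk.
Qed.

Lemma expad_unit z : nilmx (ad z) -> expad c z \in unitmx.
Proof.
move=> nz; have comm j : ad z ^+ j *m expad c z = expad c z *m ad z ^+ j.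
  rewrite /expad mulmx_sumr mulmx_suml; apply: eq_bigr => i _.
  by rewrite -scalemxAr -scalemxAl -[_ *m _]exprD -[(_ *m _)%R]exprD addnC.
rewrite -row_free_unit -kermx_eq0; apply/rowV0P => v /sub_kermxP vE.
apply/eqP; apply: contraT => v0; have [j [w0 wz]] := last_nonzero nz v0.
case/eqP: w0; transitivity (v *m ad z ^+ j *m expad c z); last by rewrite -mulmxA comm mulmxA vE mul0mx.
rewrite /expad big_ord_recl fact0 invr1 scale1r expr0 mulmxDr mulmx1 mulmx_sumr big1 ?addr0 // => i _.
rewrite -scalemxAr lift0 exprS -[_ * _]/(_ *m _) mulmxA -[_ *m _ *m ad z]mulmxA.
by rewrite -[_ ^+ _ *m ad z]exprSr wz mul0mx scaler0.
Qed.

Lemma expad_nilp z e : nilmx (ad z) -> nilmx (ad e) -> nilmx (ad (e *m expad c z)).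
Proof.
move=> nz [m em]; exists m.
have conj j : expad c z *m ad (e *m expad c z) ^+ j = ad e ^+ j *m expad c z.
  elim: j => [|j IH]; first by rewrite !expr0 mulmx1 mul1mx.
  by rewrite !exprSr -![_ * ad _]/(_ *m _) mulmxA IH -mulmxA expad_conj // mulmxA.
by apply: (can_inj (mulKmx (expad_unit nz))); rewrite conj em mul0mx mulmx0.
Qed.

Lemma expad_trace z x j : nilmx (ad z) -> \tr (ad (x *m expad c z) ^+ j) = \tr (ad x ^+ j).
Proof.
move=> nz; have u := expad_unit nz.
have conj : expad c z *m ad (x *m expad c z) ^+ j = ad x ^+ j *m expad c z.
  elim: j => [|j IH]; first by rewrite !expr0 mulmx1 mul1mx.
  by rewrite !exprSr -![_ * ad _]/(_ *m _) mulmxA IH -mulmxA expad_conj // mulmxA.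
by rewrite -[ad (x *m _) ^+ j](mulKmx u) conj mxtrace_mulC mulmxK.
Qed.

(* The curve [t |-> x exp(t z)], coordinatewise polynomial in [t]. *)
Definition expcurve (z x : vec) i : {poly k} :=
  \sum_(j < n.+2) ((x *m dpow z j) 0 i) *: 'X^j.

Lemma expcurve_horner z x t i : nilmx (ad z) ->
  (expcurve z x i).[t] = vcoord (x *m expad c (t *: z)) i.
Proof.
move=> nz; have ntz : nilmx (ad (t *: z)).
  by have [m em] := nz; exists m; rewrite admZ exprZn em scaler0.
rewrite (expad_sum ntz (ltnW (ltnSn n.+1))) /vcoord mulmx_sumr summxE /expcurve horner_sum.
by apply: eq_bigr => j _; rewrite (mul_dpowZ t x z j) hornerZ hornerXn [RHS]mxE mulrC.
Qed.

Lemma expcurve_deriv z x t i : nilmx (ad z) ->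
  (expcurve z x i)^`().[t] = br z (x *m expad c (t *: z)) 0 i.
Proof.
move=> nz; have ntz : nilmx (ad (t *: z)).
  by have [m em] := nz; exists m; rewrite admZ exprZn em scaler0.
rewrite (expad_sum ntz (ltnSn n)) mulmx_sumr brk_sumr summxE /expcurve raddf_sum horner_sum /=.
rewrite big_ord_recl derivZ derivXn mulr0n scaler0 horner0 add0r.
apply: eq_bigr => j _; rewrite derivZ derivXn hornerZ hornerMn hornerXn lift0 /=.
rewrite (mul_dpowZ t x z j) brkZr mul_dpowS scalerA.
by rewrite [RHS]mxE -mulr_natr mulrC.
Qed.

(** Here [z] is arbitrary, whereas [G_invariant] only sees nilpotent [z]; the gap is closed by
    [G_Lie_invariant]. *)
Definition Lie_invariant (q : {mpoly k[n.+1]}) := forall z x, dder q x (br z x) = 0.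

Lemma G_invariant_nilp q z x : G_invariant c q -> nilmx (ad z) -> dder q x (br z x) = 0.
Proof.
move=> Gq nz; pose f := mmap (@polyC k) (expcurve z x) q.
have nt t : ad (t *: z) ^+ n.+1 = 0 by rewrite admZ exprZn (nilp_expn nz) scaler0.
have fE : f = (q.@[vcoord x])%:P.
  apply: poly_ext => t; rewrite mmap_horner hornerC -(Gq _ (nt t) x).
  by apply: meval_eq => i; exact: expcurve_horner.
have : f^`().[0] = 0 by rewrite fE derivC horner0.
have e0 : x *m expad c (0 *: z) = x.
  rewrite scale0r (@expad_sum 0 n.+1) //; last by exists 1%N; rewrite adm0 expr1.
  rewrite big_ord_recl dpow0 mulmxDr mulmx1 mulmx_sumr big1 ?addr0 // => i _.
  by rewrite dpowE adm0 exprS mul0r scaler0 mulmx0.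
rewrite deriv_mmap dderE => e; rewrite -[RHS]e; apply: eq_bigr => i _; congr (_ * _).
  by apply: meval_eq => j; rewrite expcurve_horner // e0.
by rewrite expcurve_deriv // e0.
Qed.

Lemma Lie_G_invariant q : Lie_invariant q -> G_invariant c q.
Proof.
move=> Lq z ez x; have nz : nilmx (ad z) by exists n.+1.
pose f := mmap (@polyC k) (expcurve z x) q.
have fE t : f.[t] = q.@[vcoord (x *m expad c (t *: z))].
  by rewrite mmap_horner; apply: meval_eq => i; exact: expcurve_horner.
have f'0 : f^`() = 0.
  apply: poly_ext => t; rewrite horner0 -[RHS](Lq z (x *m expad c (t *: z))) deriv_mmap dderE.
  apply: eq_bigr => i _; congr (_ * _); last exact: expcurve_deriv.
  by apply: meval_eq => j; exact: expcurve_horner.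
have fc : f = (f`_0)%:P.
  apply/polyP => -[|j]; rewrite coefC //=.
  have := congr1 (fun g : {poly k} => g`_j) f'0; rewrite coef_deriv coef0 -mulr_natr => /eqP.
  by rewrite mulf_eq0 (negPf (natr_neq0 char0 _)) // orbF => /eqP.
have := fE 1; have := fE 0; rewrite fc !hornerC scale1r scale0r => -> <-.
congr (_.@[_]); rewrite (@expad_sum 0 n.+1) //; last by exists 1%N; rewrite adm0 expr1.
rewrite big_ord_recl dpow0 mulmxDr mulmx1 mulmx_sumr big1 ?addr0 // => i _.
by rewrite dpowE adm0 exprS mul0r scaler0 mulmx0.
Qed.

(** The conjugate of [e] by [exp (t z)] is nilpotent for every [t], so the derivative of [q] along
    it vanishes identically in [t]; its coefficient of degree 1 is the derivative along [[z, e]]. *)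
Lemma G_invariant_brk_nilp q e z x : G_invariant c q -> nilmx (ad e) -> nilmx (ad z) ->
  dder q x (br (br z e) x) = 0.
Proof.
move=> Gq ne nz; pose phi v := dder q x (br v x).
have phiP a v w : phi (a *: v + w) = a * phi v + phi w.
  by rewrite /phi brkDl brkZl dder_linear.
pose f : {poly k} := \sum_(j < n.+2) (phi (e *m dpow z j)) *: 'X^j.
have f0 : f = 0.
  apply: poly_ext => t; have ntz : nilmx (ad (t *: z)).
    by have [m em] := nz; exists m; rewrite admZ exprZn em scaler0.
  rewrite horner0 -[RHS](G_invariant_nilp x Gq (expad_nilp ntz ne)) -/(phi _).
  rewrite (expad_sum ntz (ltnW (ltnSn n.+1))) mulmx_sumr /f horner_sum.
  have phi0 : phi 0 = 0 by rewrite /phi brk0l dderE big1 // => i _; rewrite mxE mulr0.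
  have phiD v w : phi (v + w) = phi v + phi w by rewrite -[v]scale1r phiP mul1r scale1r.
  have phiZ a v : phi (a *: v) = a * phi v by rewrite -[a *: v]addr0 phiP phi0 addr0.
  rewrite (big_morph phi phiD phi0); apply: eq_bigr => j _.
  by rewrite (mul_dpowZ t e z j) hornerZ hornerXn phiZ mulrC.
have := congr1 (fun g : {poly k} => g`_1) f0; rewrite coef0 /f coef_sum.
pose i1 : 'I_n.+2 := @Ordinal n.+2 1 isT.
rewrite (bigD1 i1) //= big1 => [|i ii1].
  rewrite coefZ coefXn mulr1 addr0 => h; rewrite -[RHS]h -/(phi (br z e)); congr phi.
  by rewrite dpowE invr1 scale1r expr1 mul_adm.
rewrite coefZ coefXn; case: eqP => [e1|_]; last by rewrite mulr0.
by case/eqP: ii1; apply: val_inj; exact: esym e1.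
Qed.

End Exponential.

(** * Weights of a Cartan subalgebra *)

Section Weights.
Variables (k : closedFieldType) (n : nat) (c : 'I_n.+1 -> 'I_n.+1 -> 'I_n.+1 -> k).
Variable Bm : 'M[k]_n.+1.
Hypothesis char0 : [pchar k] =i pred0.
Hypothesis lieP : is_lie c.
Hypothesis redP : reductive c.
Hypothesis formP : good_form c Bm.
Local Notation vec := 'rV[k]_n.+1.
Local Notation br := (brk c).
Local Notation ad := (adm c).
Local Notation B := (bform Bm).
Implicit Types (x y t : vec).

(** A diagonal entry of [ad t] in the basis [P]: linear in all [t], and equal to the eigenvalue
    whenever [row i P] is an eigenvector. *)
Definition weight (P : 'M[k]_n.+1) i (t : vec) : k := (row i P *m ad t *m invmx P) 0 i.

Lemma weight_linear P i a t u : weight P i (a *: t + u) = a * weight P i t + weight P i u.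
Proof. by rewrite /weight admD admZ mulmxDr mulmxDl -scalemxAr -scalemxAl 2!mxE. Qed.

Lemma weightE P i t d : P \in unitmx -> row i P *m ad t = d *: row i P -> weight P i t = d.
Proof.
move=> uP e; rewrite /weight e -scalemxAl rowE mulmxK // !mxE !eqxx mulr1.
by [].
Qed.

(* [x] is a regular element of the Cartan subalgebra [g^x], which acts diagonally
   in the basis [P] of [g]; no linear relation of the stated shapes between weights
   holds at [x] unless it holds on the whole of [g^x]. *)
Definition cartan_data x (P : 'M[k]_n.+1) (l : nat) := [/\ P \in unitmx,
  cent_dim c x = l,
  forall t, br x t = 0 -> eigenbasis (ad t) P (weight P ^~ t) &
  forall t, br x t = 0 -> [/\ forall i, weight P i x = 0 -> weight P i t = 0,
    forall i j, weight P i x = weight P j x -> weight P i t = weight P j t &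
    forall i j h, weight P i x + weight P j x = weight P h x ->
       weight P i t + weight P j t = weight P h t]].

Lemma generic_point (K : 'M[k]_n.+1) (I : finType) (f : I -> vec -> k) :
  (forall i a t u, f i (a *: t + u) = a * f i t + f i u) ->
  exists t, (t <= K)%MS /\ forall i, f i t = 0 -> forall u, (u <= K)%MS -> f i u = 0.
Proof.
move=> fP; suff [t [tK ht]] : exists t, (t <= K)%MS /\
    forall i, i \in enum I -> f i t = 0 -> forall u, (u <= K)%MS -> f i u = 0.
  by exists t; split=> // i; apply: ht; rewrite mem_enum.
elim: (enum I) => [|i s [t [tK ht]]]; first by exists 0; split; rewrite ?sub0mx.
case: (classic (forall u, (u <= K)%MS -> f i u = 0)) => [h|].
  by exists t; split=> // j; rewrite inE => /orP[/eqP->|/ht].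
move=> /not_all_ex_not [v hv]; have [vK fv] : (v <= K)%MS /\ f i v != 0.
  by case: (boolP (v <= K)%MS) hv => vK hv; [split=> //; apply/eqP => e; apply: hv | case: hv].
have [r' hr'] := field_avoid ((- f i t / f i v) :: [seq - f j t / f j v | j <- s]).
exists (r' *: v + t); split; first by rewrite addmx_sub ?scalemx_sub.
move=> j js; rewrite fP => e u uK.
have fv0 : f j v = 0.
  apply/eqP; apply: contraT => fv0; case/negP: hr'.
  have -> : r' = - f j t / f j v by rewrite -[LHS](mulfK fv0); congr (_ / _); apply/eqP; rewrite -addr_eq0 e.
  move: js; rewrite !inE => /orP[/eqP->|js]; first by rewrite eqxx.
  by rewrite (map_f (fun j => - f j t / f j v)) ?orbT.
move: js; rewrite inE => /orP[/eqP ej|js]; first by rewrite -ej fv0 eqxx in fv.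
by apply: (ht j) => //; rewrite -[RHS]e fv0 mulr0 add0r.
Qed.

Variable Bo : 'M[k]_n.+1.
Hypothesis borelP : borel c Bo.

(** The element given by [cartan_of_borel] is replaced by a generic point of its centralizer, where
    a linear relation of one of the required shapes holds only if it holds identically. The
    centralizer does not change. *)
Lemma cartan_exists : exists x P l, cartan_data x P l /\ (2 * \rank Bo = n.+1 + l)%N.
Proof.
have [x0 [sx0 ss ab e]] := cartan_of_borel char0 lieP redP formP borelP.
set K := kermx (ad x0).
have KP (u : vec) : (u <= K)%MS = (br x0 u == 0) by rewrite -mul_adm; apply/sub_kermxP/eqP.
have rK i : br x0 (row i K) = 0 by apply/eqP; rewrite -KP row_sub.
have [||P uP hP] := @common_eigenbasis k n [seq ad (row i K) | i <- enum 'I_n.+1].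
- by move=> _ /mapP [i _ ->]; apply: ss.
- move=> _ _ /mapP [i _ ->] /mapP [j _ ->]; apply/eqP; rewrite eq_sym -subr_eq0 -(adm_brk lieP).
  by rewrite ab // adm0.
have wt t : (t <= K)%MS -> eigenbasis (ad t) P (weight P ^~ t).
  move=> /submxP [a ->]; suff [d hd] : exists d, eigenbasis (ad (a *m K)) P d.
    by move=> i; rewrite (weightE uP (hd i)) hd.
  exists (fun i => \sum_j a 0 j * weight P i (row j K)) => i.
  rewrite (mulmx_sum_row a K) (big_morph ad (admD c) (adm0 c)) mulmx_sumr scaler_suml.
  apply: eq_bigr => j _; rewrite admZ -scalemxAr -scalerA; congr (_ *: _).
  have [|d hd] := hP (ad (row j K)); first by apply: map_f; rewrite mem_enum.
  by rewrite (weightE uP (hd i)) hd.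
(* The last component selects a weight, a difference of two weights, or the defect of a relation
   saying that two weights add up to a third. *)
pose f (i : 'I_n.+1 * 'I_n.+1 * 'I_n.+1 * 'I_3) (t : vec) : k :=
  let: (a, b, h, s) := i in
  if s == 0 then weight P a t else if s == 1 then weight P a t - weight P b t
  else weight P a t + weight P b t - weight P h t.
have [|x [xK hx]] := @generic_point K _ f.
  move=> [[[a b] h] s] r t u; rewrite /f !weight_linear; do 2 case: ifP => _ //; ring.
have cx t : br x t = 0 <-> (t <= K)%MS.
  split=> [xt|]; last by rewrite KP => /eqP tK; apply: ab => //; apply/eqP; rewrite -KP.
  have [a et] := row_comb t uP; rewrite KP et -mul_adm.
  have h0 := wt x0; rewrite (eigenbasis_mul _ (h0 _)); last by rewrite KP (brkxx lieP).
  rewrite big1 // => i _; move: xt; rewrite et -mul_adm (eigenbasis_mul _ (wt x xK)).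
  move=> /(row_comb_eq0 uP) /(_ i) /eqP; rewrite mulf_eq0 => /orP[/eqP->|/eqP w0].
    by rewrite mul0r scale0r.
  have -> : weight P i x0 = 0; last by rewrite mulr0 scale0r.
  by apply: (hx (i, i, i, 0)) => //; rewrite KP (brkxx lieP).
exists x, P, (cent_dim c x0); split=> //; split=> //.
- rewrite /cent_dim; apply/eqP; rewrite eqn_leq; apply/andP; split; apply: mxrankS; apply/row_subP => i.
    by apply/cx/eqP; rewrite -mul_adm; apply/eqP/sub_kermxP; rewrite row_sub.
  by apply/sub_kermxP; rewrite mul_adm; apply/cx; rewrite row_sub.
- by move=> t /cx; exact: wt.
move=> t /cx tK; split=> [i h|i j h|i j h' h].
- by apply: (hx (i, i, i, 0)).
- by apply/eqP; rewrite -subr_eq0; apply/eqP; apply: (hx (i, j, i, 1)) => //; rewrite /f /= h subrr.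
by apply/eqP; rewrite -subr_eq0; apply/eqP; apply: (hx (i, j, h', @Ordinal 3 2 isT)) => //; rewrite /f /= h subrr.
Qed.

End Weights.

(** * Infinitesimal invariance and separation by invariants *)

Lemma eigenbasis_trace (k : closedFieldType) n (A P : 'M[k]_n.+1) d :
  P \in unitmx -> eigenbasis A P d -> \tr A = \sum_i d i.
Proof.
move=> uP h; rewrite -[A](mulKmx uP) mxtrace_mulC; apply: eq_bigr => i _.
transitivity ((row i (P *m A *m invmx P)) 0 i); first by rewrite [RHS]mxE.
rewrite !row_mul h -scalemxAl rowE mulmxK // !mxE !eqxx mulr1.
by [].
Qed.

Lemma eigenbasis_exp (k : closedFieldType) n (A P : 'M[k]_n.+1) d j :
  eigenbasis A P d -> eigenbasis (A ^+ j) P (fun i => d i ^+ j).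
Proof.
move=> h i; elim: j => [|j IH]; first by rewrite !expr0 mulmx1 scale1r.
by rewrite exprSr -[_ * A]/(_ *m A) mulmxA IH -scalemxAl h scalerA exprSr.
Qed.

Section Invariants.
Variables (k : closedFieldType) (n : nat) (c : 'I_n.+1 -> 'I_n.+1 -> 'I_n.+1 -> k).
Variable Bm : 'M[k]_n.+1.
Hypothesis char0 : [pchar k] =i pred0.
Hypothesis lieP : is_lie c.
Hypothesis redP : reductive c.
Hypothesis formP : good_form c Bm.
Local Notation vec := 'rV[k]_n.+1.
Local Notation br := (brk c).
Local Notation ad := (adm c).
Local Notation B := (bform Bm).
Implicit Types (v z t : vec).

Variables (x : vec) (P : 'M[k]_n.+1) (r : nat).
Hypothesis cartanP : cartan_data c x P r.

Lemma cartan_unit : P \in unitmx. Proof. by case: cartanP. Qed.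

Lemma cartan_eigen t i : br x t = 0 -> br t (row i P) = weight c P i t *: row i P.
Proof. by have [_ _ h _] := cartanP => /h e; rewrite -mul_adm e. Qed.

(** Each application of [ad v] shifts the generalized eigenvalue of [ad y] by [a]; in characteristic
    0 the values [b + j a] are distinct, and only finitely many are eigenvalues. *)
Lemma root_nilp y a v : br y v = a *: v -> a != 0 -> nilmx (ad v).
Proof.
move=> e a0; have gv : gev (ad y) a v by apply: eigen_gev; rewrite mul_adm.
have [rs [urs rsE _ _]] := spectrum (ad y); exists (size rs).+1.
apply: (@gev_ext _ _ (ad y)) => b u gu; rewrite mulmx0; apply/eqP; apply: contraT => u0.
have gj j : gev (ad y) (b + a *+ j) (u *m ad v ^+ j).
  elim: j => [|j IH]; first by rewrite addr0 expr0 mulmx1.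
  rewrite exprSr -[_ * ad v]/(_ *m ad v) mulmxA mul_adm mulrS addrCA.
  exact: gev_brk.
have nz j : (j <= (size rs).+1)%N -> u *m ad v ^+ j != 0.
  move=> h; apply: contraNneq u0 => e0.
  by rewrite -(subnKC h) exprD -[_ * _]/(_ *m _) mulmxA e0 mul0mx.
have sub : {subset [seq b + a *+ j | j <- iota 0 (size rs).+1] <= rs}.
  move=> m /mapP [j]; rewrite mem_iota add0n => /andP[_ h] ->; rewrite rsE.
  by apply: gev_eigenvalue (gj j); rewrite ?nz // ltnW.
have := uniq_leq_size _ sub; rewrite size_map size_iota ltnn; apply.
rewrite map_inj_in_uniq ?iota_uniq // => i j _ _ /addrI /eqP.
wlog ij : i j / (i <= j)%N.
  move=> h e0; have [/h|/ltnW/h] := leqP i j; first by apply.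
  by rewrite eq_sym => /(_ e0).
rewrite -(subnKC ij) mulrnDr -{1}[a *+ i]addr0 (inj_eq (addrI _)) eq_sym -mulr_natr mulf_eq0 (negPf a0) /=.
case: (posnP (j - i)) => [->|h]; first by rewrite addn0.
by rewrite (negPf (natr_neq0 char0 h)).
Qed.

(** Central elements act by 0, so only brackets of rows of [P] matter. A bracket with a row of
    weight 0 is a multiple of a root vector, nilpotent by [root_nilp], or zero; brackets of two root
    vectors are covered by [G_invariant_brk_nilp]. *)
Lemma G_Lie_invariant q : G_invariant c q -> Lie_invariant c q.
Proof.
move=> Gq z u; pose phi v := dder q u (br v u).
have phiP a v w : phi (a *: v + w) = a * phi v + phi w.
  by rewrite /phi brkDl brkZl dder_linear.
have phi0 : phi 0 = 0 by rewrite /phi brk0l dderE big1 // => i _; rewrite mxE mulr0.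
have phiZ a v : phi (a *: v) = a * phi v by rewrite -[a *: v]addr0 phiP phi0 addr0.
have nil v : nilmx (ad v) -> phi v = 0 by exact: G_invariant_nilp.
have xx := brkxx lieP x.
have pij i j : phi (br (row i P) (row j P)) = 0.
  have h i' j' : weight c P i' x = 0 -> phi (br (row i' P) (row j' P)) = 0.
    move=> w0; have xi : br x (row i' P) = 0 by rewrite (cartan_eigen _ xx) w0 scale0r.
    rewrite (cartan_eigen _ xi) phiZ; have [wj|wj] := eqVneq (weight c P j' x) 0.
      have [_ _ _ hg] := cartanP; have [g1 _ _] := hg _ xi.
      by rewrite g1 // mul0r.
    by rewrite nil ?mulr0 //; apply: (@root_nilp x (weight c P j' x)) => //; exact: cartan_eigen.
  have [wi|wi] := eqVneq (weight c P i x) 0; first exact: h.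
  have [wj|wj] := eqVneq (weight c P j x) 0.
    by rewrite (brkC lieP) -scaleN1r phiZ h ?mulr0.
  apply: (G_invariant_brk_nilp char0 lieP) => //; [move: wj|move: wi]; apply: root_nilp;
    exact: cartan_eigen.
have [d hd] := form_repr formP phiP.
have dgP : (dg c <= perp Bm <<d>>)%MS.
  apply: derived_sub => v w _ _; have [a ->] := row_comb v cartan_unit.
  have [b ->] := row_comb w cartan_unit.
  rewrite brk_suml summx_sub // => i _; rewrite brkZl scalemx_sub // brk_sumr summx_sub // => j _.
  rewrite brkZr scalemx_sub //; apply/perpP => t; rewrite genmxE => /sub_rVP [s ->].
  by rewrite bformZr (bformC formP) hd pij mulr0.
have [y [z0 [ez yD zz]]] := dg_center lieP redP z.
have : phi y = 0.
  by rewrite -hd (bformC formP); apply: (perpP _ _ _ (submx_trans yD dgP)); rewrite genmxE.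
rewrite -/(phi z); have -> : phi z = 1 * phi y + phi z0 by rewrite -phiP scale1r -ez.
by move=> ->; rewrite mulr0 add0r /phi -mul_adm zz mulmx0 dderE big1 // => i _; rewrite mxE mulr0.
Qed.

Lemma trace_poly j : exists q : {mpoly k[n.+1]}, forall y, q.@[vcoord y] = \tr (ad y ^+ j).
Proof.
pose M : 'M[{mpoly k[n.+1]}]_n.+1 := \sum_i ('X_i : {mpoly k[n.+1]}) *: map_mx (@mpolyC _ k) (ad (delta_mx 0 i)).
exists (\tr (M ^+ j)) => y; rewrite -trace_map_mx rmorphXn /=; congr (\tr (_ ^+ j)).
rewrite [y in RHS]row_sum_delta (big_morph ad (admD c) (adm0 c)) /M raddf_sum.
apply: eq_bigr => i _ /=; rewrite map_mxZ /= mevalXU admZ; congr (_ *: _).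
by apply/matrixP => a b; rewrite !mxE mevalC.
Qed.

Lemma form_poly z : exists q : {mpoly k[n.+1]}, forall y, q.@[vcoord y] = B z y.
Proof.
exists (\sum_i (B z (delta_mx 0 i)) *: 'X_i) => y; rewrite rmorph_sum /=.
rewrite [y in RHS]row_sum_delta bform_sumr; apply: eq_bigr => i _.
by rewrite mevalZ mevalXU bformZr mulrC.
Qed.

Lemma form_poly_dder z q u w : (forall y, q.@[vcoord y] = B z y) -> dder q u w = B z w.
Proof.
move=> hq; rewrite (@dder_line _ _ _ _ _ ((B z u)%:P + (B z w)%:P * 'X)).
  by rewrite coefD coefC coefCM coefX mulr1 add0r.
by move=> t; rewrite hq bformDr bformZr !hornerE mulrC.
Qed.

(** The invariants [\tr (ad ^+ j.+1)] give [\sum_i T i x ^+ j * T i y = 0] for all [j].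
    Interpolation isolates the indices with a given [T i x], which share the same [T i y], so all
    weights of [y] vanish and [y] is central. The linear invariants [B z] with [z] central put [y]
    in the derived algebra as well. *)
Lemma invariants_separate y : br x y = 0 ->
  (forall q, G_invariant c q -> dder q x y = 0) -> y = 0.
Proof.
move=> xy h; pose T i := weight c P i; have xx := brkxx lieP x.
have [uP _ hT hg] := cartanP; have [g1 g2 _] := hg y xy.
have tr j : \sum_i T i x ^+ j * T i y = 0.
  have [q hq] := trace_poly j.+1.
  have Gq : G_invariant c q.
    by move=> z zn u; rewrite !hq expad_trace //; exists n.+1.
  have := h q Gq; pose f := \sum_i ((T i x)%:P + (T i y)%:P * 'X) ^+ j.+1.
  rewrite (@dder_line _ _ _ _ _ f) => [|t].
    rewrite -horner_deriv0 /f raddf_sum horner_sum => e.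
    have e2 : j.+1%:R * (\sum_i T i x ^+ j * T i y) = 0; last first.
      by move/eqP: e2; rewrite mulf_eq0 (negPf (natr_neq0 char0 (ltn0Sn j))) => /eqP.
    rewrite -[RHS]e mulr_sumr.
    apply: eq_bigr => i _ /=; rewrite deriv_exp derivD derivC derivM derivC derivX.
    by rewrite mul0r !add0r mulr1 hornerMn !hornerE /= -mulr_natr; ring.
  have ext : br x (x + t *: y) = 0 by rewrite brkDr brkZr xx xy scaler0 addr0.
  rewrite hq (eigenbasis_trace uP (eigenbasis_exp j.+1 (hT _ ext))) /f horner_sum.
  apply: eq_bigr => i _; rewrite horner_exp !hornerE addrC [x + _]addrC weight_linear.
  by rewrite [in RHS]mulrC.
have trP (R : {poly k}) : \sum_i R.[T i x] * T i y = 0.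
  under eq_bigr => i _ do rewrite horner_coef mulr_suml.
  rewrite exchange_big big1 // => j _ /=.
  by under eq_bigr => i _ do rewrite -mulrA; rewrite -mulr_sumr tr mulr0.
have T0 i : T i y = 0.
  have [|R hR] := @interpolation k (undup [seq T j x | j <- enum 'I_n.+1]) 1 (fun a => (a == T i x)%:R).
    exact: undup_uniq.
  have ev j : R.[T j x] = (T j x == T i x)%:R.
    have /hR : T j x \in undup [seq T j x | j <- enum 'I_n.+1].
      by rewrite mem_undup (map_f (fun j => T j x)) ?mem_enum.
    rewrite expr1 dvdp_XsubCl /root !hornerE subr_eq0 => /eqP.
    by [].
  have := trP R; under eq_bigr => j _ do rewrite ev.
  rewrite (bigID (fun j => T j x == T i x)) /= [X in _ + X]big1 ?addr0 => [|j /negPf->]; last exact: mul0r.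
  rewrite (eq_bigr (fun=> T i y)) => [|j /eqP e]; last by rewrite e eqxx mul1r; apply: g2.
  rewrite sumr_const -mulr_natr => /eqP; rewrite mulf_eq0 => /orP[/eqP //|].
  by rewrite (negPf (natr_neq0 char0 _)) //; apply/card_gt0P; exists i; exact: (eqxx (T i x)).
have ady : ad y = 0.
  apply: (can_inj (mulKmx uP)); rewrite mulmx0; apply/row_matrixP => i.
  by rewrite row_mul (hT _ xy) -/(T i y) T0 scale0r row0.
apply: (dg_center0 lieP redP formP) => //; apply: (perp_center lieP redP formP) => z z0.
have [q hq] := form_poly z; rewrite -(form_poly_dder x y hq); apply: h.
apply: (Lie_G_invariant char0) => w u; rewrite (form_poly_dder _ _ hq) (bformC formP).
by rewrite (form_dg_center lieP formP (brk_dg _ _ _) z0).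
Qed.

Variables (l : nat) (p : 'I_l -> {mpoly k[n.+1]}).
Hypothesis rankP : lie_rank c l.
Hypothesis gensP : forall q, G_invariant c q -> exists Q : {mpoly k[l]}, q = Q \mPo [tuple p i | i < l].

Definition gradmx (u : vec) : 'M[k]_(l, n.+1) := \matrix_(i, j) (p i)^`M(j).@[vcoord u].

Lemma gradmx_mul u w i : (w *m (gradmx u)^T) 0 i = dder (p i) u w.
Proof. by rewrite mxE dderE; apply: eq_bigr => j _; rewrite !mxE mulrC. Qed.

(** The differential of every invariant is a combination of those of the [p i], so these [l]
    differentials at [x] are injective on [g^x], of dimension [r]. Hence [r <= l], while [l] is the
    least dimension of a centralizer. *)
Lemma cartan_rank : r = l /\ \rank (gradmx x) = l.
Proof.
have [_ cr _ _] := cartanP.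
have cap0 : (kermx (ad x) :&: kermx (gradmx x)^T)%MS = 0.
  apply/eqP/rowV0P => y; rewrite sub_capmx => /andP[/sub_kermxP xy /sub_kermxP gy].
  rewrite mul_adm in xy; apply: (invariants_separate xy) => q /gensP [Q ->].
  rewrite dder_comp big1 // => i _.
  by rewrite -gradmx_mul gy mxE mulr0.
have := mxrank_mul_ker (kermx (ad x)) (gradmx x)^T; rewrite cap0 mxrank0 addn0 -/(cent_dim c x) cr => e.
have le1 := mxrankM_maxr (kermx (ad x)) (gradmx x)^T; rewrite e mxrank_tr in le1.
have [_ /(_ x)] := rankP; rewrite cr => le2; have le3 := rank_leq_row (gradmx x).
have erl : r = l by apply/eqP; rewrite eqn_leq le2 (leq_trans le1).
by split=> //; apply/eqP; rewrite eqn_leq le3 (leq_trans le2).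
Qed.

End Invariants.

(** * Centralizers of the elements of an sl_2-triple *)

Section Sl2.
Variables (k : closedFieldType) (n : nat) (c : 'I_n.+1 -> 'I_n.+1 -> 'I_n.+1 -> k).
Variable Bm : 'M[k]_n.+1.
Hypothesis char0 : [pchar k] =i pred0.
Hypothesis lieP : is_lie c.
Hypothesis formP : good_form c Bm.
Local Notation vec := 'rV[k]_n.+1.
Local Notation br := (brk c).
Local Notation ad := (adm c).
Local Notation B := (bform Bm).
Implicit Types (u v z : vec).

Lemma adm_skew z : (ad z *m Bm)^T = - (ad z *m Bm).
Proof.
have entry i j : (ad z *m Bm) i j = B (br z (delta_mx 0 i)) (delta_mx 0 j).
  by rewrite /bform -mul_adm trmx_delta -[_ *m ad z *m Bm]mulmxA -rowE -colE !mxE.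
apply/matrixP => i j; rewrite mxE [RHS]mxE !entry [in RHS](bform_invl lieP formP) opprK.
by rewrite (bformC formP).
Qed.

Lemma rowsub_free (P : 'M[k]_n.+1) m (f : 'I_m -> 'I_n.+1) :
  P \in unitmx -> injective f -> row_free (rowsub f P).
Proof.
move=> uP fI; rewrite -kermx_eq0; apply/rowV0P => w /sub_kermxP.
rewrite rowsubE mulmxA => /(canRL (mulmxK uP)); rewrite mul0mx => /rowP e.
apply/rowP => s; have := e (f s); rewrite mxE (bigD1 s) //= big1 => [|t ts].
  by rewrite !mxE eqxx mulr1 addr0.
by rewrite !mxE (inj_eq fI) (negPf ts) mulr0.
Qed.

Lemma cent_dim_conj z v : nilmx (ad z) -> cent_dim c (v *m expad c z) = cent_dim c v.
Proof.
move=> nz; have uE := expad_unit nz; rewrite /cent_dim !mxrank_ker.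
congr (_ - _)%N; rewrite -(mxrankMfree (ad v) (B := expad c z)) ?row_free_unit //.
rewrite -expad_conj // -[RHS]mxrank_tr trmx_mul mxrankMfree ?mxrank_tr //.
by rewrite row_free_unit unitmx_tr.
Qed.

Variables (e h f : vec).
Hypothesis he : br h e = 2%:R *: e.
Hypothesis ef : br e f = h.
Hypothesis ne : nilmx (ad e).

Lemma sl2_ker_weight v mu : v != 0 -> br e v = 0 -> br h v = mu *: v -> exists i : nat, mu = i%:R.
Proof.
move=> v0 ev hv; apply: (@sl2_weight _ _ char0 (ad e) (ad f) (ad h) mu v) => //.
- by rewrite -(adm_brk lieP) ef.
- by rewrite -(adm_brk lieP) he admZ.
- by rewrite mul_adm.
by rewrite mul_adm.
Qed.

Variables (P : 'M[k]_n.+1) (D : 'I_n.+1 -> int).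
Hypothesis uP : P \in unitmx.
Hypothesis hD : forall i, br h (row i P) = (2%:R * (D i)%:~R) *: row i P.

Let two0 : 2%:R != 0 :> k. Proof. exact: natr_neq0. Qed.
Let intI (a b : int) : a%:~R = b%:~R :> k -> a = b.
Proof.
move=> e0; apply/eqP; rewrite -subr_eq0; apply: contraT => /(intr_neq0 char0).
by rewrite rmorphB /= e0 subrr eqxx.
Qed.

(** [N] and [G] are spanned by the rows with [D < 0] and [D >= 0]. The kernel of [ad e] lies in [G],
    since weights on it are natural numbers, and [B ([e, .], .)] vanishes on [N] for reasons of
    weight. So [N] is paired faithfully with [G] through [ad e], which has rank at least [#|A|] on
    [G]. *)
Lemma sl2_cent_bound : (cent_dim c e + 2 * #|[pred i | (D i < 0)%R]| <= n.+1)%N.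
Proof.
pose A := [pred i | (D i < 0)%R]; pose N : 'M_(#|A|, n.+1) := rowsub (@enum_val _ A) P.
pose G : 'M_(#|[predC A]|, n.+1) := rowsub (@enum_val _ [predC A]) P.
have inN (v : vec) : (v <= N)%MS -> exists a, v = \sum_(i in A) a i *: row i P.
  case/submxP => a ->; exists (fun i => \sum_(s | enum_val s == i) a 0 s).
  rewrite mulmx_sum_row (partition_big (fun s => enum_val s) (mem A)) => [|s _]; last exact: enum_valP.
  apply: eq_bigr => i _; rewrite scaler_suml; apply: eq_bigr => s /eqP <-.
  by rewrite row_rowsub.
have inG i : ~~ (D i < 0)%R -> (row i P <= G)%MS.
  move=> Di; have iA : i \in [predC A] by [].
  by rewrite -(enum_rankK_in iA iA) -row_rowsub row_sub.
have inG' (v : vec) : (v <= G)%MS -> exists a, v = \sum_(i | i \notin A) a i *: row i P.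
  case/submxP => a ->; exists (fun i => \sum_(s | enum_val s == i) a 0 s).
  rewrite mulmx_sum_row (partition_big (fun s => enum_val s) (mem [predC A])) => [|s _].
    apply: eq_bigr => i _; rewrite scaler_suml; apply: eq_bigr => s /eqP <-.
    by rewrite row_rowsub.
  exact: enum_valP.
have eb : eigenbasis (ad h) P (fun i => 2%:R * (D i)%:~R) by move=> i; rewrite mul_adm hD.
have ker v : br e v = 0 -> (v <= G)%MS.
  move=> ev; have st : (kermx (ad e) *m ad h <= kermx (ad e))%MS.
    apply/row_subP => i; apply/sub_kermxP; rewrite row_mul mul_adm mul_adm (jacobi lieP).
    have -> : br e (row i (kermx (ad e))) = 0 by rewrite -mul_adm; apply/sub_kermxP; rewrite row_sub.
    rewrite brk0r addr0 (brkC lieP e) he brkNl brkZl.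
    have -> : br e (row i (kermx (ad e))) = 0 by rewrite -mul_adm; apply/sub_kermxP; rewrite row_sub.
    by rewrite scaler0 oppr0.
  have [|rs [w [-> hw]]] := gev_sum_stable st (v := v); first by apply/sub_kermxP; rewrite mul_adm.
  apply: summx_sub => mu _; have [g wk] := hw mu.
  have [->|w0] := eqVneq (w mu) 0; first exact: sub0mx.
  have hm : br h (w mu) = mu *: w mu by rewrite -mul_adm; apply: (eigenbasis_semisimple uP eb).
  have ew : br e (w mu) = 0 by rewrite -mul_adm; apply/sub_kermxP.
  have [s es] := sl2_ker_weight w0 ew hm.
  have [a ea] := row_comb (w mu) uP; rewrite ea; apply: summx_sub => i _.
  have [->|ai] := eqVneq (a i) 0; first by rewrite scale0r sub0mx.
  rewrite scalemx_sub // inG //.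
  have : \sum_j (a j * (2%:R * (D j)%:~R - mu)) *: row j P = 0.
    rewrite (eq_bigr (fun j => (a j * (2%:R * (D j)%:~R)) *: row j P - mu *: (a j *: row j P))) => [|j _].
      by rewrite sumrB -(eigenbasis_mul _ eb) -scaler_sumr -ea mul_adm hm subrr.
    by rewrite scalerA -scalerBl mulrBr [mu * _]mulrC.
  move=> /(row_comb_eq0 uP) /(_ i) /eqP; rewrite mulf_eq0 (negPf ai) subr_eq0 es /=.
  rewrite -[2%:R]/((2%:Z)%:~R) -[s%:R]/((s%:Z)%:~R) -rmorphM => /eqP /intI; lia.
have ort u v : (u <= N)%MS -> (v <= N)%MS -> B (br e u) v = 0.
  move=> /inN [a ->] /inN [b ->]; rewrite brk_sumr (bform_suml formP) big1 // => i iA.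
  rewrite bform_sumr big1 // => j jA; rewrite brkZr (bformZl formP) bformZr.
  suff -> : B (br e (row i P)) (row j P) = 0 by rewrite !mulr0.
  have := bform_invl lieP formP h (br e (row i P)) (row j P).
  rewrite (jacobi lieP) he !hD brkZl brkZr -scalerDl (bformZl formP) bformZr => /eqP.
  rewrite -addr_eq0 -mulrDl mulf_eq0 => /orP[|/eqP //].
  rewrite -[2%:R]/((2%:Z)%:~R) -!rmorphM -!rmorphD /= => h0; exfalso.
  move: iA jA; rewrite !inE => iA jA; move: h0; apply/negP; apply: (intr_neq0 char0); lia.
have fr : row_free (N *m (ad e *m Bm) *m G^T).
  rewrite -kermx_eq0; apply/rowV0P => w /sub_kermxP; rewrite !mulmxA => e0.
  have uN : (w *m N <= N)%MS by apply: submxMl.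
  suff /ker uG : br e (w *m N) = 0.
    have fN : row_free N by apply: rowsub_free => //; exact: enum_val_inj.
    apply: (row_free_inj fN); rewrite mul0mx.
    have [a ea] := inN _ uN; have [b eb'] := inG' _ uG; rewrite ea.
    have e2 : \sum_i ((i \in A)%:R * a i - (i \notin A)%:R * b i) *: row i P = 0.
      under eq_bigr => i _ do rewrite scalerBl -!scalerA.
      rewrite sumrB -[X in X - _](_ : w *m N = _); last first.
        rewrite ea big_mkcond; apply: eq_bigr => i _.
        by case: ifP => _; rewrite ?scale1r ?scale0r.
      rewrite {1}eb' big_mkcond; apply/eqP; rewrite subr_eq0; apply/eqP; apply: eq_bigr => i _.
      by case: ifP => _; rewrite ?scale1r ?scale0r.
    rewrite big1 // => i iA; have := row_comb_eq0 uP e2 i.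
    by rewrite iA mul1r mul0r subr0 => ->; rewrite scale0r.
  apply: (bform_nondeg formP) => v; have [b ->] := row_comb v uP.
  rewrite bform_sumr big1 // => i _; rewrite bformZr.
  have [Di|Di] := boolP (D i < 0)%R.
    rewrite ort ?mulr0 //; have iA : i \in A by [].
    by rewrite -(enum_rankK_in iA iA) -row_rowsub row_sub.
  have /submxP [s ->] := inG _ Di.
  by rewrite /bform trmx_mul -mul_adm !mulmxA e0 mul0mx mxE mulr0.
have capk : (\rank (kermx (ad e)) <= \rank (G :&: kermx (ad e)))%N.
  apply: mxrankS; rewrite sub_capmx submx_refl andbT; apply/row_subP => i; apply: ker.
  by rewrite -mul_adm; apply/sub_kermxP; rewrite row_sub.
have rG : (#|A| <= \rank (G *m ad e))%N.
  have e1 : N *m (ad e *m Bm) *m G^T = - (G *m ad e *m (Bm *m N^T))^T.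
    have [sym _] := formP; have sk := adm_skew e; rewrite trmx_mul sym in sk.
    have -> : (G *m ad e *m (Bm *m N^T))^T = N *m (Bm *m (ad e)^T) *m G^T.
      by rewrite !trmx_mul !trmxK sym !mulmxA.
    by rewrite sk mulmxN mulNmx opprK.
  have := mxrankM_maxl (G *m ad e) (Bm *m N^T).
  by rewrite -mxrank_tr -[X in (\rank X <= _)%N]opprK -e1 mxrank_opp (eqP fr).
have e1 : (#|A| + #|[predC A]| = n.+1)%N by rewrite cardC card_ord.
have arith a b rg rk rc rgk : (a + b = n.+1 -> rk <= rc -> a <= rgk -> rgk + rc = rg ->
    rg <= b -> rk + 2 * a <= n.+1)%N by lia.
exact: arith _ _ _ _ _ _ e1 capk rG (mxrank_mul_ker G (ad e)) (rank_leq_row G).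
Qed.

Lemma expad_quadratic z v : nilmx (ad z) -> br z (br z (br z v)) = 0 ->
  v *m expad c z = v + br z v + 2%:R^-1 *: br z (br z v).
Proof.
move=> nz z3; rewrite (@expad_sum _ _ c z n.+3 nz); last by rewrite ltnW.
have d3 j : v *m dpow c z j.+3 = 0.
  by rewrite dpowE !exprS -[LHS]scalemxAr -![_ * _]/(_ *m _) !mulmxA !mul_adm z3 mul0mx scaler0.
rewrite mulmx_sumr 3!big_ord_recl big1 ?addr0 => [|i _]; last exact: d3.
rewrite dpow0 mulmx1 addrA; congr (_ + _ + _).
  by rewrite dpowE invr1 scale1r expr1 mul_adm.
by rewrite dpowE -[LHS]scalemxAr !exprS expr0 mulr1 -[_ * _]/(_ *m _) mulmxA !mul_adm.
Qed.

Hypothesis hf : br h f = - (2%:R *: f).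
Hypothesis nf : nilmx (ad f).
Let cZ a v : a != 0 -> cent_dim c (a *: v) = cent_dim c v.
Proof. by move=> a0; rewrite /cent_dim admZ !mxrank_ker mxrank_scale_nz. Qed.

Let nZ a v : nilmx (ad v) -> nilmx (ad (a *: v)).
Proof. by case=> m hm; exists m; rewrite admZ exprZn hm scaler0. Qed.

Lemma expad_f (s x y z : k) : (x *: e + y *: h + z *: f) *m expad c (s *: f) =
  x *: e + (y - s * x) *: h + (z + 2%:R * s * y - s ^+ 2 * x) *: f.
Proof.
have fe : br f e = - h by rewrite (brkC lieP) ef.
have fh : br f h = 2%:R *: f by rewrite (brkC lieP) hf opprK.
have ff : br f f = 0 by exact: brkxx.
set v := x *: e + y *: h + z *: f; have e1 : br (s *: f) v = - (s * x) *: h + (2%:R * s * y) *: f.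
  rewrite /v brkZl !brkDr !brkZr fe fh ff scaler0 addr0 scalerDr !scalerA scalerN scaleNr.
  by congr (_ + _ *: _); ring.
have e2 : br (s *: f) (br (s *: f) v) = - (2%:R * s ^+ 2 * x) *: f.
  rewrite e1 brkZl !brkDr !brkZr fh ff scaler0 addr0 !scalerA.
  by congr (_ *: _); ring.
rewrite expad_quadratic ?e2 ?e1; [|exact: nZ|by rewrite brkZl brkZr ff !scaler0].
have aux (E H F H' F' F'' : vec) : E + H + F + (H' + F') + F'' = E + (H + H') + (F + F' + F'').
  by rewrite -!addrA; congr (_ + (_ + _)); rewrite addrCA.
rewrite scalerA /v aux -!scalerDl; congr (_ + _ *: _ + _ *: _).
by field; rewrite two0.
Qed.

Lemma sl2_conj (s a b d : k) : cent_dim c (a *: e + b *: h + d *: f) =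
    cent_dim c (a *: e + (b - s * a) *: h + (d + 2%:R * s * b - s ^+ 2 * a) *: f).
Proof. by rewrite -expad_f cent_dim_conj //; exact: nZ. Qed.

Lemma sl2_conj_h (y z : k) : y != 0 -> cent_dim c (y *: h + z *: f) = cent_dim c h.
Proof.
move=> y0; have := sl2_conj (- z / (2%:R * y)) 0 y z; rewrite !mulr0 !subr0 scale0r !add0r => ->.
have -> : z + 2%:R * (- z / (2%:R * y)) * y = 0 by field; rewrite two0 y0.
by rewrite scale0r addr0 cZ.
Qed.

End Sl2.

Section Combination.
Variables (k : closedFieldType) (n : nat) (c : 'I_n.+1 -> 'I_n.+1 -> 'I_n.+1 -> k).
Hypothesis char0 : [pchar k] =i pred0.
Hypothesis lieP : is_lie c.
Local Notation br := (brk c).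

(** Conjugation by exponentials of [f] and [e] preserves [cent_dim] and carries a nonzero
    combination to a nonzero multiple of [e], [h] or [f]. *)
Lemma sl2_combination e h f r (x y z : k) :
  br h e = 2%:R *: e -> br e f = h -> nilmx (adm c e) ->
  br h f = - (2%:R *: f) -> nilmx (adm c f) ->
  (cent_dim c e <= r)%N -> (cent_dim c h <= r)%N -> (cent_dim c f <= r)%N ->
  (x, y, z) != (0, 0, 0) -> (cent_dim c (x *: e + y *: h + z *: f) <= r)%N.
Proof.
move=> he ef ne hf nf ce ch cf nz.
have cZ a v : a != 0 -> cent_dim c (a *: v) = cent_dim c v.
  by move=> a0; rewrite /cent_dim admZ !mxrank_ker mxrank_scale_nz.
have [x0|x0] := eqVneq x 0; last first.
  (* This value of the parameter kills the coefficient of [h]. If [x e + w f] remains with [w != 0],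
     a square root [s] of [w / x] kills the coefficient of [f], and the triple with [e] and [f]
     exchanged leads to a multiple of [h]. *)
  rewrite (sl2_conj char0 lieP ef hf nf (y / x)) divfK // subrr scale0r addr0.
  set w := z + _ - _; have [->|w0] := eqVneq w 0; first by rewrite scale0r addr0 cZ.
  have [s es] : exists s, s ^+ 2 = w / x.
    have /closed_rootP [s] : size ('X^2 - (w / x)%:P : {poly k}) != 1 by rewrite size_XnsubC.
    by rewrite /root !hornerE subr_eq0 => /eqP; exists s.
  have s0 : s != 0.
    apply/eqP => s0; move/eqP: es; rewrite s0 expr0n /= eq_sym mulf_eq0 invr_eq0 (negPf x0).
    by rewrite (negPf w0).
  have := sl2_conj char0 lieP ef hf nf s x 0 w; rewrite scale0r addr0 es divfK // mulr0 addr0 subrr scale0r addr0 sub0r => ->.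
  have fe : br f e = - h by rewrite (brkC lieP) ef.
  have h'e : br (- h) e = - (2%:R *: e) by rewrite brkNl he.
  have := sl2_conj_h char0 lieP fe h'e ne x (mulf_neq0 s0 x0).
  rewrite scalerN -scaleNr addrC => ->.
  by rewrite -scaleN1r cZ ?oppr_eq0 ?oner_eq0.
have [y0|y0] := eqVneq y 0.
  rewrite x0 y0 !scale0r !add0r cZ //.
  by move: nz; rewrite x0 y0; apply: contraNneq => ->.
by rewrite x0 scale0r add0r (sl2_conj_h char0 lieP ef hf nf).
Qed.

End Combination.

(** * Roots, coroots and simple roots *)

Section Roots.
Import Order.TTheory Num.Theory.
Variables (k : closedFieldType) (n : nat) (c : 'I_n.+1 -> 'I_n.+1 -> 'I_n.+1 -> k).
Variable Bm : 'M[k]_n.+1.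
Hypothesis char0 : [pchar k] =i pred0.
Hypothesis lieP : is_lie c.
Hypothesis redP : reductive c.
Hypothesis formP : good_form c Bm.
Local Notation vec := 'rV[k]_n.+1.
Local Notation br := (brk c).
Local Notation ad := (adm c).
Local Notation B := (bform Bm).
Implicit Types (v z t : vec).
Variables (x : vec) (P : 'M[k]_n.+1) (r : nat).
Hypothesis cartanP : cartan_data c x P r.
Local Notation T := (weight c P).
Local Notation E i := (row i P).

Let xx : br x x = 0. Proof. exact: brkxx. Qed.
Let uP : P \in unitmx. Proof. exact: cartan_unit cartanP. Qed.
Let eig t i : br x t = 0 -> br t (E i) = T i t *: E i. Proof. by have [_ _ h _] := cartanP => /h e; rewrite -mul_adm e. Qed.
Let wt0 i t : br x t = 0 -> T i x = 0 -> T i t = 0.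
Proof. by have [_ _ _ h] := cartanP => /h [g _ _]; exact: g. Qed.
Let wteq i j t : br x t = 0 -> T i x = T j x -> T i t = T j t.
Proof. by have [_ _ _ h] := cartanP => /h [_ g _]; exact: g. Qed.
Let wtD i j m t : br x t = 0 -> T i x + T j x = T m x -> T i t + T j t = T m t.
Proof. by have [_ _ _ h] := cartanP => /h [_ _ g]; exact: g. Qed.

Lemma weightZ i a t : T i (a *: t) = a * T i t.
Proof.
have w0 : T i 0 = 0 by rewrite /weight adm0 mulmx0 mul0mx mxE.
by rewrite -[a *: t]addr0 weight_linear w0 addr0.
Qed.

Lemma weight_sum I (s : seq I) (A : pred I) (g : I -> vec) i :
  T i (\sum_(j <- s | A j) g j) = \sum_(j <- s | A j) T i (g j).
Proof.
apply: (big_morph (T i)) => [u v|]; last by rewrite -[0](scale0r 0) weightZ mul0r.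
by rewrite -[u in LHS]scale1r weight_linear mul1r.
Qed.

Lemma row_unit_neq0 i : E i != 0.
Proof.
apply/eqP => e; have : \sum_j (j == i)%:R *: E j = 0.
  rewrite (bigD1 i) //= eqxx scale1r e add0r big1 // => j /negPf ->.
  by rewrite scale0r.
by move=> /(row_comb_eq0 uP) /(_ i) /eqP; rewrite eqxx oner_eq0.
Qed.

Lemma eigen_row v a : br x v = a *: v -> v != 0 -> exists m, T m x = a.
Proof.
move=> e v0; have [b ev] := row_comb v uP.
case: (classic (exists m, b m != 0)) => [[m bm]|nb]; last first.
  case/eqP: v0; rewrite ev big1 // => m _; have [->|bm] := eqVneq (b m) 0; first by rewrite scale0r.
  by case: nb; exists m.
exists m; have : \sum_j (b j * (T j x - a)) *: E j = 0.
  rewrite (eq_bigr (fun j => br x (b j *: E j) - a *: (b j *: E j))) => [|j _].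
    by rewrite sumrB -brk_sumr -scaler_sumr -ev e subrr.
  by rewrite brkZr eig // !scalerA -scalerBl mulrBr [a * _]mulrC.
by move=> /(row_comb_eq0 uP) /(_ m) /eqP; rewrite mulf_eq0 (negPf bm) subr_eq0 => /eqP.
Qed.

Lemma opp_exists i : exists j, B (E i) (E j) != 0.
Proof.
apply/existsP; apply: contraT; rewrite negb_exists => /forallP h.
case/eqP: (row_unit_neq0 i); apply: (bform_nondeg formP) => v; have [b ->] := row_comb v uP.
rewrite bform_sumr big1 // => j _; rewrite bformZr.
by have := h j; rewrite negbK => /eqP ->; rewrite mulr0.
Qed.

Definition opp_row i := proj1_sig (constructive_indefinite_description _ (opp_exists i)).
Lemma opp_rowP i : B (E i) (E (opp_row i)) != 0.
Proof. exact: proj2_sig (constructive_indefinite_description _ (opp_exists i)). Qed.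

Lemma opp_weight i t : br x t = 0 -> T (opp_row i) t = - T i t.
Proof.
move=> xt; have := bform_invl lieP formP t (E i) (E (opp_row i)).
rewrite !eig // (bformZl formP) bformZr => /eqP; rewrite -addr_eq0 -mulrDl mulf_eq0.
by rewrite (negPf (opp_rowP i)) orbF addrC addr_eq0 => /eqP.
Qed.

Lemma oppv_exists i : exists f : vec, (forall t, br x t = 0 -> br t f = - T i t *: f) /\ B (E i) f = 1.
Proof.
exists ((B (E i) (E (opp_row i)))^-1 *: E (opp_row i)); split=> [t xt|].
  by rewrite brkZr eig // opp_weight // !scalerA mulrC.
by rewrite bformZr mulVf // opp_rowP.
Qed.

Definition oppv i : vec := proj1_sig (constructive_indefinite_description _ (oppv_exists i)).
(** The vector representing the weight [T i] under the form ([coroot_form]); [corooth] is its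
    normalization as a coroot. *)
Definition corootv i : vec := br (E i) (oppv i).
Local Notation F := oppv.
Local Notation tt := corootv.

Lemma opp_eigen i t : br x t = 0 -> br t (F i) = - T i t *: F i.
Proof. by have [h _] := proj2_sig (constructive_indefinite_description _ (oppv_exists i)); exact: h. Qed.

Lemma opp_form i : B (E i) (F i) = 1.
Proof. by have [_ h] := proj2_sig (constructive_indefinite_description _ (oppv_exists i)). Qed.

Lemma coroot_cent i : br x (tt i) = 0.
Proof.
by rewrite /tt (jacobi lieP) (eig i xx) (opp_eigen i xx) brkZl brkZr -scalerDl subrr scale0r.
Qed.

Lemma coroot_form i t : br x t = 0 -> B (tt i) t = T i t.
Proof.
move=> xt; rewrite (bform_inv formP) (brkC lieP) opp_eigen // scaleNr opprK bformZr opp_form.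
exact: mulr1.
Qed.

Lemma coroot_trace i t : br x t = 0 -> \sum_m T m (tt i) * T m t = T i t.
Proof.
move=> xt; rewrite -coroot_form // (form_kap lieP redP formP) ?brk_dg // /kap.
rewrite (@eigenbasis_trace _ _ _ P (fun m => T m (tt i) * T m t)) // => m.
by rewrite mulmxA (mul_adm c (tt i)) (eig m (coroot_cent i)) -scalemxAl (mul_adm c t) (eig m xt) scalerA.
Qed.

Section Root.
Variable i : 'I_n.+1.
Hypothesis ri : T i x != 0.

Lemma root_row_nilp : nilmx (ad (E i)).
Proof. by apply: (root_nilp char0 lieP _ ri); exact: eig. Qed.

(** Otherwise [tt i = [E i, F i]] commutes with the nilpotent [ad (E i)], so all its weights vanish
    by [comm_nilp_eigen], and [coroot_trace] gives [T i x = 0]. *)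
Lemma coroot_neq0 : T i (tt i) != 0.
Proof.
apply/eqP => t0; case/eqP: ri; rewrite -(coroot_trace i xx) big1 // => m _.
suff -> : T m (tt i) = 0 by rewrite mul0r.
apply: (@comm_nilp_eigen _ _ char0 (ad (E i)) (ad (F i)) (ad (tt i)) _ (E m) root_row_nilp).
- by rewrite -(adm_brk lieP).
- apply/eqP; rewrite -subr_eq0 -(adm_brk lieP) (brkC lieP) eig ?coroot_cent // t0 scale0r oppr0 adm0.
  by [].
- exact: row_unit_neq0.
by rewrite mul_adm eig ?coroot_cent.
Qed.

Definition corooth : vec := (2%:R / T i (tt i)) *: tt i.
Definition rootf : vec := (2%:R / T i (tt i)) *: F i.

Lemma corooth_cent : br x corooth = 0.
Proof. by rewrite brkZr coroot_cent scaler0. Qed.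

Lemma corooth_row : br corooth (E i) = 2%:R *: E i.
Proof. by rewrite eig ?corooth_cent // weightZ divfK // coroot_neq0. Qed.

Lemma corooth_f : br corooth rootf = - (2%:R *: rootf).
Proof.
rewrite /rootf brkZr opp_eigen ?corooth_cent // weightZ divfK ?coroot_neq0 //.
by rewrite !scalerA -scaleNr mulrC mulNr.
Qed.

(** The last nonzero [E j *m ad (E i) ^+ m] is killed by [E i], so its weight, which is that of
    [E j] plus [2 m], is a natural number. *)
Lemma corooth_weight j : exists z : int, T j corooth = z%:~R.
Proof.
have [m [w0 we]] := last_nonzero root_row_nilp (row_unit_neq0 j).
have hw s : br corooth (E j *m ad (E i) ^+ s) = (T j corooth + 2%:R * s%:R) *: (E j *m ad (E i) ^+ s).
  elim: s => [|s IH]; first by rewrite expr0 mulmx1 mulr0 addr0 eig ?corooth_cent.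
  rewrite exprSr -[_ * ad _]/(_ *m ad _) mulmxA mul_adm (jacobi lieP) corooth_row IH.
  by rewrite brkZl brkZr -scalerDl; congr (_ *: _); rewrite mulrSr; ring.
have ef : br (E i) rootf = corooth by rewrite /rootf brkZr.
have ew : br (E i) (E j *m ad (E i) ^+ m) = 0 by rewrite -mul_adm -mulmxA -[_ *m ad _]exprSr.
have [s es] := sl2_ker_weight char0 lieP corooth_row ef root_row_nilp w0 ew (hw m).
exists (s%:Z - 2%:Z * m%:Z); apply/eqP; rewrite rmorphB rmorphM /= eq_sym subr_eq eq_sym.
by apply/eqP; exact: es.
Qed.

End Root.

Variable iota : {rmorphism rat -> k}.

(** With [z m] the integral weights of the coroot, [T m (tt i)] is [z m] times half of [T i (tt i)].
    [coroot_trace] at [tt i] then gives [T i (tt i) * N = 4] where [N] is the sum of the squares of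
    the [z m]. *)
Lemma coroot_rational i : T i x != 0 -> exists (g : 'I_n.+1 -> rat) (s : rat), 0 < s /\
  forall m, T m (tt i) = iota (g m) /\ T m (corooth i) = iota (s * g m).
Proof.
move=> ri; have t0 := coroot_neq0 ri.
pose z m : int := proj1_sig (constructive_indefinite_description _ (corooth_weight ri m)).
have zP m : T m (corooth i) = (z m)%:~R.
  exact: proj2_sig (constructive_indefinite_description _ (corooth_weight ri m)).
have tz m : T m (tt i) = T i (tt i) / 2%:R * (z m)%:~R.
  by rewrite -zP /corooth weightZ; field; rewrite t0 natr_neq0.
pose N : rat := \sum_m (z m)%:~R ^+ 2.
have two0 : 2%:R != 0 :> k by exact: natr_neq0.
have tN : T i (tt i) * iota N = 4%:R.
  have := coroot_trace i (coroot_cent i).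
  under eq_bigr => m _ do rewrite tz mulrACA -expr2 -[X in _ * X]expr2.
  rewrite -mulr_sumr => e1; rewrite /N rmorph_sum /=.
  rewrite (eq_bigr (fun m => (z m)%:~R ^+ 2)) => [|m _]; last by rewrite rmorphXn /= rmorph_int.
  apply: (mulfI t0); rewrite -[in RHS]e1; by field; rewrite two0.
have N0 : 0 < N.
  rewrite lt0r; apply/andP; split; last by apply: sumr_ge0 => m _; exact: sqr_ge0.
  apply/eqP => N0; move/eqP: tN; rewrite N0 rmorph0 mulr0 eq_sym.
  by rewrite (negPf (natr_neq0 char0 _)).
have iN : iota N != 0 by rewrite fmorph_eq0 gt_eqF.
exists (fun m => 2%:R * (z m)%:~R / N), (N / 2%:R); split; first by rewrite divr_gt0 ?ltr0n.
move=> m; split.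
  rewrite tz rmorphM rmorphM /= fmorphV rmorph_nat rmorph_int; apply: (mulIf iN).
  rewrite mulfVK // mulrAC [_ / _ * _]mulrAC tN.
  by field; rewrite two0.
rewrite zP -(rmorph_int iota); congr (iota _); field.
by rewrite gt_eqF.
Qed.


Variables (V : k -> Prop) (la : k -> rat).
Hypothesis laP : rat_functional iota V la.
Hypothesis Vx : forall i, V (T i x).
Hypothesis la_neq0 : forall i, T i x != 0 -> la (T i x) != 0.
Local Notation pos i := (0 < la (T i x)).

Let laD i j : la (T i x + T j x) = la (T i x) + la (T j x).
Proof. by have [h _] := laP; have [_ ->] := h _ _ (Vx i) (Vx j). Qed.

Let la0 : la 0 = 0.
Proof. by have [_ h] := laP; have [_] := h 0 _ (Vx 0); rewrite rmorph0 !mul0r. Qed.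

Let pos_root i : pos i -> T i x != 0.
Proof. by move=> h; apply/eqP => e; rewrite e la0 ltxx in h. Qed.

Let opp_pos i : T i x != 0 -> ~~ pos i -> pos (opp_row i).
Proof.
move=> ri; have := la_neq0 ri; rewrite -leNgt le_eqVlt => /negPf -> /= h.
have := laD i (opp_row i); rewrite opp_weight // subrr la0 => /esym/eqP.
by rewrite addrC addr_eq0 => /eqP ->; rewrite oppr_gt0.
Qed.

(* A simple root is represented by the first row of its weight. *)
Definition simple i := [&& pos i,
  [forall j, forall m, pos j && pos m ==> (T i x != T j x + T m x)] &
  [forall j : 'I_n.+1, (j < i)%N ==> (T j x != T i x)]].

Let simple_pos i : simple i -> pos i. Proof. by case/and3P. Qed.

Let simple_ind i j m : simple i -> pos j -> pos m -> T i x != T j x + T m x.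
Proof. by case/and3P => _ /forallP /(_ j) /forallP /(_ m) /implyP h _ pj pm; apply: h; rewrite pj. Qed.

(** A nonzero bracket has weight [T j - T i]. If that is 0, the two equal weights contradict the
    choice of first rows; otherwise it or its opposite is positive, and one of the two simple
    weights is a sum of positive ones. *)
Lemma simple_kill i j : simple i -> simple j -> i != j -> br (F i) (E j) = 0.
Proof.
move=> si sj ij; apply/eqP; apply: contraT => nz.
have e1 : br x (br (F i) (E j)) = (T j x - T i x) *: br (F i) (E j).
  by rewrite (jacobi lieP) (opp_eigen i xx) (eig j xx) brkZl brkZr -scalerDl addrC.
have [m em] := eigen_row e1 nz; have [m0|m0] := eqVneq (T m x) 0.
  have eij : T j x = T i x by apply/eqP; rewrite -subr_eq0 -em m0.
  move: ij; rewrite -val_eqE /= neq_ltn => /orP[lt|lt].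
    by case/and3P: sj => _ _ /forallP /(_ i) /implyP /(_ lt); rewrite eij eqxx.
  by case/and3P: si => _ _ /forallP /(_ j) /implyP /(_ lt); rewrite eij eqxx.
have [pm|npm] := boolP (pos m).
  have := simple_ind sj (simple_pos si) pm; rewrite em addrC subrK eqxx.
  by [].
have := simple_ind si (simple_pos sj) (opp_pos m0 npm).
by rewrite opp_weight // em opprB addrC subrK eqxx.
Qed.

(** The rational inner products of the roots, taken by choice; meaningful for positive [i]
    ([gramP]). *)
Definition gram i : 'I_n.+1 -> rat := epsilon (inhabits (fun=> 0)) (fun g => exists s : rat, 0 < s /\
  forall m, T m (tt i) = iota (g m) /\ T m (corooth i) = iota (s * g m)).

Lemma gramP i : pos i -> exists s : rat, 0 < s /\
  forall m, T m (tt i) = iota (gram i m) /\ T m (corooth i) = iota (s * gram i m).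
Proof.
move=> pi; apply: (epsilon_spec (inhabits _)
  (fun g => exists s : rat, 0 < s /\ forall m, T m (tt i) = iota (g m) /\ T m (corooth i) = iota (s * g m))).
exact: coroot_rational (pos_root pi).
Qed.

Lemma gramE i m : pos i -> T m (tt i) = iota (gram i m).
Proof. by move=> /gramP [s [_ /(_ m) []]]. Qed.

Lemma gram_sum i j : pos i -> pos j -> gram j i = \sum_m gram i m * gram j m.
Proof.
move=> pi pj; apply: (fmorph_inj iota); rewrite -gramE // -(coroot_trace i (coroot_cent j)) rmorph_sum.
by apply: eq_bigr => m _ /=; rewrite !gramE // rmorphM.
Qed.

(** [E j] is killed by [rootf i], so it is a highest weight vector for the triple with the roles of
    [e] and [f] exchanged, and [- corooth i] acts on it by a natural number. *)
Lemma gram_le0 i j : simple i -> simple j -> i != j -> gram i j <= 0.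
Proof.
move=> si sj ij; have pi := simple_pos si; have ri := pos_root pi.
have [s [s0 hs]] := gramP pi; have [_ e1] := hs j.
have he : br (- corooth i) (rootf i) = 2%:R *: rootf i by rewrite brkNl (corooth_f ri) opprK.
have ef : br (rootf i) (E i) = - corooth i by rewrite (brkC lieP) /rootf brkZr.
have nf : nilmx (ad (rootf i)).
  apply: (@root_nilp _ _ c char0 lieP x (- T i x)); last by rewrite oppr_eq0.
  by rewrite /rootf brkZr (opp_eigen i xx) !scalerA mulrC.
have ev : br (rootf i) (E j) = 0 by rewrite /rootf brkZl simple_kill // scaler0.
have hv : br (- corooth i) (E j) = - iota (s * gram i j) *: E j.
  by rewrite brkNl (eig j (corooth_cent i)) e1 scaleNr.
have [m em] := sl2_ker_weight char0 lieP he ef nf (row_unit_neq0 j) ev hv.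
have : s * gram i j = - m%:R.
  by apply: (fmorph_inj iota); rewrite rmorphN rmorph_nat -em opprK.
by move=> e; rewrite -(pmulr_rle0 _ s0) e oppr_le0 ler0n.
Qed.

(** [p] and [m] are the positive and negative parts of [q]. By hypothesis the squared norm of the
    combination with coefficients [p] is a mixed sum of terms [p j * m i * gram i j], at most 0 by
    [gram_le0]. So this combination vanishes, and [la], positive on simple weights, forces
    [p = 0]. *)
Lemma simple_independent (q : 'I_n.+1 -> rat) :
  (forall j, simple j -> \sum_(i | simple i) q i * gram i j = 0) -> forall i, simple i -> q i <= 0.
Proof.
move=> hq i0 si0; pose p i := Num.max (q i) 0; pose m i := p i - q i.
have p0 i : 0 <= p i by rewrite /p le_max lexx orbT.
have m0 i : 0 <= m i by rewrite /m subr_ge0 /p le_max lexx.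
have pm i : p i * m i = 0.
  by rewrite /m /p; case: (leP (q i) 0) => h; rewrite ?mul0r // subrr mulr0.
pose rho s := \sum_(i | simple i) p i * gram i s.
have sq : \sum_s rho s ^+ 2 = \sum_(j | simple j) p j * \sum_(i | simple i) p i * gram i j.
  rewrite (eq_bigr (fun s => \sum_(j | simple j) \sum_(i | simple i) p j * (p i * (gram j s * gram i s)))).
    rewrite exchange_big; apply: eq_bigr => j sj /=; rewrite exchange_big mulr_sumr; apply: eq_bigr => i si /=.
    by rewrite -!mulr_sumr -gram_sum ?simple_pos.
  move=> s _; rewrite expr2 mulr_suml; apply: eq_bigr => j _; rewrite mulr_sumr.
  by apply: eq_bigr => i _; ring.
have le0 : \sum_s rho s ^+ 2 <= 0.
  rewrite sq; apply: sumr_le0 => j sj.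
  have -> : \sum_(i | simple i) p i * gram i j = \sum_(i | simple i) m i * gram i j.
    apply/eqP; rewrite -subr_eq0 -sumrB; apply/eqP; rewrite -[RHS](hq j sj).
    by apply: eq_bigr => i _; rewrite /m; ring.
  rewrite mulr_sumr; apply: sumr_le0 => i si; rewrite mulrA.
  have [->|ij] := eqVneq i j; first by rewrite pm mul0r.
  by apply: mulr_ge0_le0; [exact: mulr_ge0 | exact: gram_le0].
have rho0 s : rho s = 0.
  have /eqP e : \sum_s rho s ^+ 2 == 0 by rewrite eq_le le0 sumr_ge0 // => t _; exact: sqr_ge0.
  have /(_ s isT) := psumr_eq0P (fun (a : 'I_n.+1) _ => sqr_ge0 (rho a)) e.
  by move/eqP; rewrite sqrf_eq0 => /eqP.
have ex : \sum_(i | simple i) iota (p i) * T i x = 0.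
  rewrite (eq_bigr (fun i => \sum_s iota (p i * gram i s) * T s x)) => [|i si].
    rewrite exchange_big big1 // => s _ /=.
    by rewrite -mulr_suml -rmorph_sum /= -/(rho s) rho0 rmorph0 mul0r.
  rewrite -(coroot_trace i xx) mulr_sumr; apply: eq_bigr => s _.
  by rewrite gramE ?simple_pos // rmorphM mulrA.
have [lD lZ] := laP.
have [_ ela] : V (\sum_(i | simple i) iota (p i) * T i x) /\
    la (\sum_(i | simple i) iota (p i) * T i x) = \sum_(i | simple i) p i * la (T i x).
  elim/big_rec2: _ => [|i a b _ [Vb eb]].
    by have [] := lZ 0 _ (Vx 0); rewrite rmorph0 !mul0r.
  have [Vi ei] := lZ (p i) _ (Vx i); have [? ->] := lD _ _ Vi Vb.
  by split=> //; rewrite ei eb.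
move/esym/eqP: ela; rewrite ex la0 psumr_eq0 => [|i si]; last by rewrite mulr_ge0 // ltW // simple_pos.
move=> /allP /(_ i0 (mem_index_enum _)); rewrite si0 /= mulf_eq0 (negPf (la_neq0 (pos_root (simple_pos si0)))) orbF.
by move=> /eqP e; rewrite -e /p le_max lexx.
Qed.

(** [gram] restricted to simple indices and completed by the identity is invertible, by
    [simple_independent] applied to a kernel vector and its opposite. The right-hand side 2 is the
    value of [h] on simple roots in a principal triple. *)
Lemma simple_solve : exists a : 'I_n.+1 -> rat,
  forall j, simple j -> \sum_(i | simple i) a i * gram i j = 2%:R.
Proof.
pose M : 'M[rat]_n.+1 := \matrix_(i, j) (if simple i && simple j then gram i j else (i == j)%:R).
have Mj (v : 'rV[rat]_n.+1) j : simple j -> (v *m M) 0 j = \sum_(i | simple i) v 0 i * gram i j.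
  move=> sj; rewrite mxE (bigID simple) /= [X in _ + X]big1 ?addr0 => [|i si].
    by apply: eq_bigr => i si; rewrite mxE si sj.
  rewrite mxE (negPf si) /=; case: eqP => [e|_]; last by rewrite mulr0.
  by rewrite -e (negPf si) in sj.
have uM : M \in unitmx.
  rewrite -row_free_unit -kermx_eq0; apply/rowV0P => v /sub_kermxP vM; apply/rowP => j; rewrite mxE.
  have [sj|sj] := boolP (simple j); last first.
    have := congr1 (fun w : 'rV_n.+1 => w 0 j) vM; rewrite !mxE (bigD1 j) //= big1 => [|i ij].
      by rewrite mxE (negPf sj) andbF eqxx mulr1 addr0.
    by rewrite mxE (negPf sj) andbF (negPf ij) mulr0.
  have h1 : v 0 j <= 0.
    apply: (simple_independent (q := fun i => v 0 i)) => // s ss.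
    by rewrite -Mj // vM mxE.
  have h2 : - v 0 j <= 0.
    apply: (simple_independent (q := fun i => - v 0 i)) => // s ss.
    under eq_bigr => i _ do rewrite mulNr.
    by rewrite sumrN -Mj // vM mxE oppr0.
  by apply/eqP; rewrite eq_le h1 -oppr_le0.
pose a : 'rV[rat]_n.+1 := const_mx 2%:R *m invmx M; exists (fun i => a 0 i) => j sj.
by rewrite -Mj // mulmxKV // mxE.
Qed.


(** A positive weight that splits as a sum of two positive ones is treated by induction on the
    number of rows with smaller [la]; one that does not split is simple at its first row. *)
Lemma simple_height (hh : vec) : br x hh = 0 -> (forall j, simple j -> T j hh = 2%:R) ->
  forall m, pos m -> exists d : nat, (0 < d)%N /\ T m hh = 2%:R * d%:R.
Proof.
move=> xh h2 m; have [b] := ubnP #|[pred j | la (T j x) < la (T m x)]|.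
elim: b m => // b IH m hb pm.
have [/existsP [j /existsP [s /and3P [pj ps /eqP e]]]|nd] :=
    boolP [exists j, exists s, [&& pos j, pos s & T m x == T j x + T s x]].
  have lt u w : pos u -> pos w -> T m x = T u x + T w x ->
      (#|[pred a | (la (T a x) < la (T u x))%R]| < b)%N.
    move=> pu pw e'; apply: leq_trans (_ : #|[pred a | (la (T a x) < la (T m x))%R]| <= b)%N; last by rewrite -ltnS.
    have um : la (T u x) < la (T m x) by rewrite e' laD ltrDl.
    apply: proper_card; apply/properP; split.
      by apply/subsetP => a; rewrite !inE => /lt_trans; apply.
    by exists u; rewrite !inE // ltxx.
  have [d1 [d1_gt0 e1]] := IH j (lt _ _ pj ps e) pj.
  have [|d2 [d2_gt0 e2]] := IH s _ ps; first by apply: (lt _ _ ps pj); rewrite addrC.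
  exists (d1 + d2)%N; split; first by rewrite addn_gt0 d1_gt0.
  by rewrite -(wtD xh (esym e)) e1 e2 natrD mulrDr.
exists 1%N; split=> //; rewrite mulr1.
have [m0 /eqP em0 hmin] := arg_minnP (P := fun j : 'I_n.+1 => T j x == T m x) (fun j => nat_of_ord j) (eqxx (T m x)).
rewrite -(wteq xh em0); apply: h2; apply/and3P; split.
- by rewrite em0.
- apply/forallP => j; apply/forallP => s; apply/implyP => /andP [pj ps]; rewrite em0.
  by apply: contra nd => e; apply/existsP; exists j; apply/existsP; exists s; rewrite pj ps.
apply/forallP => j; apply/implyP => jm; rewrite em0; apply: contraL jm => e.
by rewrite -leqNgt; exact: hmin.
Qed.

(** [e] is the sum of the simple root vectors, and [f] has the coefficients of [h], so that [[e, f]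
    = h] because the mixed brackets vanish by [simple_kill]. The last clause says that the weights
    of [h] are even, and 0 only on [g^x]. *)
Lemma cartan_triple : exists e h f, [/\ br x h = 0, br h e = 2%:R *: e, br e f = h,
  br h f = - (2%:R *: f) & forall m, exists D : int, T m h = 2%:R * D%:~R /\ (D = 0 -> T m x = 0)].
Proof.
have [a ha] := simple_solve.
pose h := \sum_(i | simple i) iota (a i) *: tt i; pose e := \sum_(i | simple i) E i.
pose f := \sum_(i | simple i) iota (a i) *: F i.
have xh : br x h = 0.
  by rewrite brk_sumr big1 // => i _; rewrite brkZr coroot_cent scaler0.
have h2 j : simple j -> T j h = 2%:R.
  move=> sj; rewrite weight_sum -(rmorph_nat iota 2) -(ha j sj) rmorph_sum.
  by apply: eq_bigr => i si /=; rewrite weightZ gramE ?simple_pos // rmorphM.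
exists e, h, f; split=> //.
- rewrite /e brk_sumr scaler_sumr; apply: eq_bigr => i si.
  by rewrite (eig i xh) h2.
- rewrite /e brk_suml; apply: eq_bigr => i si; rewrite /f brk_sumr (bigD1 i) //= big1 ?addr0.
    by rewrite brkZr.
  move=> j /andP [sj ji]; rewrite brkZr (brkC lieP) simple_kill // oppr0 scaler0.
  by [].
- rewrite /f brk_sumr scaler_sumr -sumrN; apply: eq_bigr => i si.
  by rewrite brkZr (opp_eigen i xh) h2 // scaleNr scalerN !scalerA mulrC.
move=> m; have [m0|m0] := eqVneq (T m x) 0.
  by exists 0; split=> //; rewrite (wt0 xh m0) mulr0.
have [pm|npm] := boolP (pos m).
  have [d [d0 ed]] := simple_height xh h2 pm; exists d%:Z; split=> // - [d00].
  by rewrite d00 in d0.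
have [d [d0 ed]] := simple_height xh h2 (opp_pos m0 npm).
exists (- d%:Z); split; last by move=> /eqP; rewrite oppr_eq0 => /eqP [d00]; rewrite d00 in d0.
by rewrite rmorphN mulrN -ed opp_weight // opprK.
Qed.

End Roots.

(** * The principal sl_2-triple *)

Section Principal.
Variables (k : closedFieldType) (n : nat) (c : 'I_n.+1 -> 'I_n.+1 -> 'I_n.+1 -> k).
Variable Bm : 'M[k]_n.+1.
Hypothesis char0 : [pchar k] =i pred0.
Hypothesis lieP : is_lie c.
Hypothesis redP : reductive c.
Hypothesis formP : good_form c Bm.
Local Notation br := (brk c).
Local Notation ad := (adm c).

(** The bounds of [sl2_cent_bound] for [e] and [f] add up to: the dimensions of [g^e] and [g^f] have
    sum at most twice the number of zero weights, hence at most [2 r]. As each is at least [r], both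
    equal [r]. *)
Theorem principal_triple x P r : cartan_data c x P r -> lie_rank c r ->
  exists e h f, forall a b d : k, (a, b, d) != (0, 0, 0) ->
    cent_dim c (a *: e + b *: h + d *: f) = r.
Proof.
move=> cartanP [_ rmin]; have [uP cx hT hg] := cartanP.
have [iota _] := rat_embedding char0.
have [|V [la [laP Vt Vs]]] := rational_functional_nz iota
    (s := [seq weight c P i x | i <- enum 'I_n.+1 & weight c P i x != 0]) [seq weight c P i x | i <- enum 'I_n.+1].
  by apply/mapP => -[i]; rewrite mem_filter => /andP[/eqP h _] /esym.
have Vx i : V (weight c P i x) by apply: Vt; rewrite (map_f (fun i => weight c P i x)) ?mem_enum.
have lanz i : weight c P i x != 0 -> la (weight c P i x) != 0.
  by move=> h; have [] := Vs (weight c P i x) _; rewrite // (map_f (fun i => weight c P i x)) // mem_filter h mem_enum.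
have [e [h [f [xh he ef hf hD]]]] := cartan_triple char0 lieP redP formP cartanP laP Vx lanz.
pose D m := proj1_sig (constructive_indefinite_description _ (hD m)).
have DP m : weight c P m h = 2%:R * (D m)%:~R /\ (D m = 0 -> weight c P m x = 0).
  exact: proj2_sig (constructive_indefinite_description _ (hD m)).
have two0 : 2%:R != 0 :> k by exact: natr_neq0.
have ne : nilmx (ad e) by apply: (root_nilp char0 lieP he two0).
have nf : nilmx (ad f) by apply: (@root_nilp _ _ c char0 lieP h (- 2%:R)); rewrite ?oppr_eq0 // scaleNr.
have hP m : br h (row m P) = (2%:R * (D m)%:~R) *: row m P.
  by have [<- _] := DP m; rewrite -mul_adm hT.
have b1 := sl2_cent_bound char0 lieP formP he ef ne uP hP.
have fe : br f e = - h by rewrite (brkC lieP) ef.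
have h'f : br (- h) f = 2%:R *: f by rewrite brkNl hf opprK.
have hP' m : br (- h) (row m P) = (2%:R * (- D m)%:~R) *: row m P.
  by rewrite brkNl hP rmorphN mulrN scaleNr.
have b2 := sl2_cent_bound char0 lieP formP h'f fe nf uP hP'.
have zero : (#|[pred m | D m == 0]| <= r)%N.
  pose A := [pred m | D m == 0]; pose N : 'M_(#|A|, n.+1) := rowsub (@enum_val _ A) P.
  have /eqP <- : row_free N by apply: rowsub_free => //; exact: enum_val_inj.
  rewrite -cx; apply: mxrankS; apply/row_subP => s; apply/sub_kermxP.
  rewrite row_rowsub hT ?brkxx //; have [_ ->] := DP (enum_val s); first by rewrite scale0r.
  by have := enum_valP s; rewrite inE => /eqP.
have tot : (#|[pred m | D m == 0]| + #|[pred m | (D m < 0)%R]| + #|[pred m | (- D m < 0)%R]| = n.+1)%N.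
  rewrite -[RHS](card_ord n.+1) -(cardC [pred m | D m == 0]) -addnA; congr (_ + _)%N.
  rewrite -(cardID [pred m | (D m < 0)%R] [predC [pred m | D m == 0]]); congr (_ + _)%N.
    by apply: eq_card => m; rewrite !inE; lia.
  by apply: eq_card => m; rewrite !inE; lia.
have re := rmin e; have rf := rmin f.
have arith z0 p q u v : (u + 2 * p <= n.+1 -> v + 2 * q <= n.+1 -> z0 <= r -> z0 + p + q = n.+1 ->
    r <= u -> r <= v -> u <= r /\ v <= r)%N by lia.
have [ce cf] := arith _ _ _ _ _ b1 b2 zero tot re rf.
have ch : (cent_dim c h <= r)%N.
  rewrite -cx; apply: mxrankS; apply/row_subP => s; apply/sub_kermxP.
  have : row s (kermx (ad h)) *m ad h = 0 by apply/sub_kermxP; rewrite row_sub.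
  have [a ->] := row_comb (row s (kermx (ad h))) uP.
  rewrite (eigenbasis_mul _ (hT _ xh)) (eigenbasis_mul _ (hT _ (brkxx lieP x))) => /(row_comb_eq0 uP) ha.
  rewrite big1 // => m _; have /eqP := ha m; rewrite mulf_eq0 => /orP[/eqP->|]; first by rewrite mul0r scale0r.
  have [-> D0] := DP m; rewrite mulf_eq0 (negPf two0) /= => Dm.
  rewrite D0 ?mulr0 ?scale0r //; apply/eqP; apply: contraLR Dm => Dm.
  exact: intr_neq0.
exists e, h, f => a b d nz; apply/eqP; rewrite eqn_leq rmin andbT.
exact: (sl2_combination char0 lieP he ef ne hf nf ce ch cf nz).
Qed.

End Principal.

(** * Bordered determinants of skew matrices *)

Definition bordered (R : comNzRingType) n l (A : 'M[R]_n) (U : 'M[R]_(n, l)) : 'M[R]_(n + l) :=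
  block_mx A U U^T 0.

Section Bordered.
Variables (k : fieldType) (n l : nat).
Implicit Types (A : 'M[k]_n) (G : 'M[k]_(l, n)) (U : 'M[k]_(n, l)).

Lemma singular_det m (M : 'M[k]_m) (v : 'rV[k]_m) : v != 0 -> v *m M = 0 -> \det M = 0.
Proof.
move=> v0 vM; apply/eqP; apply: contraNT v0 => dM.
have uM : M \in unitmx by rewrite unitmxE unitfE.
by rewrite -(mulmxK uM v) vM mul0mx.
Qed.

Lemma unit_det m (M : 'M[k]_m) : (forall v : 'rV[k]_m, v *m M = 0 -> v = 0) -> \det M != 0.
Proof.
move=> h; rewrite -unitfE -unitmxE -row_free_unit -kermx_eq0; apply/rowV0P => v /sub_kermxP.
exact: h.
Qed.

Lemma bordered_eq0 A U (v : 'rV[k]_n) : v != 0 -> v *m A = 0 -> v *m U = 0 -> \det (bordered A U) = 0.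
Proof.
move=> v0 vA vU; apply: (@singular_det _ _ (row_mx v 0)).
  by apply: contra v0; rewrite row_mx_eq0 => /andP[].
by rewrite /bordered mul_row_block vA vU !mul0mx !addr0 row_mx0.
Qed.

Lemma bordered_neq0 A G U : A^T = - A -> G *m A = 0 -> (kermx A <= G)%MS -> G *m U \in unitmx ->
  \det (bordered A U) != 0.
Proof.
move=> skA GA kA uGU; apply: unit_det => v; rewrite -[v]hsubmxK mul_row_block mulmx0 addr0.
set a := lsubmx v; set w := rsubmx v => /eqP.
rewrite row_mx_eq0 => /andP [/eqP e1 /eqP e2].
have AG : A *m G^T = 0.
  by rewrite -[A]trmxK skA linearN /= mulNmx -trmx_mul GA trmx0 oppr0.
have w0 : w = 0.
  have : w *m (G *m U)^T = 0.
    have := congr1 (fun M => M *m G^T) e1; rewrite mul0mx mulmxDl -mulmxA AG mulmx0 add0r.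
    by rewrite -mulmxA -trmx_mul.
  by move/(canRL (mulmxK _)); rewrite unitmx_tr => /(_ uGU); rewrite mul0mx.
have /submxP [s es] : (a <= G)%MS.
  by apply: (submx_trans _ kA); apply/sub_kermxP; rewrite -[LHS]addr0 -[X in _ + X](mul0mx _ U^T) -w0.
move: e2; rewrite es -mulmxA => /(canRL (mulmxK uGU)); rewrite mul0mx => s0.
by rewrite w0 s0 mul0mx row_mx0.
Qed.

(** If [G *m U] and [G *m U'] are invertible and [G] contains the kernel of [A], then
    [U' = A Y + U C], and row and column operations multiply the bordered determinant by
    [\det C ^+ 2], the square of the ratio of the two minors. In the other cases both sides
    vanish. *)
Lemma bordered_minor A G U U' : A^T = - A -> G *m A = 0 ->
  \det (bordered A U) * \det (G *m U') ^+ 2 = \det (bordered A U') * \det (G *m U) ^+ 2.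
Proof.
move=> skA GA.
have sing V W : \det (G *m V) = 0 -> \det (bordered A V) * \det (G *m W) ^+ 2 = 0.
  move=> dV; have [w [w0 wV]] : exists w : 'rV[k]_l, w != 0 /\ w *m (G *m V) = 0.
    have : ~~ row_free (G *m V) by rewrite row_free_unit unitmxE unitfE dV eqxx.
    rewrite -kermx_eq0 => /rowV0Pn [w /sub_kermxP wV w0]; by exists w.
  have [wG|wG] := eqVneq (w *m G) 0.
    by rewrite (@singular_det _ (G *m W) w) ?expr0n ?mulr0 // mulmxA wG mul0mx.
  by rewrite (@bordered_eq0 A V (w *m G)) ?mul0r // -mulmxA ?GA ?mulmx0.
have [dU|dU] := eqVneq (\det (G *m U)) 0; first by rewrite (sing U) // dU expr0n mulr0.
have [dU'|dU'] := eqVneq (\det (G *m U')) 0; first by rewrite (sing U') // dU' expr0n mulr0.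
have uU : G *m U \in unitmx by rewrite unitmxE unitfE.
have uU' : G *m U' \in unitmx by rewrite unitmxE unitfE.
have [kA|] := boolP (kermx A <= G)%MS; last first.
  move=> nk; have [v vA vG] : exists2 v : 'rV[k]_n, v *m A = 0 & ~~ (v <= G)%MS.
    have [i hi] := row_subPn nk; exists (row i (kermx A)) => //.
    by apply/sub_kermxP; rewrite row_sub.
  have z V : G *m V \in unitmx -> \det (bordered A V) = 0.
    move=> uV; apply: (@bordered_eq0 A V (v - v *m V *m invmx (G *m V) *m G)).
    - by apply: contraNneq vG => /eqP; rewrite subr_eq0 => /eqP ->; rewrite submxMl.
    - by rewrite mulmxBl vA -[_ *m G *m A]mulmxA GA mulmx0 subr0.
    by rewrite mulmxBl -[_ *m G *m V]mulmxA mulmxKV // subrr.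
  by rewrite !z // !mul0r.
pose C := invmx (G *m U) *m (G *m U').
have GC : G *m (U' - U *m C) = 0 by rewrite mulmxBr mulmxA mulKVmx // subrr.
have [Y eY] : exists Y, U' - U *m C = A *m Y.
  have /submxP [Y eY] : ((U' - U *m C)^T <= A)%MS.
    rewrite submxE; have ck : ((cokermx A)^T <= kermx A)%MS.
      apply/sub_kermxP; apply: trmx_inj.
      by rewrite trmx_mul trmxK skA mulNmx mulmx_coker oppr0 trmx0.
    have /submxP [H eH] := submx_trans ck kA.
    by rewrite -[cokermx A]trmxK eH trmx_mul mulmxA -trmx_mul GC trmx0 mul0mx.
  exists (- Y^T); apply: trmx_inj; rewrite trmx_mul skA [(- Y^T)^T]linearN /= trmxK mulNmx mulmxN opprK.
  exact: eY.
have eU' : U' = A *m Y + U *m C by rewrite -eY subrK.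
pose S := (- Y^T *m A + C^T *m U^T) *m Y + - Y^T *m U *m C.
have e1 : block_mx 1%:M 0 (- Y^T) C^T *m bordered A U *m block_mx 1%:M Y 0 C =
          block_mx A U' U'^T S.
  rewrite /bordered !mulmx_block !mul1mx !mul0mx !mulmx1 !mulmx0 !addr0 -eU'.
  by congr block_mx; rewrite eU' raddfD /= !trmx_mul skA mulmxN mulNmx.
have e2 : block_mx 1%:M 0 (- (S *m invmx (G *m U') *m G)) 1%:M *m block_mx A U' U'^T S = bordered A U'.
  rewrite /bordered mulmx_block !mul1mx !mul0mx !addr0; congr block_mx.
    by rewrite mulNmx -mulmxA GA mulmx0 oppr0 add0r.
  by rewrite mulNmx -[_ *m G *m U']mulmxA mulmxKV // addNr.
have := congr1 determinant e2; rewrite det_mulmx det_lblock !det1 !mul1r -e1 !det_mulmx.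
rewrite det_lblock det_ublock !det1 !mul1r det_tr => <-.
have -> : \det C = \det (G *m U') / \det (G *m U) by rewrite det_mulmx det_inv mulrC.
field.
exact: dU.
Qed.

Lemma bordered_scale A U t : t ^+ l * \det (bordered (t *: A) U) = t ^+ n * \det (bordered A U).
Proof.
have e : bordered (t *: A) U *m block_mx 1%:M 0 0 t%:M = block_mx t%:M 0 0 1%:M *m bordered A U.
  rewrite /bordered !mulmx_block !mulmx1 !mulmx0 !mul0mx !mul1mx !addr0 !add0r.
  by rewrite !mul_scalar_mx mul_mx_scalar.
have := congr1 determinant e; rewrite !det_mulmx !det_lblock !det1 !det_scalar mul1r mulr1 => <-.
by rewrite mulrC.
Qed.

Lemma bordered_conj A U (Q : 'M[k]_n) : \det (bordered (Q *m A *m Q^T) (Q *m U)) = \det Q ^+ 2 * \det (bordered A U).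
Proof.
have -> : bordered (Q *m A *m Q^T) (Q *m U) = block_mx Q 0 0 1%:M *m bordered A U *m block_mx Q^T 0 0 1%:M.
  rewrite /bordered !mulmx_block !mulmx1 !mulmx0 !mul0mx !mul1mx !addr0 !add0r trmx_mul.
  by [].
rewrite !det_mulmx !det_lblock !det1 !mulr1 det_tr; ring.
Qed.

End Bordered.

Lemma homogf_pos (k : closedFieldType) n (F : {mpoly k[n]}) d : prime_elt F -> homogf d F -> (0 < d)%N.
Proof.
move=> [F0 Fu _]; case: d => // h; case/negP: Fu.
have e : F = (F.@[fun=> 0])%:MP.
  apply: mpoly_ext => v; rewrite mevalC; have := h 0 v; rewrite expr0 mul1r => <-.
  by apply: meval_eq => i; rewrite mul0r.
have a0 : F.@[fun=> 0] != 0 by apply: contraNneq F0 => z; rewrite e z mpolyC0.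
by rewrite e rmorph_unit // unitfE.
Qed.

(** * Jacobian minors against bordered determinants of [ad] *)

Section GenericSkew.
Variables (k : closedFieldType) (n : nat) (c : 'I_n.+1 -> 'I_n.+1 -> 'I_n.+1 -> k) (l : nat).
Variable Bm : 'M[k]_n.+1.
Local Notation R := {mpoly k[n.+1]}.
Local Notation ad := (adm c).

(** The factor [invmx Bm] makes the matrix skew symmetric and puts the gradients of the invariants
    in its kernel ([skew_adT], [grad_skew]). *)
Definition skew_ad (y : 'rV[k]_n.+1) := invmx Bm *m ad y.

Definition generic_skew : 'M[R]_n.+1 :=
  \sum_i ('X_i : R) *: map_mx (@mpolyC _ k) (skew_ad (delta_mx 0 i)).

Lemma pf_sig (U : 'M[k]_(n.+1, l)) : {q : R | forall y, q.@[vcoord y] = \det (bordered (skew_ad y) U)}.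
Proof.
exists (\det (bordered generic_skew (mxC n.+1 U))) => y.
rewrite -det_map_mx /bordered map_block_mx -map_trmx map_mx0.
have -> : map_mx (meval (vcoord y)) (mxC n.+1 U) = U by apply/matrixP => i j; rewrite /mxC !mxE /= mevalC.
congr (\det (block_mx _ _ _ _)); rewrite /generic_skew raddf_sum /skew_ad.
rewrite [y in RHS]row_sum_delta (big_morph ad (admD c) (adm0 c)) mulmx_sumr.
apply: eq_bigr => i _ /=; rewrite map_mxZ /= mevalXU admZ -scalemxAr; congr (_ *: _).
by apply/matrixP => a b; rewrite mxE mxE /= mevalC.
Qed.

End GenericSkew.

Section Kostant.
Variables (k : closedFieldType) (n : nat) (c : 'I_n.+1 -> 'I_n.+1 -> 'I_n.+1 -> k).
Variable Bm : 'M[k]_n.+1.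
Hypothesis char0 : [pchar k] =i pred0.
Hypothesis lieP : is_lie c.
Hypothesis formP : good_form c Bm.
Local Notation vec := 'rV[k]_n.+1.
Local Notation br := (brk c).
Local Notation ad := (adm c).
Local Notation B := (bform Bm).
Local Notation R := {mpoly k[n.+1]}.
Variables (l : nat) (p : 'I_l -> R).
Hypothesis ranklb : forall y : vec, (l <= cent_dim c y)%N.
Hypothesis GLie : forall q, G_invariant c q -> Lie_invariant c q.
Hypothesis pG : forall i, G_invariant c (p i).
Hypothesis gensP : forall q, G_invariant c q -> exists Q : {mpoly k[l]}, q = Q \mPo [tuple p i | i < l].
Variables (e h f : vec).
Hypothesis tripleP : forall a b d : k, (a, b, d) != (0, 0, 0) ->
  cent_dim c (a *: e + b *: h + d *: f) = l.
Variable x0 : vec.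
Hypothesis gradx0 : \rank (gradmx p x0) = l.

Let J (y : vec) : 'M[k]_(l, n.+1) := gradmx p y.
Local Notation skew_ad := (skew_ad c Bm).
Let A := skew_ad.
Let uB : Bm \in unitmx. Proof. by case: formP => _ []. Qed.
Let symB : Bm^T = Bm. Proof. by case: formP. Qed.

Lemma skew_adT y : (A y)^T = - A y.
Proof.
have e1 := adm_skew lieP formP y; rewrite trmx_mul symB in e1.
rewrite /A /skew_ad trmx_mul trmx_inv symB; apply: (can_inj (mulKmx uB)); apply: (can_inj (mulmxK uB)).
by rewrite mulmxN mulNmx !mulmxA mulmxV // mul1mx e1 mulmxKV // e1.
Qed.

(** Row [i] is [eps_i (y)]: the gradient of [p i] carried to g by the form. *)
Definition epsmx (y : vec) : 'M[k]_(l, n.+1) := J y *m invmx Bm.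

Lemma epsmx_form y i w : B (row i (epsmx y)) w = dder (p i) y w.
Proof.
rewrite /bform /epsmx row_mul mulmxKV // mxE dderE.
by apply: eq_bigr => j _; rewrite !mxE.
Qed.

Lemma epsmx_cent y : epsmx y *m ad y = 0.
Proof.
apply/row_matrixP => i; rewrite row_mul row0 mul_adm; apply: (bform_nondeg formP) => w.
rewrite (bform_invl lieP formP) epsmx_form.
have -> : br y w = (-1) *: br w y + 0 by rewrite addr0 scaleN1r -(brkC lieP).
by rewrite dder_linear (GLie (pG i)) mulr0 add0r dderE big1 ?oppr0 // => j _; rewrite mxE mulr0.
Qed.

Lemma grad_skew y : J y *m A y = 0.
Proof. by rewrite /A /skew_ad mulmxA -/(epsmx y) epsmx_cent. Qed.

Lemma ker_skew y : (\rank (kermx (A y)) = cent_dim c y)%N.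
Proof.
rewrite /cent_dim !mxrank_ker; congr (_ - _)%N.
rewrite -mxrank_tr trmx_mul mxrankMfree ?mxrank_tr // row_free_unit unitmx_tr unitmx_inv.
exact: uB.
Qed.

(* [minor] and [pf] are variables, so that unification cannot expand determinants. *)
Variables minor pf : 'M[k]_(n.+1, l) -> R.
Hypothesis minor_def : forall U, minor U = \det (jacobian p *m mxC n.+1 U).
Hypothesis pfE : forall U y, (pf U).@[vcoord y] = \det (bordered (skew_ad y) U).

Lemma minorE U y : (minor U).@[vcoord y] = \det (J y *m U).
Proof.
rewrite minor_def -det_map_mx map_mxM; congr (\det (_ *m _)).
  by apply/matrixP => i j; rewrite !mxE.
by apply/matrixP => i j; rewrite /mxC !mxE /= mevalC.
Qed.

Let vcoord_surj (v : 'I_n.+1 -> k) : exists y : vec, v =1 vcoord y.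
Proof. by exists (\row_i v i) => i; rewrite /vcoord mxE. Qed.

Lemma poly_ext_vec (u w : R) : (forall y : vec, u.@[vcoord y] = w.@[vcoord y]) -> u = w.
Proof.
move=> ext; apply: mpoly_ext => v; have [y ey] := vcoord_surj v.
by rewrite !(meval_eq _ ey).
Qed.

Lemma pf_minor U U' : pf U * minor U' ^+ 2 = pf U' * minor U ^+ 2.
Proof.
have key (a b a' b' : R) : (forall y : vec, a.@[vcoord y] * b.@[vcoord y] ^+ 2 =
    a'.@[vcoord y] * b'.@[vcoord y] ^+ 2) -> a * b ^+ 2 = a' * b' ^+ 2.
  by move=> h0; apply: poly_ext_vec => y; have := h0 y; rewrite !expr2 !mevalM.
apply: key => y; rewrite (pfE U y) (pfE U' y) (minorE U y) (minorE U' y).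
exact: (bordered_minor U U' (skew_adT y) (grad_skew y)).
Qed.

Lemma pf_regular y : cent_dim c y = l -> exists U, (pf U).@[vcoord y] != 0.
Proof.
move=> ry; have rk : \rank (kermx (A y)) = l by rewrite ker_skew.
have ex m : \rank (kermx (A y)) = m -> exists G : 'M[k]_(m, n.+1), row_free G /\ (G :=: kermx (A y))%MS.
  by move<-; exists (row_base (kermx (A y))); split; [exact: row_base_free | exact: eq_row_base].
have [G [Gf GE]] := ex _ rk; exists (pinvmx G); rewrite pfE; apply: (@bordered_neq0 _ _ _ (A y) G).
- exact: skew_adT.
- by apply/sub_kermxP; rewrite -GE.
- by rewrite GE.
by rewrite mulmxVp // unitmx1.
Qed.

Lemma pf_cent U y : (pf U).@[vcoord y] != 0 -> cent_dim c y = l.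
Proof.
move=> h0; apply/eqP; rewrite eqn_leq ranklb andbT -ker_skew leqNgt; apply: contraNN h0 => lt.
rewrite pfE; have : (kermx (A y) :&: kermx U)%MS != 0.
  apply: contraTneq lt => cap0; rewrite -leqNgt; have := mxrank_mul_ker (kermx (A y)) U.
  by rewrite cap0 mxrank0 addn0 => <-; exact: rank_leq_col.
case/rowV0Pn => v; rewrite sub_capmx => /andP [/sub_kermxP vA /sub_kermxP vU] v0.
by rewrite (bordered_eq0 v0 vA vU).
Qed.

Lemma minor_neq0 : exists U, minor U != 0.
Proof.
have fJ : row_free (J x0) by rewrite /row_free gradx0.
exists (pinvmx (J x0)); apply/eqP => m0; have := minorE (pinvmx (J x0)) x0.
by rewrite m0 meval0 mulmxVp // det1 => /esym/eqP; rewrite oner_eq0.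
Qed.

Let le_l : (l <= n.+1)%N. Proof. by apply: leq_trans (ranklb 0) _; rewrite /cent_dim rank_leq_row. Qed.

Lemma pf_homog U : homogf (n.+1 - l) (pf U).
Proof.
move=> t v; have [y ey] := vcoord_surj v; rewrite (meval_eq _ ey) pfE.
pose g := mmap (@polyC k) (fun i => (y 0 i)%:P * 'X) (pf U).
have gE s : g.[s] = \det (bordered (s *: A y) U).
  rewrite mmap_horner -(_ : A (s *: y) = s *: A y); last by rewrite /A /skew_ad admZ scalemxAr.
  by rewrite -pfE; apply: meval_eq => i; rewrite !hornerE /vcoord mxE mulrC.
have eg : g = (\det (bordered (A y) U)) *: 'X^(n.+1 - l).
  have X0 : 'X^l != 0 :> {poly k} by rewrite monic_neq0 ?monicXn.
  apply: (mulfI X0); rewrite -scalerAr -exprD subnKC //; apply: poly_ext => s.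
  by rewrite hornerM hornerZ !hornerXn gE bordered_scale mulrC.
have := congr1 (fun u : {poly k} => u.[t]) eg; rewrite mmap_horner hornerZ hornerXn mulrC => <-.
by apply: meval_eq => i; rewrite !hornerE ey mulrC.
Qed.

Lemma prime_regular_zero (F : R) d : prime_elt F -> homogf d F ->
  exists y : vec, cent_dim c y = l /\ F.@[vcoord y] = 0.
Proof.
move=> pF hF; have [a [b [ab0 z]]] := homogf_zero (vcoord e) (vcoord h) (homogf_pos pF hF) hF.
exists (a *: e + b *: h); split.
  rewrite -[_ + _]addr0 -[X in _ + X](scale0r f); apply: tripleP.
  by apply: contra ab0 => /eqP [-> ->].
by rewrite -[RHS]z; apply: meval_eq => i; rewrite /vcoord !mxE.
Qed.

(* The quotient [minor U ^ 2 / pf U] is a polynomial independent of [U]: a prime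
   in its denominator would divide every [pf U], and so vanish at a regular point. *)
Lemma minor_pf : exists q : R, q != 0 /\ forall U, minor U ^+ 2 = q * pf U.
Proof.
have [U0 m0] := minor_neq0; have m20 : minor U0 ^+ 2 != 0 by rewrite expf_neq0.
have pf0 : pf U0 != 0.
  apply/eqP => p0; have [|U1] := @pf_regular (1 *: e + 0 *: h + 0 *: f).
    by apply: tripleP; rewrite !xpair_eqE oner_eq0.
  suff -> : pf U1 = 0 by rewrite meval0 eqxx.
  by have /eqP := pf_minor U1 U0; rewrite p0 mul0r mulf_eq0 (negPf m20) orbF => /eqP.
have UR := @factorial_mpoly k n.+1.
have [d [a [b [d0 ea eb cop]]]] := coprime_reduction UR m20 pf0.
have rel U : pf U * a = b * minor U ^+ 2.
  by apply: (mulfI d0); rewrite mulrCA -ea pf_minor eb mulrA.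
have b0 : b != 0 by apply: contraNneq pf0 => b0; rewrite eb b0 mulr0.
have ub : b \is a GRing.unit.
  apply: contraT => nb; have [F pF Fb] := prime_factor UR b0 nb.
  have Fpf U : rdvd F (pf U).
    have [_ _ FM] := pF; have Fab : rdvd F (pf U * a) by rewrite rel; apply: rdvdMr.
    by case: (FM _ _ Fab) => // Fa; case: (cop F pF Fa Fb).
  have [w ew] := Fpf U0; have Fw : F * w = pf U0 by rewrite mulrC -ew.
  have [t hF] : exists t, homogf t F.
    by apply: (@homogf_factor _ _ F w (n.+1 - l)); rewrite Fw //; exact: pf_homog.
  have [y [ry Fy]] := prime_regular_zero pF hF; have [U] := pf_regular ry.
  by have [w' ->] := Fpf U; rewrite mevalM Fy mulr0 eqxx.
exists (a * b^-1); split.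
  rewrite mulf_neq0 ?invr_eq0 //; apply: contraNneq m20 => a0; by rewrite ea a0 mulr0.
by move=> U; apply: (mulrI ub); rewrite -rel mulrC [a / b]mulrC !mulrA divrr // mul1r.
Qed.

(** The derivatives of a relation of minimal degree form a row that annihilates the Jacobian matrix,
    so they are relations too, hence zero. *)
Lemma jacobian_independent (Q : {mpoly k[l]}) : Q \mPo [tuple p i | i < l] = 0 -> Q = 0.
Proof.
move=> Q0; apply: NNPP => nQ.
have [H [[H0 HP] Hmin]] := exists_minimal (fun H : {mpoly k[l]} => msize H)
  (P := fun H => H \mPo [tuple p i | i < l] = 0 /\ H != 0) (ex_intro _ Q (conj Q0 (introN eqP nQ))).
have [U mU] := minor_neq0.
have dH i : H^`M(i) \mPo [tuple p j | j < l] = 0.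
  have h0 : (\row_i (H^`M(i) \mPo [tuple p j | j < l])) *m jacobian p = 0.
    apply/rowP => j; rewrite mxE [RHS]mxE -[RHS](mderiv0 _ j) -[in RHS]H0 mderiv_comp_mpoly.
    by apply: eq_bigr => s _; rewrite !mxE tnth_mktuple.
  have h1 := congr1 (fun M => M *m (mxC n.+1 U *m \adj (jacobian p *m mxC n.+1 U))) h0.
  rewrite mul0mx !mulmxA -[_ *m jacobian p *m _]mulmxA -mulmxA mul_mx_adj mul_mx_scalar in h1.
  have := congr1 (fun M : 'rV_l => M 0 i) h1; rewrite !mxE => /eqP.
  by rewrite mulf_eq0 -minor_def (negPf mU) => /eqP.
have H'0 i : H^`M(i) = 0.
  apply/eqP; apply: contraT => ne; have := msize_mderiv i HP; rewrite ltnNge.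
  by rewrite Hmin.
have eH := mderiv_all_eq0 char0 H'0; case/eqP: HP; rewrite eH in H0 *.
move: H0; rewrite comp_mpolyC => /eqP; rewrite mpolyC_eq0 => /eqP ->.
by rewrite mpolyC0.
Qed.

Lemma linear_subst (E : 'M[k]_n.+1) (q : R) : exists qE : R, forall y, qE.@[vcoord y] = q.@[vcoord (y *m E)].
Proof.
exists (q \mPo [tuple \sum_j E j i *: 'X_j | i < n.+1]) => y; rewrite comp_mpoly_meval.
apply: meval_eq => i; rewrite tnth_mktuple rmorph_sum /vcoord mxE /=.
by apply: eq_bigr => j _; rewrite mevalZ mevalXU mulrC.
Qed.

(** The quadratic form [B y y] is a polynomial killed by the infinitesimal action, hence fixed by
    exponentials; polarization gives the bilinear form. *)
Lemma expad_form z u v : nilmx (ad z) -> B (u *m expad c z) (v *m expad c z) = B u v.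
Proof.
move=> nz; have ez : ad z ^+ n.+1 = 0 by exact: nilp_expn.
pose q : R := \sum_i \sum_j (Bm i j) *: ('X_i * 'X_j).
have qE y : q.@[vcoord y] = B y y.
  rewrite /q rmorph_sum /= /bform mxE; under [RHS]eq_bigr => j _ do rewrite mxE mulr_suml.
  rewrite [RHS]exchange_big; apply: eq_bigr => i _; rewrite rmorph_sum; apply: eq_bigr => j _ /=.
  by rewrite mevalZ mevalM !mevalXU !mxE /vcoord; ring.
have Bq y w : B (y + w) (y + w) = B y y + 2%:R * B y w + B w w.
  by rewrite bformDr !(bformDl formP) (bformC formP w y); ring.
have Lq : Lie_invariant c q.
  move=> w y; rewrite (@dder_line _ _ _ _ _ ((B y y)%:P + (2%:R * B y (br w y))%:P * 'X + (B (br w y) (br w y))%:P * 'X^2)).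
    rewrite !coefD coefC coefCM coefX coefCM coefXn /= mulr0 addr0 add0r mulr1.
    have e1 : B y (br w y) = - B y (br w y) by rewrite -(bform_invl lieP formP) (bformC formP).
    have : 2%:R * B y (br w y) = 0 by rewrite mulr_natl mulr2n {1}e1 addNr.
    by [].
  move=> t; rewrite qE Bq !(bformZr, bformZl formP) !(hornerD, hornerM, hornerC, hornerXn, hornerX).
  by ring.
have inv y : B (y *m expad c z) (y *m expad c z) = B y y.
  by rewrite -!qE; apply: (Lie_G_invariant char0 Lq).
have two0 : 2%:R != 0 :> k by exact: natr_neq0.
have := inv (u + v); rewrite mulmxDl !Bq !inv => /(addIr _) /(addrI _).
exact: mulfI.
Qed.

Lemma expad_formE z : nilmx (ad z) -> expad c z *m Bm *m (expad c z)^T = Bm.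
Proof.
move=> nz; apply/matrixP => i j; have := expad_form (delta_mx 0 i : vec) (delta_mx 0 j : vec) nz.
have entry (M : 'M[k]_n.+1) : ((delta_mx 0 i : vec) *m M *m (delta_mx 0 j : vec)^T) 0 0 = M i j.
  by rewrite trmx_delta -rowE -colE !mxE.
rewrite /bform entry => <-; rewrite trmx_mul !mulmxA.
by rewrite -[delta_mx 0 i *m _ *m Bm]mulmxA -[delta_mx 0 i *m _ *m _]mulmxA entry.
Qed.

Lemma gradmx_expad z y : nilmx (ad z) -> J (y *m expad c z) *m (expad c z)^T = J y.
Proof.
move=> nz; have ez : ad z ^+ n.+1 = 0 by exact: nilp_expn.
have dE i w : dder (p i) (y *m expad c z) (w *m expad c z) = dder (p i) y w.
  pose g := mmap (@polyC k) (fun j => (y 0 j)%:P + (w 0 j)%:P * 'X) (p i).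
  rewrite (@dder_line _ _ _ _ _ g) // => t.
  have -> : y *m expad c z + t *: (w *m expad c z) = (y + t *: w) *m expad c z.
    by rewrite mulmxDl scalemxAl.
  rewrite mmap_horner (pG i ez); apply: meval_eq => j.
  by rewrite !hornerE /vcoord !mxE mulrC.
have tr (M : 'M[k]_(l, n.+1)) i j : ((delta_mx 0 j : vec) *m M^T) 0 i = M i j by rewrite -rowE !mxE.
apply/matrixP => i j; rewrite -[LHS]tr -[RHS]tr trmx_mul trmxK mulmxA !gradmx_mul.
exact: dE.
Qed.

(** [E] preserves the form, so [\det E ^+ 2 = 1], and it transports both the gradients and
    [skew_ad]. Passing from [y] to [y *m E] and from [V] to [E^T *m V] therefore changes neither the
    minor nor the bordered determinant. *)
Lemma ratio_invariant q : q != 0 -> (forall U, minor U ^+ 2 = q * pf U) -> G_invariant c q.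
Proof.
move=> q0 hq z ez x1; have nz : nilmx (ad z) by exists n.+1.
set E := expad c z; have uE : E \in unitmx := expad_unit nz.
have FE : E *m Bm *m E^T = Bm := expad_formE nz.
have ET : E^T \in unitmx by rewrite unitmx_tr.
have iET : E^T *m invmx Bm *m E = invmx Bm.
  set X := _ *m E; have e1 : Bm *m X = 1%:M.
    by apply: (can_inj (mulKmx uE)); rewrite /X !mulmxA FE mulmxV // mul1mx mulmx1.
  by rewrite -[X](mulKmx uB) e1 mulmx1.
have AE y : skew_ad (y *m E) = E^T *m skew_ad y *m E^T^T.
  have e2 : E^T *m invmx Bm = invmx Bm *m invmx E by rewrite -[LHS](mulmxK uE) iET.
  rewrite trmxK /skew_ad !mulmxA e2 -!mulmxA; congr (_ *m _).
  by apply: (can_inj (mulKmx uE)); rewrite mulKVmx // expad_conj.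
have dE : \det E ^+ 2 = 1.
  have := congr1 determinant FE; rewrite !det_mulmx det_tr mulrAC -expr2 => e1.
  apply: (mulIf (x := \det Bm)); first by rewrite -unitfE -unitmxE.
  by rewrite mul1r.
have [qE hqE] := linear_subst E q.
have rel V y : (q.@[vcoord (y *m E)] - q.@[vcoord y]) * (pf V).@[vcoord y] = 0.
  have h1 := congr1 (meval (vcoord (y *m E))) (hq (E^T *m V)).
  have h2 := congr1 (meval (vcoord y)) (hq V).
  rewrite expr2 !mevalM minorE pfE -expr2 in h1; rewrite expr2 !mevalM minorE -expr2 in h2.
  have e1 : \det (J (y *m E) *m (E^T *m V)) = \det (J y *m V) by rewrite mulmxA gradmx_expad.
  rewrite e1 h2 AE bordered_conj det_tr dE mul1r -pfE in h1.
  by rewrite mulrBl -h1 subrr.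
have [U0 m0] := minor_neq0; have pf0 : pf U0 != 0.
  by apply: contraNneq m0 => p0; have := hq U0; rewrite p0 mulr0 => /eqP; rewrite expf_eq0.
suff e0 : qE = q by rewrite -hqE e0.
have /eqP : (qE - q) * pf U0 = 0.
  by apply: poly_ext_vec => y; rewrite mevalM mevalB hqE meval0 rel.
by rewrite mulf_eq0 (negPf pf0) orbF subr_eq0 => /eqP.
Qed.

Definition lie_deriv z (q : R) : R := \sum_i q^`M(i) * (\sum_j (ad z) j i *: 'X_j).

Lemma lie_derivE z q y : (lie_deriv z q).@[vcoord y] = dder q y (br z y).
Proof.
rewrite dderE /lie_deriv rmorph_sum; apply: eq_bigr => i _; rewrite /= mevalM; congr (_ * _).
rewrite -mul_adm mxE rmorph_sum; apply: eq_bigr => j _ /=.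
by rewrite mevalZ mevalXU mulrC.
Qed.

Lemma lie_derivM z u w : lie_deriv z (u * w) = lie_deriv z u * w + u * lie_deriv z w.
Proof.
rewrite /lie_deriv mulr_suml mulr_sumr -big_split; apply: eq_bigr => i _ /=.
by rewrite mderivM; ring.
Qed.

(** Deriving [F ^+ j.+1 * w = q] shows that [F] divides [lie_deriv z F * w]. If it does not divide
    the first factor, it divides [w]; one more power of [F] is split off and the size of [w]
    decreases. *)
Lemma prime_lie_deriv z F q : prime_elt F -> q != 0 -> lie_deriv z q = 0 -> rdvd F q ->
  rdvd F (lie_deriv z F).
Proof.
move=> pF; have [F0 Fu FM] := pF.
have lX j : lie_deriv z (F ^+ j.+1) = j.+1%:R * F ^+ j * lie_deriv z F.
  elim: j => [|j IH]; first by rewrite expr1 expr0 !mul1r.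
  by rewrite exprS lie_derivM IH [j.+2%:R]mulrSr [F ^+ j.+1]exprS; ring.
have main N w j : (msize w <= N)%N -> w != 0 -> lie_deriv z (F ^+ j.+1 * w) = 0 -> rdvd F (lie_deriv z F).
  elim: N w j => [|N IH] w j sw w0; first by rewrite leqn0 msize_poly_eq0 (negPf w0) in sw.
  rewrite lie_derivM lX exprS => e1.
  have /eqP e2 : F ^+ j * (j.+1%:R * lie_deriv z F * w + F * lie_deriv z w) = 0 by rewrite -[RHS]e1; ring.
  move: e2; rewrite mulf_eq0 expf_eq0 (negPf F0) andbF orFb addr_eq0 => /eqP e3.
  have d1 : rdvd F (lie_deriv z F * w).
    exists (- (j.+1%:R^-1 *: lie_deriv z w)).
    have nj : j.+1%:R != 0 :> k by exact: natr_neq0.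
    apply: (scalerI nj); rewrite -[LHS]mul_mpolyC rmorph_nat mulrA e3 mulNr -scalerAl scalerN scalerA.
    by rewrite mulfV // scale1r mulrC.
  have [//|[w' ew]] := FM _ _ d1.
  have w'0 : w' != 0 by apply: contraNneq w0 => z0; rewrite ew z0 mul0r.
  apply: (IH w' j.+1) => //; last by rewrite exprSr -mulrA [F * w']mulrC -ew lie_derivM lX exprS.
  have [t Ft] := prime_nonconstant char0 pF; have := msize_mderiv t F0.
  move: Ft; rewrite -msize_gt0 => Ft lt; move: sw; rewrite ew msizeM // => sw.
  have ar u1 u2 g : ((u1 + u2).-1 <= N.+1 -> 0 < g -> g < u2 -> u1 <= N)%N by lia.
  exact: (ar _ _ _ sw Ft lt).
move=> q0 Dq [w ew]; apply: (main (msize w) w 0%N) => //.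
  by apply: contraNneq q0 => w0; rewrite ew w0 mul0r.
by rewrite expr1 mulrC -ew.
Qed.

(** Along the curve [y exp (t z)] the hypothesis becomes [g' = M g], which for reasons of degree
    forces [g' = 0]. *)
Lemma divides_invariant F : (forall z, rdvd F (lie_deriv z F)) -> G_invariant c F.
Proof.
move=> h0 z ez y; have nz : nilmx (ad z) by exists n.+1.
have [m em] := h0 z.
pose g := mmap (@polyC k) (expcurve c z y) F; pose M := mmap (@polyC k) (expcurve c z y) m.
have ev (q : R) t : (mmap (@polyC k) (expcurve c z y) q).[t] = q.@[vcoord (y *m expad c (t *: z))].
  by rewrite mmap_horner; apply: meval_eq => i; exact: expcurve_horner.
have e1 : g^`() = M * g.
  apply: poly_ext => t; rewrite hornerM !ev -mevalM -em lie_derivE deriv_mmap dderE.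
  apply: eq_bigr => i _; congr (_ * _); last exact: expcurve_deriv.
  by apply: meval_eq => j; exact: expcurve_horner.
have g'0 : g^`() = 0.
  have [g0|g0] := eqVneq g 0; first by rewrite g0 raddf0.
  have [M0|M0] := eqVneq M 0; first by rewrite e1 M0 mul0r.
  have := lt_size_deriv g0; rewrite e1 size_mul // ltnNge.
  by have := M0; rewrite -size_poly_gt0; case: (size M) => // a _; rewrite addSn leq_addl.
have gc : g = (g`_0)%:P.
  apply/polyP => -[|j]; rewrite coefC //=.
  have := congr1 (fun u : {poly k} => u`_j) g'0; rewrite coef_deriv coef0 -mulr_natr => /eqP.
  by rewrite mulf_eq0 (negPf (natr_neq0 char0 _)) // orbF => /eqP.
have := ev F 1; have := ev F 0; rewrite -/g gc !hornerC scale1r scale0r => -> <-.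
congr (_.@[vcoord _]).
have n0 : nilmx (ad 0) by exists 1%N; rewrite adm0 expr1.
rewrite (@expad_sum _ _ c 0 n.+1 n0) // big_ord_recl dpow0 mulmxDr mulmx1 mulmx_sumr big1 ?addr0 // => i _.
by rewrite dpowE adm0 exprS mul0r scaler0 mulmx0.
Qed.

(* Knop's argument: a prime factor of the ratio would be an invariant dividing all
   the maximal minors of the Jacobian matrix. *)
Lemma ratio_const : exists a : k, a != 0 /\ forall U, minor U ^+ 2 = a%:MP * pf U.
Proof.
have [q [q0 hq]] := minor_pf; have Gq := ratio_invariant q0 hq.
have [uq|nq] := boolP (q \is a GRing.unit).
  have /andP [/eqP eq _] : (q == (q@_0)%:MP) && (q@_0 \is a GRing.unit) := uq.
  exists q@_0; rewrite -eq; split=> //.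
  by apply: contraNneq q0 => z; rewrite eq z mpolyC0.
have [F pF Fq] := prime_factor (@factorial_mpoly k n.+1) q0 nq.
have GF : G_invariant c F.
  apply: divides_invariant => z; apply: (prime_lie_deriv pF q0) => //.
  by apply: poly_ext_vec => y; rewrite lie_derivE meval0 (GLie Gq).
have [Fh eF] := gensP GF; have [F0 _ _] := pF.
case: (knop_contradiction char0 pF eF) => [g [w ew]|U]; last first.
  rewrite -minor_def; apply: (@prime_elt_exp _ F _ 2 pF); rewrite hq; case: Fq => w ->.
  by exists (w * pf U); rewrite mulrAC.
(* A quotient of invariants is invariant, hence a polynomial in the [p i]; with
   [jacobian_independent], divisibility by [F] lifts to divisibility by [Fh]. *)
have Gw : G_invariant c w.
  move=> z ez y; have [wE hwE] := linear_subst (expad c z) w.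
  suff e0 : wE = w by rewrite -hwE e0.
  have /eqP : (wE - w) * F = 0.
    apply: poly_ext_vec => y'; rewrite mevalM mevalB hwE meval0 mulrBl -{1}(GF z ez y') -!mevalM -ew.
    have Gg : G_invariant c (g \mPo [tuple p i | i < l]).
      move=> z' ez' y''; rewrite !comp_mpoly_meval; apply: meval_eq => i.
      by rewrite tnth_mktuple pG.
    by rewrite Gg // subrr.
  by rewrite mulf_eq0 (negPf F0) orbF subr_eq0 => /eqP.
have [W eW] := gensP Gw; exists W; apply/eqP; rewrite -subr_eq0; apply/eqP.
by apply: jacobian_independent; rewrite rmorphB rmorphM /= -eW -eF ew subrr.
Qed.

End Kostant.

(** * The pencil of centralizers attached to a pair *)

Section Pencil.
Variables (k : closedFieldType) (n : nat) (c : 'I_n.+1 -> 'I_n.+1 -> 'I_n.+1 -> k).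
Variable Bm : 'M[k]_n.+1.
Hypothesis char0 : [pchar k] =i pred0.
Hypothesis lieP : is_lie c.
Hypothesis formP : good_form c Bm.
Local Notation vec := 'rV[k]_n.+1.
Local Notation br := (brk c).
Local Notation ad := (adm c).
Local Notation B := (bform Bm).
Variables (l : nat) (d : 'I_l -> nat) (ep : vec -> 'M[k]_(l, n.+1)).
Hypothesis ep_cent : forall y, ep y *m ad y = 0.
Hypothesis ep_free : forall y, cent_dim c y = l -> row_free (ep y).
Hypothesis ep_homog : forall i t y, row i (ep (t *: y)) = t ^+ (d i).-1 *: row i (ep y).
Hypothesis ep_poly : forall i j x y, exists g : {poly k}, forall a, ep (a *: x + y) i j = g.[a].
Hypothesis d_pos : forall i, (0 < d i)%N.

Section Pair.
Variables (x y : vec) (u : 'I_l -> nat -> vec).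
Hypothesis uP : forall i t, \sum_(m < d i) t ^+ m *: u i m = row i (ep (x + t *: y)).

Lemma pencil_ext (N : nat) (v : nat -> vec) :
  (forall t, \sum_(m < N) t ^+ m *: v m = 0) -> forall m, (m < N)%N -> v m = 0.
Proof.
move=> hv m mN; apply/rowP => j; rewrite mxE.
have e : \poly_(s < N) (v s 0 j) = 0.
  apply: poly_ext => t; rewrite horner_poly horner0.
  have := congr1 (fun w : vec => w 0 j) (hv t); rewrite summxE mxE => e0; rewrite -[RHS]e0.
  by apply: eq_bigr => s _; rewrite [in RHS]mxE mulrC.
by have := congr1 (fun q : {poly k} => q`_m) e; rewrite coef_poly mN coef0.
Qed.

Lemma pencil_rel i : [/\ br x (u i 0) = 0, br y (u i (d i).-1) = 0 &
  forall m, (m.+1 < d i)%N -> br x (u i m.+1) = - br y (u i m)].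
Proof.
have di := d_pos i; pose v m : vec :=
  (if (m < d i)%N then br x (u i m) else 0) + (if (0 < m)%N then br y (u i m.-1) else 0).
have hv t : \sum_(m < (d i).+1) t ^+ m *: v m = 0.
  have e0 : row i (ep (x + t *: y)) *m ad (x + t *: y) = 0 by rewrite -row_mul ep_cent row0.
  rewrite -[RHS]e0 mul_adm brkDl brkZl -uP !brk_sumr scaler_sumr.
  rewrite /v; under eq_bigr => m _ do rewrite scalerDr.
  rewrite big_split /=; congr (_ + _).
    rewrite big_ord_recr /= ltnn scaler0 addr0; apply: eq_bigr => m _.
    by rewrite ltn_ord brkZr.
  rewrite big_ord_recl /= scaler0 add0r; apply: eq_bigr => m _.
  by rewrite brkZr scalerA -exprS.
have hz := pencil_ext hv; split.
- by have := hz 0%N isT; rewrite /v di ltnn addr0.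
- by have := hz (d i) (ltnSn _); rewrite /v ltnn di add0r.
move=> m md; have := hz m.+1 (ltnW _); rewrite /v md /= => /(_ _)/eqP; rewrite addr_eq0 => h0.
by apply/eqP/h0; rewrite ltnS.
Qed.

(** For [a != 0] this is homogeneity. Both sides are polynomial in [a], which gives the value at
    0. *)
Lemma pencil_eval i a b : \sum_(m < d i) (a ^+ ((d i).-1 - m) * b ^+ m) *: u i m = row i (ep (a *: x + b *: y)).
Proof.
have nz s : s != 0 -> \sum_(m < d i) (s ^+ ((d i).-1 - m) * b ^+ m) *: u i m = row i (ep (s *: x + b *: y)).
  move=> s0; have -> : s *: x + b *: y = s *: (x + (b / s) *: y).
    by rewrite scalerDr scalerA mulrC divfK.
  rewrite ep_homog -uP scaler_sumr; apply: eq_bigr => m _; rewrite scalerA; congr (_ *: _).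
  have md : (m <= (d i).-1)%N by rewrite -ltnS prednK.
  by rewrite -{2}(subnK md) exprD -mulrA -exprMn mulrCA mulfV // mulr1.
have [->|] := eqVneq a 0; last exact: nz.
apply/rowP => j; have [g hg] := ep_poly i j x (b *: y).
pose f : {poly k} := \sum_(m < d i) ((b ^+ m * u i m 0 j) *: 'X^((d i).-1 - m)).
have fE s : f.[s] = (\sum_(m < d i) (s ^+ ((d i).-1 - m) * b ^+ m) *: u i m) 0 j.
  rewrite /f horner_sum summxE; apply: eq_bigr => m _.
  by rewrite hornerZ hornerXn [RHS]mxE mulrC mulrA.
rewrite -fE mxE hg; congr (_.[_]); apply: (mulfI (negbT (polyX_eq0 k))).
apply: poly_ext => s; rewrite !hornerM hornerX; have [->|s0] := eqVneq s 0; first by rewrite !mul0r.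
by rewrite fE nz // mxE hg.
Qed.

(** The relations of [pencil_rel] move one unit from [m] to [s], until either [u i 0], which
    commutes with [x], or the last [u j s], which commutes with [y], is reached. *)
Lemma pencil_isotropic i j m s : (m < d i)%N -> (s < d j)%N -> B (br x (u i m)) (u j s) = 0.
Proof.
elim: m s => [|m IH] s mi sj.
  by have [-> _ _] := pencil_rel i; rewrite (bform0l formP).
have [_ _ ->] := pencil_rel i; rewrite // -scaleN1r (bformZl formP) mulN1r (bform_invl lieP formP) opprK.
have [s1|s1] := ltnP s.+1 (d j).
  have [_ _ hs] := pencil_rel j; have -> : br y (u j s) = - br x (u j s.+1) by rewrite hs // opprK.
  by rewrite bformNr -(bform_invl lieP formP) IH // ltnW.
have -> : s = (d j).-1 by apply/eqP; rewrite -eqSS prednK // eqn_leq sj.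
by have [_ -> _] := pencil_rel j; rewrite bform0r.
Qed.

Lemma pencil_orth i m : (m < d i)%N -> B (u i m) (br x y) = 0.
Proof.
rewrite -(bform_inv formP) (brkC lieP) -scaleN1r (bformZl formP) mulN1r.
case: m => [|m] mi; first by have [-> _ _] := pencil_rel i; rewrite (bform0l formP) oppr0.
have [_ _ ->] := pencil_rel i; rewrite // -scaleN1r (bformZl formP) mulN1r (bform_invl lieP formP).
by rewrite (brkxx lieP) bform0r !oppr0.
Qed.


Definition pidx : finType := {i : 'I_l & 'I_(d i)}.
Local Notation b := #|pidx|.
Definition pfst (s : 'I_b) : 'I_l := tag (enum_val s : {i : 'I_l & 'I_(d i)}).
Definition psnd (s : 'I_b) : nat := tagged (enum_val s : {i : 'I_l & 'I_(d i)}).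
Definition prank i (t : 'I_(d i)) : 'I_b := enum_rank (Tagged (fun i => 'I_(d i)) t : pidx).

Lemma psnd_lt s : (psnd s < d (pfst s))%N. Proof. exact: ltn_ord. Qed.
Lemma prank_fst i t : pfst (@prank i t) = i. Proof. by rewrite /pfst enum_rankK. Qed.
Lemma prank_snd i t : psnd (@prank i t) = t. Proof. by rewrite /psnd enum_rankK. Qed.
Lemma prank_eq s i t : (s == @prank i t) = (pfst s == i) && (psnd s == t).
Proof.
apply/eqP/andP => [->|[/eqP e1 /eqP e2]]; first by rewrite prank_fst prank_snd !eqxx.
apply: enum_val_inj; rewrite enum_rankK; move: e1 e2; rewrite /pfst /psnd.
by case: (enum_val s) => j r /= e1; subst j => /val_inj ->.
Qed.

Definition pencilmx : 'M[k]_(b, n.+1) := \matrix_(s < b) u (pfst s) (psnd s).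
Local Notation E := pencilmx.

Lemma pidx_sum (A : comNzRingType) m (w : 'I_l -> nat -> 'rV[A]_m) (a : 'I_l -> nat -> A) :
  (\row_s a (pfst s) (psnd s)) *m (\matrix_(s < b) w (pfst s) (psnd s)) =
  \sum_i \sum_(m < d i) a i m *: w i m.
Proof.
rewrite mulmx_sum_row sig_big_dep /= (reindex (@enum_val pidx predT)) /=.
  by apply: eq_big => [s|s _]; rewrite ?mxE ?rowK.
by apply: onW_bij; exact: enum_val_bij.
Qed.

(** Inverse of the encoding by [pfst] and [psnd]. Coefficients are indexed by all natural numbers,
    with value 0 from [d i] on. *)
Definition pcoef (A : nmodType) (v : 'rV[A]_b) i m : A :=
  if @insub nat (fun s => (s < d i)%N) 'I_(d i) m is Some t then v 0 (prank t) else 0.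

Lemma pcoefE (A : nmodType) (v : 'rV[A]_b) : v = \row_s pcoef v (pfst s) (psnd s).
Proof.
apply/rowP => s; rewrite mxE /pcoef insubT ?psnd_lt // => lt.
by congr (v 0 _); apply/eqP; rewrite prank_eq !eqxx.
Qed.

(* Bolsinov's argument: on the space of linear relations between the [u i m] the shift
   of [m], corrected to annihilate [ad x], has an eigenvector; it is a relation between
   the [ep (la x + y)]. *)
Lemma pencil_free : (forall a b : k, (a, b) != (0, 0) -> cent_dim c (a *: x + b *: y) = l) ->
  row_free E.
Proof.
move=> reg; have rx : cent_dim c x = l.
  by rewrite -[RHS](reg 1 0) ?scale1r ?scale0r ?addr0 // xpair_eqE oner_eq0.
have fx := ep_free rx.
have kx : (kermx (ad x) <= ep x)%MS.
  have sub : (ep x <= kermx (ad x))%MS by apply/sub_kermxP; exact: ep_cent.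
  by have /mxrank_leqif_sup/geq_leqif <- := sub; rewrite (eqP fx) -rx.
have u0 i : u i 0 = row i (ep x).
  have := uP i 0; rewrite scale0r addr0 => <-; have := d_pos i; case: (d i) => // D _.
  rewrite big_ord_recl expr0 scale1r big1 ?addr0 // => m _.
  by rewrite lift0 expr0n scale0r.
(* [Sh] sends the index [(i, m)] to [(i, m.+1)], or to 0 at the top; [J0] places coefficients at the
   indices [(i, 0)], where the [u i 0] are the rows of [ep x]. *)
pose Sh : 'M[k]_b := \matrix_(t, s) ((pfst t == pfst s) && ((psnd t).+1 == psnd s))%:R.
pose J0 : 'M[k]_(l, b) := \matrix_(i, s) ((i == pfst s) && (psnd s == 0%N))%:R.
have J0E : J0 *m E = ep x.
  apply/row_matrixP => i; rewrite row_mul mulmx_sum_row -u0 (bigD1 (prank (Ordinal (d_pos i)))) //=.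
  rewrite big1 => [|s]; last first.
    by rewrite prank_eq /= => h; rewrite !mxE [i == _]eq_sym (negPf h) scale0r.
  by rewrite !mxE prank_fst prank_snd !eqxx scale1r addr0 rowK prank_fst prank_snd.
have row_Sh t : row t Sh *m E = if ((psnd t).+1 < d (pfst t))%N then u (pfst t) (psnd t).+1 else 0.
  rewrite mulmx_sum_row; case: ifP => [lt|nlt].
    rewrite (bigD1 (prank (Ordinal lt))) //= big1 => [|s].
      by rewrite !mxE prank_fst prank_snd !eqxx scale1r addr0 rowK prank_fst prank_snd.
    rewrite prank_eq /= => h; rewrite !mxE [pfst t == _]eq_sym [_.+1 == _]eq_sym.
    by rewrite (negPf h) scale0r.
  rewrite big1 // => s _; rewrite !mxE; case: eqP => [e1|_] /=; last by rewrite scale0r.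
  case: eqP => [e2|_]; last by rewrite scale0r.
  by rewrite e1 e2 psnd_lt in nlt.
have ShEx : Sh *m E *m ad x = - (E *m ad y).
  apply/row_matrixP => t; rewrite !row_mul row_Sh linearN /= row_mul rowK !mul_adm.
  have [_ yl hr] := pencil_rel (pfst t); case: ifP => [lt|nlt]; first exact: hr.
  rewrite brk0r; suff -> : psnd t = (d (pfst t)).-1 by rewrite yl oppr0.
  by apply/eqP; rewrite -eqSS prednK // eqn_leq psnd_lt leqNgt nlt.
(* A relation shifted by [Sh] gives a vector of [g^x], which the rows of [ep x] span since [x] is
   regular; subtracting its coordinates at the indices [(i, 0)] restores a relation. *)
pose S := Sh - Sh *m E *m pinvmx (ep x) *m J0.
rewrite -kermx_eq0; apply: contraT => N0; set N := kermx E in N0.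
have NS : (N *m S <= N)%MS.
  have SE : S *m E = Sh *m E - Sh *m E *m pinvmx (ep x) *m ep x.
    by rewrite /S mulmxBl -[_ *m J0 *m E]mulmxA J0E.
  have le : (N *m (Sh *m E) <= ep x)%MS.
    apply: (submx_trans _ kx); apply/sub_kermxP; rewrite -mulmxA ShEx mulmxN mulmxA.
    by rewrite mulmx_ker mul0mx oppr0.
  apply/sub_kermxP; rewrite -mulmxA SE mulmxBr; apply/eqP; rewrite subr_eq0; apply/eqP.
  by rewrite -{1}(mulmxKpV le) !mulmxA.
have [v [v0 vN [la vS]]] : exists v : 'rV[k]_b, [/\ v != 0, (v <= N)%MS & exists la, v *m S = la *: v].
  have rN : (0 < \rank N)%N by rewrite lt0n mxrank_eq0.
  have ex m (Q : 'M[k]_(m, b)) : (0 < m)%N -> row_free Q -> (Q :=: N)%MS ->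
      exists v : 'rV[k]_b, [/\ v != 0, (v <= N)%MS & exists la, v *m S = la *: v].
    case: m Q => // m Q _ Qf QN; have /submxP [C eC] : (Q *m S <= Q)%MS.
      by rewrite QN (submx_trans _ NS) // submxMr // QN.
    have [la [z [z0 zC]]] := closed_eigenvector C; exists (z *m Q); split.
    - by rewrite mulmx_free_eq0.
    - by rewrite -QN submxMl.
    by exists la; rewrite -mulmxA eC mulmxA zC scalemxAl.
  exact: (ex _ (row_base N) rN (row_base_free N) (eq_row_base N)).
have vE : v *m E = 0 by apply/sub_kermxP.
(* the eigenvector equation determines [v] from its top coefficients *)
have step t : ((psnd t).+1 < d (pfst t))%N -> forall s, pfst s = pfst t -> psnd s = (psnd t).+1 ->
    v 0 t = la * v 0 s.
  move=> lt s e1 e2; pose w := v *m Sh *m E *m pinvmx (ep x).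
  have eS : (v *m S) 0 s = (v *m Sh) 0 s - (w *m J0) 0 s.
    have sub (M1 M2 : 'rV[k]_b) : (M1 - M2) 0 s = M1 0 s - M2 0 s by rewrite !mxE.
    have eq : v *m S = v *m Sh - w *m J0 by rewrite /S mulmxBr /w !mulmxA.
    by rewrite eq sub.
  have w0 : (w *m J0) 0 s = 0.
    by rewrite mxE big1 // => i _; rewrite [X in _ * X]mxE e2 andbF mulr0.
  have -> : la * v 0 s = (v *m S) 0 s by rewrite vS mxE.
  rewrite eS w0.
  rewrite subr0 mxE (bigD1 t) //= big1 => [|t' tt']; first by rewrite mxE e1 e2 !eqxx mulr1 addr0.
  rewrite mxE; case: eqP => [e3|_] /=; last by rewrite mulr0.
  case: eqP => [e4|_]; last by rewrite mulr0.
  case/eqP: tt'; apply: enum_val_inj; apply/eqP; rewrite -[enum_val t']/(enum_val t').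
  have : t' == prank (Ordinal (psnd_lt t)) by rewrite prank_eq e3 e1 eqxx /=; move: e4; rewrite e2 => -[->].
  have : t == prank (Ordinal (psnd_lt t)) by rewrite prank_eq !eqxx.
  by move=> /eqP <- /eqP ->.
pose top i : 'I_b := prank (Ordinal (d_pos i)).
have last_lt i : ((d i).-1 < d i)%N by rewrite prednK.
pose g i := v 0 (prank (Ordinal (last_lt i))).
have vg j t : (psnd t + j)%N = (d (pfst t)).-1 -> v 0 t = la ^+ j * g (pfst t).
  elim: j t => [|j IH] t ej.
    rewrite expr0 mul1r; congr (v 0 _); apply/eqP; rewrite prank_eq eqxx /=.
    by move: ej; rewrite addn0 => ->.
  have lt : ((psnd t).+1 < d (pfst t))%N.
    by rewrite -[X in (_ < X)%N](prednK (d_pos _)) -ej addnS !ltnS leq_addr.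
  pose s := prank (Ordinal lt); have e1 : pfst s = pfst t by rewrite prank_fst.
  have e2 : psnd s = (psnd t).+1 by rewrite prank_snd.
  rewrite (step t lt s e1 e2) (IH s) ?e1 ?e2; first by rewrite exprS mulrA.
  by rewrite addSnnS.
have g0 : \row_i g i = 0.
  have fr : row_free (ep (la *: x + 1 *: y)).
    by apply: ep_free; apply: reg; rewrite xpair_eqE oner_eq0 andbF.
  apply: (row_free_inj fr); rewrite mul0mx -[RHS]vE.
  have -> : v = \row_s (la ^+ ((d (pfst s)).-1 - psnd s) * 1 ^+ psnd s * g (pfst s)).
    apply/rowP => s; rewrite mxE expr1n mulr1; apply: vg; rewrite subnKC //.
    by rewrite -ltnS prednK // psnd_lt.
  rewrite (pidx_sum u (fun i m => la ^+ ((d i).-1 - m) * 1 ^+ m * g i)) mulmx_sum_row.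
  apply: eq_bigr => i _; rewrite mxE -pencil_eval scaler_sumr; apply: eq_bigr => m _.
  by rewrite scalerA mulrC.
case/eqP: v0; apply/rowP => s; rewrite mxE (vg ((d (pfst s)).-1 - psnd s)%N).
  by have := congr1 (fun w : 'rV_l => w 0 (pfst s)) g0; rewrite !mxE => ->; rewrite mulr0.
by rewrite subnKC // -ltnS prednK // psnd_lt.
Qed.

End Pair.

Section Generic.
Variables (x y : vec) (u : 'I_l -> nat -> vec).
Hypothesis uP : forall i t, \sum_(m < d i) t ^+ m *: u i m = row i (ep (x + t *: y)).
Hypothesis rx : cent_dim c x = l.
Hypothesis fE : row_free (pencilmx u).
Hypothesis dimP : (2 * #|pidx| = n.+1 + l)%N.
Local Notation E := (pencilmx u).

Let fx : row_free (ep x). Proof. exact: ep_free. Qed.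
Let mem i m : (m < d i)%N -> (u i m <= E)%MS.
Proof.
move=> mi; have := row_sub (prank (Ordinal mi)) E.
by rewrite rowK prank_fst prank_snd.
Qed.

(* [E] is a maximal isotropic subspace for the form [B([x, .], .)]. *)
Lemma pencil_maximal (v : vec) : (forall i m, (m < d i)%N -> B (br x v) (u i m) = 0) -> (v <= E)%MS.
Proof.
move=> hv; have iso (w : vec) : (w <= E)%MS -> forall i m, (m < d i)%N -> B (br x w) (u i m) = 0.
  move=> /submxP [z ->] i m mi; rewrite mulmx_sum_row brk_sumr (bform_suml formP) big1 // => s _.
  rewrite rowK brkZr (bformZl formP) (pencil_isotropic uP) ?mulr0 //.
  exact: psnd_lt.
pose K := kermx (ad x *m Bm *m E^T).
have rowB (w : vec) s : B w (row s E) = (w *m Bm *m E^T) 0 s.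
  by rewrite /bform mxE [RHS]mxE; apply: eq_bigr => j _; rewrite !mxE.
have inK (w : vec) : (w <= K)%MS = [forall s, B (br x w) (row s E) == 0].
  apply/sub_kermxP/forallP => [e s|e].
    have := congr1 (fun M : 'rV_#|pidx| => M 0 s) e; rewrite !mulmxA mul_adm [RHS]mxE => e1.
    by rewrite rowB e1.
  apply/rowP => s; rewrite [RHS]mxE; have /eqP := e s; rewrite rowB => e1.
  by rewrite -[RHS]e1 !mulmxA mul_adm.
have EK : (E <= K)%MS.
  apply/row_subP => s; rewrite inK; apply/forallP => t; rewrite rowK [row t _]rowK; apply/eqP.
  by apply: (pencil_isotropic uP); exact: psnd_lt.
have rK : (\rank K <= #|pidx|)%N.
  have rM : (#|pidx| - l <= \rank (ad x *m Bm *m E^T))%N.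
    have skew := adm_skew lieP formP x.
    have -> : \rank (ad x *m Bm *m E^T) = \rank (E *m ad x).
      rewrite -mxrank_tr trmx_mul trmxK skew mulmxN mxrank_opp mulmxA mxrankMfree //.
      by rewrite row_free_unit; case: formP => _ [].
    have aux (a b r q L : nat) : (a + b)%N = r -> r = q -> (b <= L)%N -> (q - L <= a)%N by lia.
    rewrite -rx; exact: aux (mxrank_mul_ker E (ad x)) (eqP fE) (mxrankS (capmxSr _ _)).
  rewrite mxrank_ker; have := rM; have := dimP; have := rank_leq_row (ad x *m Bm *m E^T).
  move: (\rank _) => a h1 h2 h3; lia.
have vK : (v <= K)%MS by rewrite inK; apply/forallP => s; rewrite rowK hv // psnd_lt.
apply: submx_trans vK _; have /mxrank_leqif_sup/geq_leqif <- := EK.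
by rewrite (eqP fE).
Qed.

(** If [a2 = 0] then [[x, v] = 0]. Otherwise [[y, v]] is a multiple of [[x, v]], and [pencil_rel]
    carries the orthogonality from [u i m] to [u i m.+1]. *)
Lemma pencil_contains a1 a2 v : (a1, a2) != (0, 0) -> br (a1 *: x + a2 *: y) v = 0 -> (v <= E)%MS.
Proof.
rewrite xpair_eqE negb_and => ab; rewrite brkDl !brkZl => e.
have [b0|b0] := eqVneq a2 0.
  move: e ab; rewrite b0 scale0r addr0 eqxx orbF => /eqP; rewrite scaler_eq0 => /orP[/eqP->|/eqP xv _].
    by rewrite eqxx.
  by apply: pencil_maximal => i m mi; rewrite xv (bform0l formP).
apply: pencil_maximal => i m; elim: m => [|m IH] mi.
  have [e0 _ _] := pencil_rel uP i.
  by rewrite (bform_invl lieP formP) e0 bform0r oppr0.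
have [_ _ hr] := pencil_rel uP i.
rewrite (bform_invl lieP formP) hr // bformNr opprK -[RHS]oppr0.
have yv : br y v = - (a1 / a2) *: br x v.
  apply: (scalerI b0); rewrite scalerA mulrN mulrC divfK // scaleNr.
  by apply/eqP; rewrite -addr_eq0 addrC e.
have := bform_invl lieP formP y v (u i m); rewrite yv (bformZl formP) IH ?mulr0 => [|]; last exact: ltnW.
by move/eqP; rewrite eq_sym oppr_eq0 => /eqP ->; rewrite oppr0.
Qed.

End Generic.

(* Each [u i m] is a combination of the values of the pencil at [d i] distinct points. *)
Lemma pencil_inVp x y (u : 'I_l -> nat -> vec) i m :
  (forall i t, \sum_(m < d i) t ^+ m *: u i m = row i (ep (x + t *: y))) ->
  (m < d i)%N -> inVp c x y (u i m).
Proof.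
move=> uP mi; pose D := d i.
pose Vd : 'M[k]_D := \matrix_(s, t) (s%:R ^+ t : k).
have uV : Vd \in unitmx.
  have -> : Vd = (Vandermonde D (\row_(s < D) s%:R))^T by apply/matrixP => s t; rewrite !mxE.
  rewrite unitmx_tr unitmxE det_Vandermonde unitfE; apply/prodf_neq0 => s _.
  apply/prodf_neq0 => t st; rewrite !mxE -natrB ?(ltnW st) //.
  by have /pcharf0P -> := char0; rewrite subn_eq0 -ltnNge.
have e : u i m = \sum_(s < D) (invmx Vd (Ordinal mi) s) *: row i (ep (x + s%:R *: y)).
  rewrite (eq_bigr (fun s : 'I_D => \sum_(t < D) (invmx Vd (Ordinal mi) s * Vd s t) *: u i t)) => [|s _].
    rewrite exchange_big (bigD1 (Ordinal mi)) //= addrC big1 ?add0r => [|t tm].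
      rewrite -scaler_suml; have := congr1 (fun M : 'M_D => M (Ordinal mi) (Ordinal mi)) (mulVmx uV).
      by rewrite !mxE eqxx => ->; rewrite scale1r.
    rewrite -scaler_suml; have := congr1 (fun M : 'M_D => M (Ordinal mi) t) (mulVmx uV).
    by rewrite !mxE eq_sym (negPf tm) => ->; rewrite scale0r.
  by rewrite -uP scaler_sumr; apply: eq_bigr => t _; rewrite scalerA mxE.
exists (map (fun s : 'I_D => ((1, s%:R), invmx Vd (Ordinal mi) s *: row i (ep (x + s%:R *: y)))) (enum 'I_D)).
apply/andP; split.
  apply/allP => _ /mapP [s _ ->] /=; rewrite xpair_eqE oner_eq0 /= scale1r brkZr -mul_adm -row_mul.
  by rewrite ep_cent row0 scaler0.
by rewrite big_map big_enum /= -e.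
Qed.

End Pencil.

(** * Removing denominators *)

Section Saturation.
Variables (k : closedFieldType) (N r m : nat).
Local Notation R := {mpoly k[N]}.
Variable E : 'M[R]_(r, m).
Hypothesis no_common : forall F : R, prime_elt F ->
  (forall U : 'M[k]_(m, r), rdvd F (\det (E *m mxC N U))) -> False.

(** Modulo [F] the row [a] annihilates [E], some maximal minor of which is nonzero there; so [F]
    divides every entry of [a]. *)
Lemma prime_cancel (F : R) (v : 'rV[R]_m) (a : 'rV[R]_r) :
  prime_elt F -> F *: v = a *m E -> exists a', v = a' *m E.
Proof.
move=> pF e; have [K [f f0]] := residue_field pF; have [F0 _ _] := pF.
have fF : f F = 0 by apply/f0; exists 1; rewrite mul1r.
have fa : map_mx f a = 0.
  apply/eqP; apply: contraT => a0; case: (no_common pF) => U; apply/f0.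
  rewrite -(det_map_mx f); apply/eqP/det0P; exists (map_mx f a) => //.
  by rewrite -map_mxM mulmxA -e map_mxM map_mxZ fF scale0r mul0mx.
have dv i : exists q, a 0 i = q * F.
  by apply/f0; have := congr1 (fun M : 'rV_r => M 0 i) fa; rewrite !mxE.
pose q := \row_i proj1_sig (constructive_indefinite_description _ (dv i)).
have aq : a = F *: q.
  by apply/rowP => i; rewrite !mxE mulrC; case: constructive_indefinite_description.
exists q; apply/rowP => j; apply: (mulfI F0).
by have := congr1 (fun M : 'rV_m => M 0 j) e; rewrite aq -scalemxAl !mxE.
Qed.

Lemma saturation (P : R) (v : 'rV[R]_m) (a : 'rV[R]_r) :
  P != 0 -> P *: v = a *m E -> exists a', v = a' *m E.
Proof.
move=> P0; have [u [s [uu ps ->]]] := @factorial_mpoly k N P P0; clear P0.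
elim: s ps v a => [|F s IH] ps v a.
  rewrite big_nil mulr1 => e; exists (u^-1 *: a).
  by rewrite -scalemxAl -e scalerA mulVr // scale1r.
rewrite big_cons mulrCA -scalerA => e.
have pF : prime_elt F by apply: ps; rewrite mem_head.
have [a' e'] := prime_cancel pF e.
by apply: IH e' => q qs; apply: ps; rewrite in_cons qs orbT.
Qed.

Lemma row_combination_unique (U : 'M[k]_(m, r)) (a : 'rV[R]_r) :
  \det (E *m mxC N U) != 0 -> a *m E = 0 -> a = 0.
Proof.
move=> d0 e; have e1 : \det (E *m mxC N U) *: a = 0.
  by rewrite -mul_mx_scalar -mul_mx_adj !mulmxA e !mul0mx.
apply/rowP => i; apply/eqP; have := congr1 (fun M : 'rV_r => M 0 i) e1.
by rewrite !mxE => /eqP; rewrite mulf_eq0 (negPf d0).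
Qed.
End Saturation.

(** * Functions on pairs and membership in V' *)

Section Pairs.
Variables (k : closedFieldType) (n : nat).
Local Notation vec := 'rV[k]_n.
Local Notation R := {mpoly k[n + n]}.

Definition pcoord (x y : vec) : 'I_(n + n) -> k :=
  fun i => match split i with inl a => x 0 a | inr b => y 0 b end.

Lemma pcoord_surj v : exists x y, v =1 pcoord x y.
Proof.
exists (\row_a v (lshift n a)), (\row_b v (rshift n b)) => i; rewrite /pcoord.
by case: splitP => a e; rewrite mxE; congr (v _); exact: val_inj.
Qed.

Lemma eval2_ext (P : R) : (forall x y, eval2 P x y = 0) -> P = 0.
Proof.
move=> h; apply: mpoly_ext => v; have [x [y e]] := pcoord_surj v.
by rewrite (meval_eq _ e) meval0; exact: h.
Qed.

Lemma zdenseT : zdense (fun _ _ : vec => True).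
Proof. by move=> P h; apply: eval2_ext => x y; exact: h. Qed.

Lemma fst_poly (q : {mpoly k[n]}) : exists Q : R, forall x y, eval2 Q x y = q.@[vcoord x].
Proof.
exists (q \mPo [tuple 'X_(lshift n i) | i < n]) => x y; rewrite /eval2 comp_mpoly_meval.
apply: meval_eq => i; rewrite tnth_mktuple mevalXU.
by rewrite -[lshift n i]/(unsplit (inl i)) unsplitK.
Qed.

Variable c : 'I_n -> 'I_n -> 'I_n -> k.

Lemma inVp0 x y : inVp c x y 0.
Proof. by exists [::]; rewrite /= big_nil. Qed.

Lemma inVpD x y v w : inVp c x y v -> inVp c x y w -> inVp c x y (v + w).
Proof.
move=> [s /andP [s1 /eqP s2]] [t /andP [t1 /eqP t2]]; exists (s ++ t).
by rewrite all_cat s1 t1 big_cat s2 t2 /=.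
Qed.

Lemma inVpZ x y a v : inVp c x y v -> inVp c x y (a *: v).
Proof.
move=> [s /andP [/allP s1 /eqP s2]]; exists [seq (t.1, a *: t.2) | t <- s]; apply/andP; split.
  apply/allP => _ /mapP [t ts ->] /=; have /andP [-> /eqP e] := s1 t ts.
  by rewrite brkZr e scaler0 eqxx.
by rewrite big_map -scaler_sumr -s2.
Qed.
End Pairs.

(** * Generation, independence and saturation of [B_g] *)

Section Basis.
Variables (k : closedFieldType) (n : nat) (c : 'I_n.+1 -> 'I_n.+1 -> 'I_n.+1 -> k).
Variable Bm : 'M[k]_n.+1.
Hypothesis char0 : [pchar k] =i pred0.
Hypothesis lieP : is_lie c.
Hypothesis formP : good_form c Bm.
Local Notation vec := 'rV[k]_n.+1.
Local Notation br := (brk c).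
Local Notation ad := (adm c).
Local Notation B := (bform Bm).
Local Notation R := {mpoly k[n.+1 + n.+1]}.
Variables (l : nat) (d : 'I_l -> nat) (ep : vec -> 'M[k]_(l, n.+1)).
Hypothesis ep_cent : forall y, ep y *m ad y = 0.
Hypothesis ep_free : forall y, cent_dim c y = l -> row_free (ep y).
Hypothesis ep_homog : forall i t y, row i (ep (t *: y)) = t ^+ (d i).-1 *: row i (ep y).
Hypothesis ep_poly : forall i j x y, exists g : {poly k}, forall a, ep (a *: x + y) i j = g.[a].
Hypothesis d_pos : forall i, (0 < d i)%N.
Local Notation b := #|pidx d|.
Hypothesis dimP : (2 * b = n.+1 + l)%N.
Variable eps : 'I_l -> nat -> 'I_n.+1 -> R.
Local Notation ev x y := (fun i m => evalv (eps i m) x y).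
Hypothesis epsE : forall i t x y, \sum_(m < d i) t ^+ m *: evalv (eps i m) x y = row i (ep (x + t *: y)).
Variables (e h f : vec).
Hypothesis tripleP : forall a b d : k, (a, b, d) != (0, 0, 0) ->
  cent_dim c (a *: e + b *: h + d *: f) = l.
Variable Q : {mpoly k[n.+1]}.
Hypothesis Q0 : Q != 0.
Hypothesis QP : forall y, Q.@[vcoord y] != 0 -> cent_dim c y = l.

Let uP x y i t : \sum_(m < d i) t ^+ m *: ev x y i m = row i (ep (x + t *: y)).
Proof. exact: epsE. Qed.

Definition epsM : 'M[R]_(b, n.+1) := \matrix_(s < b) (fun i m => \row_j eps i m j) (pfst s) (psnd s).
Local Notation E := epsM.
Local Notation minor U := (\det (E *m mxC (n.+1 + n.+1) U)).

Lemma epsM_eval x y : map_mx (meval (pcoord x y)) E = pencilmx d (ev x y).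
Proof. by apply/matrixP => s j; rewrite !mxE. Qed.

Lemma mxC_eval N m r (U : 'M[k]_(m, r)) (v : 'I_N -> k) : map_mx (meval v) (mxC N U) = U.
Proof. by apply/matrixP => i j; rewrite !mxE /= mevalC. Qed.

Lemma epsM_minor (U : 'M[k]_(n.+1, b)) x y : (minor U).@[pcoord x y] = \det (pencilmx d (ev x y) *m U).
Proof. by rewrite -(det_map_mx (meval (pcoord x y))) map_mxM epsM_eval mxC_eval. Qed.

Lemma eps_homog i m t x y : (m < d i)%N ->
  evalv (eps i m) (t *: x) (t *: y) = t ^+ (d i).-1 *: evalv (eps i m) x y.
Proof.
move=> mi; apply/eqP; rewrite -subr_eq0; apply/eqP.
apply: (@pencil_ext k n (d i)
  (fun m => evalv (eps i m) (t *: x) (t *: y) - t ^+ (d i).-1 *: evalv (eps i m) x y)) => // a.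
under eq_bigr => s _ do rewrite scalerBr.
rewrite sumrB epsE.
have -> : t *: x + a *: (t *: y) = t *: (x + a *: y) by rewrite scalerDr !scalerA [a * t]mulrC.
rewrite ep_homog -epsE scaler_sumr; apply/eqP; rewrite subr_eq0; apply/eqP.
by apply: eq_bigr => s _; rewrite !scalerA mulrC.
Qed.

Lemma minor_homog (U : 'M[k]_(n.+1, b)) : homogf (\sum_(s < b) (d (pfst s)).-1) (minor U).
Proof.
move=> t v; have [x [y e0]] := pcoord_surj v.
have e1 : (fun i => t * v i) =1 pcoord (t *: x) (t *: y).
  by move=> i; rewrite e0 /pcoord; case: (split i) => a; rewrite !mxE.
rewrite (meval_eq _ e0) (meval_eq _ e1) !epsM_minor.
have -> : pencilmx d (ev (t *: x) (t *: y)) =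
    diag_mx (\row_s t ^+ (d (pfst s)).-1) *m pencilmx d (ev x y).
  apply/matrixP => s j; rewrite mul_diag_mx.
  by have := congr1 (fun w : vec => w 0 j) (eps_homog t x y (psnd_lt s)); rewrite !mxE.
rewrite -mulmxA det_mulmx det_diag; congr (_ * _); rewrite expr_sum.
by apply: eq_bigr => s _; rewrite mxE.
Qed.

(** The coefficients on [e], [h], [f] of a combination of the pair with scalars [s], [t] are those
    of the product of the polynomials [s + t X] and [a1 + a2 X], which is nonzero; so the
    combination is regular. *)
Lemma triple_free a1 a2 : (a1, a2) != (0, 0) ->
  row_free (pencilmx d (ev (a1 *: e + a2 *: h) (a1 *: h + a2 *: f))).
Proof.
move=> a0; apply: (pencil_free ep_cent ep_free ep_homog ep_poly d_pos
  (uP (a1 *: e + a2 *: h) (a1 *: h + a2 *: f))) => s t st.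
have -> : s *: (a1 *: e + a2 *: h) + t *: (a1 *: h + a2 *: f) =
    (s * a1) *: e + (s * a2 + t * a1) *: h + (t * a2) *: f.
  by rewrite !scalerDr !scalerA !scalerDl !addrA.
apply: tripleP; apply: contraTneq a0 => -[h1 h2 h3]; rewrite negbK.
move: st h1 h2 h3; rewrite !xpair_eqE; have [->|s0] := eqVneq s 0.
  rewrite !mul0r add0r /= => t0 _ /eqP h2 /eqP h3; move: h2 h3.
  by rewrite !mulf_eq0 (negPf t0) /= => -> ->.
move=> _ /eqP; rewrite mulf_eq0 (negPf s0) /= => /eqP ->; rewrite mulr0 addr0 eqxx /=.
by move=> /eqP; rewrite mulf_eq0 (negPf s0).
Qed.

Lemma free_minor m r (A : 'M[k]_(r, m)) : row_free A -> \det (A *m pinvmx A) != 0.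
Proof. by move=> Af; rewrite mulmxVp // det1 oner_eq0. Qed.

Lemma minor_exists : exists U : 'M[k]_(n.+1, b), minor U != 0.
Proof.
have a0 : (1, 0) != (0, 0) :> k * k by rewrite xpair_eqE oner_eq0.
have fr := free_minor (triple_free a0).
exists (pinvmx (pencilmx d (ev (1 *: e + 0 *: h) (1 *: h + 0 *: f)))).
by apply: contraNneq fr => z; rewrite -epsM_minor z meval0.
Qed.

(* A common prime factor is homogeneous of positive degree, so it vanishes at some point
   of the plane of pairs [(a e + b h, a h + b f)], where the pencil stays free. *)
Lemma no_common_factor (F : R) : prime_elt F ->
  (forall U : 'M[k]_(n.+1, b), rdvd F (minor U)) -> False.
Proof.
move=> pF dv; have [U0 mU0] := minor_exists; have [q eq] := dv U0.
have [D FD] : exists D, homogf D F.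
  apply: (@homogf_factor _ _ F q (\sum_(s < b) (d (pfst s)).-1)); rewrite mulrC -eq //.
  exact: minor_homog.
have [a1 [a2 [a0]]] := homogf_zero (pcoord e h) (pcoord h f) (homogf_pos pF FD) FD.
have e1 : (fun i => a1 * pcoord e h i + a2 * pcoord h f i) =1
    pcoord (a1 *: e + a2 *: h) (a1 *: h + a2 *: f).
  by move=> i; rewrite /pcoord; case: (split i) => j; rewrite !mxE.
rewrite (meval_eq _ e1) => F0; have /eqP := free_minor (triple_free a0); apply.
have [q' eq'] := dv (pinvmx (pencilmx d (ev (a1 *: e + a2 *: h) (a1 *: h + a2 *: f)))).
by rewrite -epsM_minor eq' mevalM F0 mulr0.
Qed.

(** Cramer's rule: the adjugate expresses [minor U] times a vector of the row space by the rows.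
    Pointwise membership comes from [pencil_contains], and density turns it into an identity of
    polynomials. *)
Lemma inB_multiple phi : inB c phi ->
  exists P a, P != 0 /\ P *: (\row_j phi j) = a *m E.
Proof.
move=> [D [zD hD]]; have [U mU] := minor_exists; have [Q1 Q1E] := fst_poly Q.
pose a := \row_j phi j *m mxC (n.+1 + n.+1) U *m \adj (E *m mxC (n.+1 + n.+1) U).
exists (minor U), a; split=> //; apply/rowP => j; apply/eqP; rewrite -subr_eq0.
have Q10 : Q1 != 0.
  have [v vQ] := mpoly_nonvanishing Q0; apply: contraNneq vQ => z.
  have ve : v =1 vcoord (\row_i v i) by move=> i; rewrite /vcoord mxE.
  by rewrite (meval_eq _ ve) -(Q1E _ 0) z /eval2 meval0.
set W := minor U *: \row_j phi j - a *m E.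
have -> : (minor U *: \row_j phi j) 0 j - (a *m E) 0 j = W 0 j by rewrite [RHS]mxE [X in _ = _ + X]mxE.
(* If the pencil is not free then [minor U] vanishes, and if [x] is not regular then [Q1] does; with
   these two factors the identity holds at all points of [D]. *)
have : minor U * Q1 * W 0 j = 0.
  apply: zD => x y Dxy; rewrite /eval2 -/(pcoord x y) !mevalM.
  have [z|z] := eqVneq (minor U).@[pcoord x y] 0; first by rewrite z !mul0r.
  have [zQ|zQ] := eqVneq Q.@[vcoord x] 0.
    by have := Q1E x y; rewrite zQ /eval2 -/(pcoord x y) => ->; rewrite mulr0 mul0r.
  have rx := QP zQ; rewrite epsM_minor in z; set Exy := pencilmx d (ev x y) in z.
  have fE : row_free Exy.
    apply/row_freeP; exists (U *m invmx (Exy *m U)).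
    by rewrite mulmxA mulmxV // unitmxE unitfE.
  have vE : (evalv phi x y <= Exy)%MS.
    have [s /andP [/allP s1 /eqP ->]] := hD x y Dxy; rewrite big_seq; apply: summx_sub => t ts.
    have /andP [t0 /eqP t1] := s1 t ts.
    exact: (pencil_contains lieP formP ep_cent ep_free d_pos (uP x y) rx fE dimP t0 t1).
  have [w ew] := submxP vE.
  have e1 : map_mx (meval (pcoord x y)) W = 0.
    have ep0 : map_mx (meval (pcoord x y)) (\row_j phi j) = evalv phi x y.
      by apply/rowP => i; rewrite !mxE.
    have eW : map_mx (meval (pcoord x y)) (minor U *: \row_j phi j) =
        \det (Exy *m U) *: map_mx (meval (pcoord x y)) (\row_j phi j).
      by rewrite -epsM_minor; exact: map_mxZ.
    rewrite /W /a map_mxB eW !map_mxM map_mx_adj map_mxM epsM_eval mxC_eval ep0.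
    rewrite -/Exy ew -!mulmxA [Exy *m (U *m _)]mulmxA [_ *m (_ *m Exy)]mulmxA mul_mx_adj.
    by rewrite mul_scalar_mx scalemxAr subrr.
  have := congr1 (fun M : 'rV_n.+1 => M 0 j) e1; rewrite mxE => ->.
  by rewrite [X in _ * X]mxE mulr0.
by move/eqP; rewrite !mulf_eq0 (negPf mU) (negPf Q10).
Qed.

Lemma inB_span phi : inB c phi <-> exists a, \row_j phi j = a *m E.
Proof.
split=> [/inB_multiple [P [a [P0 e0]]]|[a e0]].
  exact: (saturation no_common_factor P0 e0).
exists (fun _ _ => True); split=> [|x y _]; first exact: zdenseT.
have -> : evalv phi x y = map_mx (meval (pcoord x y)) a *m pencilmx d (ev x y).
  by rewrite -epsM_eval -map_mxM -e0; apply/rowP => i; rewrite !mxE.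
rewrite [map_mx _ a]pcoefE pidx_sum.
apply: (big_ind (inVp c x y)); [exact: inVp0|exact: inVpD|] => i _.
apply: (big_ind (inVp c x y)); [exact: inVp0|exact: inVpD|] => m _.
apply: inVpZ; apply: (pencil_inVp char0 ep_cent) (uP x y) _; exact: ltn_ord.
Qed.

Lemma epsM_sum (coef : 'I_l -> nat -> R) j : ((\row_s coef (pfst s) (psnd s)) *m E) 0 j =
  \sum_(i < l) \sum_(m < d i) coef i m * eps i m j.
Proof.
rewrite pidx_sum summxE; apply: eq_bigr => i _; rewrite summxE; apply: eq_bigr => m _.
by rewrite !mxE.
Qed.

Lemma inB_eps i m : (m < d i)%N -> inB c (eps i m).
Proof.
move=> mi; exists (fun _ _ => True); split=> [|x y _]; first exact: zdenseT.
exact: (pencil_inVp char0 ep_cent (uP x y) mi).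
Qed.

Lemma eps_independent (coef : 'I_l -> nat -> R) :
  (forall j, \sum_(i < l) \sum_(m < d i) coef i m * eps i m j = 0) ->
  forall i m, (m < d i)%N -> coef i m = 0.
Proof.
move=> h0 i m mi; have [U mU] := minor_exists.
have e0 : (\row_s coef (pfst s) (psnd s)) *m E = 0.
  by apply/rowP => j; rewrite epsM_sum h0 mxE.
have := congr1 (fun M : 'rV_b => M 0 (prank (Ordinal mi))) (row_combination_unique mU e0).
by rewrite !mxE prank_fst prank_snd.
Qed.

Lemma eps_generate phi : inB c phi -> exists coef : 'I_l -> nat -> R,
  forall j, phi j = \sum_(i < l) \sum_(m < d i) coef i m * eps i m j.
Proof.
move=> /inB_span [a e0]; exists (pcoef a) => j; rewrite -epsM_sum -pcoefE -e0.
by rewrite mxE.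
Qed.

Lemma inB_saturated phi : inB c phi <-> exists P : R, P != 0 /\ inB c (fun j => P * phi j).
Proof.
split=> [hphi|[P [P0 /inB_span [a e0]]]].
  exists 1; split; first exact: oner_neq0.
  have /inB_span [a e0] := hphi; apply/inB_span; exists a; rewrite -e0.
  by apply/rowP => j; rewrite !mxE mul1r.
apply/inB_span; apply: (saturation no_common_factor P0 (a := a)); rewrite -e0.
by apply/rowP => j; rewrite !mxE.
Qed.

Lemma inB_orth phi : inB c phi -> forall x y, B (evalv phi x y) (br x y) = 0.
Proof.
move=> /inB_span [a e0] x y.
have -> : evalv phi x y = map_mx (meval (pcoord x y)) a *m pencilmx d (ev x y).
  by rewrite -epsM_eval -map_mxM -e0; apply/rowP => i; rewrite !mxE.
rewrite [map_mx _ a]pcoefE pidx_sum (bform_suml formP) big1 // => i _.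
rewrite (bform_suml formP) big1 // => m _; rewrite (bformZl formP).
by rewrite (pencil_orth lieP formP ep_cent d_pos (uP x y)) ?mulr0 //; exact: ltn_ord.
Qed.

Theorem basis_theorem :
  [/\ forall i m, (m < d i)%N -> inB c (eps i m),
    forall coef : 'I_l -> nat -> R,
      (forall j, \sum_(i < l) \sum_(m < d i) coef i m * eps i m j = 0) ->
      forall i m, (m < d i)%N -> coef i m = 0,
    forall phi, inB c phi -> exists coef : 'I_l -> nat -> R,
      forall j, phi j = \sum_(i < l) \sum_(m < d i) coef i m * eps i m j,
    forall phi, inB c phi <-> exists P : R, P != 0 /\ inB c (fun j => P * phi j)
  & forall phi, inB c phi -> forall x y, B (evalv phi x y) (br x y) = 0].
Proof.
split; [exact: inB_eps|exact: eps_independent|exact: eps_generate|exact: inB_saturated|exact: inB_orth].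
Qed.

End Basis.

Lemma minor_free (K : fieldType) r m (A : 'M[K]_(r, m)) U : \det (A *m U) != 0 -> row_free A.
Proof.
move=> d0; apply/row_freeP; exists (U *m invmx (A *m U)).
by rewrite mulmxA mulmxV // unitmxE unitfE.
Qed.

(** * Degrees of the gradients and conclusion *)

Section Degrees.
Variables (k : closedFieldType) (n : nat).

Lemma homogf_msupp d (q : {mpoly k[n]}) : (forall m, m \in msupp q -> mdeg m = d) -> homogf d q.
Proof.
move=> hq t v; rewrite !mevalE mulr_sumr big_seq [RHS]big_seq; apply: eq_bigr => m mq.
rewrite mulrCA; congr (_ * _); rewrite -(hq m mq) mdegE expr_sum -big_split /=.
by apply: eq_bigr => i _; rewrite exprMn.
Qed.

Lemma homog_mderiv d (q : {mpoly k[n]}) i m : homog_of d q -> m \in msupp q^`M(i) -> (mdeg m).+1 = d.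
Proof.
move=> hq; rewrite mcoeff_msupp mcoeff_mderiv => m0.
have mq : (m + U_(i))%MM \in msupp q.
  by rewrite mcoeff_msupp; apply: contraNneq m0 => ->; rewrite mul0rn.
have /allP/(_ _ mq)/eqP <- : all [pred m | mdeg m == d] (msupp q) := hq.
by rewrite mdegD mdeg1 addn1.
Qed.
End Degrees.

Section GradientDegrees.
Variables (k : closedFieldType) (n l : nat) (p : 'I_l -> {mpoly k[n.+1]}) (d : 'I_l -> nat).
Hypothesis ph : forall i, homog_of (d i) (p i).
Local Notation vec := 'rV[k]_n.+1.

Lemma gradmxE (y : vec) i j : gradmx p y i j = ((p i)^`M(j)).@[vcoord y].
Proof. by rewrite /gradmx mxE. Qed.

Lemma gradmx_homog t (y : vec) i j : gradmx p (t *: y) i j = t ^+ (d i).-1 * gradmx p y i j.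
Proof.
have H : homogf (d i).-1 (p i)^`M(j) by apply: homogf_msupp => m /(homog_mderiv (ph i)) <-.
by rewrite !gradmxE -H; apply: meval_eq => s; rewrite /vcoord mxE.
Qed.

Lemma degree_pos (x : vec) i : row_free (gradmx p x) -> (0 < d i)%N.
Proof.
move=> fr; rewrite lt0n; apply/eqP => d0.
have z : row i (gradmx p x) = 0.
  apply/rowP => j; rewrite mxE gradmxE mxE.
  suff -> : (p i)^`M(j) = 0 by rewrite meval0.
  apply/eqP; rewrite -msupp_eq0; case E: (msupp _) => [//|m s].
  by have := @homog_mderiv _ _ (d i) (p i) j m (ph i); rewrite E mem_head d0 => /(_ isT).
have /(row_free_inj fr)/matrixP/(_ 0 i) : (delta_mx 0 i : 'rV[k]_l) *m gradmx p x = 0 *m gradmx p x.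
  by rewrite -rowE z mul0mx.
rewrite !mxE !eqxx => /eqP.
by rewrite oner_eq0.
Qed.

Lemma gradmx_det_homog t (y : vec) (U : 'M[k]_(n.+1, l)) :
  \det (gradmx p (t *: y) *m U) = t ^+ (\sum_i (d i).-1) * \det (gradmx p y *m U).
Proof.
have -> : gradmx p (t *: y) = diag_mx (\row_i t ^+ (d i).-1) *m gradmx p y.
  by apply/matrixP => i j; rewrite mul_diag_mx gradmx_homog [RHS]mxE [in RHS]mxE.
rewrite -mulmxA det_mulmx det_diag; congr (_ * _); rewrite expr_sum.
by apply: eq_bigr => i _; rewrite mxE.
Qed.

Lemma epsmx_poly (Bm : 'M[k]_n.+1) i j (x y : vec) :
  exists g : {poly k}, forall a, epsmx Bm p (a *: x + y) i j = g.[a].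
Proof.
exists (\sum_s (invmx Bm s j) *: mmap (@polyC k) (fun t => (x 0 t)%:P * 'X + (y 0 t)%:P) (p i)^`M(s)) => a.
rewrite horner_sum mxE; apply: eq_bigr => s _; rewrite hornerZ mulrC; congr (_ * _).
rewrite gradmxE mmap_horner; apply: meval_eq => t.
by rewrite /vcoord !hornerE !mxE mulrC.
Qed.

Lemma epsmx_homog (Bm : 'M[k]_n.+1) i t (y : vec) :
  row i (epsmx Bm p (t *: y)) = t ^+ (d i).-1 *: row i (epsmx Bm p y).
Proof.
rewrite /epsmx !row_mul scalemxAl; congr (_ *m _).
by apply/rowP => j; rewrite mxE gradmx_homog [RHS]mxE [in RHS]mxE.
Qed.
End GradientDegrees.

Lemma bform_inj (k : fieldType) n (Bm : 'M[k]_n) (v w : 'rV[k]_n) : Bm \in unitmx ->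
  (forall u, bform Bm v u = bform Bm w u) -> v = w.
Proof.
move=> Bu hvw; apply: (can_inj (mulmxK Bu)); apply/rowP => j.
by have := hvw (delta_mx 0 j); rewrite /bform trmx_delta -!colE ![col _ _ _ _]mxE.
Qed.

Lemma exponent_inj (k : closedFieldType) i j (c : k) : c != 0 ->
  (forall t, t ^+ i * c = t ^+ j * c) -> i = j.
Proof.
move=> c0 h; have e : 'X^i = 'X^j :> {poly k}.
  by apply: poly_ext => t; rewrite !hornerXn; apply: (mulIf c0).
by have := congr1 (fun q : {poly k} => size q) e; rewrite !size_polyXn => -[].
Qed.

Unset Implicit Arguments.

Theorem theorem2p2 (k : closedFieldType) (n : nat)
  (c : 'I_n -> 'I_n -> 'I_n -> k) (Bm : 'M[k]_n)
  (l : nat) (p : 'I_l -> {mpoly k[n]}) (d : 'I_l -> nat)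
  (eps : 'I_l -> nat -> 'I_n -> {mpoly k[n + n]}) (b : nat) :
  [pchar k] =i pred0 ->
  is_lie c -> reductive c -> good_form c Bm ->
  lie_rank c l ->
  (exists B : 'M[k]_n, borel c B /\ \rank B = b) ->
  (forall i, G_invariant c (p i)) ->
  (forall i, homog_of (d i) (p i)) ->
  (forall i j : 'I_l, (i <= j)%N -> (d i <= d j)%N) ->
  (forall q : {mpoly k[n]}, G_invariant c q ->
     exists Q : {mpoly k[l]}, q = Q \mPo [tuple p i | i < l]) ->
  (forall (i : 'I_l) (x y w : 'rV[k]_n) (t : k),
     bform Bm (\sum_(m < d i) t ^+ m *: evalv (eps i m) x y) w
     = dder (p i) (x + t *: y) w) ->
  (* (i) *)
  ((\sum_(i < l) d i)%N = b /\
   (forall (i : 'I_l) (m : nat), (m < d i)%N -> inB c (eps i m)) /\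
   (forall coef : 'I_l -> nat -> {mpoly k[n + n]},
      (forall j, \sum_(i < l) \sum_(m < d i) coef i m * eps i m j = 0) ->
      forall (i : 'I_l) (m : nat), (m < d i)%N -> coef i m = 0) /\
   (forall phi, inB c phi ->
      exists coef : 'I_l -> nat -> {mpoly k[n + n]},
        forall j, phi j = \sum_(i < l) \sum_(m < d i) coef i m * eps i m j)) /\
  (* (ii) *)
  (forall phi : 'I_n -> {mpoly k[n + n]},
     inB c phi <-> exists P : {mpoly k[n + n]}, P != 0 /\ inB c (fun j => P * phi j)) /\
  (* (iii) *)
  (forall phi, inB c phi -> forall x y : 'rV[k]_n,
     bform Bm (evalv phi x y) (brk c x y) = 0).
Proof.
(* In dimension 0 all vectors and all ranks vanish; the matrix rings used above have positive
   size. *)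
case: n c Bm p eps => [|n'] c Bm p eps char0 lieP redP formP rk [Bo [bo rBo]] pG ph _ gens epsP.
  have l0 : l = 0%N.
    by case: rk => [[x <-] _]; apply/eqP; rewrite -leqn0; exact: rank_leq_row.
  have b0 : b = 0%N by rewrite -rBo; apply/eqP; rewrite -leqn0 rank_leq_row.
  have allB phi : inB c phi.
    exists (fun _ _ => True); split; first exact: zdenseT.
    by move=> x y _; exists [::]; apply/andP; split=> //; apply/eqP/rowP; case.
  clear rk gens epsP ph pG; subst l b; split; last first.
    split=> [phi|phi _ x y].
      by split=> // _; exists 1; split=> //; exact: oner_neq0.
    have -> : evalv phi x y = 0 by apply/rowP; case.
    by rewrite (bform0l formP).
  split; first by rewrite big_ord0.
  split; first by case.
  by split=> [coef _|phi _]; [case|exists (fun _ _ => 0); case].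
have [x [P [r [cd dimB]]]] := cartan_exists char0 lieP redP formP bo.
have [rl gx] := cartan_rank char0 lieP redP formP cd rk gens; subst r.
have [e [h [f tr]]] := principal_triple char0 lieP redP formP cd rk.
have GL (q : {mpoly k[n'.+1]}) : G_invariant c q -> Lie_invariant c q.
  exact: (G_Lie_invariant char0 lieP redP formP cd).
have lb : forall y, (l <= cent_dim c y)%N by case: rk.
pose minor (U : 'M[k]_(n'.+1, l)) := \det (jacobian p *m mxC n'.+1 U).
have minor_def U : minor U = \det (jacobian p *m mxC n'.+1 U) by [].
pose pf (U : 'M[k]_(n'.+1, l)) := proj1_sig (@pf_sig k n' c l Bm U).
have pfE U y : (pf U).@[vcoord y] = \det (bordered (skew_ad c Bm y) U).
  exact: (proj2_sig (@pf_sig k n' c l Bm U) y).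
have [a [a0 ratio]] := ratio_const char0 lieP formP lb GL pG gens tr gx minor_def pfE.
have ratioE U y : (minor U).@[vcoord y] ^+ 2 = a * (pf U).@[vcoord y].
  by have := congr1 (meval (vcoord y)) (ratio U); rewrite !expr2 !mevalM mevalC.
have [U0 mU0] := minor_neq0 gx minor_def.
have Bu : Bm \in unitmx by case: formP => _ [].
(* At a regular point some bordered determinant is nonzero, and the constant ratio makes the
   corresponding Jacobian minor nonzero as well. *)
have gfree y : cent_dim c y = l -> row_free (gradmx p y).
  move=> cy; have [U pU] := pf_regular lieP formP pfE cy; apply: (@minor_free _ _ _ _ U).
  rewrite -(minorE minor_def) -(sqrf_eq0 (minor U).@[_]) ratioE mulf_eq0 negb_or a0.
  exact: pU.
have ep_free y : cent_dim c y = l -> row_free (epsmx Bm p y).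
  move=> cy; rewrite /row_free /epsmx mxrankMfree ?row_free_unit ?unitmx_inv //.
  exact: gfree.
have d_pos i : (0 < d i)%N by apply: (@degree_pos _ _ _ _ _ ph x i); rewrite /row_free gx.
have epsE i t (y z : 'rV[k]_n'.+1) :
    \sum_(m < d i) t ^+ m *: evalv (eps i m) y z = row i (epsmx Bm p (y + t *: z)).
  by apply: (bform_inj Bu) => w; rewrite epsP (epsmx_form formP).
have [v mv] := mpoly_nonvanishing mU0.
have [y ey] : exists y : 'rV[k]_n'.+1, v =1 vcoord y.
  by exists (\row_i v i) => i; rewrite /vcoord mxE.
have {}mv : (minor U0).@[vcoord y] != 0 by rewrite -(meval_eq _ ey).
have pf0 : pf U0 != 0.
  apply: contraNneq mv => z; rewrite -(sqrf_eq0 (minor U0).@[_]) ratioE z meval0.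
  by rewrite mulr0.
(* The square of the minor has degree twice the sum of the [(d i).-1], and the bordered determinant
   has degree [n'.+1 - l]; both are read off by scaling a point where the minor does not vanish. *)
have degE : ((\sum_i (d i).-1) * 2 = n'.+1 - l)%N.
  apply: (@exponent_inj k _ _ ((minor U0).@[vcoord y] ^+ 2)).
    by rewrite sqrf_eq0.
  move=> t; rewrite exprM -exprMn (minorE minor_def) -(gradmx_det_homog ph) -!(minorE minor_def).
  rewrite !ratioE mulrCA; congr (_ * _); have := pf_homog lb pfE U0 t (vcoord y) => <-.
  by apply: meval_eq => i; rewrite /vcoord mxE.
have ln : (l <= n'.+1)%N by rewrite -gx; exact: rank_leq_col.
have sumd : (\sum_i d i = \sum_i (d i).-1 + l)%N.
  rewrite (eq_bigr (fun i => (d i).-1 + 1)%N) => [|i _]; last by rewrite addn1 prednK.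
  by rewrite big_split /= sum1_card card_ord.
have cardE : (#|pidx d| = \sum_i d i)%N.
  by rewrite /pidx card_tagged sumnE big_map big_enum /=; apply: eq_bigr => i _; rewrite card_ord.
have dimP : (2 * #|pidx d| = n'.+1 + l)%N.
  by rewrite cardE sumd; move: degE ln; move: (\sum_i (d i).-1)%N => D; lia.
have [h1 h2 h3 h4 h5] := basis_theorem char0 lieP formP (epsmx_cent lieP formP GL pG) ep_free
  (epsmx_homog ph Bm) (epsmx_poly p Bm) d_pos dimP epsE tr pf0 (@pf_cent _ _ _ _ formP _ lb _ pfE U0).
do 2?split=> //; rewrite -rBo; move: dimP dimB; rewrite cardE.
by move: (\sum_i d i)%N (\rank Bo) => D D'; lia.
Qed.
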